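(* Let $n\ge2$, and let $L$ be as in the context, with ergosphere $S_\Delta$. Let $S_0\subset\mathbb R^n$ be a smooth closed (compact) hypersurface lying inside the ergosphere $S_\Delta$, with interior $\Omega_{int}$ (bounded side) and exterior $\Omega_{ext}=\mathbb R^n\setminus\overline{\Omega_{int}}$. Suppose that $S_0\times\mathbb R$ is a characteristic surface for $L$, i.e. $\sum_{j,k=1}^n g^{jk}(x)\nu_j(x)\nu_k(x)=0$ for all $x\in S_0$, and that $$\sum_{j=1}^n g^{j0}(x)\nu_j(x)<0\quad\text{for all }x\in S_0,$$ where $\nu=(\nu_1,\dots,\nu_n)$ is the unit normal to $S_0$ pointing out of $\Omega_{int}$. Then for every $T>0$ there is a constant $C>0$ such that every $v\in H^2(\Omega_{ext}\times(0,T))$ satisfying $$Lv=f\ \text{ in }\Omega_{ext}\times(0,T),\qquad v(0,x)=\varphi_0(x),\quad v_{x_0}(0,x)=\varphi_1(x)\ \text{ for } x\in\Omega_{ext}$$ (no boundary condition being imposed on $S_0\times(0,T)$) obeys $$\max_{0\le x_0\le T}\big(\|v(x_0,\cdot)\|_{1,\Omega_{ext}}^2+\|v_{x_0}(x_0,\cdot)\|_{0,\Omega_{ext}}^2\big)\le C\Big(\|\varphi_0\|_{1,\Omega_{ext}}^2+\|\varphi_1\|_{0,\Omega_{ext}}^2+\int_0^T\|f(x_0,\cdot)\|_{0,\Omega_{ext}}^2\,dx_0\Big),$$ where $\|\cdot\|_{m,\Omega_{ext}}$ is the norm of $H^m(\Omega_{ext})$.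
   Context: Operator: with $x_0\in\mathbb R$ the time variable and $x=(x_1,\dots,x_n)\in\mathbb R^n$, $$Lu=\sum_{j,k=0}^n\frac{1}{\sqrt{(-1)^n g(x)}}\frac{\partial}{\partial x_j}\Big(\sqrt{(-1)^n g(x)}\,g^{jk}(x)\frac{\partial u}{\partial x_k}\Big),$$ where $[g^{jk}(x)]_{j,k=0}^n$ is a real symmetric matrix independent of $x_0$, $g(x)=(\det[g^{jk}(x)]_{j,k=0}^n)^{-1}$, the quadratic form $\sum_{j,k=0}^n g^{jk}(x)\xi_j\xi_k$ has signature $(1,-1,\dots,-1)$ for every $x\in\mathbb R^n$. The coefficients $g^{jk}$, $0\le j,k\le n$, are smooth and bounded together with all their derivatives of any order; there is $C_0>0$ with $g^{00}(x)\ge C_0$ for all $x$, and $\sum_{j,k=1}^n g^{jk}(x)\xi_j\xi_k\le -C_0\sum_{j=1}^n\xi_j^2$ for all $x$ with $|x|$ large. Ergosphere: $\Delta(x)=\det[g^{jk}(x)]_{j,k=1}^n$; the ergosphere $S_\Delta=\{x:\Delta(x)=0\}$ is assumed to be a smooth closed hypersurface, with $(-1)^n\Delta>0$ in its exterior and $(-1)^n\Delta<0$ in its interior. ''$S_0$ lies inside the ergosphere'' means that $S_0$ is contained in the (open) interior of $S_\Delta$. *)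

(* Defs.v *)
From HB Require Import structures.
From mathcomp Require Import all_boot all_order all_algebra.
From mathcomp Require Import all_classical all_reals all_analysis.
Set Implicit Arguments.
Unset Strict Implicit.
Unset Printing Implicit Defensive.
Import Order.TTheory GRing.Theory Num.Theory.
Import numFieldNormedType.Exports.
Local Open Scope classical_set_scope.
Local Open Scope ring_scope.

(* Index [ord0] of ['rV[R]_n.+1] is the time coordinate x_0 and
   [lift ord0 j] is the [j]-th spatial coordinate; [cons_row t x] is the
   point (t, x) and [tail_row (t, x)] is x. *)
Definition cons_row (R : realType) (n : nat) (t : R) (x : 'rV[R]_n) :
    'rV[R]_n.+1 :=
  \row_j (if unlift ord0 j is Some i then x ord0 i else t).

Definition tail_row (R : realType) (n : nat) (y : 'rV[R]_n.+1) : 'rV[R]_n :=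
  \row_j y ord0 (lift ord0 j).

Lemma tail_cons_row (R : realType) (n : nat) (t : R) (x : 'rV[R]_n) :
  tail_row (cons_row t x) = x.
Proof. by apply/rowP => j; rewrite !mxE liftK. Qed.

Lemma cons_row0 (R : realType) (n : nat) (t : R) (x : 'rV[R]_n) :
  cons_row t x ord0 ord0 = t.
Proof. by rewrite mxE unlift_none. Qed.

(* R^n carries the sigma-algebra generated by the coordinates, that is, the
   Borel sigma-algebra. *)
Definition rV_display : measure_display.
Proof. exact: default_measure_display. Qed.

Section rV_measurable.
Variables (R : realType) (n : nat).

Definition rV_coord (i : 'I_n) (x : 'rV[R]_n) : R := x ord0 i.

Let rV_set0 : g_sigma_preimage rV_coord set0.
Proof. exact: sigma_algebra0. Qed.

Let rV_setC A :
  g_sigma_preimage rV_coord A -> g_sigma_preimage rV_coord (~` A).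
Proof. exact: sigma_algebraC. Qed.

Let rV_bigcup (F : (set 'rV[R]_n)^nat) :
  (forall i, g_sigma_preimage rV_coord (F i)) ->
  g_sigma_preimage rV_coord (\bigcup_i (F i)).
Proof. exact: sigma_algebra_bigcup. Qed.

HB.instance Definition _ := @isMeasurable.Build rV_display
  'rV[R]_n (g_sigma_preimage rV_coord) rV_set0 rV_setC rV_bigcup.

Lemma measurable_rV_coord (i : 'I_n) :
  measurable_fun [set: 'rV[R]_n] (fun x : 'rV[R]_n => x ord0 i).
Proof.
move=> _ Y mY; rewrite setTI; apply: sub_sigma_algebra.
rewrite -bigcup_seq/=; exists i; first by rewrite /= mem_index_enum.
by exists Y => //; rewrite setTI.
Qed.

Lemma measurable_fun_rV d (T : measurableType d) (f : T -> 'rV[R]_n) :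
  (forall i, measurable_fun [set: T] (fun t => f t ord0 i)) ->
  measurable_fun [set: T] f.
Proof.
move=> mf _ Y; rewrite setTI => mY.
apply: (mY [set A | measurable (f @^-1` A)]); split.
  split => /=.
  - by rewrite preimage_set0; exact: measurable0.
  - by move=> A mA; rewrite setTD preimage_setC; exact: measurableC.
  - by move=> F mF; rewrite preimage_bigcup; exact: bigcup_measurable.
rewrite -bigcup_seq => A [i _ [B mB <-]]; rewrite setTI /=.
by have := mf i measurableT B mB; rewrite setTI.
Qed.

End rV_measurable.

Lemma measurable_cons_row (R : realType) (n : nat) :
  measurable_fun [set: R * 'rV[R]_n] (fun p => cons_row p.1 p.2).
Proof.
apply: measurable_fun_rV => j.
under eq_fun do rewrite mxE.
case: (unliftP ord0 j) => [i _|_]; last exact: measurable_fst.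
exact: (measurableT_comp (measurable_rV_coord i) measurable_snd).
Qed.

Lemma measurable_tail_row (R : realType) (n : nat) :
  measurable_fun [set: 'rV[R]_n.+1] (@tail_row R n).
Proof.
apply: measurable_fun_rV => j.
under eq_fun do rewrite mxE.
exact: measurable_rV_coord.
Qed.

(* Lebesgue measure on R^n.+1 is the image of the product of the Lebesgue
   measures on R and R^n under (t, x) |-> cons_row t x. *)
Section lebesgue_rV_step.
Variables (R : realType) (n : nat).
Variable m : {sigma_finite_measure set 'rV[R]_n -> \bar R}.

Definition lebesgue_rV_step : set 'rV[R]_n.+1 -> \bar R :=
  pushforward (@lebesgue_measure R \x m)%E (fun p => cons_row p.1 p.2).

Let step0 : lebesgue_rV_step set0 = 0%E.
Proof. by rewrite /lebesgue_rV_step /pushforward preimage_set0 measure0. Qed.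

Let step_ge0 A : (0 <= lebesgue_rV_step A)%E.
Proof. by rewrite /lebesgue_rV_step /pushforward; exact: measure_ge0. Qed.

Let mpre A : measurable A ->
  measurable ((fun p : R * 'rV[R]_n => cons_row p.1 p.2) @^-1` A).
Proof.
by move=> mA; have := @measurable_cons_row R n measurableT A mA; rewrite setTI.
Qed.

Let step_sigma_additive : semi_sigma_additive lebesgue_rV_step.
Proof.
move=> F mF tF mUF; rewrite /lebesgue_rV_step /pushforward preimage_bigcup.
apply: measure_semi_sigma_additive.
- by move=> k; exact: mpre.
- apply/trivIsetP => /= i j _ _ ij; rewrite -preimage_setI.
  by move/trivIsetP : tF => /(_ _ _ _ _ ij) ->//; rewrite preimage_set0.
- by rewrite -preimage_bigcup; exact: mpre.
Qed.

HB.instance Definition _ := isMeasure.Build _ _ _ lebesgue_rV_step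
  step0 step_ge0 step_sigma_additive.

Let step_sigma_finite : sigma_finite setT lebesgue_rV_step.
Proof.
have /sigma_finiteP[F [TF ndF Foo]] := sigma_finiteT (@lebesgue_measure R).
have /sigma_finiteP[H [TH ndH Hoo]] := sigma_finiteT m.
exists (fun k => [set y : 'rV[R]_n.+1 | F k (y ord0 ord0) /\ H k (tail_row y)]).
  apply/seteqP; split => // y _.
  have [i _ Fi] : (\bigcup_i F i) (y ord0 ord0) by rewrite -TF.
  have [j _ Hj] : (\bigcup_i H i) (tail_row y) by rewrite -TH.
  exists (maxn i j) => //; split.
  - by move: Fi; exact/subsetPset/ndF/leq_maxl.
  - by move: Hj; exact/subsetPset/ndH/leq_maxr.
move=> k; have [mF Fk] := Foo k; have [mH Hk] := Hoo k; split.
  apply: measurableI.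
  - by have := @measurable_rV_coord R n.+1 ord0 measurableT _ mF; rewrite setTI.
  - by have := @measurable_tail_row R n measurableT _ mH; rewrite setTI.
rewrite /lebesgue_rV_step /pushforward.
rewrite (_ : _ @^-1` _ = F k `*` H k); last first.
  by apply/seteqP; split => -[t x]; rewrite /= tail_cons_row cons_row0.
by rewrite product_measure1E// lte_mul_pinfty// ge0_fin_numE.
Qed.

HB.instance Definition _ := Measure_isSigmaFinite.Build _ _ _ lebesgue_rV_step
  step_sigma_finite.

End lebesgue_rV_step.

Fixpoint lebesgue_rV (R : realType) (n : nat) :
    {sigma_finite_measure set 'rV[R]_n -> \bar R} :=
  match n with
  | 0 => dirac (0 : 'rV[R]_0)
  | n'.+1 => lebesgue_rV_step (lebesgue_rV R n')
  end.

Section calculus.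
Variables (R : realType) (n : nat).
Implicit Types (f psi phi u w : 'rV[R]_n -> R) (D K : set 'rV[R]_n).

Definition partial f (j : 'I_n) : 'rV[R]_n -> R := 'D_(delta_mx ord0 j) f.

Definition partials f (s : seq 'I_n) : 'rV[R]_n -> R := foldl partial f s.

Definition smooth f : Prop :=
  forall s, continuous (partials f s) /\
    forall j x, derivable (partials f s) x (delta_mx ord0 j).

Definition bounded_derivatives f : Prop :=
  forall s, exists M : R, forall x, `|partials f s x| <= M.

Definition grad f (x : 'rV[R]_n) : 'rV[R]_n := \row_j partial f j x.

Definition test_function D phi : Prop :=
  smooth phi /\
  exists K, [/\ compact K, K `<=` D & forall x, ~ K x -> phi x = 0].

Definition locally_integrable_on D u : Prop :=
  measurable_fun D u /\
  forall K, compact K -> K `<=` D ->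
    (lebesgue_rV R n).-integrable K (EFin \o u).

(* [w] is the weak (distributional) derivative of [u] on the open set [D]
   with respect to the coordinates listed, with multiplicity, in [s]. *)
Definition weak_derivative D (s : seq 'I_n) u w : Prop :=
  [/\ locally_integrable_on D u, locally_integrable_on D w &
      forall phi, test_function D phi ->
        (\int[lebesgue_rV R n]_(x in D) (u x * partials phi s x)%:E =
         \int[lebesgue_rV R n]_(x in D)
            ((-1) ^+ size s * (w x * phi x))%:E)%E].

(* The square of the L^2(D) norm. *)
Definition L2norm2 D u : \bar R :=
  (\int[lebesgue_rV R n]_(x in D) ((u x) ^+ 2)%:E)%E.

Definition multi_index (m : nat) (a : {ffun 'I_n -> 'I_m.+1}) : seq 'I_n :=
  flatten [seq nseq (a i) i | i <- enum 'I_n].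

(* The square of the H^m(D) norm, the sum of the squared L^2(D) norms of the
   weak derivatives of order at most [m]. The infimum is over an empty set,
   hence +oo, if these do not all exist; otherwise they are unique almost
   everywhere and the infimum is over a singleton. *)
Definition sobolev_norm2 (m : nat) D u : \bar R :=
  ereal_inf
    [set (\sum_(a : {ffun 'I_n -> 'I_m.+1} | (\sum_i a i <= m)%N)
            L2norm2 D (w a))%E
    | w in [set w : {ffun 'I_n -> 'I_m.+1} -> 'rV[R]_n -> R |
        forall a : {ffun 'I_n -> 'I_m.+1}, (\sum_i a i <= m)%N ->
          weak_derivative D (multi_index a) u (w a)]].

Definition in_sobolev (m : nat) D u : Prop := (sobolev_norm2 m D u < +oo)%E.

End calculus.

Section hypersurfaces.
Variables (R : realType) (n : nat).
Implicit Types (S D : set 'rV[R]_n) (psi : 'rV[R]_n -> R) (x : 'rV[R]_n).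

Definition local_equation S x psi : Prop :=
  [/\ smooth psi, grad psi x != 0 & \forall y \near x, S y <-> psi y = 0].

Definition closed_hypersurface S : Prop :=
  [/\ S !=set0, compact S & forall x, S x -> exists psi, local_equation S x psi].

Definition exterior D : set 'rV[R]_n := ~` closure D.

(* [D] is the interior of the closed hypersurface [S]: a bounded open set such
   that [S] is the common boundary of [D] and of [exterior D]. For connected
   [S] this is the bounded component of the complement of [S]. *)
Definition hypersurface_interior S D : Prop :=
  [/\ open D, bounded_set D, closure D `\` D = S &
      closure (exterior D) `\` exterior D = S].

Definition outward_unit_normal S D x (nu : 'rV[R]_n) : Prop :=
  [/\ \sum_j nu ord0 j ^+ 2 = 1,
      exists psi, local_equation S x psi /\
        exists c : R, grad psi x = c *: nu &
      \forall t \near (0 : R)^'+,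
        D (x - t *: nu) /\ exterior D (x + t *: nu)].

End hypersurfaces.

Section operator.
Variables (R : realType) (n : nat).
(* [G x] is the matrix [g^{jk}(x)], with row and column 0 for time. *)
Variable G : 'rV[R]_n -> 'M[R]_n.+1.

(* Signature (1, -1, ..., -1): a linear change of variables takes the
   quadratic form to xi_0^2 - xi_1^2 - ... - xi_n^2. *)
Definition lorentzian (A : 'M[R]_n.+1) : Prop :=
  exists2 P : 'M[R]_n.+1, P \in unitmx &
    P *m A *m P^T = diag_mx (\row_j (if j == ord0 then 1 else -1)).

Definition spatial_part (A : 'M[R]_n.+1) : 'M[R]_n :=
  \matrix_(j, k) A (lift ord0 j) (lift ord0 k).

Record wave_coefficients (C0 : R) : Prop := {
  wave_sym : forall x, (G x)^T = G x;
  wave_signature : forall x, lorentzian (G x);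
  wave_smooth : forall j k, smooth (fun x => G x j k);
  wave_bounded : forall j k, bounded_derivatives (fun x => G x j k);
  wave_C0 : 0 < C0;
  wave_time : forall x, C0 <= G x ord0 ord0;
  wave_space : exists r : R, forall x : 'rV[R]_n, r <= `|x| ->
    forall xi : 'rV[R]_n,
      \sum_j \sum_k spatial_part (G x) j k * xi ord0 j * xi ord0 k <=
      - C0 * \sum_j xi ord0 j ^+ 2 }.

Definition ergo_det (x : 'rV[R]_n) : R := \det (spatial_part (G x)).

Definition ergosphere : set 'rV[R]_n := [set x | ergo_det x = 0].

Definition ergosphere_interior (E : set 'rV[R]_n) : Prop :=
  [/\ closed_hypersurface ergosphere,
      hypersurface_interior ergosphere E,
      forall x, exterior E x -> 0 < (-1) ^+ n * ergo_det x &
      forall x, E x -> (-1) ^+ n * ergo_det x < 0].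

Definition metric_det (x : 'rV[R]_n) : R := (\det (G x))^-1.

Definition density (x : 'rV[R]_n) : R := Num.sqrt ((-1) ^+ n * metric_det x).

(* [L v = f] on the open subset [Q] of space-time, all derivatives in
   [L] being weak derivatives on [Q]: [dv k] is the derivative of [v] in x_k
   and [p j k] that of sqrt((-1)^n g) g^{jk} dv_k in x_j. *)
Definition wave_equation (Q : set 'rV[R]_n.+1) (v f : 'rV[R]_n.+1 -> R) :
    Prop :=
  exists (dv : 'I_n.+1 -> 'rV[R]_n.+1 -> R)
         (p : 'I_n.+1 -> 'I_n.+1 -> 'rV[R]_n.+1 -> R),
  [/\ forall k, weak_derivative Q [:: k] v (dv k),
      forall j k, weak_derivative Q [:: j]
        (fun y => density (tail_row y) * G (tail_row y) j k * dv k y) (p j k) &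
      {ae lebesgue_rV R n.+1, forall y, Q y ->
        \sum_j \sum_k (density (tail_row y))^-1 * p j k y = f y}].

End operator.

Section time_slices.
Variables (R : realType) (n : nat) (T : R) (D : set 'rV[R]_n).
Implicit Types (u : 'rV[R]_n.+1 -> R) (w : 'rV[R]_n -> R) (t : R).

(* D x (0, T), time being the first coordinate. *)
Definition cylinder : set 'rV[R]_n.+1 :=
  [set y : 'rV[R]_n.+1 | (0 < y ord0 ord0 < T) /\ D (tail_row y)].

(* [w] is u(t, .), in the sense of the continuous representative
   [0, T] -> L^2(D) of [u]: u(s, .) tends to [w] in L^2(D) as s tends to t,
   s ranging over (0, T) up to a null set. *)
Definition time_trace u t w : Prop :=
  [/\ measurable_fun D w, (L2norm2 D w < +oo)%E &
      forall e : R, 0 < e -> exists2 d : R, 0 < d &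
        {ae @lebesgue_measure R, forall s : R, 0 < s < T -> `|s - t| < d ->
          (L2norm2 D (fun x => (u (cons_row s x) - w x)%R) <= e%:E)%E}].

(* The value of the squared norm [N] at u(t, .), and +oo if [u] has no
   trace at time [t]; traces are unique almost everywhere. *)
Definition slice_norm2 (N : ('rV[R]_n -> R) -> \bar R) u t : \bar R :=
  ereal_inf [set N w | w in [set w | time_trace u t w]].

End time_slices.

(* Main.v *)
Require Import Defs.
From HB Require Import structures.
From mathcomp Require Import all_boot all_order all_algebra.
From mathcomp Require Import fingroup perm.
From mathcomp Require Import (coercions) finmap.
From mathcomp Require Import all_classical all_reals all_analysis.
From mathcomp Require Import measurable_realfun ring lra zify.
Set Implicit Arguments.
Unset Strict Implicit.
Unset Printing Implicit Defensive.
Import Order.TTheory GRing.Theory Num.Theory.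
Import numFieldNormedType.Exports.
Local Open Scope classical_set_scope.
Local Open Scope ring_scope.

(* The estimate is the energy estimate for the multiplier grad x_0. With a = dv
   and G the matrix of the coefficients, the component T^0 of the energy current
   T^j = 2 (G a)_j (G a)_0 - G_j0 <a, G a> is coercive because dx_0 is timelike
   (uniformly so: by compactness near the origin and by the hypothesis on the
   spatial part at infinity), and the divergence of T is Lv (G a)_0 up to a form
   in a with bounded coefficients. On S_0 the normal nu is null and
   <dx_0, nu> < 0, so energy only leaves the exterior through S_0. The flux
   through S_0 is never formed: T is multiplied by chi_m^2, where the cutoffs
   chi_m vanish near S_0 and tend to 1. Completing the square bounds the flux
   through w by <w, w> / <dx_0, w> (G a)_0^2; for w = d psi, psi an equation of
   S_0 that is positive outside, <w, w> = O(psi) because S_0 is characteristic.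
   Hence a step function of m psi, whose gradient is O(m) on a layer of width
   1/m, contributes at most a multiple of |a|^2 uniformly in m. Gronwall's lemma
   concludes.

   As v is only in H^2, its derivatives have no pointwise slices: a function u
   in L^2 with u_{x_0} in L^2 is represented by c(x) + int_0^{x_0} w(r, x) dr,
   and the energy identity is obtained from the product rule for such
   representatives in time and along lines in space. *)

(** * Smooth functions *)

(** Integration by parts in space has only the weak definition at its disposal. Multiplied by a
    compactly supported cutoff, a function and its derivative in direction [j] become integrable on
    whole lines; the function is then recovered both as the integral of its derivative from the left
    and as minus the integral to the right. Representing the two factors of a product in opposite
    ways turns integration by parts into an exchange of two integrals, without boundary term. Each
    factor needs its own cutoff, hence the square of the cutoffs.

    The current controls only the derivatives of [v]; [v] itself is added to the energy through its
    time derivative. The symmetry of the second derivatives comes from indexing the Sobolev data by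
    multi-indices.

    The norms in the conclusion are infima over traces, so traces must be shown unique, and their
    weak derivatives in space must be the slices of the derivatives of [v]. Both rest on a Hölder
    bound of exponent 1/2 in time, which also makes the energy continuous, so that its maximum is
    attained. *)

Section lines.
Variables (R : realType) (n : nat).
Implicit Types (f g : 'rV[R]_n -> R) (x v : 'rV[R]_n).

(** The two difference quotients agree as functions of [h], so derivability and the value of the
    derivative pass together between a line and the real variable. *)
Lemma derive_lineE f x v (s : R) :
  (fun h : R => h^-1 *: (((fun t : R => f (x + t *: v)) \o shift s) (h *: 1)
     - f (x + s *: v))) =
  (fun h : R => h^-1 *: ((f \o shift (x + s *: v)) (h *: v) - f (x + s *: v))).
Proof.
apply/funext => h /=; congr (_ *: (f _ - _)).
by rewrite -[h%:A]/(h * 1) mulr1 scalerDl addrCA addrC -addrA.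
Qed.

Lemma is_derive_line f x v (s : R) : derivable f (x + s *: v) v ->
  is_derive s 1 (fun t : R => f (x + t *: v)) ('D_v f (x + s *: v)).
Proof.
move=> df; apply: DeriveDef.
  by rewrite /derivable derive_lineE.
by rewrite /derive derive_lineE.
Qed.

Lemma is_derive_of_line f x v d :
  is_derive (0 : R) 1 (fun t : R => f (x + t *: v)) d -> is_derive x v f d.
Proof.
move=> -[df <-].
have := derive_lineE f x v 0; rewrite scale0r addr0 => E.
by apply: DeriveDef; [rewrite /derivable -E|rewrite /derive -E];
  move: df; rewrite /derivable /= scale0r addr0.
Qed.

Lemma is_derive_comp1 f (g : R -> R) x v (d : R) : derivable f x v ->
  is_derive (f x) 1 g d -> is_derive x v (fun y => g (f y)) (d * 'D_v f x).
Proof.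
move=> df dg; apply: is_derive_of_line.
have E : x + 0 *: v = x by rewrite scale0r addr0.
have dl : is_derive (0:R) 1 (fun t : R => f (x + t *: v)) ('D_v f x).
  by rewrite -{2}E; apply: is_derive_line; rewrite E.
by apply: (is_derive1_comp (f := g) _ dl); rewrite E.
Qed.

End lines.

Section smooth_functions.
Variables (R : realType) (n : nat).
Implicit Types (f g : 'rV[R]_n -> R) (x v : 'rV[R]_n).

(* An opaque copy of [smooth]: unification would otherwise unfold it. *)
Variant Cinf f : Prop := Cinf_of of smooth f.

Lemma CinfP f : Cinf f <-> smooth f.
Proof. by split => [[]|sf]; [|exact: Cinf_of]. Qed.

(** Coinduction for smoothness: the list in [smooth] is consumed from its head, so stability of [P]
    under one partial derivative carries it through every iterate. The closure properties below
    amount to finding a suitable [P]. *)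
Lemma smooth_coind (P : ('rV[R]_n -> R) -> Prop) :
  (forall f, P f -> [/\ continuous f,
     forall j x, derivable f x (delta_mx ord0 j) & forall j, P (partial f j)]) ->
  forall f, P f -> Cinf f.
Proof.
move=> H f Pf; apply: Cinf_of => s; suff [] : P (partials f s) /\ True.
  by move=> /H[? ? _].
by split => //; elim: s f Pf => //= j s IH f /H[_ _ /(_ j)]; exact: IH.
Qed.

Lemma smooth_continuous f : Cinf f -> continuous f.
Proof. by case=> /(_ [::])[]. Qed.

Lemma smooth_derivable f j x : Cinf f -> derivable f x (delta_mx ord0 j).
Proof. by case=> /(_ [::])[_]; exact. Qed.

Lemma smooth_partial f j : Cinf f -> Cinf (partial f j).
Proof. by case=> sf; apply: Cinf_of => s; exact: (sf (j :: s)). Qed.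

Local Opaque partial.

Lemma is_partial f j x : Cinf f ->
  is_derive x (delta_mx ord0 j) f (partial f j x).
Proof. by move=> sf; apply: derivableP; exact: smooth_derivable. Qed.

Lemma partial_val f j x d : is_derive x (delta_mx ord0 j) f d ->
  partial f j x = d.
Proof. by move=> H; exact: derive_val. Qed.

Lemma partial_cst (c : R) j : partial (cst c : 'rV[R]_n -> R) j = cst 0.
Proof. by apply/funext => x; apply: partial_val. Qed.

Lemma smooth_cst (c : R) : Cinf (fun _ : 'rV[R]_n => c).
Proof.
apply: (smooth_coind (P := fun f => exists c, f = cst c)); last by exists c.
move=> _ [{}c ->]; split; [exact: cst_continuous|move=> *|].
  exact: derivable_cst.
by move=> j; exists 0; rewrite partial_cst.
Qed.

(* Closure under products forces the class to be sums of products: the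
   Leibniz rule does not stay within single products. *)
Let sum2 (l : seq (('rV[R]_n -> R) * ('rV[R]_n -> R))) : 'rV[R]_n -> R :=
  fun x => \sum_(p <- l) p.1 x * p.2 x.

Let is_derive_sum2 l j x : {in l, forall p, Cinf p.1 /\ Cinf p.2} ->
  is_derive x (delta_mx ord0 j) (sum2 l)
   (sum2 (flatten [seq [:: (partial p.1 j, p.2); (p.1, partial p.2 j)]
            | p <- l]) x).
Proof.
elim: l => [|p l IH] H.
  have -> : sum2 [::] = cst 0 by apply/funext => y; rewrite /sum2 big_nil.
  exact: is_derive_cst.
have [sp1 sp2] : Cinf p.1 /\ Cinf p.2 by apply: H; rewrite mem_head.
have {}IH : _ := IH (fun q ql => H q (mem_behead (s := p :: l) ql)).
have -> : sum2 (p :: l) = p.1 * p.2 + sum2 l.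
  by apply/funext => y; rewrite /sum2 big_cons.
have d1 := is_partial j x sp1; have d2 := is_partial j x sp2.
apply: is_derive_eq.
by rewrite /sum2 /= !big_cons /= /GRing.scale /= addrA [p.1 x * _ + _]addrC
  [p.2 x * _]mulrC.
Qed.

Let smooth_sum2 l : {in l, forall p, Cinf p.1 /\ Cinf p.2} ->
  Cinf (sum2 l).
Proof.
move=> H; apply: (smooth_coind (P := fun f => exists2 l,
  {in l, forall p, Cinf p.1 /\ Cinf p.2} & f = sum2 l)); last by exists l.
move=> {l H} _ [l H ->]; split.
- move=> x; elim: l H => [|p l IH] H.
    have -> : sum2 [::] = cst 0 by apply/funext => y; rewrite /sum2 big_nil.
    exact: cst_continuous.
  have [sp1 sp2] : Cinf p.1 /\ Cinf p.2 by apply: H; rewrite mem_head.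
  have {}IH : _ := IH (fun q ql => H q (mem_behead (s := p :: l) ql)).
  have -> : sum2 (p :: l) = p.1 * p.2 + sum2 l.
    by apply/funext => y; rewrite /sum2 big_cons.
  apply: (@cvgD _ R^o _ _ _ (p.1 * p.2) (sum2 l) _ _ _ IH).
  by apply: cvgM; exact: smooth_continuous.
- by move=> j x; have := is_derive_sum2 j x H; case.
- move=> j; exists (flatten [seq [:: (partial p.1 j, p.2); (p.1, partial p.2 j)]
            | p <- l]).
    move=> q /flatten_mapP[p /H[s1 s2]].
    by rewrite !inE => /orP[]/eqP-> /=; split => //; exact: smooth_partial.
  by apply/funext => x; apply: partial_val; exact: is_derive_sum2.
Qed.

Lemma smoothM f g : Cinf f -> Cinf g -> Cinf (fun x => f x * g x).
Proof.
move=> sf sg; have : Cinf (sum2 [:: (f, g)]).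
  by apply: smooth_sum2 => p; rewrite inE => /eqP ->.
by congr Cinf; apply/funext => x; rewrite /sum2 big_seq1.
Qed.

Lemma smoothD f g : Cinf f -> Cinf g -> Cinf (fun x => f x + g x).
Proof.
move=> sf sg; have : Cinf (sum2 [:: (cst 1, f); (cst 1, g)]).
  by apply: smooth_sum2 => p; rewrite !inE => /orP[]/eqP -> /=; split => //;
    exact: smooth_cst.
by congr Cinf; apply/funext => x; rewrite /sum2 !big_cons big_nil /= !mul1r addr0.
Qed.

Lemma smooth_sum (I : Type) (r : seq I) (P : pred I) (F : I -> 'rV[R]_n -> R) :
  (forall i, P i -> Cinf (F i)) -> Cinf (fun x => \sum_(i <- r | P i) F i x).
Proof.
move=> H; elim: r => [|i r IH].
  by under eq_fun do rewrite big_nil; exact: smooth_cst.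
have [Pi|nPi] := boolP (P i); last first.
  by under eq_fun do rewrite big_cons (negbTE nPi).
under eq_fun do rewrite big_cons Pi.
by apply: smoothD => //; exact: H.
Qed.

Lemma smooth_prod (I : Type) (r : seq I) (P : pred I) (F : I -> 'rV[R]_n -> R) :
  (forall i, P i -> Cinf (F i)) -> Cinf (fun x => \prod_(i <- r | P i) F i x).
Proof.
move=> H; elim: r => [|i r IH].
  by under eq_fun do rewrite big_nil; exact: smooth_cst.
have [Pi|nPi] := boolP (P i); last first.
  by under eq_fun do rewrite big_cons (negbTE nPi).
under eq_fun do rewrite big_cons Pi.
by apply: smoothM => //; exact: H.
Qed.

Lemma smoothZ (c : R) f : Cinf f -> Cinf (fun x => c * f x).
Proof. by move=> sf; apply: smoothM => //; exact: smooth_cst. Qed.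

Lemma smoothN f : Cinf f -> Cinf (fun x => - f x).
Proof.
by move=> /(smoothZ (-1)); congr Cinf; apply/funext => x; rewrite mulN1r.
Qed.

Lemma smoothB f g : Cinf f -> Cinf g -> Cinf (fun x => f x - g x).
Proof. by move=> sf sg; apply: smoothD => //; exact: smoothN. Qed.

Lemma partialM f g j x : Cinf f -> Cinf g ->
  partial (fun x => f x * g x) j x = partial f j x * g x + f x * partial g j x.
Proof.
move=> sf sg; apply: partial_val.
apply: is_derive_eq (is_deriveM (is_partial j x sf) (is_partial j x sg)) _.
by rewrite addrC [g x *: _]mulrC.
Qed.

Lemma partialD f g j x : Cinf f -> Cinf g ->
  partial (fun x => f x + g x) j x = partial f j x + partial g j x.
Proof.
move=> sf sg; apply: partial_val.
exact: is_deriveD (is_partial j x sf) (is_partial j x sg).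
Qed.

Lemma partialN f j x : Cinf f ->
  partial (fun x => - f x) j x = - partial f j x.
Proof.
by move=> sf; apply: partial_val; exact: is_deriveN (is_partial j x sf).
Qed.

Lemma partialZ (c : R) f j x : Cinf f ->
  partial (fun x => c * f x) j x = c * partial f j x.
Proof.
move=> sf; rewrite partialM//; last exact: smooth_cst.
by rewrite partial_cst mul0r add0r.
Qed.

(* The functions [F k] are the successive derivatives of [F 0] on a set
   containing the values of [f]. *)
Lemma smooth_comp (F : nat -> R -> R) f :
  (forall k x, is_derive (f x) 1 (F k) (F k.+1 (f x))) -> Cinf f ->
  Cinf (fun x => F 0%N (f x)).
Proof.
move=> dF sf.
(* Sums of products [F k (f x) * p x] with [p] smooth are stable under partial derivatives: the
   chain rule raises [k] and the Leibniz rule differentiates [p]. The list [dl j l] records the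
   outcome. *)
pose comb (l : seq (nat * ('rV[R]_n -> R))) (x : 'rV[R]_n) :=
  \sum_(p <- l) F p.1 (f x) * p.2 x.
pose dl j (l : seq (nat * ('rV[R]_n -> R))) := flatten [seq
  [:: (p.1.+1, fun x => partial f j x * p.2 x); (p.1, partial p.2 j)] | p <- l].
have combD l j x : {in l, forall p, Cinf p.2} ->
    is_derive x (delta_mx ord0 j) (comb l) (comb (dl j l) x).
  elim: l => [|p l IH] H.
    have -> : comb [::] = cst 0 by apply/funext => y; rewrite /comb big_nil.
    exact: is_derive_cst.
  have sp : Cinf p.2 by apply: H; rewrite mem_head.
  have {}IH : _ := IH (fun q ql => H q (mem_behead (s := p :: l) ql)).
  have -> : comb (p :: l) = (fun x => F p.1 (f x)) * p.2 + comb l.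
    by apply/funext => y; rewrite /comb big_cons.
  have d1 := is_derive_comp1 (@smooth_derivable _ j x sf) (dF p.1 x).
  have d2 := is_partial j x sp.
  apply: is_derive_eq.
  rewrite /comb /dl /= !big_cons /= /GRing.scale /= addrA.
  rewrite [X in X + _]addrC; congr (_ + _ + _).
  by rewrite [RHS]mulrA mulrC.
have : Cinf (comb [:: (0%N, cst 1)]).
  apply: (smooth_coind (P := fun g => exists2 l,
    {in l, forall p, Cinf p.2} & g = comb l)); last first.
    exists [:: (0%N, cst 1)] => // p; rewrite inE => /eqP ->.
    exact: smooth_cst.
  move=> _ [l H ->]; split.
  - move=> x; elim: l H => [|p l IH] H.
      have -> : comb [::] = cst 0 by apply/funext => y; rewrite /comb big_nil.
      exact: cst_continuous.
    have sp : Cinf p.2 by apply: H; rewrite mem_head.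
    have {}IH : _ := IH (fun q ql => H q (mem_behead (s := p :: l) ql)).
    have -> : comb (p :: l) = (fun x => F p.1 (f x)) * p.2 + comb l.
      by apply/funext => y; rewrite /comb big_cons.
    apply: (@cvgD _ R^o _ _ _ ((fun x => F p.1 (f x)) * p.2) (comb l) _ _ _ IH).
    apply: cvgM; last exact: smooth_continuous.
    apply: (@continuous_comp _ _ _ f (F p.1)); first exact: smooth_continuous.
    apply: differentiable_continuous; apply/derivable1_diffP.
    by have [] := dF p.1 x.
  - by move=> j x; have := combD l j x H; case.
  - move=> j; exists (dl j l).
      move=> q /flatten_mapP[p /H sp].
      rewrite !inE => /orP[]/eqP-> /=; last exact: smooth_partial.
      by apply: smoothM => //; exact: smooth_partial.
    by apply/funext => x; apply: partial_val; exact: combD.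
by congr Cinf; apply/funext => x; rewrite /comb big_seq1 mulr1.
Qed.

Lemma partials_near f g s x : (\near x, f x = g x) ->
  \near x, partials f s x = partials g s x.
Proof.
elim: s f g x => //= j s IH f g x fg; apply: IH.
move/nbhs_interior: fg; apply: filterS => y fg.
exact: near_eq_derive.
Qed.

(** Iterated partial derivatives at a point depend only on the germ there, by [partials_near]. *)
Lemma smooth_local f :
  (forall x, exists2 g, Cinf g & \forall y \near x, g y = f y) -> Cinf f.
Proof.
move=> H; apply: Cinf_of => s; split => [x|j x]; have [g sg /(partials_near s) gf] := H x.
  have [cg _] := (CinfP g).1 sg s.
  rewrite /continuous_at -(nbhs_singleton gf).
  apply: cvg_trans (cg x); apply: (@near_eq_cvg _ _ (nbhs x)).
  by apply: (filterS _ gf) => y ->.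
have [_ dg] := (CinfP g).1 sg s.
by apply: near_eq_derivable (dg j x).
Unshelve. all: by end_near. Qed.

Lemma is_derive_coord i j x :
  is_derive x (delta_mx ord0 j) (fun y : 'rV[R]_n => y ord0 i) ((i == j)%:R : R).
Proof.
apply: is_derive_of_line.
have -> : (fun t : R => (x + t *: delta_mx ord0 j) ord0 i) =
   cst (x ord0 i) + id * cst ((i == j)%:R).
  by apply/funext => t; rewrite !mxE.
apply: is_derive_eq (is_deriveD (is_derive_cst _ _ _)
  (is_deriveM (is_derive_id _ _) (is_derive_cst _ _ _))) _.
by rewrite scaler0 !add0r /GRing.scale /= mulr1.
Qed.

Lemma smooth_coord i : Cinf (fun x : 'rV[R]_n => x ord0 i).
Proof.
apply: (smooth_coind (P := fun f => f = (fun x : 'rV[R]_n => x ord0 i) \/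
  exists c, f = cst c)); last by left.
move=> _ [->|[c ->]]; split.
- exact: coord_continuous.
- by move=> j x; have [] := is_derive_coord i j x.
- by move=> j; right; exists (i == j)%:R; apply/funext => x; apply: partial_val;
    exact: is_derive_coord.
- exact: cst_continuous.
- by move=> *; exact: derivable_cst.
- by move=> j; right; exists 0; rewrite partial_cst.
Qed.

End smooth_functions.

Lemma double_quarter_min (R : realFieldType) (a b : R) : 0 < a -> 0 < b ->
  2 * (Num.min a b / 4) < a.
Proof.
move=> a0 b0; have : Num.min a b <= a by rewrite ge_min lexx.
by move: (Num.min a b) => c; lra.
Qed.

Lemma le_dist_half (R : realFieldType) (a b c e : R) :
  `|a - b| < e / 2 -> `|a - c| < e / 2 -> `|b - c| <= e.
Proof.
rewrite !ltr_norml => /andP[? ?] /andP[? ?].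
by rewrite ler_norml; apply/andP; split; lra.
Qed.

(** * Mean value theorem along coordinates, symmetry of second partial derivatives, gradients *)

Section mean_value.
Variables (R : realType) (n : nat).
Implicit Types (f g : 'rV[R]_n -> R) (x v : 'rV[R]_n).

(** The intermediate point is located only by [|c| <= |h|], which treats both signs of the increment
    alike. *)
Lemma mean_value_partial f j x (h : R) : Cinf f ->
  exists2 c : R, `|c| <= `|h| & f (x + h *: delta_mx ord0 j) - f x =
    h * partial f j (x + c *: delta_mx ord0 j).
Proof.
move=> sf.
pose g (t : R) := f (x + t *: delta_mx ord0 j).
pose dg (t : R) := partial f j (x + t *: delta_mx ord0 j).
have dl (t : R) : is_derive t 1 g (dg t).
  by apply: is_derive_line; exact: smooth_derivable.
have cg : continuous g.
  move=> t; apply: differentiable_continuous; apply/derivable1_diffP.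
  by have [] := dl t.
have gh : g h = f (x + h *: delta_mx ord0 j) by [].
have g0 : g 0 = f x by rewrite /g scale0r addr0.
rewrite -gh -g0.
have [h0|h0] := leP 0 h.
  have [|c ch E] := @MVT_segment R g dg 0 h h0 (fun t _ => dl t).
    exact: continuous_subspaceT.
  exists c; last by rewrite E subr0 mulrC.
  by move: ch; rewrite in_itv /= => /andP[c0 ch]; rewrite !ger0_norm.
have [|c ch E] := @MVT_segment R g dg h 0 (ltW h0) (fun t _ => dl t).
  exact: continuous_subspaceT.
exists c; last by rewrite -opprB E sub0r mulrN opprK mulrC.
move: ch; rewrite in_itv /= => /andP[ch c0].
by rewrite !ler0_norm ?lerN2// ltW.
Qed.

Lemma continuous_dist f x (e : R) : continuous f -> 0 < e ->
  exists2 d : R, 0 < d & forall y, `|y - x| < d -> `|f y - f x| < e.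
Proof.
move=> cf e0; have /cvgrPdist_lt/(_ e e0) := cf x.
move=> /nbhs_normP[d /= d0 H]; exists d => // y yx.
by rewrite distrC; apply: H; rewrite /ball_ /= distrC.
Qed.

Lemma norm_delta_mx j : `|delta_mx ord0 j : 'rV[R]_n| <= 1.
Proof.
rewrite /Num.norm /= mx_normrE; apply/bigmax_leP; split => // -[i k] _ /=.
by rewrite mxE; case: (_ && _); rewrite ?normr1 ?normr0.
Qed.

Lemma derive_shiftE f x v w :
  (fun h : R => h^-1 *: (((fun y => f (y + v)) \o shift x) (h *: w)
     - f (x + v))) =
  (fun h : R => h^-1 *: ((f \o shift (x + v)) (h *: w) - f (x + v))).
Proof. by apply/funext => h /=; rewrite addrA. Qed.

Lemma is_derive_shift f x v w d : is_derive (x + v) w f d ->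
  is_derive x w (fun y => f (y + v)) d.
Proof.
move=> -[df <-]; apply: DeriveDef.
  by rewrite /derivable derive_shiftE.
by rewrite /derive derive_shiftE.
Qed.

Lemma partial_shift f v j x : Cinf f ->
  partial (fun y => f (y + v)) j x = partial f j (x + v).
Proof.
by move=> sf; apply: partial_val; apply: is_derive_shift; exact: is_partial.
Qed.

Lemma smooth_shift f v : Cinf f -> Cinf (fun y => f (y + v)).
Proof.
move=> sf; apply: (smooth_coind (P := fun g => exists2 f, Cinf f &
  g = fun y => f (y + v))); last by exists f.
move=> {sf f} _ [f sf ->]; split.
- move=> x; apply: (@cvg_comp _ _ _ (fun y => y + v) f _ (nbhs (x + v))).
    apply: (@cvgD _ 'rV[R]_n _ (nbhs x) _ id (cst v)); last exact: cvg_cst.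
    exact: cvg_id.
  exact: smooth_continuous.
- by move=> j x; have [] := is_derive_shift (is_partial j (x + v) sf).
- move=> j; exists (partial f j); first exact: smooth_partial.
  by apply/funext => x; rewrite partial_shift.
Qed.

(** Schwarz's argument: the second difference over a small square is symmetric in the two
    directions, and two mean value steps turn it into [r * r] times a mixed derivative at a nearby
    point, in either order. Continuity of the two mixed derivatives concludes. *)
Lemma partial_sym f i j x : Cinf f ->
  partial (partial f i) j x = partial (partial f j) i x.
Proof.
move=> sf.
have key k l (e : R) : 0 < e -> exists2 p : 'rV[R]_n, `|p - x| <= 2 * e &
    f (x + e *: delta_mx ord0 k + e *: delta_mx ord0 l) -
    f (x + e *: delta_mx ord0 k) - (f (x + e *: delta_mx ord0 l) - f x) =
    e * e * partial (partial f k) l p.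
  move=> e0; pose g y := f (y + e *: delta_mx ord0 l) - f y.
  have sg : Cinf g by apply: smoothB => //; exact: smooth_shift.
  have [c ce Ec] := mean_value_partial k x e sg.
  have [d de Ed] := mean_value_partial l (x + c *: delta_mx ord0 k) e
    (smooth_partial k sf).
  exists (x + c *: delta_mx ord0 k + d *: delta_mx ord0 l).
    rewrite -[x + _ + _]addrA [x + _]addrC addrK (le_trans (ler_normD _ _))// !normrZ.
    rewrite mulr_natl mulr2n; move: ce de; rewrite (gtr0_norm e0) => ce de.
    by apply: lerD; rewrite -[leRHS]mulr1; apply: ler_pM => //;
      exact: norm_delta_mx.
  move: Ec; rewrite /g => ->; rewrite -mulrA -Ed.
  have sg1 := smooth_shift (e *: delta_mx ord0 l) sf; have s2 := smoothN sf.
  by rewrite (partialD _ _ sg1 s2) (partialN _ _ sf) (partial_shift _ _ _ sf).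
have c1 : continuous (partial (partial f i) j).
  by apply: smooth_continuous; do 2 apply: smooth_partial.
have c2 : continuous (partial (partial f j) i).
  by apply: smooth_continuous; do 2 apply: smooth_partial.
apply/eqP; rewrite -subr_eq0 -normr_le0; apply/ler_addgt0Pl => e e0.
rewrite addr0.
have e2 : 0 < e / 2 by rewrite divr_gt0.
have [d1 d10 H1] := continuous_dist x c1 e2.
have [d2 d20 H2] := continuous_dist x c2 e2.
(* The intermediate points lie within [2 * r] of [x], which has to be smaller than both [d1] and
   [d2]. *)
pose r := Num.min d1 d2 / 4.
have r0 : 0 < r by rewrite divr_gt0// lt_min d10.
have [p px Ep] := key i j r r0; have [q qx Eq] := key j i r r0.
have r1 : 2 * r < d1 by apply: double_quarter_min.
have r2 : 2 * r < d2 by rewrite /r minC; apply: double_quarter_min.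
have {}H1 := H1 _ (le_lt_trans px r1); have {}H2 := H2 _ (le_lt_trans qx r2).
have E : partial (partial f i) j p = partial (partial f j) i q.
  apply: (@mulfI _ (r * r)); first by rewrite mulf_neq0 ?gt_eqF.
  have Ex : x + r *: delta_mx ord0 j + r *: delta_mx ord0 i =
    x + r *: delta_mx ord0 i + r *: delta_mx ord0 j by rewrite addrAC.
  rewrite Ex in Eq; apply: etrans (esym Ep) (etrans _ Eq).
  by move: (f (x + _ + _)) (f (x + _)) (f (x + _)) (f x) => a b c d; ring.
by rewrite E in H1; exact: le_dist_half H1 H2.
Qed.

(** The quotient splits into the one in direction [v] and an increment along coordinate [j] from a
    moving base point; the mean value theorem and continuity of the partial derivative give the
    limit of the latter. Adding coordinates one at a time then yields every directional
    derivative. *)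
Lemma is_derive_addl f x v (s : R) j d : Cinf f -> is_derive x v f d ->
  is_derive x (v + s *: delta_mx ord0 j) f (d + s * partial f j x).
Proof.
move=> sf [df <-].
suff H : (fun h : R => h^-1 *: ((f \o shift x) (h *: (v + s *: delta_mx ord0 j)) - f x))
    @ 0^' --> 'D_v f x + s * partial f j x.
  by apply: DeriveDef; [apply/cvg_ex; eexists; exact: H|exact: cvg_lim].
have -> : (fun h : R => h^-1 *: ((f \o shift x) (h *: (v + s *: delta_mx ord0 j)) - f x)) =
  (fun h : R => h^-1 *: ((f \o shift x) (h *: v) - f x)) +
  (fun h : R => h^-1 * (f (h *: v + x + (h * s) *: delta_mx ord0 j) - f (h *: v + x))).
  apply/funext => h /=.
  rewrite [RHS](_ : _ =
      h^-1 *: (f (h *: v + x + (h * s) *: delta_mx ord0 j) - f x)).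
    by rewrite [h *: (_ + _)]scalerDr scalerA addrAC.
  rewrite -[LHS]/(h^-1 * (f (h *: v + x) - f x) + h^-1 * (_ - _)) -mulrDr.
  by congr (_ * _); rewrite addrC subrKA.
apply: cvgD; first exact: df.
apply/cvgrPdist_le => e e0.
pose M := `|s| + 1.
have M0 : 0 < M by rewrite ltr_wpDl.
have cp : continuous (partial f j) by apply: smooth_continuous; exact: smooth_partial.
have [r r0 H] := continuous_dist x cp (divr_gt0 e0 M0).
pose K := `|v| + `|s| + 1.
have K0 : 0 < K by rewrite ltr_wpDl// addr_ge0.
rewrite near_withinE; apply/nbhs_normP; exists (r / K) => /=.
  by rewrite divr_gt0.
move=> h; rewrite /ball_ /= sub0r normrN => hr h0.
have [c ch ->] := mean_value_partial j (h *: v + x) (h * s) sf.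
rewrite -mulrA mulKf// -mulrBr normrM.
have : `|partial f j x - partial f j (h *: v + x + c *: delta_mx ord0 j)| < e / M.
  rewrite distrC; apply: H; rewrite addrAC addrK.
  rewrite (le_lt_trans (ler_normD _ _))// !normrZ.
  have c1 : `|c| * `|delta_mx ord0 j : 'rV[R]_n| <= `|h| * `|s|.
    rewrite -normrM -[leRHS]mulr1; apply: ler_pM => //.
    exact: norm_delta_mx.
  apply: (@le_lt_trans _ _ (`|h| * K)).
    by rewrite /K !mulrDr mulr1 -addrA lerD// ler_wpDr.
  by rewrite -ltr_pdivlMr.
move=> /ltW; rewrite ler_pdivlMr// => He.
rewrite mulrC (le_trans _ He)//; apply: ler_wpM2l => //.
by rewrite /M lerDl.
Qed.

Lemma is_derive_grad f x v : Cinf f ->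
  is_derive x v f (\sum_j v ord0 j * partial f j x).
Proof.
move=> sf; rewrite {1}(row_sum_delta v).
elim: (index_enum _) => [|j r IH]; last first.
  by rewrite !big_cons addrC [X in is_derive _ _ _ X]addrC; exact: is_derive_addl.
by rewrite !big_nil; exact: is_derive0.
Qed.

End mean_value.

(** * Smooth steps *)

Section flat_function.
Variable R : realType.
Implicit Types (p : {poly R}) (x y : R).

Definition flat_poly p x : R := if 0 < x then p.[x^-1] * expR (- x^-1) else 0.

(** For [x > 0] the derivative of [p(1/x) exp(-1/x)] is [x^-2 (p - p')(1/x) exp(-1/x)], so functions
    of this form are closed under differentiation. *)
Definition flat_deriv_poly p : {poly R} := 'X^2 * (p - p^`()).

(** The induction on [p] replaces [p] by [p * 'X + c], so it is run with an arbitrary extra factor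
    [y ^+ k]; monomials are bounded through the exponential series. *)
Lemma poly_expRN_bounded p : exists2 M : R, 0 <= M &
  forall y, 0 <= y -> `|p.[y]| * expR (- y) <= M.
Proof.
suff [M HM] : exists M : nat -> R, forall k y, 0 <= y ->
    y ^+ k * `|p.[y]| * expR (- y) <= M k.
  exists (`|M 0%N|) => // y y0.
  by rewrite (le_trans _ (ler_norm _))// -[leLHS]mul1r mulrA (HM 0%N).
elim/poly_ind: p => [|p c [M HM]].
  by exists (fun=> 0) => k y y0; rewrite horner0 normr0 mulr0 mul0r.
exists (fun k => M k.+1 + `|c| * (k.+1)`!%:R) => k y y0.
have yk : 0 <= y ^+ k by rewrite exprn_ge0.
apply: (@le_trans _ _ (y ^+ k.+1 * `|p.[y]| * expR (- y) + `|c| * (y ^+ k * expR (- y)))).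
  rewrite exprS -[leRHS](_ : y ^+ k * (y * `|p.[y]| + `|c|) * expR (- y) = _); last by ring.
  rewrite ler_wpM2r ?expR_ge0// ler_wpM2l// hornerMXaddC.
  by rewrite (le_trans (ler_normD _ _))// normrM (ger0_norm y0) mulrC.
rewrite lerD ?HM// ler_wpM2l// expRN ler_pdivrMr ?expR_gt0//.
case: k {yk} => [|k].
  by rewrite expr0 mul1r (le_trans _ (expR_ge1Dx y))// lerDl.
have := expR_ge1Dxn k y0; rewrite -lerBrDl => H.
have {}H : y ^+ k.+1 / (k.+1)`!%:R <= expR y by rewrite (le_trans H)// gerBl.
move: H; rewrite ler_pdivrMr ?ltr0n ?fact_gt0// mulrC => /le_trans; apply.
by rewrite ler_wpM2r ?expR_ge0// ler_nat leq_fact.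
Qed.

Lemma flat_poly_bounded p : exists2 M : R, 0 <= M & forall x, `|flat_poly p x| <= M.
Proof.
have [M M0 HM] := poly_expRN_bounded p; exists M => // x.
rewrite /flat_poly; case: ifPn => x0; last by rewrite normr0.
by rewrite normrM (ger0_norm (expR_ge0 _)) HM// invr_ge0 ltW.
Qed.

Lemma is_derive_flat_poly p x :
  is_derive x 1 (flat_poly p) (flat_poly (flat_deriv_poly p) x).
Proof.
have [x0|x0|->] := ltgtP x 0.
- apply: (@near_eq_is_derive _ _ _ (cst 0)) => //.
    near=> y; rewrite /flat_poly ifF//; apply/negbTE; rewrite -leNgt ltW//.
    by near: y; exact: lt_nbhsl.
  rewrite /flat_poly ifF; last by apply/negbTE; rewrite -leNgt ltW.
  exact: is_derive_cst.
- apply: (@near_eq_is_derive _ _ _ ((horner p \o (fun y => y^-1)) *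
      (expR \o (fun y => - y^-1)))).
    near=> y; rewrite /flat_poly ifT//.
    by near: y; exact: lt_nbhsr.
  have dV : is_derive x 1 (fun y : R => y^-1) (- x ^- 2 *: 1).
    by apply: (is_deriveV _ (is_derive_id _ _)); rewrite gt_eqF.
  have d1 := is_derive1_comp (is_derive_poly p x^-1) dV.
  have d2 := is_derive1_comp (g := fun y => - y^-1) (is_derive_expR (- x^-1)) (is_deriveN dV).
  apply: is_derive_eq (is_deriveM d1 d2) _.
  rewrite /flat_poly x0 /flat_deriv_poly !hornerE /= /GRing.scale /=.
  by rewrite expr2 -[x ^- 2]exprVn; ring.
(* At 0, for [h > 0], the difference quotient is [h] times the bounded function [('X^2 * p).[h^-1] *
   expR (- h^-1)], hence tends to 0. *)
- have [M M0 HM] := poly_expRN_bounded ('X^2 * p).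
  have -> : flat_poly (flat_deriv_poly p) 0 = 0 by rewrite /flat_poly ltxx.
  suff H : (fun h : R => h^-1 *: ((flat_poly p \o shift 0) (h *: 1) - flat_poly p 0))
      @ 0^' --> (0 : R).
    by apply: DeriveDef; [apply/cvg_ex; eexists; exact: H|exact: cvg_lim].
  apply/cvgrPdist_le => e e0; rewrite near_withinE; apply/nbhs_normP.
  exists (e / (M + 1)) => /=; first by rewrite divr_gt0// ltr_wpDl.
  move=> h; rewrite /ball_ /= sub0r normrN => hr h0.
  rewrite sub0r normrN addr0 /flat_poly ltxx subr0 /GRing.scale /= mulr1.
  case: ifPn => hp; last by rewrite mulr0 normr0 ltW.
  have : h^-1 * (p.[h^-1] * expR (- h^-1)) =
      h * (('X^2 * p).[h^-1] * expR (- h^-1)).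
    rewrite !hornerE /=; field; by rewrite gt_eqF.
  move=> ->; rewrite normrM [X in _ * X]normrM (ger0_norm (expR_ge0 _)).
  apply: (@le_trans _ _ (`|h| * M)).
    by rewrite ler_wpM2l// HM// invr_ge0 ltW.
  rewrite ltr_pdivlMr ?ltr_wpDl// in hr.
  by rewrite (le_trans _ (ltW hr))// ler_wpM2l// lerDl.
Unshelve. all: by end_near. Qed.

Definition flat x : R := flat_poly 1 x.

Lemma flat_le0 x : x <= 0 -> flat x = 0.
Proof. by move=> x0; rewrite /flat /flat_poly ltNge x0. Qed.

Lemma flat_gt0 x : 0 < x -> flat x = expR (- x^-1).
Proof. by move=> x0; rewrite /flat /flat_poly x0 hornerE mul1r. Qed.

Lemma flat_ge0 x : 0 <= flat x.
Proof.
by have [x0|x0] := leP x 0; [rewrite flat_le0|rewrite flat_gt0// expR_ge0].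
Qed.

Lemma le_flat x y : x <= y -> flat x <= flat y.
Proof.
move=> xy; have [x0|x0] := leP x 0; first by rewrite flat_le0// flat_ge0.
have y0 := lt_le_trans x0 xy.
by rewrite !flat_gt0// ler_expR lerN2 lef_pV2.
Qed.

Lemma smooth_flat n (f : 'rV[R]_n -> R) : Cinf f -> Cinf (fun z => flat (f z)).
Proof.
pose F k := flat_poly (iter k flat_deriv_poly 1).
apply: (@smooth_comp _ _ F) => k x.
by rewrite /F iterS; exact: is_derive_flat_poly.
Qed.

(** A smooth step rising from 0 to 1 on [[0, 1]]. It is made by composition with a constant
    denominator, so that its smoothness follows from [smooth_flat] without inverting a function. *)
Definition step x : R := flat (flat 1 - flat (1 - x)) / flat (flat 1).

Definition dflat x : R := flat_poly (flat_deriv_poly 1) x.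

Definition dstep x : R :=
  dflat (flat 1 - flat (1 - x)) * dflat (1 - x) / flat (flat 1).

Let flat1_gt0 : 0 < flat 1.
Proof. by rewrite flat_gt0// expR_gt0. Qed.

Let flatflat1_gt0 : 0 < flat (flat 1).
Proof. by rewrite flat_gt0// expR_gt0. Qed.

Lemma step_le0 x : x <= 0 -> step x = 0.
Proof.
move=> x0; rewrite /step [flat (_ - _)]flat_le0 ?mul0r// subr_le0 le_flat//.
by lra.
Qed.

Lemma step_ge1 x : 1 <= x -> step x = 1.
Proof.
move=> x1; rewrite /step [flat (1 - x)]flat_le0; last by lra.
by rewrite subr0 divff// gt_eqF.
Qed.

Lemma step_ge0 x : 0 <= step x.
Proof. by rewrite divr_ge0 ?flat_ge0. Qed.

Lemma step_le1 x : step x <= 1.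
Proof.
by rewrite ler_pdivrMr// mul1r le_flat// gerBl flat_ge0.
Qed.

Lemma is_derive_step x : is_derive x 1 step (dstep x).
Proof.
have d0 (y : R) : is_derive y 1 flat (dflat y) by exact: is_derive_flat_poly.
have d1 : is_derive x 1 (fun y : R => 1 - y) (0 - 1).
  exact: (is_deriveB (is_derive_cst _ _ _) (is_derive_id _ _)).
have d2 := is_derive1_comp (g := fun y : R => 1 - y) (d0 (1 - x)) d1.
have d3 := is_deriveB (is_derive_cst (flat 1) x 1) d2.
have d4 := is_derive1_comp (g := fun y : R => flat 1 - flat (1 - y))
  (d0 (flat 1 - flat (1 - x))) d3.
apply: is_derive_eq (is_deriveM d4 (is_derive_cst (flat (flat 1))^-1 x 1)) _.
by rewrite /dstep /GRing.scale /=; ring.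
Qed.

Lemma dstep_bounded : exists2 M : R, 0 <= M & forall x, `|dstep x| <= M.
Proof.
have [M M0 HM] := flat_poly_bounded (flat_deriv_poly 1).
exists (M * M / flat (flat 1)) => [|x]; first by rewrite divr_ge0 ?mulr_ge0// ltW.
rewrite /dstep 2!normrM normrV ?unitfE ?gt_eqF// (gtr0_norm flatflat1_gt0).
by apply: ler_wpM2r; [rewrite invr_ge0 ltW|apply: ler_pM => //; exact: HM].
Qed.

Lemma dflat_ge0 x : 0 <= dflat x.
Proof.
rewrite /dflat /flat_poly /flat_deriv_poly; case: ifPn => // x0.
rewrite derivC subr0 mulr1 !hornerE mulr_ge0 ?expR_ge0//.
by rewrite exprn_ge0// invr_ge0 ltW.
Qed.

(** The sign is essential: the flux through the hypersurface is bounded from above only, and such a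
    bound survives multiplication by a nonnegative factor. *)
Lemma dstep_ge0 x : 0 <= dstep x.
Proof. by rewrite divr_ge0 ?mulr_ge0 ?dflat_ge0// ltW. Qed.

Lemma dflat_le0 x : x <= 0 -> dflat x = 0.
Proof. by move=> x0; rewrite /dflat /flat_poly ltNge x0. Qed.

Lemma dstep_eq0 x : (x <= 0) || (1 <= x) -> dstep x = 0.
Proof.
rewrite /dstep => /orP[x0|x1].
  by rewrite dflat_le0 ?mul0r// subr_le0; apply: le_flat; lra.
by rewrite [dflat (1 - x)]dflat_le0 ?mulr0 ?mul0r// subr_le0.
Qed.

Lemma smooth_step n (f : 'rV[R]_n -> R) : Cinf f -> Cinf (fun z => step (f z)).
Proof.
move=> sf; have s1 : Cinf (fun z => flat (1 - f z)).
  by apply: smooth_flat; apply: smoothB => //; exact: smooth_cst.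
apply: smoothM; last exact: smooth_cst.
by apply: smooth_flat; apply: smoothB => //; exact: smooth_cst.
Qed.

Lemma partial_step n (f : 'rV[R]_n -> R) j z : Cinf f ->
  partial (fun z => step (f z)) j z = dstep (f z) * partial f j z.
Proof.
move=> sf; apply: partial_val; apply: is_derive_comp1.
  exact: smooth_derivable.
exact: is_derive_step.
Qed.

End flat_function.

(** * Integrable and square-integrable functions *)

Lemma ae_eq_integrable d (T : measurableType d) (R : realType)
    (mu : {measure set T -> \bar R}) (f g : T -> \bar R) :
  measurable_fun setT g -> ae_eq mu setT f g ->
  mu.-integrable setT f -> mu.-integrable setT g.
Proof.
move=> mg fg /integrableP[mf ioo]; apply/integrableP; split => //.
rewrite (ae_eq_integral (abse \o f))//; try exact: measurableT_comp.
by apply: filterS fg => x fg /fg /= ->.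
Qed.

Section real_integrals.
Context d (T : measurableType d) (R : realType) (mu : {measure set T -> \bar R}).
Implicit Types f g u w c : T -> R.

Definition intg f := mu.-integrable setT (EFin \o f).

Lemma intg_measurable f : intg f -> measurable_fun setT f.
Proof. by move=> /integrableP[/measurable_EFinP]. Qed.

Lemma intg_le f g : measurable_fun setT f -> intg g ->
  (forall x, `|f x| <= g x) -> intg f.
Proof.
move=> mf ig fg; apply: le_integrable ig => //.
  exact/measurable_EFinP.
by move=> x _ /=; rewrite lee_fin (le_trans (fg x))// ler_norm.
Qed.

Lemma intgD f g : intg f -> intg g -> intg (fun x => f x + g x).
Proof. by move=> intf ing; exact: (integrableD measurableT intf ing). Qed.

Lemma intgZ (k : R) f : intg f -> intg (fun x => k * f x).
Proof. by move=> intf; exact: (integrableZl measurableT k intf). Qed.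

Lemma intgN f : intg f -> intg (fun x => - f x).
Proof. by move=> /(intgZ (-1)); congr intg; apply/funext => x; rewrite mulN1r. Qed.

Lemma intgB f g : intg f -> intg g -> intg (fun x => f x - g x).
Proof. by move=> intf ing; exact: (integrableB measurableT intf ing). Qed.

Lemma intg0 : intg (fun=> 0).
Proof. exact: integrable0. Qed.

Lemma intg_sum (I : Type) (r : seq I) (F : I -> T -> R) :
  (forall i, intg (F i)) -> intg (fun x => \sum_(i <- r) F i x).
Proof.
move=> H; elim: r => [|i r IH].
  by under eq_fun do rewrite big_nil; exact: intg0.
by under eq_fun do rewrite big_cons; apply: intgD.
Qed.

Lemma intg_abs f : intg f -> intg (fun x => `|f x|).
Proof.
move=> intf; apply: (intg_le _ (_ : intg (fun x => `|f x|))).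
- by apply: measurableT_comp => //; exact: intg_measurable.
- have /integrable_abse := intf; apply: eq_integrable => // x _.
- by move=> x; rewrite normr_id.
Qed.

Lemma RintD f g : intg f -> intg g ->
  \int[mu]_x (f x + g x) = \int[mu]_x f x + \int[mu]_x g x.
Proof. by move=> intf ing; rewrite RintegralD. Qed.

Lemma RintB f g : intg f -> intg g ->
  \int[mu]_x (f x - g x) = \int[mu]_x f x - \int[mu]_x g x.
Proof. by move=> intf ing; rewrite RintegralB. Qed.

Lemma RintZ (k : R) f : intg f -> \int[mu]_x (k * f x) = k * \int[mu]_x f x.
Proof. by move=> intf; rewrite RintegralZl. Qed.

Lemma RintN f : intg f -> \int[mu]_x (- f x) = - \int[mu]_x f x.
Proof.
by move=> intf; under eq_Rintegral do rewrite -mulN1r; rewrite RintZ ?mulN1r.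
Qed.

Lemma Rint0 : \int[mu]_x (0 : R) = 0 :> R.
Proof. by rewrite /Rintegral integral0. Qed.

Lemma Rint_sum (I : Type) (r : seq I) (F : I -> T -> R) :
  (forall i, intg (F i)) ->
  \int[mu]_x (\sum_(i <- r) F i x) = \sum_(i <- r) \int[mu]_x F i x.
Proof.
move=> H; elim: r => [|i r IH].
  by under eq_Rintegral do rewrite big_nil; rewrite big_nil Rint0.
under eq_Rintegral do rewrite big_cons.
by rewrite big_cons RintD ?IH//; exact: intg_sum.
Qed.

Lemma Rint_le f g : intg f -> intg g -> (forall x, f x <= g x) ->
  \int[mu]_x f x <= \int[mu]_x g x.
Proof. by move=> intf ing fg; exact: le_Rintegral. Qed.

Lemma Rint_ge0 f : (forall x, 0 <= f x) -> 0 <= \int[mu]_x f x.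
Proof. by move=> f0; exact: Rintegral_ge0. Qed.

Lemma Rint_norm f : intg f -> `|\int[mu]_x f x| <= \int[mu]_x `|f x|.
Proof. by move=> intf; exact: le_normr_Rintegral. Qed.

Lemma RintE f : intg f -> (\int[mu]_x (f x)%:E)%E = (\int[mu]_x f x)%:E.
Proof.
by move=> intf; rewrite /Rintegral fineK//; exact: integrable_fin_num.
Qed.

Lemma ae_intg f g : {ae mu, forall x, f x = g x} -> measurable_fun setT g ->
  intg f -> intg g.
Proof.
move=> fg mg intf; apply: (ae_eq_integrable (f := EFin \o f)) => //.
  exact/measurable_EFinP.
by apply: filterS fg => x fg _ /=; rewrite fg.
Qed.

Lemma ae_Rint f g : {ae mu, forall x, f x = g x} -> measurable_fun setT f ->
  measurable_fun setT g -> \int[mu]_x f x = \int[mu]_x g x.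
Proof.
move=> fg mf mg; rewrite /Rintegral; congr fine; apply: ae_eq_integral => //.
- exact/measurable_EFinP.
- exact/measurable_EFinP.
- by apply: filterS fg => x fg _; rewrite fg.
Qed.

Lemma Rint_dct (F : nat -> T -> R) f g : (forall n, measurable_fun setT (F n)) ->
  (forall x, F ^~ x @ \oo --> f x) -> intg g ->
  (forall n x, `|F n x| <= g x) ->
  intg f /\ (fun n => \int[mu]_x F n x) @ \oo --> \int[mu]_x f x.
Proof.
move=> mF Ff ig Fg.
have mf : measurable_fun setT f.
  by apply: (measurable_fun_cvg (h := F)) => // x _; exact: Ff.
have [|||||intf _ H] := @dominated_convergence _ _ _ mu setT measurableT
  (fun n x => (F n x)%:E) (EFin \o f) (EFin \o g).
- by move=> n; exact/measurable_EFinP.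
- exact/measurable_EFinP.
- by apply: aeW => x _; apply: cvg_EFin; [exact: nearW|exact: Ff].
- exact: ig.
- by apply: aeW => x n _; rewrite lee_fin.
split => //; rewrite /Rintegral.
have iF n : intg (F n) by exact: intg_le (mF n) ig (Fg n).
by apply: fine_cvg; move: H; rewrite RintE// => H; apply: cvg_trans H;
  apply: near_eq_cvg; apply: nearW => n; rewrite /= (RintE (iF n)).
Qed.

Lemma Rint_eq0 f : intg f -> (forall x, 0 <= f x) -> \int[mu]_x f x = 0 ->
  {ae mu, forall x, f x = 0}.
Proof.
move=> intf f0 f00.
have : (\int[mu]_x `|(f x)%:E| = 0)%E.
  by under eq_integral do rewrite gee0_abs ?lee_fin//; rewrite RintE// f00.
move=> /(ae_eq_integral_abs mu measurableT (measurable_int _ intf)).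
by apply: filterS => x /(_ I) [].
Qed.

Definition L2 f := measurable_fun setT f /\ intg (fun x => f x ^+ 2).

Lemma L2M f g : L2 f -> L2 g -> intg (fun x => f x * g x).
Proof.
move=> [mf f2] [mg g2]; apply: (intg_le _ (intgD f2 g2)).
  exact: measurable_funM.
move=> x; rewrite normrM.
have : 0 <= (`|f x| - `|g x|) ^+ 2 by rewrite sqr_ge0.
rewrite -[f x ^+ 2]real_normK ?num_real// -[g x ^+ 2]real_normK ?num_real//.
by have := normr_ge0 (f x); have := normr_ge0 (g x); nra.
Qed.

Lemma L2D f g : L2 f -> L2 g -> L2 (fun x => f x + g x).
Proof.
move=> Lf Lg; have fg := L2M Lf Lg; move: Lf Lg => [mf f2] [mg g2]; split.
  exact: measurable_funD.
have := intgD (intgD f2 (intgZ 2 fg)) g2; congr intg.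
by apply/funext => x; ring.
Qed.

Lemma L2_bounded c f (M : R) : measurable_fun setT c -> (forall x, `|c x| <= M) ->
  L2 f -> L2 (fun x => c x * f x).
Proof.
move=> mc cM [mf f2]; have mcf : measurable_fun setT (fun x => c x * f x).
  exact: measurable_funM.
split => //; apply: (intg_le _ (intgZ (M ^+ 2) f2)).
  exact: measurable_funX.
move=> x; rewrite exprMn normrM !normrX real_normK ?num_real// [X in _ * X]real_normK ?num_real//.
rewrite ler_wpM2r ?sqr_ge0// -[c x ^+ 2]real_normK ?num_real// ler_sqr ?nnegrE//.
exact: le_trans (cM x).
Qed.

Lemma L2Z (k : R) f : L2 f -> L2 (fun x => k * f x).
Proof. exact: (L2_bounded (M := `|k|)). Qed.

Lemma L20 : L2 (fun=> 0).
Proof.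
by split; [exact: measurable_cst|under eq_fun do rewrite expr0n; exact: intg0].
Qed.

Lemma L2_sum (I : Type) (r : seq I) (F : I -> T -> R) :
  (forall i, L2 (F i)) -> L2 (fun x => \sum_(i <- r) F i x).
Proof.
move=> H; elim: r => [|i r IH].
  by under eq_fun do rewrite big_nil; exact: L20.
by under eq_fun do rewrite big_cons; apply: L2D.
Qed.

Lemma ae_L2 f g : {ae mu, forall x, f x = g x} -> measurable_fun setT g ->
  L2 f -> L2 g.
Proof.
move=> fg mg [mf f2]; split => //; apply: ae_intg f2.
  by apply: filterS fg => x ->.
exact: measurable_funX.
Qed.

End real_integrals.

(** * Fubini's theorem for real-valued functions, and almost every section *)

Section product_integrals.
Context d1 d2 (T1 : measurableType d1) (T2 : measurableType d2) (R : realType).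
Variables (m1 : {sigma_finite_measure set T1 -> \bar R})
  (m2 : {sigma_finite_measure set T2 -> \bar R}).
Implicit Types f : T1 * T2 -> R.

Notation m12 := (m1 \x m2)%E.

Lemma ae_prod1 (P : T1 * T2 -> Prop) : {ae m12, forall z, P z} ->
  {ae m1, forall x, {ae m2, forall y, P (x, y)}}.
Proof.
move=> [N [mN N0 NP]].
have H : {ae m1, forall x, m2 (xsection N x) = 0%E}.
  have mF := measurable_fun_xsection m2 mN.
  have : (\int[m1]_x `|m2 (xsection N x)| = 0)%E.
    rewrite -[RHS]N0; apply: eq_integral => x _.
    by rewrite gee0_abs.
  move=> /(ae_eq_integral_abs _ measurableT mF).
  by apply: filterS => x /(_ I).
apply: filterS H => x Hx; exists (xsection N x); split => //.
  exact: measurable_xsection.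
by move=> y /= nP; rewrite /xsection/= inE; exact: NP.
Qed.

(** The product measure is the integral of the measures of the sections in [T2]; for the sections in
    [T1] Tonelli's theorem is applied to the indicator of the null set. *)
Lemma ae_prod2 (P : T1 * T2 -> Prop) : {ae m12, forall z, P z} ->
  {ae m2, forall y, {ae m1, forall x, P (x, y)}}.
Proof.
move=> [N [mN N0 NP]].
have H : {ae m2, forall y, m1 (ysection N y) = 0%E}.
  have mF := measurable_fun_ysection m1 mN.
  have : (\int[m2]_y `|m1 (ysection N y)| = 0)%E.
    have := @fubini_tonelli2 _ _ _ _ _ m1 m2 (EFin \o \1_N).
    have -> : (\int[m12]_z (EFin \o \1_N) z = 0)%E.
      by rewrite /= integral_indic// setIT.
    move=> ->//; last 2 first.
    - by apply/measurable_EFinP; exact: (@measurable_indic _ _ _ setT N).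
    - by move=> z; rewrite lee_fin.
    apply: eq_integral => y _; rewrite gee0_abs//.
    rewrite /fubini_G -[in LHS](setIT (ysection N y)) -integral_indic//; last exact: measurable_ysection.
    by apply: eq_integral => x _; rewrite /= !indicE/= mem_ysection.
  move=> /(ae_eq_integral_abs _ measurableT mF).
  by apply: filterS => x /(_ I).
apply: filterS H => y Hy; exists (ysection N y); split => //.
  exact: measurable_ysection.
by move=> x /= nP; rewrite /ysection/= inE; exact: NP.
Qed.

Lemma ae_intg1 f : intg m12 f -> {ae m1, forall x, intg m2 (fun y => f (x, y))}.
Proof. by move=> intf; exact: (ae_integrable1 intf). Qed.

Lemma ae_intg2 f : intg m12 f -> {ae m2, forall y, intg m1 (fun x => f (x, y))}.
Proof. by move=> intf; exact: (ae_integrable2 intf). Qed.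

Lemma intg_fubini1 f : intg m12 f -> intg m1 (fun x => \int[m2]_y f (x, y)) /\
  \int[m1]_x \int[m2]_y f (x, y) = \int[m12]_z f z.
Proof.
move=> intf.
have iF := integrable_fubini_F intf; have EF := integral12_prod_meas1 intf.
have mF : measurable_fun setT (fun x => \int[m2]_y f (x, y)).
  exact: (measurableT_comp (fine_measurable measurableT) (measurable_fubini_F intf)).
have aeF : {ae m1, forall x, setT x ->
    fubini_F m2 (EFin \o f) x = (\int[m2]_y f (x, y))%:E}.
  by apply: filterS (ae_intg1 intf) => x /= ix _; rewrite -RintE.
have mF' : measurable_fun setT (EFin \o (fun x => \int[m2]_y f (x, y))).
  exact/measurable_EFinP.
split; first exact: (ae_eq_integrable mF' aeF iF).
rewrite [RHS]/Rintegral -[in RHS]/(EFin \o f) -EF [LHS]/Rintegral; congr fine.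
apply: ae_eq_integral => //; try exact: (measurable_fubini_F intf).
by apply: filterS aeF => x H _; rewrite H.
Qed.

Lemma intg_fubini2 f : intg m12 f -> intg m2 (fun y => \int[m1]_x f (x, y)) /\
  \int[m2]_y \int[m1]_x f (x, y) = \int[m12]_z f z.
Proof.
move=> intf.
have EF := integral21_prod_meas1 intf.
have mF : measurable_fun setT (fun y => \int[m1]_x f (x, y)).
  exact: (measurableT_comp (fine_measurable measurableT) (measurable_fubini_G intf)).
have aeF : {ae m2, forall y, setT y ->
    fubini_G m1 (EFin \o f) y = (\int[m1]_x f (x, y))%:E}.
  by apply: filterS (ae_intg2 intf) => x /= ix _; rewrite -RintE.
have mF' : measurable_fun setT (EFin \o (fun y => \int[m1]_x f (x, y))).
  exact/measurable_EFinP.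
split; last first.
  rewrite [RHS]/Rintegral -[in RHS]/(EFin \o f) -EF [LHS]/Rintegral; congr fine.
  apply: ae_eq_integral => //; try exact: (measurable_fubini_G intf).
  by apply: filterS aeF => x H _; rewrite H.
apply/integrableP; split => //.
have /integrable21ltyP : measurable_fun setT (EFin \o f).
  exact: measurable_int _ intf.
move=> /(_ m1 m2)[+ _] => /(_ intf); apply: le_lt_trans.
have H1 : measurable_fun setT (fun y => \int[m1]_x `|(f (x, y))%:E|)%E.
  apply: (measurable_fun_fubini_tonelli_G (fun z => `|(f z)%:E|%E)) => //.
  by apply: measurableT_comp => //; exact: measurable_int _ intf.
apply: ae_ge0_le_integral => //.
- by apply: measurableT_comp.
- by move=> y _; exact: integral_ge0.
apply: filterS (ae_intg2 intf) => y /= iy _.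
have H2 : (`|(\int[m1]_x f (x, y))%:E| <= \int[m1]_x `|(f (x, y))%:E|)%E.
  rewrite -(RintE iy); apply: le_abse_integral => //.
  exact: measurable_int _ iy.
exact: H2.
Qed.

Lemma Rint_swap f : intg m12 f ->
  \int[m1]_x \int[m2]_y f (x, y) = \int[m2]_y \int[m1]_x f (x, y).
Proof.
by move=> intf; rewrite (intg_fubini1 intf).2 (intg_fubini2 intf).2.
Qed.

End product_integrals.

(** * Lebesgue measure along a coordinate *)

Section insertion.
Variables (R : realType) (n : nat).
Implicit Types (j : 'I_n.+1) (t : R) (y : 'rV[R]_n) (x : 'rV[R]_n.+1).

(** For [j = ord0] this is [cons_row]; an arbitrary slot serves to integrate along spatial lines. *)
Definition ins_row j t y : 'rV[R]_n.+1 :=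
  \row_k (if unlift j k is Some i then y ord0 i else t).

Definition del_row j x : 'rV[R]_n := \row_i x ord0 (lift j i).

Lemma ins_row_at j t y : ins_row j t y ord0 j = t.
Proof. by rewrite mxE unlift_none. Qed.

Lemma ins_row_lift j t y i : ins_row j t y ord0 (lift j i) = y ord0 i.
Proof. by rewrite mxE liftK. Qed.

Lemma ins_del_row j x : ins_row j (x ord0 j) (del_row j x) = x.
Proof. by apply/rowP => k; rewrite mxE; case: unliftP => [i ->|->]; rewrite ?mxE. Qed.

Lemma del_ins_row j t y : del_row j (ins_row j t y) = y.
Proof. by apply/rowP => k; rewrite mxE ins_row_lift. Qed.

Lemma measurable_ins_row_comp d (T : measurableType d) j (f : T -> R)
    (g : T -> 'rV[R]_n) :
  measurable_fun setT f -> measurable_fun setT g ->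
  measurable_fun setT (fun z => ins_row j (f z) (g z)).
Proof.
move=> mf mg; apply: measurable_fun_rV => k.
under eq_fun do rewrite mxE.
case: (unliftP j k) => [i _|_]; last exact: mf.
exact: (measurableT_comp (measurable_rV_coord i) mg).
Qed.

Lemma measurable_ins_row j :
  measurable_fun [set: measurableTypeR R * 'rV[R]_n] (fun p => ins_row j p.1 p.2).
Proof.
by apply: measurable_ins_row_comp; [exact: measurable_fst|exact: measurable_snd].
Qed.

Lemma measurable_del_row j : measurable_fun [set: 'rV[R]_n.+1] (del_row j).
Proof.
apply: measurable_fun_rV => i; under eq_fun do rewrite mxE.
exact: measurable_rV_coord.
Qed.

End insertion.

Lemma cons_rowE (R : realType) n (t : R) (y : 'rV[R]_n) :
  cons_row t y = ins_row ord0 t y.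
Proof. by []. Qed.

Lemma tail_rowE (R : realType) n (x : 'rV[R]_n.+1) : tail_row x = del_row ord0 x.
Proof. by []. Qed.

Lemma cons_ins_row (R : realType) n (j : 'I_n.+1) (s t : R) (y : 'rV[R]_n) :
  ins_row ord0 s (ins_row j t y) = ins_row (lift ord0 j) t (ins_row ord0 s y).
Proof.
apply/rowP => k; rewrite [LHS]mxE.
case: (unliftP ord0 k) => [i ->|->]; last first.
  rewrite (_ : ord0 = lift (lift ord0 j) ord0 :> 'I_n.+2) ?ins_row_lift ?ins_row_at//.
  exact: val_inj.
case: (unliftP j i) => [l ->|->]; last by rewrite !ins_row_at.
rewrite ins_row_lift (_ : lift ord0 (lift j l) = lift (lift ord0 j) (lift ord0 l)).
  by rewrite !ins_row_lift.
by apply: val_inj; rewrite /= /bump /=; lia.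
Qed.

Section insertion_measure.
Variable R : realType.
Notation lambda := (@lebesgue_measure R).
Notation leb n := (lebesgue_rV R n).

Lemma integral_cons_row n (f : 'rV[R]_n.+1 -> \bar R) :
  measurable_fun setT f -> (forall x, 0 <= f x)%E ->
  (\int[leb n.+1]_x f x =
   \int[lambda \x leb n]_p f (ins_row ord0 p.1 p.2))%E.
Proof.
move=> mf f0.
transitivity (\int[pushforward (lambda \x leb n)%E
  (fun p : measurableTypeR R * 'rV[R]_n => cons_row p.1 p.2)]_(x in setT) f x)%E; first by [].
rewrite ge0_integral_pushforward//; first exact: measurable_cons_row.
Qed.

(** Lebesgue measure is built by adding coordinates in front. For another slot the first coordinate
    is split off, the induction hypothesis is used on the rest, and Tonelli's theorem exchanges the
    two real variables. *)
Lemma integral_ins_row n (j : 'I_n.+1) (f : 'rV[R]_n.+1 -> \bar R) :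
  measurable_fun setT f -> (forall x, 0 <= f x)%E ->
  (\int[leb n.+1]_x f x =
   \int[lambda \x leb n]_p f (ins_row j p.1 p.2))%E.
Proof.
elim: n j f => [|n IH] j f mf f0.
  by rewrite (ord1 j); exact: integral_cons_row.
case: (unliftP ord0 j) => [j' ->|->]; last exact: integral_cons_row.
have mg : measurable_fun setT (fun q : (measurableTypeR R * measurableTypeR R) * 'rV[R]_n =>
    f (ins_row ord0 q.1.1 (ins_row j' q.1.2 q.2))).
  apply: (measurableT_comp mf); apply: measurable_ins_row_comp.
    exact: (measurableT_comp measurable_fst measurable_fst).
  apply: measurable_ins_row_comp; last exact: measurable_snd.
  exact: (measurableT_comp measurable_snd measurable_fst).
have mfi k : measurable_fun setT (fun p : measurableTypeR R * 'rV[R]_n.+1 => f (ins_row k p.1 p.2)).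
  by apply: (measurableT_comp mf); exact: measurable_ins_row.
have ms k (s : measurableTypeR R) : measurable_fun setT (fun x : 'rV[R]_n.+1 => f (ins_row k s x)).
  exact: (measurableT_comp (mfi k) (measurable_pair1 s)).
have mst k (l : 'I_n.+1) (s : measurableTypeR R) : measurable_fun setT
    (fun p : measurableTypeR R * 'rV[R]_n => f (ins_row k s (ins_row l p.1 p.2))).
  by apply: (measurableT_comp (ms k s)); exact: measurable_ins_row.
pose F0 (p : measurableTypeR R * 'rV[R]_n.+1) := f (ins_row ord0 p.1 p.2).
pose F1 (p : measurableTypeR R * 'rV[R]_n.+1) := f (ins_row (lift ord0 j') p.1 p.2).
pose H (q : measurableTypeR R * measurableTypeR R) :=
  (\int[leb n]_y f (ins_row ord0 q.1 (ins_row j' q.2 y)))%E.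
have f00 p : (0 <= F0 p)%E by exact: f0.
have f10 p : (0 <= F1 p)%E by exact: f0.
have H0 q : (0 <= H q)%E by exact: integral_ge0.
have mH : measurable_fun setT H by exact: (measurable_fun_fubini_tonelli_F (m2 := leb n) _ mg (fun q => f0 _)).
have E0 : (\int[lambda \x leb n.+1]_p F0 p = \int[lambda]_s \int[lambda]_t H (s, t))%E.
  rewrite (fubini_tonelli1 F0 (mfi ord0) f00); apply: eq_integral => s _.
  rewrite /fubini_F [LHS](IH j' _ (ms ord0 s) (fun x => f0 _)).
  exact: (fubini_tonelli1 _ (mst ord0 j' s) (fun p => f0 _)).
have E1 : (\int[lambda \x leb n.+1]_p F1 p = \int[lambda]_t \int[lambda]_s H (s, t))%E.
  rewrite (fubini_tonelli1 F1 (mfi _) f10); apply: eq_integral => t _.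
  rewrite /fubini_F [LHS](integral_cons_row (ms (lift ord0 j') t) (fun x => f0 _)).
  rewrite [LHS](fubini_tonelli1 _ (mst (lift ord0 j') ord0 t) (fun p => f0 _)).
  by apply: eq_integral => s _; apply: eq_integral => y _; rewrite /= cons_ins_row.
rewrite (integral_cons_row mf f0) [LHS]E0 [RHS]E1.
exact: (fubini_tonelli H mH H0).
Qed.

Lemma lebesgue_rV_ins n (j : 'I_n.+1) (A : set 'rV[R]_n.+1) : measurable A ->
  leb n.+1 A = (lambda \x leb n)%E ((fun p => ins_row j p.1 p.2) @^-1` A).
Proof.
move=> mA; have mf : measurable_fun setT (EFin \o \1_A : 'rV[R]_n.+1 -> \bar R).
  by apply/measurable_EFinP; exact: measurable_indic.
have mA' : measurable ((fun p : measurableTypeR R * 'rV[R]_n => ins_row j p.1 p.2) @^-1` A).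
  by rewrite -[X in measurable X]setTI; exact: measurable_ins_row.
have := integral_ins_row j mf; rewrite /= integral_indic// setIT => ->.
  transitivity (\int[lambda \x leb n]_p
      (\1_((fun p => ins_row j p.1 p.2) @^-1` A) p)%:E)%E => //.
  by rewrite integral_indic// setIT.
by move=> x; rewrite lee_fin.
Qed.

Lemma ae_ins_row n (j : 'I_n.+1) (P : 'rV[R]_n.+1 -> Prop) :
  {ae leb n.+1, forall x, P x} <->
  {ae (lambda \x leb n)%E, forall p, P (ins_row j p.1 p.2)}.
Proof.
split=> -[N [mN N0 NP]].
  exists ((fun p : measurableTypeR R * 'rV[R]_n => ins_row j p.1 p.2) @^-1` N); split.
  - by rewrite -[X in measurable X]setTI; exact: measurable_ins_row.
  - by rewrite -[RHS]N0 (lebesgue_rV_ins j mN).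
  - by move=> p /= nP; exact: NP.
pose g (x : 'rV[R]_n.+1) := (x ord0 j, del_row j x).
have mg : measurable_fun setT g.
  apply/measurable_fun_pairP; split; first exact: measurable_rV_coord.
  exact: measurable_del_row.
have mgN : measurable (g @^-1` N) by rewrite -[X in measurable X]setTI; exact: mg.
exists (g @^-1` N); split => //.
- rewrite (lebesgue_rV_ins j mgN) -[RHS]N0; congr (_ _).
  by apply/seteqP; split => -[t y]; rewrite /g /= ins_row_at del_ins_row.
- by move=> x /= nP; apply: NP; rewrite /= ins_del_row.
Qed.

Lemma intg_ins_row n (j : 'I_n.+1) (f : 'rV[R]_n.+1 -> R) :
  measurable_fun setT f ->
  intg (leb n.+1) f <-> intg (lambda \x leb n)%E (fun p => f (ins_row j p.1 p.2)).
Proof.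
move=> mf; have mfi : measurable_fun setT (fun p : measurableTypeR R * 'rV[R]_n => f (ins_row j p.1 p.2)).
  by apply: (measurableT_comp mf); exact: measurable_ins_row.
have mfe : measurable_fun setT (EFin \o f) by exact/measurable_EFinP.
have mfa : measurable_fun setT (fun x => `|(f x)%:E|%E) by exact: measurableT_comp.
have E := integral_ins_row j mfa (fun x => abse_ge0 _).
split=> /integrableP[_ H]; apply/integrableP; split.
- exact/measurable_EFinP.
- by move: H; rewrite E.
- exact/measurable_EFinP.
- by move: H; rewrite E.
Qed.

Lemma Rint_ins_row n (j : 'I_n.+1) (f : 'rV[R]_n.+1 -> R) :
  measurable_fun setT f ->
  \int[leb n.+1]_x f x = \int[(lambda \x leb n)%E]_p f (ins_row j p.1 p.2).
Proof.
move=> mf; have mfe : measurable_fun setT (EFin \o f) by exact/measurable_EFinP.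
have Ep := integral_ins_row j (measurable_funepos mfe) (funepos_ge0 _).
have En := integral_ins_row j (measurable_funeneg mfe) (funeneg_ge0 _).
rewrite /Rintegral; congr fine; rewrite integralE [RHS]integralE.
congr (_ - _)%E.
  by rewrite [LHS]Ep; apply: eq_integral => p _; rewrite !funeposE.
by rewrite [LHS]En; apply: eq_integral => p _; rewrite !funenegE.
Qed.

End insertion_measure.

(** * Coordinate boxes and the Borel sets of the space *)

Section boxes.
Variables (R : realType) (n : nat).
Implicit Types (a b x : 'rV[R]_n) (D : set 'rV[R]_n).

Definition obox a b : set 'rV[R]_n :=
  [set x | forall i, a ord0 i < x ord0 i < b ord0 i].
Definition cbox a b : set 'rV[R]_n :=
  [set x | forall i, a ord0 i <= x ord0 i <= b ord0 i].

Lemma obox_sub_cbox a b : obox a b `<=` cbox a b.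
Proof. by move=> x H i; have /andP[? ?] := H i; rewrite !ltW. Qed.

Lemma measurable_obox a b : measurable (obox a b).
Proof.
rewrite (_ : obox a b = \bigcap_(i in [set: 'I_n])
    ((fun x : 'rV[R]_n => x ord0 i) @^-1` `]a ord0 i, b ord0 i[)); last first.
  by apply/seteqP; split=> x H i => [_|]; have := H i; rewrite /= in_itv//=; apply.
apply: fin_bigcap_measurable => // i _.
rewrite -[X in measurable X]setTI; exact: measurable_rV_coord.
Qed.

Lemma measurable_cbox a b : measurable (cbox a b).
Proof.
rewrite (_ : cbox a b = \bigcap_(i in [set: 'I_n])
    ((fun x : 'rV[R]_n => x ord0 i) @^-1` `[a ord0 i, b ord0 i])); last first.
  by apply/seteqP; split=> x H i => [_|]; have := H i; rewrite /= in_itv//=; apply.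
apply: fin_bigcap_measurable => // i _.
rewrite -[X in measurable X]setTI; exact: measurable_rV_coord.
Qed.

Lemma compact_cbox a b : compact (cbox a b).
Proof.
have := rV_compact (fun i => @segment_compact R (a ord0 i) (b ord0 i)).
congr compact; apply/seteqP; split => x H i; have := H i; rewrite /= in_itv//=.
Qed.

Lemma nbhs_cbox x D : open D -> D x -> exists2 e : R, 0 < e &
  forall y : 'rV[R]_n, (forall i, `|y ord0 i - x ord0 i| < e) -> D y.
Proof.
move=> oD Dx; have /nbhs_ballP[e e0 H] := open_nbhs_nbhs (conj oD Dx).
exists e => // y yx; apply: H; split => // i j.
by rewrite (ord1 i) -ball_normE /ball_ /= distrC.
Qed.

(* When [D] contains no box the enumeration below has nothing to list, so the
   boxes are enumerated as optional pairs. *)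
Lemma open_rat_boxes D : open D ->
  exists ab : nat -> option ('rV[R]_n * 'rV[R]_n),
  (forall k a b, ab k = Some (a, b) -> cbox a b `<=` D) /\
  forall x, D x -> exists k a b, ab k = Some (a, b) /\ obox a b x.
Proof.
move=> oD.
pose r (q : 'rV[rat]_n * 'rV[rat]_n) : 'rV[R]_n * 'rV[R]_n :=
  (map_mx ratr q.1, map_mx ratr q.2).
exists (fun k => if unpickle k is Some q then
   if `[< cbox (r q).1 (r q).2 `<=` D >] then Some (r q) else None else None).
split=> [k a b|x Dx].
  case: (unpickle k) => // q; case: asboolP => // H [E1 E2].
  by move: H; rewrite /r /= E1 E2.
have [e e0 He] := nbhs_cbox oD Dx.
have /choice[f Hf] i : exists q : rat, ratr q \in `](x ord0 i - e), (x ord0 i)[.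
  by apply: rat_in_itvoo; rewrite gtrBl.
have /choice[g Hg] i : exists q : rat, ratr q \in `](x ord0 i), (x ord0 i + e)[.
  by apply: rat_in_itvoo; rewrite ltrDl.
pose q : 'rV[rat]_n * 'rV[rat]_n := (\row_i f i, \row_i g i).
exists (pickle q), (r q).1, (r q).2; rewrite pickleK.
case: asboolP => [H|]; last first.
  case=> y H; apply: He => i; have := H i; rewrite !mxE.
  have := Hf i; have := Hg i; rewrite !in_itv /= => /andP[g1 g2] /andP[f1 f2].
  move=> /andP[h1 h2]; rewrite ltr_norml; apply/andP; split.
    by rewrite ltrBrDl addrC; apply: lt_le_trans h1; rewrite addrC.
  by rewrite ltrBlDl; exact: le_lt_trans g2.
split; first by case: (r q).
move=> i; rewrite !mxE; have := Hf i; have := Hg i; rewrite !in_itv /=.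
by move=> /andP[-> _] /andP[_ ->].
Qed.

(** Measurability refers to the sigma-algebra generated by the coordinates; by [open_rat_boxes] an
    open set is a countable union of open boxes. *)
Lemma open_measurable_rV D : open D -> measurable D.
Proof.
move=> /open_rat_boxes[ab [H1 H2]].
rewrite (_ : D = \bigcup_k (if ab k is Some (a, b) then obox a b else set0)).
  apply: bigcupT_measurable => k; case: (ab k) => [[a b]|]; last exact: measurable0.
  exact: measurable_obox.
apply/seteqP; split => x; first by move=> /H2[k [a [b [E xab]]]]; exists k => //; rewrite E.
move=> [k _]; case E : (ab k) => [[a b]|//] xab.
by apply: (H1 _ _ _ E); exact: obox_sub_cbox.
Qed.

Lemma closed_measurable_rV D : closed D -> measurable D.
Proof.
move=> cD; rewrite -[D]setCK; apply: measurableC; apply: open_measurable_rV.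
exact: closed_openC.
Qed.

Lemma continuous_measurable_rV (f : 'rV[R]_n -> R) :
  continuous f -> measurable_fun setT f.
Proof.
move=> cf; apply: (measurability _ (RGenOpens.measurableE R)).
move=> _ [_ [a [b ->] <-]]; rewrite setTI; apply: open_measurable_rV.
by apply: open_comp => //; exact: interval_open.
Qed.

End boxes.

Lemma lebesgue_rV_box_lty (R : realType) n (a b : 'rV[R]_n) :
  (lebesgue_rV R n (cbox a b) < +oo)%E.
Proof.
elim: n a b => [|n IH] a b.
  by rewrite /= diracE; case: (_ \in _); rewrite ltry.
rewrite (lebesgue_rV_ins ord0); last exact: measurable_cbox.
rewrite (_ : _ @^-1` _ = `[a ord0 ord0, b ord0 ord0] `*`
    cbox (del_row ord0 a) (del_row ord0 b)); last first.
  apply/seteqP; split => -[t y] /=.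
    move=> H; split; first by have := H ord0; rewrite ins_row_at in_itv.
    by move=> i; have := H (lift ord0 i); rewrite ins_row_lift !mxE.
  rewrite in_itv /= => -[H1 H2] k; case: (unliftP ord0 k) => [i ->|->].
    by have := H2 i; rewrite ins_row_lift !mxE.
  by rewrite ins_row_at.
rewrite product_measure1E//; last exact: measurable_cbox.
apply: lte_mul_pinfty => //.
rewrite -[X in X \is a fin_num]/(lebesgue_measure `[a ord0 ord0, b ord0 ord0]%classic).
by rewrite lebesgue_measure_itv; case: ifP.
Qed.

Lemma compact_sub_cbox (R : realType) n (K : set 'rV[R]_n) : compact K ->
  exists a b, K `<=` cbox a b.
Proof.
move=> /compact_bounded[M [_ HM]]; exists (const_mx (- (M + 1))), (const_mx (M + 1)).
move=> x /(HM (M + 1)); rewrite ltrDl ltr01 => /(_ isT) xM i.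
rewrite !mxE -ler_norml; apply: le_trans xM.
rewrite [leRHS]/Num.norm /= mx_normrE.
by apply/bigmax_geP; right => /=; exists (ord0, i).
Qed.

Lemma lebesgue_rV_compact (R : realType) n (K : set 'rV[R]_n) : compact K ->
  (lebesgue_rV R n K < +oo)%E.
Proof.
move=> cK; have [a [b Kab]] := compact_sub_cbox cK.
apply: le_lt_trans (lebesgue_rV_box_lty a b); apply: le_measure => //.
  rewrite inE; apply: closed_measurable_rV; apply: compact_closed => //.
rewrite inE; exact: measurable_cbox.
Qed.

(** * The du Bois-Reymond lemma *)

Section bumps.
Variable R : realType.

(** The transition layers have width [1 / m] and lie inside the interval, so the bumps vanish off
    []a, b[] and are eventually 1 at each of its points: their limit is the indicator of the open
    interval. *)
Definition bump1 (a b : R) (m : nat) (t : R) : R :=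
  step (m%:R * (t - a)) * step (m%:R * (b - t)).

Lemma bump1_ge0 a b m t : 0 <= bump1 a b m t.
Proof. by rewrite mulr_ge0 ?step_ge0. Qed.

Lemma bump1_le1 a b m t : bump1 a b m t <= 1.
Proof. by rewrite mulr_ile1 ?step_ge0 ?step_le1. Qed.

Lemma bump1_out a b m t : ~~ (a < t < b) -> bump1 a b m t = 0.
Proof.
rewrite negb_and -!leNgt => /orP[ta|bt].
  by rewrite /bump1 step_le0 ?mul0r// mulr_ge0_le0// subr_le0.
by rewrite /bump1 [X in _ * X]step_le0 ?mulr0// mulr_ge0_le0// subr_le0.
Qed.

Lemma bump1_in a b t : a < t < b -> exists m0, forall m, (m0 <= m)%N -> bump1 a b m t = 1.
Proof.
move=> /andP[at_ tb].
have H (d : R) : 0 < d -> exists m0, forall m, (m0 <= m)%N -> 1 <= m%:R * d.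
  move=> d0; exists (Num.truncn d^-1).+1 => m hm.
  rewrite -ler_pdivrMr// mul1r (le_trans (ltW (truncnS_gt _)))//.
  by rewrite ler_nat.
have [m1 H1] := H (t - a) ltac:(by rewrite subr_gt0).
have [m2 H2] := H (b - t) ltac:(by rewrite subr_gt0).
exists (maxn m1 m2) => m; rewrite geq_max => /andP[h1 h2].
by rewrite /bump1 !step_ge1 ?mul1r ?H1 ?H2.
Qed.

Lemma continuous_step : continuous (@step R).
Proof.
move=> t; apply: differentiable_continuous; apply/derivable1_diffP.
by have [] := is_derive_step t.
Qed.

Lemma continuous_bump1 a b m : continuous (bump1 a b m).
Proof.
move=> t; apply: cvgM.
  apply: (@cvg_comp _ _ _ (fun t => m%:R * (t - a)) (@step R) _ (nbhs (m%:R * (t - a)))).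
    apply: cvgM; first exact: cvg_cst.
    by apply: (@cvgB _ R^o); [exact: cvg_id|exact: cvg_cst].
  exact: continuous_step.
apply: (@cvg_comp _ _ _ (fun t => m%:R * (b - t)) (@step R) _ (nbhs (m%:R * (b - t)))).
  apply: cvgM; first exact: cvg_cst.
  by apply: (@cvgB _ R^o); [exact: cvg_cst|exact: cvg_id].
exact: continuous_step.
Qed.

Lemma smooth_bump1 n a b m (f : 'rV[R]_n -> R) : Cinf f ->
  Cinf (fun x => bump1 a b m (f x)).
Proof.
move=> sf; apply: smoothM; apply: smooth_step; apply: smoothM.
- exact: smooth_cst.
- by apply: smoothB => //; exact: smooth_cst.
- exact: smooth_cst.
- by apply: smoothB => //; exact: smooth_cst.
Qed.

Variable n : nat.
Implicit Types (a b x : 'rV[R]_n) (D : set 'rV[R]_n).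

Definition bump a b (m : nat) x : R :=
  \prod_i bump1 (a ord0 i) (b ord0 i) m (x ord0 i).

Lemma bump_ge0 a b m x : 0 <= bump a b m x.
Proof. by apply: prodr_ge0 => i _; exact: bump1_ge0. Qed.

Lemma bump_le1 a b m x : bump a b m x <= 1.
Proof. suff /andP[] : 0 <= bump a b m x <= 1 by [].
rewrite /bump; elim/big_rec: _ => [|i y _ /andP[y0 y1]]; first by rewrite ler01 lexx.
by rewrite mulr_ge0 ?bump1_ge0// mulr_ile1 ?bump1_ge0 ?bump1_le1. Qed.

Lemma bump_out a b m x : ~ obox a b x -> bump a b m x = 0.
Proof.
move=> H; have [i Hi] : exists i, ~~ (a ord0 i < x ord0 i < b ord0 i).
  by apply: contrapT => nH; apply: H => i; apply/negPn/negP => Hi; apply: nH; exists i.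
by rewrite /bump (bigD1 i)//= bump1_out ?mul0r.
Qed.

Lemma smooth_bump a b m : Cinf (bump a b m).
Proof. by apply: smooth_prod => i _; apply: smooth_bump1; exact: smooth_coord. Qed.

Lemma test_bump D a b m : cbox a b `<=` D -> test_function D (bump a b m).
Proof.
move=> abD; split; first by apply/CinfP; exact: smooth_bump.
exists (cbox a b); split => //; first exact: compact_cbox.
by move=> x nx; apply: bump_out => /obox_sub_cbox.
Qed.

Lemma bump_cvg a b x : (fun m => bump a b m x) @ \oo --> (\1_(obox a b) x : R).
Proof.
have [xab|xab] := pselect (obox a b x); last first.
  rewrite indicE memNset//; under eq_fun do rewrite bump_out//.
  exact: cvg_cst.
rewrite indicE mem_set//.
have /choice[f Hf] i : exists m0, forall m, (m0 <= m)%N ->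
    bump1 (a ord0 i) (b ord0 i) m (x ord0 i) = 1.
  exact: bump1_in.
apply: cvg_near_cst; exists (\max_i f i)%N => // m /= hm.
by rewrite /bump big1// => i _; apply: Hf; rewrite (leq_trans _ hm)// leq_bigmax.
Qed.

End bumps.

Section du_bois_reymond.
Variables (R : realType) (n : nat).
Notation leb := (lebesgue_rV R n).
Implicit Types (a b x : 'rV[R]_n) (D : set 'rV[R]_n) (g u : 'rV[R]_n -> R).

Let boxes : set (set 'rV[R]_n) := [set A | exists a b, A = obox a b].

Let boxI a b a' b' : obox a b `&` obox a' b' =
  obox (\row_i Num.max (a ord0 i) (a' ord0 i)) (\row_i Num.min (b ord0 i) (b' ord0 i)).
Proof.
apply/seteqP; split => x.
  by move=> [H H'] i; rewrite !mxE gt_max lt_min; have /andP[-> ->] := H i;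
    have /andP[-> ->] := H' i.
move=> H; split => i; have := H i; rewrite !mxE gt_max lt_min;
  by move=> /andP[/andP[h1 h2] /andP[h3 h4]]; apply/andP.
Qed.

(** The preimage of an open interval under a coordinate is the union of the open boxes bounded by
    [k] in the other coordinates. *)
Lemma measurable_boxes : (@measurable _ 'rV[R]_n) = <<s boxes >>.
Proof.
apply/seteqP; split.
  apply: smallest_sub; first exact: smallest_sigma_algebra.
  rewrite -bigcup_seq => A [i _ [B mB <-]]; rewrite setTI.
  have mf : @measurable_fun _ _ (g_sigma_algebraType boxes) R setT (rV_coord i).
    apply: (measurability _ (RGenOpens.measurableE R)).
    move=> _ [_ [a [b ->] <-]]; rewrite setTI.
    rewrite (_ : _ @^-1` _ = \bigcup_k obox
        (\row_l if l == i then a else - k%:R) (\row_l if l == i then b else k%:R)).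
      by apply: bigcupT_measurable => k; apply: sub_sigma_algebra; do 2 eexists.
    apply/seteqP; split => x; rewrite /rV_coord /=; last first.
      by move=> [k _ /(_ i)]; rewrite !mxE eqxx in_itv.
    rewrite in_itv /= => xab; exists (Num.truncn `|x|).+1 => // l.
    rewrite !mxE; case: eqP => [-> //|_]; rewrite -ltr_norml.
    apply: le_lt_trans (truncnS_gt _).
    rewrite [leRHS]/Num.norm /= mx_normrE.
    by apply/bigmax_geP; right => /=; exists (ord0, l).
  by have := mf measurableT B mB; rewrite setTI.
apply: smallest_sub; first exact: sigma_algebra_measurable.
by move=> _ [a [b ->]]; exact: measurable_obox.
Qed.

(** Dominated convergence replaces the bumps by indicators of open boxes. These are stable under
    intersection and generate the Borel sets, so Dynkin's theorem makes the integral of [g1] vanish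
    on every measurable set. *)
Lemma dBR_box g a b : intg leb g ->
  (forall a' b' m, cbox a' b' `<=` cbox a b ->
     \int[leb]_x (g x * bump a' b' m x) = 0) ->
  {ae leb, forall x, obox a b x -> g x = 0}.
Proof.
move=> ig H.
have mg := intg_measurable ig.
have sub0 a' b' : cbox a' b' `<=` cbox a b -> \int[leb]_x (g x * \1_(obox a' b') x) = 0.
  move=> sab.
  have [|||_ L] := @Rint_dct _ _ _ leb (fun m x => g x * bump a' b' m x)
      (fun x => g x * \1_(obox a' b') x) (fun x => `|g x|) _ _ (intg_abs ig).
  - move=> m; apply: measurable_funM => //; apply: continuous_measurable_rV.
    exact/smooth_continuous/smooth_bump.
  - by move=> x; apply: cvgM; [exact: cvg_cst|exact: bump_cvg].
  - move=> m x; rewrite normrM ler_piMr// ger0_norm ?bump_ge0//.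
    exact: bump_le1.
  move: L; under eq_fun do rewrite H//.
  by move=> /(cvg_unique _ (@cvg_cst _ _ _ _ _)) => /(_ (@Rhausdorff _)).
pose g1 x := g x * \1_(obox a b) x.
have ig1 : intg leb g1.
  apply: (intg_le _ (intg_abs ig)).
    by apply: measurable_funM => //; apply: measurable_indic; exact: measurable_obox.
  by move=> x; rewrite /g1 normrM ler_piMr// indicE; case: (_ \in _); rewrite ?normr1 ?normr0.
pose P A := (\int[leb]_(x in A) (g1 x)%:E = 0)%E.
have PE A : measurable A -> P A <-> \int[leb]_x (g1 x * \1_A x) = 0.
  move=> mA; have igA : intg leb (fun x => g1 x * \1_A x).
    apply: (intg_le _ (intg_abs ig1)).
      by apply: measurable_funM; [exact: intg_measurable ig1|exact: measurable_indic].
    by move=> x; rewrite normrM ler_piMr// indicE; case: (_ \in _); rewrite ?normr1 ?normr0.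
  have E : (\int[leb]_(x in A) (g1 x)%:E = (\int[leb]_x (g1 x * \1_A x))%:E)%E.
    rewrite integral_mkcond -RintE//; apply: eq_integral => x _.
    by rewrite patchE indicE; case: (_ \in _); rewrite ?mulr1 ?mulr0.
  by rewrite /P E; split => [[]|->].
have PA : forall A, measurable A -> P A.
  rewrite measurable_boxes.
  apply: (dynkin_induction (G := boxes) (P := P) measurable_boxes).
  - move=> _ _ [a1 [b1 ->]] [a2 [b2 ->]]; rewrite boxI; by do 2 eexists.
  - apply/(PE _ measurableT); rewrite -[RHS](sub0 a b)//.
    by apply: eq_Rintegral => x _; rewrite indicT mulr1.
  - move=> _ [a' [b' ->]]; apply/(PE _ (measurable_obox _ _)).
    rewrite -[RHS](sub0 (\row_i Num.max (a ord0 i) (a' ord0 i))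
      (\row_i Num.min (b ord0 i) (b' ord0 i))).
      apply: eq_Rintegral => x _; rewrite /g1 -mulrA -boxI indicI.
      by [].
    move=> x Hx i; have := Hx i; rewrite !mxE ge_max le_min.
    by move=> /andP[/andP[-> _] /andP[-> _]].
  - move=> S mS /(PE _ mS) PS; apply/(PE _ (measurableC mS)).
    have iS B : measurable B -> intg leb (fun x => g1 x * \1_B x).
      move=> mB; apply: (intg_le _ (intg_abs ig1)).
        by apply: measurable_funM; [exact: intg_measurable ig1|exact: measurable_indic].
      by move=> x; rewrite normrM ler_piMr// indicE; case: (_ \in _); rewrite ?normr1 ?normr0.
    have : \int[leb]_x (g1 x * \1_setT x) = 0.
      rewrite -[RHS](sub0 a b)//.
      by apply: eq_Rintegral => x _; rewrite indicT mulr1.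
    have -> : \int[leb]_x (g1 x * \1_setT x) =
        \int[leb]_x (g1 x * \1_S x + g1 x * \1_(~` S) x).
      apply: eq_Rintegral => x _; rewrite -mulrDr indicT indicC.
      by congr (_ * _); rewrite /= indicE; case: (_ \in _); rewrite ?addr0 ?add0r.
    by rewrite RintD ?iS//; [rewrite PS add0r|exact: measurableC].
  - move=> F mF tF PF; rewrite /P integral_bigcup//.
      by apply: eseries0 => k _ _; exact: PF.
    apply: (integrableS measurableT) => //; exact: bigcup_measurable.
have : ae_eq leb setT (EFin \o g1) (cst 0%E).
  apply: integral_ae_eq => //.
  by move=> A _ mA; rewrite (PA A mA) integral0.
apply: filterS => x /(_ Logic.I) /= [E] xab.
by move: E; rewrite /g1 indicE mem_set ?mulr1.
Qed.

(** Only products of one-variable bumps are used as test functions, which suits the tensor products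
    below. Countably many rational boxes cover [D], and [u] is integrable on each closed box
    contained in [D], so [dBR_box] applies there. *)
Lemma dBR D u : open D -> measurable_fun D u ->
  (forall K, compact K -> K `<=` D -> leb.-integrable K (EFin \o u)) ->
  (forall a b m, cbox a b `<=` D ->
     \int[leb]_(x in D) (u x * bump a b m x) = 0) ->
  {ae leb, forall x, D x -> u x = 0}.
Proof.
move=> oD mu iu H; have [ab [H1 H2]] := open_rat_boxes oD.
have Hk k : {ae leb, forall x a b, ab k = Some (a, b) -> obox a b x -> u x = 0}.
  case E : (ab k) => [[a b]|]; last by apply: aeW => x a b.
  have sD := H1 _ _ _ E.
  have mK := measurable_cbox a b.
  have iK := iu _ (@compact_cbox _ _ a b) sD.
  have ig : intg leb (u \_ (cbox a b)).
    move: iK => /(integrable_mkcond _ mK); apply: eq_integrable => // x _.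
    by rewrite /= !patchE; case: (_ \in _).
  have : {ae leb, forall x, obox a b x -> (u \_ (cbox a b)) x = 0}.
    apply: dBR_box => // a' b' m sab.
    rewrite -[RHS](H a' b' m); last exact: subset_trans sD.
    rewrite [RHS]Rintegral_mkcond; apply: eq_Rintegral => x _.
    rewrite !patchE.
    have [xK|xK] := pselect (cbox a b x).
      by rewrite !mem_set//; exact: sD.
    rewrite memNset// mul0r; case: ifP => // _.
    rewrite bump_out ?mulr0// => /obox_sub_cbox /sab; exact: xK.
  apply: filterS => x Hx a' b' [<- <-] xab.
  by rewrite -(Hx xab) patchE mem_set//; exact: obox_sub_cbox.
have : {ae leb, forall x k, forall a b, ab k = Some (a, b) -> obox a b x -> u x = 0}.
  exact: ae_foralln Hk.
apply: filterS => x Hx Dx.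
by have [k [a [b [E xab]]]] := H2 _ Dx; exact: Hx E xab.
Qed.

End du_bois_reymond.

(** * Weak derivatives along a line *)

Lemma ae_impl d (T : measurableType d) (R : realType)
    (mu : {measure set T -> \bar R}) (P Q : T -> Prop) : (forall x, P x -> Q x) ->
  {ae mu, forall x, P x} -> {ae mu, forall x, Q x}.
Proof. by move=> PQ; apply: filterS. Qed.

Lemma measurable_Rint d1 d2 (T1 : measurableType d1) (T2 : measurableType d2)
    (R : realType) (m2 : {sigma_finite_measure set T2 -> \bar R})
    (f : T1 * T2 -> R) : measurable_fun setT f ->
  measurable_fun setT (fun x => \int[m2]_y f (x, y)).
Proof.
move=> mf; suff H : measurable_fun setT (fun x => (\int[m2]_y (f (x, y))%:E)%E).
  exact: (measurableT_comp (fine_measurable measurableT) H).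
have mfe : measurable_fun setT (EFin \o f) by exact/measurable_EFinP.
rewrite (_ : (fun x => _) = (fun x => \int[m2]_y (EFin \o f)^\+ (x, y) -
    \int[m2]_y (EFin \o f)^\- (x, y))%E); last first.
  apply/funext => x; rewrite integralE.
  by congr (_ - _)%E; apply: eq_integral => y _; rewrite ?funeposE ?funenegE.
apply: emeasurable_funB.
  apply: (measurable_fun_fubini_tonelli_F (m2 := m2)) => //.
  exact: measurable_funepos.
apply: (measurable_fun_fubini_tonelli_F (m2 := m2)) => //.
exact: measurable_funeneg.
Qed.

Lemma intg_prod d1 d2 (T1 : measurableType d1) (T2 : measurableType d2)
    (R : realType) (m1 : {sigma_finite_measure set T1 -> \bar R})
    (m2 : {sigma_finite_measure set T2 -> \bar R}) (f : T1 -> R) (g : T2 -> R) :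
  intg m1 f -> intg m2 g -> intg (m1 \x m2)%E (fun p => f p.1 * g p.2).
Proof.
move=> intf ing.
have mfg : measurable_fun setT (fun p : T1 * T2 => f p.1 * g p.2).
  apply: measurable_funM.
    exact: (measurableT_comp (intg_measurable intf) measurable_fst).
  exact: (measurableT_comp (intg_measurable ing) measurable_snd).
apply/integrable12ltyP; first exact/measurable_EFinP.
have -> : (\int[m1]_x \int[m2]_y `|(EFin \o (fun p : T1 * T2 => (f p.1 * g p.2)%R)) (x, y)| =
    \int[m1]_x ((`|f x| * \int[m2]_y `|g y|)%R)%:E)%E.
  apply: eq_integral => x _; rewrite /= -RintZ; last exact: intg_abs.
  rewrite -RintE; last by apply: intgZ; exact: intg_abs.
  by apply: eq_integral => y _; rewrite normrM.
have i1 : intg m1 (fun x => `|f x| * \int[m2]_y `|g y|).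
  by under eq_fun do rewrite mulrC; apply: intgZ; exact: intg_abs.
by rewrite RintE// ltry.
Qed.

Section half_lines.
Variable R : realType.
Notation lambda := (@lebesgue_measure R).
Notation RR := (measurableTypeR R).

(** Primitives are written as integrals of this kernel over the whole line, so that integrating by
    parts becomes an exchange of integrals. *)
Definition below (r t : R) : R := if (r < t)%R then 1 else 0.

Lemma below_bound r t : `|below r t| <= 1.
Proof. by rewrite /below; case: ifP; rewrite ?normr1 ?normr0. Qed.

Lemma measurable_below d (T : measurableType d) (f g : T -> R) :
  measurable_fun setT f -> measurable_fun setT g ->
  measurable_fun setT (fun x => below (f x) (g x)).
Proof.
by move=> mf mg; apply: measurable_fun_ifT => //; exact: measurable_fun_ltr.
Qed.

Lemma intg_below_l (f : R -> R) (t : R) : intg lambda f ->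
  intg lambda (fun r => below r t * f r).
Proof.
move=> intf; apply: (intg_le _ (intg_abs intf)).
  apply: measurable_funM; last exact: intg_measurable intf.
  by apply: measurable_below.
by move=> r; rewrite normrM ler_piMl// below_bound.
Qed.

Lemma intg_below_r (f : R -> R) (t : R) : intg lambda f ->
  intg lambda (fun r => below t r * f r).
Proof.
move=> intf; apply: (intg_le _ (intg_abs intf)).
  apply: measurable_funM; last exact: intg_measurable intf.
  by apply: measurable_below.
by move=> r; rewrite normrM ler_piMl// below_bound.
Qed.

(** Fubini's theorem: [K] is bounded and [f], [g] are integrable, so [K(r, t) f(r) g(t)] is
    integrable on the plane. *)
Lemma kernel_swap (K : R -> R -> R) (f g : R -> R) :
  measurable_fun setT (fun p : RR * RR => K p.1 p.2) ->
  (forall r t, `|K r t| <= 1) -> intg lambda f -> intg lambda g ->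
  \int[lambda]_t (g t * \int[lambda]_r (K r t * f r)) =
  \int[lambda]_r (f r * \int[lambda]_t (K r t * g t)).
Proof.
move=> mK K1 intf ing.
have iK1 t : intg lambda (fun r => K r t * f r).
  apply: (intg_le _ (intg_abs intf)); last by move=> r; rewrite normrM ler_piMl.
  apply: measurable_funM; last exact: intg_measurable intf.
  exact: (measurableT_comp mK (measurable_pair2 t)).
have iK2 r : intg lambda (fun t => K r t * g t).
  apply: (intg_le _ (intg_abs ing)); last by move=> t; rewrite normrM ler_piMl.
  apply: measurable_funM; last exact: intg_measurable ing.
  exact: (measurableT_comp mK (measurable_pair1 r)).
have ifg : intg (lambda \x lambda)%E (fun p : RR * RR => K p.1 p.2 * (f p.1 * g p.2)).
  apply: (intg_le _ (intg_abs (intg_prod intf ing))).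
    by apply: measurable_funM => //; exact: intg_measurable (intg_prod intf ing).
  by move=> p; rewrite normrM ler_piMl.
have := Rint_swap ifg => /= E.
transitivity (\int[lambda]_t \int[lambda]_r (K r t * (f r * g t))).
  apply: eq_Rintegral => t _; rewrite -RintZ//.
  by apply: eq_Rintegral => r _; rewrite mulrCA [g t * _]mulrC.
rewrite -E; apply: eq_Rintegral => r _; rewrite -RintZ//.
by apply: eq_Rintegral => t _; rewrite mulrCA.
Qed.

End half_lines.

Section primitives.
Variables (R : realType) (a b : R) (m : nat).
Notation lambda := (@lebesgue_measure R).
Notation beta := (bump1 a b m).

Lemma intg_bump1 : intg lambda beta.
Proof.
have mb : @measurable_fun _ _ (measurableTypeR R) R setT beta.
  exact: (continuous_measurable_fun (@continuous_bump1 R a b m)).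
apply: (intg_le mb (_ : intg lambda (\1_(`[a, b]%classic)))).
  exact: integrable_indic_itv.
move=> t; rewrite ger0_norm ?bump1_ge0// indicE.
have [h|h] := pselect (`[a, b]%classic t); first by rewrite mem_set// bump1_le1.
rewrite memNset// bump1_out//; apply/negP => /andP[h1 h2].
by apply: h; rewrite /= in_itv /= !ltW.
Qed.

(** Two primitives of the same bump, which vanish to the left of [a] and to the right of [b]
    respectively; they differ by the total mass of the bump. *)
Definition lprim (t : R) : R := \int[lambda]_r (below r t * beta r).
Definition rprim (t : R) : R := - \int[lambda]_r (below t r * beta r).

Lemma is_derive_lprim (t : R) : is_derive t 1 lprim (beta t).
Proof.
have E : lprim = (fun x => \int[lambda]_(r in `]-oo, x]) beta r).
  apply/funext => x; rewrite -Rintegral_itv_bndo_bndc; last first.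
    apply: (integrableS measurableT) => //; exact: intg_bump1.
  rewrite [RHS]Rintegral_mkcond; apply: eq_Rintegral => r _.
  rewrite patchE mem_setE /= in_itv /= /below.
  by case: ifP => _; rewrite ?mul1r ?mul0r.
have H1 : t < t + 1 by rewrite ltrDl.
have H2 : lambda.-integrable [set` Interval -oo%O (BRight (t + 1))] (EFin \o beta).
  by apply: (integrableS measurableT) => //; exact: intg_bump1.
have H3 : (-oo%O < BRight t)%E by rewrite ltNyr.
have [dF dE] := continuous_FTC1 H1 H2 H3 (@continuous_bump1 R a b m t).
by rewrite E; apply: DeriveDef; [exact: dF|rewrite -derive1E; exact: dE].
Qed.

Lemma rprimE t : rprim t = lprim t - \int[lambda]_r beta r.
Proof.
have i1 := intg_below_l t intg_bump1; have i2 := intg_below_r t intg_bump1.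
suff -> : \int[lambda]_r beta r =
    \int[lambda]_r (below r t * beta r) + \int[lambda]_r (below t r * beta r).
  by rewrite /rprim /lprim; ring.
rewrite -RintD//; apply: ae_Rint.
- exists [set t]; split; [exact: measurable_set1|exact: lebesgue_measure_set1|].
  move=> r /= H; apply: contrapT => rt; apply: H; rewrite /below.
  have [h|h|h] := ltgtP r t; rewrite ?mul1r ?mul0r ?add0r ?addr0//.
- exact: intg_measurable intg_bump1.
- exact: intg_measurable (intgD i1 i2).
Qed.

Lemma is_derive_rprim (t : R) : is_derive t 1 rprim (beta t).
Proof.
have -> : rprim = lprim - cst (\int[lambda]_r beta r).
  by apply/funext => x; rewrite rprimE.
by apply: is_derive_eq (is_deriveB (is_derive_lprim t) (is_derive_cst _ _ _)) _;
  rewrite subr0.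
Qed.

End primitives.

Section ae_products.
Context d1 d2 (T1 : measurableType d1) (T2 : measurableType d2) (R : realType).
Variables (m1 : {sigma_finite_measure set T1 -> \bar R})
  (m2 : {sigma_finite_measure set T2 -> \bar R}).

Lemma ae_snd (P : T2 -> Prop) : {ae m2, forall y, P y} ->
  {ae (m1 \x m2)%E, forall p, P p.2}.
Proof.
move=> [N [mN N0 NP]]; exists (setT `*` N); split.
- exact: measurableX.
- transitivity (m1 setT * m2 N)%E; first exact: product_measure1E.
  by rewrite N0 mule0.
- by move=> p /= nP; split => //; exact: NP.
Qed.

End ae_products.

Lemma intg_le_ae d (T : measurableType d) (R : realType)
    (mu : {measure set T -> \bar R}) (f g : T -> R) :
  measurable_fun setT f -> intg mu g -> {ae mu, forall x, `|f x| <= g x} ->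
  intg mu f.
Proof.
move=> mf ig fg; have mg := intg_measurable ig.
pose f' x := if (`|f x| <= g x)%R then f x else 0.
have mf' : measurable_fun setT f'.
  apply: measurable_fun_ifT => //; apply: measurable_fun_ler => //.
  exact: measurableT_comp.
apply: (@ae_intg _ _ _ _ f') => //.
  by apply: filterS fg => x; rewrite /f' => ->.
apply: (intg_le mf' (intg_abs ig)) => x; rewrite /f'; case: ifP => [h|_].
  exact: le_trans h (ler_norm _).
by rewrite normr0.
Qed.

Lemma Cinf_of_partials (R : realType) n (f : 'rV[R]_n -> R) : continuous f ->
  (forall j x, derivable f x (delta_mx ord0 j)) -> (forall j, Cinf (partial f j)) ->
  Cinf f.
Proof.
move=> cf df sf; apply: (smooth_coind (P := fun g => g = f \/ Cinf g)); last by left.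
move=> g [->|sg]; split; [exact: cf|exact: df|by move=> j; right; exact: sf| | |].
- exact: smooth_continuous.
- by move=> j x; exact: smooth_derivable.
- by move=> j; right; exact: smooth_partial.
Qed.

Section tensor_tests.
Variables (R : realType) (n : nat) (j : 'I_n.+1).

Lemma bump_ins_row (a b : 'rV[R]_n.+1) m (t : R) (y : 'rV[R]_n) :
  bump a b m (ins_row j t y) =
  bump1 (a ord0 j) (b ord0 j) m t * bump (del_row j a) (del_row j b) m y.
Proof.
rewrite /bump (@bigD1_ord _ _ _ _ j (fun=> true)
  (fun i => bump1 (a ord0 i) (b ord0 i) m (ins_row j t y ord0 i)) isT) ins_row_at.
congr (_ * _); by apply: eq_bigr => i _; rewrite ins_row_lift !mxE.
Qed.

Variables (P beta : R -> R).
Hypothesis dP : forall t : R, is_derive t 1 P (beta t).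
Hypothesis sbeta : forall f : 'rV[R]_n.+1 -> R, Cinf f -> Cinf (fun x => beta (f x)).

Let is_derive_Pcoord i x : is_derive x (delta_mx ord0 i)
  (fun x : 'rV[R]_n.+1 => P (x ord0 j)) (beta (x ord0 j) * (j == i)%:R).
Proof.
have dc := is_derive_coord j i x.
have := is_derive_comp1 (f := fun x : 'rV[R]_n.+1 => x ord0 j) _ (dP (x ord0 j)).
by move=> /(_ _ (ex_derive (is_derive := dc))); rewrite (derive_val (is_derive := dc)).
Qed.

Let continuous_P : continuous P.
Proof.
move=> t; apply: differentiable_continuous; apply/derivable1_diffP.
by have [] := dP t.
Qed.

Let smooth_Pcoord : Cinf (fun x : 'rV[R]_n.+1 => P (x ord0 j)).
Proof.
apply: Cinf_of_partials.
- move=> x; apply: (@cvg_comp _ _ _ (fun x : 'rV[R]_n.+1 => x ord0 j) P _ (nbhs (x ord0 j))).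
    exact: coord_continuous.
  exact: continuous_P.
- by move=> i x; have [] := is_derive_Pcoord i x.
- move=> i; rewrite (_ : partial _ _ = (fun x => beta (x ord0 j) * (j == i)%:R)).
    apply: smoothM; last exact: smooth_cst.
    by apply: sbeta; exact: smooth_coord.
  by apply/funext => x; apply: partial_val; exact: is_derive_Pcoord.
Qed.

Let smooth_bump_del a b m : Cinf (fun x : 'rV[R]_n.+1 => bump a b m (del_row j x)).
Proof.
apply: smooth_prod => i _; apply: smooth_bump1.
rewrite (_ : (fun x => _) = (fun x : 'rV[R]_n.+1 => x ord0 (lift j i))).
  exact: smooth_coord.
by apply/funext => x; rewrite mxE.
Qed.

(** Only composition with the derivative [beta] is assumed to preserve smoothness; [P] may be a
    primitive given by an integral, without compact support. *)
Lemma smooth_tensor a b m :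
  Cinf (fun x : 'rV[R]_n.+1 => P (x ord0 j) * bump a b m (del_row j x)).
Proof. by apply: smoothM; [exact: smooth_Pcoord|exact: smooth_bump_del]. Qed.

Lemma partial_tensor a b m x :
  partial (fun x : 'rV[R]_n.+1 => P (x ord0 j) * bump a b m (del_row j x)) j x =
  beta (x ord0 j) * bump a b m (del_row j x).
Proof.
rewrite (partialM _ _ smooth_Pcoord (smooth_bump_del a b m)).
rewrite (partial_val (is_derive_Pcoord j x)) eqxx mulr1.
rewrite [X in _ + _ * X](_ : _ = 0) ?mulr0 ?addr0//.
apply: partial_val; apply: is_derive_of_line.
rewrite (_ : (fun t => _) = cst (bump a b m (del_row j x))); first exact: is_derive_cst.
apply/funext => t; congr (bump _ _ _ _); apply/rowP => i.
rewrite !mxE; have -> : (lift j i == j) = false.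
  by rewrite eq_sym (negbTE (neq_lift _ _)).
by rewrite andbF mulr0 addr0.
Qed.

End tensor_tests.

Section line_derivatives.
Variables (R : realType) (n : nat) (j : 'I_n.+1).
Notation lambda := (@lebesgue_measure R).
Notation RR := (measurableTypeR R).
Notation leb := (lebesgue_rV R n).
Notation lebS := (lebesgue_rV R n.+1).
Implicit Types A B : 'rV[R]_n.+1 -> R.

(* Weak differentiability in direction [j] on the whole space, against test
   functions that need not have compact support. *)
Definition line_deriv A alpha := [/\ intg lebS A, intg lebS alpha &
  forall Psi, Cinf Psi -> (exists M, forall x, `|Psi x| <= M) ->
    (exists M, forall x, `|partial Psi j x| <= M) ->
    \int[lebS]_x (A x * partial Psi j x) = - \int[lebS]_x (alpha x * Psi x)].

Section representation.
Variable K : R -> R -> R.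
Hypothesis mK : measurable_fun setT (fun p : RR * RR => K p.1 p.2).
Hypothesis K1 : forall r t, `|K r t| <= 1.
Let prim a b m (r : R) : R := - \int[lambda]_t (K r t * bump1 a b m t).
Hypothesis dprim : forall a b m (r : R),
  is_derive r 1 (prim a b m) (bump1 a b m r).
Variables A alpha : 'rV[R]_n.+1 -> R.
Hypothesis Aalpha : line_deriv A alpha.

Let V (p : RR * 'rV[R]_n) := \int[lambda]_r (K r p.1 * alpha (ins_row j r p.2)).
Let h (y : 'rV[R]_n) := \int[lambda]_r `|alpha (ins_row j r y)|.

Let malpha : measurable_fun setT alpha.
Proof. by have [_ /intg_measurable] := Aalpha. Qed.

Let ialpha : intg (lambda \x leb)%E (fun p => alpha (ins_row j p.1 p.2)).
Proof. by have [_ ia _] := Aalpha; exact/intg_ins_row. Qed.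

Let ih : intg leb h.
Proof. exact: (intg_fubini2 (intg_abs ialpha)).1. Qed.

Let mV : measurable_fun setT V.
Proof.
apply: (@measurable_Rint _ _ (RR * 'rV[R]_n)%type RR R lambda
  (fun q => K q.2 q.1.1 * alpha (ins_row j q.2 q.1.2))).
have m1 : measurable_fun setT (fun q : (RR * 'rV[R]_n) * RR => q.1.1).
  exact: (measurableT_comp measurable_fst measurable_fst).
have m2 : measurable_fun setT (fun q : (RR * 'rV[R]_n) * RR => q.1.2).
  exact: (measurableT_comp measurable_snd measurable_fst).
have m3 : measurable_fun setT (fun q : (RR * 'rV[R]_n) * RR => q.2).
  exact: measurable_snd.
apply: measurable_funM.
  have mp : measurable_fun setT
      (fun q : (RR * 'rV[R]_n) * RR => ((q.2, q.1.1) : RR * RR)).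
    by apply/measurable_fun_pairP; split.
  exact: (measurableT_comp mK mp).
have mi : measurable_fun setT (fun q : (RR * 'rV[R]_n) * RR => ins_row j q.2 q.1.2).
  exact: measurable_ins_row_comp.
exact: (measurableT_comp malpha mi).
Qed.

Let iK (f : R -> R) t : intg lambda f -> intg lambda (fun r => K r t * f r).
Proof.
move=> intf; apply: (intg_le _ (intg_abs intf)); last first.
  by move=> r; rewrite normrM ler_piMl.
apply: measurable_funM; last exact: intg_measurable intf.
exact: (measurableT_comp mK (measurable_pair2 (t : RR))).
Qed.

Let VE : {ae (lambda \x leb)%E, forall p, `|V p| <= h p.2}.
Proof.
have H := @ae_snd _ _ RR _ R lambda leb _ (ae_intg2 ialpha).
apply: filterS H => p ip; rewrite /V /h.
rewrite (le_trans (Rint_norm (iK p.1 ip)))//.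
apply: Rint_le; [exact/intg_abs/iK|exact: intg_abs|].
by move=> r; rewrite normrM ler_piMl.
Qed.

Let iVw (c : R -> R) (w : RR * 'rV[R]_n -> R) : intg lambda c ->
  measurable_fun setT w -> (forall p, `|w p| <= `|c p.1|) ->
  intg (lambda \x leb)%E (fun p => V p * w p).
Proof.
move=> ic mw wc; apply: (intg_le_ae _ (intg_prod (intg_abs ic) ih)).
  exact: measurable_funM mV mw.
apply: filterS VE => p Vp; rewrite normrM mulrC; apply: ler_pM => //.
Qed.

Let Z (z : 'rV[R]_n.+1) : RR * 'rV[R]_n := (z ord0 j, del_row j z).

Let mZ : measurable_fun setT Z.
Proof.
apply/measurable_fun_pairP; split; first exact: measurable_rV_coord.
exact: measurable_del_row.
Qed.

Let ZK p : Z (ins_row j p.1 p.2) = p.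
Proof. by case: p => t y; rewrite /Z ins_row_at del_ins_row. Qed.

Let mVZ : measurable_fun setT (fun z => V (Z z)).
Proof. exact: (measurableT_comp mV mZ). Qed.

Let iVZ (c : R -> R) (w : 'rV[R]_n.+1 -> R) : intg lambda c ->
  measurable_fun setT w -> (forall z, `|w z| <= `|c (z ord0 j)|) ->
  intg lebS (fun z => V (Z z) * w z).
Proof.
move=> ic mw wc; apply/(intg_ins_row j); first exact: measurable_funM.
under eq_fun do rewrite ZK.
apply: (iVw ic).
  by apply: (measurableT_comp mw); exact: measurable_ins_row.
by move=> p; have := wc (ins_row j p.1 p.2); rewrite ins_row_at.
Qed.

Let mbump a b m : measurable_fun setT (bump a b m : 'rV[R]_n.+1 -> R).
Proof. exact: continuous_measurable_rV (smooth_continuous (smooth_bump a b m)). Qed.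

Let mbump' a b m : measurable_fun setT (bump a b m : 'rV[R]_n -> R).
Proof. exact: continuous_measurable_rV (smooth_continuous (smooth_bump a b m)). Qed.

Let bump_dom a b m (z : 'rV[R]_n.+1) :
  `|bump a b m z| <= `|bump1 (a ord0 j) (b ord0 j) m (z ord0 j)|.
Proof.
rewrite -[z in bump a b m z](ins_del_row j) bump_ins_row normrM ler_piMr//.
by rewrite ger0_norm ?bump_ge0 ?bump_le1.
Qed.

Let iVbump a b m : intg lebS (fun z => V (Z z) * bump a b m z).
Proof.
by apply: (iVZ (intg_bump1 (a ord0 j) (b ord0 j) m)) => // z; exact: bump_dom.
Qed.

Let prim_bounded a b m : exists M, forall r, `|prim a b m r| <= M.
Proof.
exists (\int[lambda]_r `|bump1 a b m r|) => r; rewrite normrN.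
have i1 : intg lambda (fun t => K r t * bump1 a b m t).
  apply: (intg_le _ (intg_abs (intg_bump1 a b m))).
    apply: measurable_funM; last exact: intg_measurable (intg_bump1 a b m).
    exact: (measurableT_comp mK (measurable_pair1 (r : RR))).
  by move=> t; rewrite normrM ler_piMl.
rewrite (le_trans (Rint_norm i1))//; apply: Rint_le.
- exact: intg_abs.
- exact/intg_abs/intg_bump1.
- by move=> t; rewrite normrM ler_piMl.
Qed.

(** The test function [Psi] is the primitive [prim] in the variable [j] times a bump in the others;
    its partial derivative in direction [j] is [bump a b m]. On the side of [V], [kernel_swap] moves
    the kernel from [alpha] to the bump and produces [- prim], so both sides are minus the integral
    of [alpha * Psi]. *)
Let test_rep a b m : \int[lebS]_z (V (Z z) * bump a b m z) =
  \int[lebS]_z (A z * bump a b m z).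
Proof.
have [_ _ Aa] := Aalpha.
pose a1 := a ord0 j; pose b1 := b ord0 j.
pose phi := bump (del_row j a) (del_row j b) m.
pose Psi (x : 'rV[R]_n.+1) := prim a1 b1 m (x ord0 j) * phi (del_row j x).
have sb (f : 'rV[R]_n.+1 -> R) : Cinf f -> Cinf (fun x => bump1 a1 b1 m (f x)).
  exact: smooth_bump1.
have dPsi x : partial Psi j x = bump a b m x.
  rewrite (partial_tensor j (dprim a1 b1 m) sb).
  by rewrite -[x in RHS](ins_del_row j) bump_ins_row.
have phi1 y : `|phi y| <= 1 by rewrite ger0_norm ?bump_ge0 ?bump_le1.
have [M HM] := prim_bounded a1 b1 m.
have M0 : 0 <= M by exact: le_trans (normr_ge0 _) (HM 0).
have PsiM x : `|Psi x| <= M.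
  by rewrite normrM -[leRHS]mulr1; apply: ler_pM => //; exact: phi1.
have sPsi : Cinf Psi by exact: smooth_tensor (dprim a1 b1 m) sb _ _ _.
have := Aa Psi sPsi (ex_intro _ M PsiM).
have -> : partial Psi j = bump a b m by exact/funext.
move=> ->; last by exists 1 => x; rewrite ger0_norm ?bump_ge0 ?bump_le1.
have mPsi : measurable_fun setT Psi.
  exact: continuous_measurable_rV (smooth_continuous sPsi).
rewrite (Rint_ins_row j); last exact: measurable_funM.
rewrite (Rint_ins_row j); last exact: measurable_funM.
have i1 : intg (lambda \x leb)%E (fun p => V p * bump a b m (ins_row j p.1 p.2)).
  have /(intg_ins_row j) := iVbump a b m.
  move=> /(_ (measurable_funM mVZ (mbump a b m))).
  by under eq_fun do rewrite ZK.
have i2 : intg (lambda \x leb)%E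
    (fun p => alpha (ins_row j p.1 p.2) * Psi (ins_row j p.1 p.2)).
  apply: (intg_le _ (intgZ M (intg_abs ialpha))).
    apply: measurable_funM; first exact: intg_measurable ialpha.
    by apply: (measurableT_comp mPsi); exact: measurable_ins_row.
  by move=> p; rewrite normrM mulrC ler_wpM2r.
under eq_Rintegral do rewrite ZK.
rewrite -(intg_fubini2 i1).2 -(intg_fubini2 i2).2 -RintN; last exact: (intg_fubini2 i2).1.
apply: ae_Rint.
- apply: filterS (ae_intg2 ialpha) => y iy.
  have ib := intg_bump1 a1 b1 m.
  have i3 : intg lambda (fun t => bump1 a1 b1 m t * V (t, y)).
    have mVy : measurable_fun setT (fun t : RR => V (t, y)).
      exact: (measurableT_comp mV (measurable_pair2 y)).
    apply: (intg_le _ (intgZ (h y) (intg_abs ib))).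
      by apply: measurable_funM => //; exact: intg_measurable ib.
    move=> t; rewrite normrM mulrC ler_wpM2r// /V /h.
    rewrite (le_trans (Rint_norm (iK t iy)))//.
    apply: Rint_le; [exact/intg_abs/iK|exact: intg_abs|].
    by move=> r; rewrite normrM ler_piMl.
  have i4 : intg lambda (fun r => alpha (ins_row j r y) * prim a1 b1 m r).
    have mp : @measurable_fun _ _ RR R setT (prim a1 b1 m).
      apply: continuous_measurable_fun => t; apply: differentiable_continuous.
      by apply/derivable1_diffP; have [] := dprim a1 b1 m t.
    apply: (intg_le _ (intgZ M (intg_abs iy))).
      by apply: measurable_funM => //; exact: intg_measurable iy.
    by move=> r; rewrite normrM mulrC ler_wpM2r.
  transitivity (phi y * \int[lambda]_t (bump1 a1 b1 m t * V (t, y))).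
    rewrite -RintZ//; apply: eq_Rintegral => t _.
    by rewrite bump_ins_row /= -/a1 -/b1 -/phi; ring.
  rewrite (kernel_swap mK K1 iy ib).
  transitivity (- (phi y * \int[lambda]_r (alpha (ins_row j r y) * prim a1 b1 m r))).
    rewrite -mulrN -RintN//; congr (_ * _); apply: eq_Rintegral => r _.
    by rewrite /prim mulrN opprK.
  congr (- _); rewrite -RintZ//; apply: eq_Rintegral => r _.
  by rewrite /Psi ins_row_at del_ins_row; ring.
- exact: intg_measurable (intg_fubini2 i1).1.
- exact: intg_measurable (intgN (intg_fubini2 i2).1).
Qed.

(** An integrable function with integrable derivative on a line tends to 0 at both ends, so it can
    be represented from either end. The kernel [K] allows both choices, [below r t] from the left
    and [- below t r] from the right. *)
Lemma line_rep : {ae (lambda \x leb)%E, forall p,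
  A (ins_row j p.1 p.2) = \int[lambda]_r (K r p.1 * alpha (ins_row j r p.2))}.
Proof.
have [iA _ _] := Aalpha.
suff H : {ae lebS, forall z, A z = V (Z z)}.
  have H' := (ae_ins_row j _).1 H.
  by apply: ae_impl H' => p /= ->; rewrite ZK.
(* Along a line [V] is bounded but need not be integrable, so it is compared with [A] on boxes that
   exhaust the space. *)
pose bx (k : nat) : 'rV[R]_n.+1 := const_mx k%:R.
have Hk k : {ae lebS, forall z, obox (- bx k) (bx k) z -> A z - V (Z z) = 0}.
  have mC : measurable (cbox (- bx k) (bx k)) by exact: measurable_cbox.
  pose I1 : 'rV[R]_n.+1 -> R := \1_(cbox (- bx k) (bx k)).
  have mI1 : measurable_fun setT I1 by exact: measurable_indic.
  have I1b z : `|I1 z| <= 1.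
    by rewrite /I1 indicE; case: (_ \in _); rewrite ?normr1 ?normr0.
  have i1 : intg lebS (fun z => V (Z z) * I1 z).
    apply: (iVZ (_ : intg lambda (\1_(`[- k%:R, k%:R]%classic)))) => //.
      exact: integrable_indic_itv.
    move=> z; rewrite /I1 !indicE.
    have [zC|zC] := pselect (cbox (- bx k) (bx k) z).
      rewrite [X in _ <= X](_ : _ = 1); first exact: I1b.
      rewrite mem_set ?normr1//= in_itv /=.
      by have := zC j; rewrite !mxE.
    by rewrite memNset// normr0.
  have i2 : intg lebS (fun z => A z * I1 z).
    apply: (intg_le _ (intg_abs iA)).
      by apply: measurable_funM => //; exact: intg_measurable iA.
    by move=> z; rewrite normrM ler_piMr.
  have := dBR_box (intgB i2 i1) (a := - bx k) (b := bx k).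
  have I1in z : cbox (- bx k) (bx k) z -> I1 z = 1.
    by move=> zC; rewrite /I1 indicE mem_set.
  move=> H; have {}H : {ae lebS, forall z, obox (- bx k) (bx k) z ->
      A z * I1 z - V (Z z) * I1 z = 0}.
    apply: H => a b m sab.
    have iAb : intg lebS (fun z => A z * bump a b m z).
      apply: (intg_le _ (intg_abs iA)).
        by apply: measurable_funM => //; exact: intg_measurable iA.
      by move=> z; rewrite normrM ler_piMr// ger0_norm ?bump_ge0 ?bump_le1.
    transitivity (\int[lebS]_z (A z * bump a b m z - V (Z z) * bump a b m z)).
      apply: eq_Rintegral => z _.
      have [zC|zC] := pselect (cbox (- bx k) (bx k) z).
        by rewrite I1in// !mulr1 mulrBl.
      by rewrite bump_out ?mulr0 ?subr0// => /obox_sub_cbox/sab.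
    by rewrite RintB// test_rep subrr.
  apply: filterS H => z Hz zo; have := Hz zo.
  by rewrite (I1in _ (obox_sub_cbox zo)) !mulr1.
have := ae_foralln Hk; apply: filterS => z Hz.
apply/eqP; rewrite -subr_eq0; apply/eqP; apply: (Hz (Num.truncn `|z|).+1) => i.
rewrite !mxE -ltr_norml; apply: le_lt_trans (truncnS_gt _).
rewrite [leRHS]/Num.norm /= mx_normrE.
by apply/bigmax_geP; right => /=; exists (ord0, i).
Qed.

End representation.

(** With [A] represented from the left and [B] from the right, both terms are, up to sign, the
    integral of [alpha(r) * beta(t)] over the half-plane [r < t], and the signs are opposite. *)
Theorem line_deriv_parts A alpha B beta :
  line_deriv A alpha -> line_deriv B beta ->
  intg lebS (fun x => alpha x * B x) -> intg lebS (fun x => A x * beta x) ->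
  \int[lebS]_x (alpha x * B x) + \int[lebS]_x (A x * beta x) = 0.
Proof.
move=> LA LB i1 i2.
have mB1 : measurable_fun setT (fun p : RR * RR => below p.1 p.2).
  by apply: measurable_below; [exact: measurable_fst|exact: measurable_snd].
have mB2 : measurable_fun setT (fun p : RR * RR => - below p.2 p.1).
  apply: (@measurable_funN _ _ _ _ (fun p : RR * RR => below p.2 p.1)).
  by apply: measurable_below; [exact: measurable_snd|exact: measurable_fst].
have bB (r t : R) : `|- below t r| <= 1 by rewrite normrN; exact: below_bound.
have dB a b m (r : R) : is_derive r 1
    (fun r : R => - \int[lambda]_t (- below t r * bump1 a b m t)) (bump1 a b m r).
  rewrite (_ : (fun r0 : R => _) = lprim a b m); first exact: is_derive_lprim.
  apply/funext => s; rewrite -RintN.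
    by apply: eq_Rintegral => t _; rewrite mulNr opprK.
  have := intgN (intg_below_l s (intg_bump1 a b m)); congr intg.
  by apply/funext => t; rewrite mulNr.
have RA := @line_rep (fun r t => below r t) mB1 (@below_bound R)
  (fun a b m r => is_derive_rprim a b m r) _ _ LA.
have RB := @line_rep (fun r t => - below t r) mB2 bB dB _ _ LB.
have [_ /(intg_measurable) ma _] := LA; have [_ /(intg_measurable) mb _] := LB.
have [/(intg_measurable) mA ia0 _] := LA; have [/(intg_measurable) mB ib0 _] := LB.
have mM (f g : 'rV[R]_n.+1 -> R) : measurable_fun setT f -> measurable_fun setT g ->
    measurable_fun setT (fun x => f x * g x) by exact: measurable_funM.
have ia := (intg_ins_row j ma).1 ia0; have ib := (intg_ins_row j mb).1 ib0.
have j1 := (intg_ins_row j (mM _ _ ma mB)).1 i1.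
have j2 := (intg_ins_row j (mM _ _ mA mb)).1 i2.
rewrite (Rint_ins_row j (mM _ _ ma mB)) (Rint_ins_row j (mM _ _ mA mb)).
have [k1 e1] := intg_fubini2 j1; have [k2 e2] := intg_fubini2 j2.
rewrite -e1 -e2 -RintD// -[RHS](@Rint0 _ _ R leb); apply: ae_Rint.
- have H1 := ae_prod2 RA; have H2 := ae_prod2 RB.
  have H3 := ae_intg2 ia; have H4 := ae_intg2 ib.
  have H5 := ae_intg2 j1; have H6 := ae_intg2 j2.
  apply: filterS (filterI H1 (filterI H2 (filterI H3 (filterI H4 (filterI H5 H6))))).
  move=> y [h1 [h2 [h3 [h4 [h5 h6]]]]].
  have E1 : \int[lambda]_t (alpha (ins_row j t y) * B (ins_row j t y)) =
      - \int[lambda]_t (alpha (ins_row j t y) *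
          \int[lambda]_r (below t r * beta (ins_row j r y))).
    have E t : \int[lambda]_r (- below t r * beta (ins_row j r y)) =
        - \int[lambda]_r (below t r * beta (ins_row j r y)).
      by rewrite -RintN ?intg_below_r//; apply: eq_Rintegral => r _; rewrite mulNr.
    have mI : measurable_fun setT (fun t : RR =>
        \int[lambda]_r (below t r * beta (ins_row j r y))).
      apply: (@measurable_Rint _ _ RR RR R lambda
        (fun q => below q.1 q.2 * beta (ins_row j q.2 y))).
      apply: measurable_funM => //.
      exact: (measurableT_comp (intg_measurable h4) measurable_snd).
    have bI t : `|\int[lambda]_r (below t r * beta (ins_row j r y))| <=
        \int[lambda]_r `|beta (ins_row j r y)|.
      rewrite (le_trans (Rint_norm (intg_below_r t h4)))//.
      apply: Rint_le; [exact/intg_abs/intg_below_r|exact: intg_abs|].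
      by move=> r; rewrite normrM ler_piMl// below_bound.
    have iI : intg lambda (fun t => alpha (ins_row j t y) *
          \int[lambda]_r (below t r * beta (ins_row j r y))).
      apply: (intg_le _ (intgZ (\int[lambda]_r `|beta (ins_row j r y)|) (intg_abs h3))).
        by apply: measurable_funM => //; exact: intg_measurable h3.
      by move=> t; rewrite normrM mulrC ler_wpM2r.
    rewrite -RintN//; apply: ae_Rint.
    - by apply: filterS h2 => t /= ->; rewrite E mulrN.
    - exact: intg_measurable h5.
    - exact: intg_measurable (intgN iI).
  have E2 : \int[lambda]_t (A (ins_row j t y) * beta (ins_row j t y)) =
      \int[lambda]_t (beta (ins_row j t y) *
          \int[lambda]_r (below r t * alpha (ins_row j r y))).
    have mI : measurable_fun setT (fun t : RR =>
        \int[lambda]_r (below r t * alpha (ins_row j r y))).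
      apply: (@measurable_Rint _ _ RR RR R lambda
        (fun q => below q.2 q.1 * alpha (ins_row j q.2 y))).
      apply: measurable_funM; first by apply: measurable_below;
        [exact: measurable_snd|exact: measurable_fst].
      exact: (measurableT_comp (intg_measurable h3) measurable_snd).
    apply: ae_Rint.
    - by apply: filterS h1 => t /= ->; rewrite mulrC.
    - exact: intg_measurable h6.
    - by apply: measurable_funM => //; exact: intg_measurable h4.
  rewrite [X in X + _]E1 [X in _ + X]E2 /=.
  by rewrite (kernel_swap mB1 (@below_bound R) h3 h4) addNr.
- exact: intg_measurable (intgD k1 k2).
- exact: measurable_cst.
Qed.

End line_derivatives.

(** * Weak derivatives on open sets *)

Lemma intg_indic d (T : measurableType d) (R : realType)
    (mu : {measure set T -> \bar R}) (A : set T) :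
  measurable A -> (mu A < +oo)%E -> intg mu (\1_A : T -> R).
Proof.
move=> mA Aoo; apply/integrableP; split.
  by apply/measurable_EFinP; exact: measurable_indic.
rewrite (_ : (\int[mu]_x `|(EFin \o \1_A) x| = mu A)%E)//.
have := integral_indic mu measurableT mA; rewrite setIT => <-.
apply: eq_integral => x _.
by rewrite /= ger0_norm.
Qed.

Section test_functions.
Variables (R : realType) (n : nat).
Notation leb := (lebesgue_rV R n).
Implicit Types (D : set 'rV[R]_n) (u w phi : 'rV[R]_n -> R).

Lemma test_Cinf D phi : test_function D phi -> Cinf phi.
Proof. by case=> s _; apply/CinfP. Qed.

Lemma test_out D phi x : test_function D phi -> ~ D x -> phi x = 0.
Proof. by move=> [_ [K [_ KD H]]] nD; apply: H => /KD. Qed.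

Lemma testM D phi f : test_function D phi -> Cinf f ->
  test_function D (fun x => phi x * f x).
Proof.
move=> [s [K [cK KD H]]] sf; split.
  by apply/CinfP; apply: smoothM => //; exact/CinfP.
by exists K; split => // x /H ->; rewrite mul0r.
Qed.

Lemma partial_near0 phi j x : (\near x, phi x = 0) -> partial phi j x = 0.
Proof.
move=> H; rewrite -[RHS](congr1 (@^~ x) (partial_cst 0 j : _ = cst (0:R))).
exact: near_eq_derive.
Qed.

Lemma test_partial D phi j : test_function D phi -> test_function D (partial phi j).
Proof.
move=> [s [K [cK KD H]]]; split.
  by apply/CinfP; apply: smooth_partial; exact/CinfP.
exists K; split => // x nK; apply: partial_near0.
have oK : open (~` K) by apply: closed_openC; apply: compact_closed.
by apply: filterS (open_nbhs_nbhs (conj oK nK)) => y; exact: H.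
Qed.

Lemma test_partials D phi s : test_function D phi -> test_function D (partials phi s).
Proof. by elim: s phi => [|j s IH] phi tphi //; apply: IH; exact: test_partial. Qed.

Lemma test_bounded D phi : test_function D phi -> exists M, forall x, `|phi x| <= M.
Proof.
move=> tphi; have [_ [K [cK _ H]]] := tphi.
have cphi := smooth_continuous (test_Cinf tphi).
have /compact_bounded[M [_ HM]] := continuous_compact
  (continuous_subspaceT cphi : {within K, continuous phi}) cK.
exists (`|M| + 1) => x.
have [xK|/H ->] := pselect (K x); last by rewrite normr0 addr_ge0.
apply: (HM (`|M| + 1)); last by exists x.
by rewrite ltr_pwDr// ler_norm.
Qed.

Lemma measurable_test D phi : test_function D phi -> measurable_fun setT phi.
Proof. by move=> /test_Cinf/smooth_continuous/continuous_measurable_rV. Qed.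

Lemma L2_test D phi : test_function D phi -> L2 leb phi.
Proof.
move=> tphi; have mphi := measurable_test tphi; split => //.
have [M HM] := test_bounded tphi; have [_ [K [cK _ H]]] := tphi.
have mK : measurable K by apply: closed_measurable_rV; exact: compact_closed.
have iK : intg leb (\1_K : _ -> R).
  by apply: intg_indic => //; exact: lebesgue_rV_compact.
apply: (intg_le _ (intgZ (M ^+ 2) iK)); first exact: measurable_funX.
move=> x; rewrite indicE ger0_norm ?sqr_ge0//.
have [xK|xK] := pselect (K x); last by rewrite H// expr0n memNset// mulr0.
rewrite mem_set// mulr1 -real_normK ?num_real// ler_sqr ?nnegrE//.
exact: le_trans (HM x).
Qed.

Lemma intg_test D u phi : locally_integrable_on D u -> test_function D phi ->
  intg leb (fun x => u x * phi x).
Proof.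
move=> [mu iu] tphi; have [_ [K [cK KD H]]] := tphi.
have mK : measurable K by apply: closed_measurable_rV; exact: compact_closed.
have [M HM] := test_bounded tphi.
have iuK : intg leb (u \_ K).
  have := iu K cK KD => /(integrable_mkcond _ mK); apply: eq_integrable => // x _.
  by rewrite /= !patchE; case: (_ \in _).
have E : (fun x => u x * phi x) = (fun x => (u \_ K) x * phi x).
  apply/funext => x; rewrite patchE.
  have [xK|xK] := pselect (K x); first by rewrite mem_set.
  by rewrite memNset// H// !mulr0.
rewrite E; apply: (intg_le _ (intgZ M (intg_abs iuK))).
  by apply: measurable_funM; [exact: intg_measurable iuK|exact: measurable_test tphi].
by move=> x; rewrite normrM mulrC ler_wpM2r.
Qed.

Lemma Rint_test D u phi : test_function D phi ->
  \int[leb]_(x in D) (u x * phi x) = \int[leb]_x (u x * phi x).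
Proof.
move=> tphi; rewrite Rintegral_mkcond; apply: eq_Rintegral => x _.
rewrite patchE; have [xD|xD] := pselect (D x); first by rewrite mem_set.
by rewrite memNset// (test_out tphi)// mulr0.
Qed.

Lemma wdE D s u w phi : weak_derivative D s u w -> test_function D phi ->
  \int[leb]_x (u x * partials phi s x) =
  (-1) ^+ size s * \int[leb]_x (w x * phi x).
Proof.
move=> [lu lw H] tphi.
rewrite -(Rint_test _ (test_partials s tphi)) /Rintegral H// -/(Rintegral _ _ _).
rewrite -RintZ; last exact: intg_test tphi.
rewrite -[RHS]/(Rintegral _ _ _) [LHS]Rintegral_mkcond; apply: eq_Rintegral => x _.
rewrite patchE; have [xD|xD] := pselect (D x); first by rewrite mem_set.
by rewrite memNset// (test_out tphi)// !mulr0.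
Qed.

Lemma wdI D s u w : locally_integrable_on D u -> locally_integrable_on D w ->
  (forall phi, test_function D phi -> \int[leb]_x (u x * partials phi s x) =
     (-1) ^+ size s * \int[leb]_x (w x * phi x)) -> weak_derivative D s u w.
Proof.
move=> lu lw H; split => // phi tphi.
have E u' psi : locally_integrable_on D u' -> test_function D psi ->
    (\int[leb]_(x in D) (u' x * psi x)%:E = (\int[leb]_x (u' x * psi x))%:E)%E.
  move=> lu' tpsi; rewrite -RintE; last exact: intg_test tpsi.
  rewrite [LHS]integral_mkcond; apply: eq_integral => x _.
  rewrite patchE; have [xD|xD] := pselect (D x); first by rewrite mem_set.
  by rewrite memNset// (test_out tpsi)// mulr0.
rewrite E//; last exact: test_partials.
rewrite H// -RintZ; last exact: intg_test tphi.
have tphi' : test_function D (fun x => phi x * (-1) ^+ size s).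
  by apply: testM => //; exact: smooth_cst.
have := E w _ lw tphi'; under eq_integral do rewrite mulrA [_ * (-1) ^+ _]mulrC.
by move=> ->; congr (_%:E); apply: eq_Rintegral => x _; rewrite mulrC mulrA.
Qed.

Lemma li_patch D u : open D -> L2 leb (u \_ D) -> locally_integrable_on D u.
Proof.
move=> oD [mu iu]; have mD := open_measurable_rV oD; split.
  by have /(measurable_restrict _ mD measurableT) := mu; rewrite setTI.
move=> K cK KD.
have mK : measurable K by apply: closed_measurable_rV; exact: compact_closed.
have iK : intg leb (\1_K : _ -> R).
  by apply: intg_indic => //; exact: lebesgue_rV_compact.
apply/(integrable_mkcond _ mK).
have LK : L2 leb (\1_K : _ -> R).
  split; first exact: measurable_indic.
  by move: iK; congr intg; apply/funext => x; rewrite indicE; case: (_ \in _); rewrite ?expr1n ?expr0n.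
have := L2M (conj mu iu : L2 leb (u \_ D)) LK; apply: eq_integrable => // x _ /=.
rewrite !patchE indicE.
have [xK|xK] := pselect (K x); last by rewrite (memNset xK) mulr0.
by rewrite (mem_set xK) (mem_set (KD _ xK)) mulr1.
Qed.

Lemma L2norm2E D u : measurable D -> L2 leb (u \_ D) ->
  L2norm2 D u = (\int[leb]_x ((u \_ D) x ^+ 2))%:E.
Proof.
move=> mD [_ iu]; rewrite -RintE// /L2norm2 [LHS]integral_mkcond.
by apply: eq_integral => x _; rewrite !patchE; case: (_ \in _); rewrite ?expr0n.
Qed.

Lemma L2_patch D u : measurable D -> measurable_fun D u -> (L2norm2 D u < +oo)%E ->
  L2 leb (u \_ D).
Proof.
move=> mD mu u2.
have mp : measurable_fun setT (u \_ D).
  by apply/(measurable_restrict _ mD measurableT); rewrite setTI.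
split => //; apply/integrableP; split.
  by apply/measurable_EFinP; exact: measurable_funX.
move: u2; rewrite /L2norm2 [X in (X < _)%E -> _]integral_mkcond; congr (_ < _)%E.
apply: eq_integral => x _; rewrite /= ger0_norm ?sqr_ge0// !patchE.
by case: (_ \in _); rewrite ?expr0n.
Qed.

Lemma wd_unique D s u u' w w' : open D ->
  weak_derivative D s u w -> weak_derivative D s u' w' ->
  {ae leb, forall x, D x -> u x = u' x} -> {ae leb, forall x, D x -> w x = w' x}.
Proof.
move=> oD W W' uu'.
have [lu lw _] := W; have [lu' lw' _] := W'.
have mD := open_measurable_rV oD.
have H : {ae leb, forall x, D x -> w x - w' x = 0}.
  apply: (dBR oD).
  - by apply: measurable_funB; [exact: lw.1|exact: lw'.1].
  - move=> K cK KD; have mK : measurable K.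
      by apply: closed_measurable_rV; exact: compact_closed.
    have := integrableB mK (lw.2 K cK KD) (lw'.2 K cK KD).
    by apply: eq_integrable.
  - move=> a b m abD; have tb := test_bump m abD.
    rewrite (Rint_test _ tb).
    transitivity (\int[leb]_x (w x * bump a b m x - w' x * bump a b m x)).
      by apply: eq_Rintegral => x _; rewrite mulrBl.
    rewrite RintB; [|exact: intg_test tb|exact: intg_test tb].
    have s1 : ((-1) ^+ size s != 0 :> R) by rewrite signr_eq0.
    apply: (mulfI s1); rewrite mulr0 mulrBr -(wdE W tb) -(wdE W' tb).
    have tp := test_partials s tb.
    apply/eqP; rewrite subr_eq0; apply/eqP; apply: ae_Rint.
    + apply: filterS uu' => x uu'; have [/uu' -> //|xD] := pselect (D x).
      by rewrite (test_out tp)// !mulr0.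
    + exact: intg_measurable (intg_test lu tp).
    + exact: intg_measurable (intg_test lu' tp).
by apply: filterS H => x H /H/eqP; rewrite subr_eq0 => /eqP.
Qed.

End test_functions.

Lemma dist_continuous (R : realType) n (f : 'rV[R]_n -> R) :
  (forall x (e : R), 0 < e -> exists2 d : R, 0 < d &
     forall y, `|y - x| < d -> `|f y - f x| < e) -> continuous f.
Proof.
move=> H x; suff : forall e : R, 0 < e -> \forall y \near x, `|f x - f y| < e.
  by move=> H'; apply/(@cvgrPdist_lt _ _ _ (nbhs x)).
move=> e e0; have [d d0 Hd] := H x e e0.
apply/nbhs_normP; exists d => //= y; rewrite /ball_ /= => xy.
by rewrite distrC; apply: Hd; rewrite distrC.
Qed.

Section inserted_tests.
Variables (R : realType) (n : nat) (j : 'I_n.+1).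
Implicit Types (phi : 'rV[R]_n -> R) (x : 'rV[R]_n.+1).

Lemma norm_del_row x : `|del_row j x| <= `|x|.
Proof.
rewrite [leLHS]/Num.norm /= mx_normrE; apply/bigmax_leP; split => // -[i k] _ /=.
rewrite mxE [leRHS]/Num.norm /= mx_normrE.
by apply/bigmax_geP; right => /=; exists (ord0, lift j k).
Qed.

Lemma continuous_del phi : continuous phi ->
  continuous (fun x : 'rV[R]_n.+1 => phi (del_row j x)).
Proof.
move=> cphi; apply: dist_continuous => x e e0.
have [d d0 H] := continuous_dist (del_row j x) cphi e0.
exists d => // y yx; apply: H.
have -> : del_row j y - del_row j x = del_row j (y - x).
  by apply/rowP => i; rewrite !mxE.
exact: le_lt_trans (norm_del_row _) yx.
Qed.

Lemma is_derive_del_lift phi i x : Cinf phi ->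
  is_derive x (delta_mx ord0 (lift j i)) (fun x => phi (del_row j x))
    (partial phi i (del_row j x)).
Proof.
move=> sphi; apply: is_derive_of_line.
have -> : (fun t : R => phi (del_row j (x + t *: delta_mx ord0 (lift j i)))) =
    (fun t : R => phi (del_row j x + t *: delta_mx ord0 i)).
  apply/funext => t; congr phi; apply/rowP => k.
  by rewrite !mxE (inj_eq (@lift_inj _ j)).
have := @is_derive_line _ _ phi (del_row j x) (delta_mx ord0 i) 0.
rewrite scale0r addr0; apply; exact: smooth_derivable.
Qed.

Lemma is_derive_del_at phi x :
  is_derive x (delta_mx ord0 j) (fun x => phi (del_row j x)) 0.
Proof.
apply: is_derive_of_line.
rewrite (_ : (fun t => _) = cst (phi (del_row j x))); first exact: is_derive_cst.
apply/funext => t; congr phi; apply/rowP => i.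
rewrite !mxE; have -> : (lift j i == j) = false.
  by rewrite eq_sym (negbTE (neq_lift _ _)).
by rewrite andbF mulr0 addr0.
Qed.

Lemma smooth_del phi : Cinf phi -> Cinf (fun x : 'rV[R]_n.+1 => phi (del_row j x)).
Proof.
move=> sphi; apply: (smooth_coind (P := fun f => exists2 phi, Cinf phi &
  f = fun x => phi (del_row j x))); last by exists phi.
move=> {sphi phi} _ [phi sphi ->]; split.
- exact/continuous_del/smooth_continuous.
- move=> k x; case: (unliftP j k) => [i ->|->].
    by have [] := is_derive_del_lift i x sphi.
  by have [] := is_derive_del_at phi x.
- move=> k; case: (unliftP j k) => [i ->|->].
    exists (partial phi i); first exact: smooth_partial.
    by apply/funext => x; apply: partial_val; exact: is_derive_del_lift.
  exists (fun=> 0); first exact: smooth_cst.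
  by apply/funext => x; apply: partial_val; exact: is_derive_del_at.
Qed.

Lemma partial_del_lift phi i x : Cinf phi ->
  partial (fun x : 'rV[R]_n.+1 => phi (del_row j x)) (lift j i) x =
  partial phi i (del_row j x).
Proof. by move=> sphi; apply: partial_val; exact: is_derive_del_lift. Qed.

Lemma partial_del_at phi x :
  partial (fun x : 'rV[R]_n.+1 => phi (del_row j x)) j x = 0.
Proof. by apply: partial_val; exact: is_derive_del_at. Qed.

End inserted_tests.

(** For a bounded smooth [Psi] the product [chi * Psi] is a test function on [Q]. Thus the cutoff
    turns a weak derivative on [Q] into a derivative on the whole space, tested against functions
    without compact support. *)
Lemma loc_line_deriv (R : realType) n (j : 'I_n.+1) (Q : set 'rV[R]_n.+1)
    (U W chi : 'rV[R]_n.+1 -> R) : L2 (lebesgue_rV R n.+1) U ->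
  L2 (lebesgue_rV R n.+1) W ->
  (forall phi, test_function Q phi ->
    \int[lebesgue_rV R n.+1]_x (U x * partial phi j x) =
    - \int[lebesgue_rV R n.+1]_x (W x * phi x)) ->
  test_function Q chi ->
  line_deriv j (fun x => U x * chi x) (fun x => W x * chi x + U x * partial chi j x).
Proof.
move=> LU LW H tchi; have sc := test_Cinf tchi.
have Lc := L2_test tchi; have tpc := test_partial j tchi; have Lpc := L2_test tpc.
have i1 := L2M LU Lc; have i2 := L2M LW Lc; have i3 := L2M LU Lpc.
split => //; first exact: intgD.
move=> Psi sP [M1 H1] [M2 H2].
have tcP := testM tchi sP.
have mP := continuous_measurable_rV (smooth_continuous sP).
have mdP := continuous_measurable_rV (smooth_continuous (smooth_partial j sP)).
have LcP : L2 (lebesgue_rV R n.+1) (fun x => chi x * Psi x) by exact: L2_test tcP.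
have LcdP : L2 (lebesgue_rV R n.+1) (fun x => chi x * partial Psi j x).
  exact: L2_test (testM tchi (smooth_partial j sP)).
have LdcP : L2 (lebesgue_rV R n.+1) (fun x => partial chi j x * Psi x).
  exact: L2_test (testM tpc sP).
have k1 := L2M LU LcdP; have k2 := L2M LW LcP; have k3 := L2M LU LdcP.
have := H _ tcP.
have -> : \int[lebesgue_rV R n.+1]_x (U x * partial (fun x => chi x * Psi x) j x) =
  \int[lebesgue_rV R n.+1]_x (U x * (partial chi j x * Psi x) +
     U x * (chi x * partial Psi j x)).
  by apply: eq_Rintegral => x _; rewrite partialM// mulrDr.
rewrite RintD// => E.
transitivity (\int[lebesgue_rV R n.+1]_x (U x * (chi x * partial Psi j x))).
  by apply: eq_Rintegral => x _; rewrite mulrA.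
transitivity (- (\int[lebesgue_rV R n.+1]_x (W x * (chi x * Psi x)) +
  \int[lebesgue_rV R n.+1]_x (U x * (partial chi j x * Psi x)))).
  by rewrite opprD -E [X in X - _]addrC addrK.
rewrite -RintD//; congr (- _); apply: eq_Rintegral => x _.
by rewrite mulrDl !mulrA.
Qed.

(** * Functions on a time cylinder *)

Lemma cauchy_schwarz d (T : measurableType d) (R : realType)
    (mu : {measure set T -> \bar R}) (f g : T -> R) : L2 mu f -> L2 mu g ->
  (\int[mu]_x (f x * g x)) ^+ 2 <= \int[mu]_x (f x ^+ 2) * \int[mu]_x (g x ^+ 2).
Proof.
move=> Lf Lg; have ifg := L2M Lf Lg; have [mf if2] := Lf; have [mg ig2] := Lg.
have [a0|a0] := eqVneq (\int[mu]_x (f x ^+ 2)) 0.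
  have f0 := Rint_eq0 if2 (fun x => sqr_ge0 (f x)) a0.
  rewrite a0 mul0r (_ : \int[mu]_x _ = 0) ?expr0n// -[RHS](@Rint0 _ _ R mu).
  apply: ae_Rint => //; last exact: intg_measurable ifg.
  by apply: filterS f0 => x /eqP; rewrite sqrf_eq0 => /eqP ->; rewrite mul0r.
have a_gt0 : 0 < \int[mu]_x (f x ^+ 2).
  by rewrite lt_neqAle eq_sym a0 Rint_ge0// => x; exact: sqr_ge0.
set a := \int[mu]_x (f x ^+ 2) in a0 a_gt0 *; set i := \int[mu]_x (f x * g x).
set b := \int[mu]_x (g x ^+ 2).
have : 0 <= \int[mu]_x ((i / a * f x - g x) ^+ 2) by apply: Rint_ge0 => x; exact: sqr_ge0.
have -> : \int[mu]_x ((i / a * f x - g x) ^+ 2) = b - i ^+ 2 / a.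
  transitivity (\int[mu]_x ((i / a) ^+ 2 * f x ^+ 2 - (2 * (i / a)) * (f x * g x) + g x ^+ 2)).
    by apply: eq_Rintegral => x _; ring.
  rewrite RintD//; last by apply: intgB; exact: intgZ.
  rewrite RintB; try exact: intgZ.
  by rewrite !RintZ// -/a -/b -/i; field.
by rewrite subr_ge0 ler_pdivrMr// mulrC.
Qed.

Section slices.
Variables (R : realType) (n : nat) (j : 'I_n.+1).
Notation lambda := (@lebesgue_measure R).
Notation RR := (measurableTypeR R).
Notation leb := (lebesgue_rV R n).
Notation lebS := (lebesgue_rV R n.+1).

Lemma L2_ins_row (U : 'rV[R]_n.+1 -> R) : measurable_fun setT U ->
  L2 lebS U <-> L2 (lambda \x leb)%E (fun p => U (ins_row j p.1 p.2)).
Proof.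
move=> mU; split=> -[m1 i1]; split => //.
- by apply: (measurableT_comp mU); exact: measurable_ins_row.
- exact: (intg_ins_row j (measurable_funX 2 mU)).1.
- exact: (intg_ins_row j (measurable_funX 2 mU)).2.
Qed.

Lemma measurable_ins_at (U : 'rV[R]_n.+1 -> R) y : measurable_fun setT U ->
  measurable_fun setT (fun r : RR => U (ins_row j r y)).
Proof.
move=> mU; apply: (measurableT_comp mU).
by apply: measurable_ins_row_comp; [exact: measurable_id|exact: measurable_cst].
Qed.

Lemma measurable_ins_slice (U : 'rV[R]_n.+1 -> R) r : measurable_fun setT U ->
  measurable_fun setT (fun y => U (ins_row j r y)).
Proof.
move=> mU; apply: (measurableT_comp mU).
by apply: measurable_ins_row_comp; [exact: measurable_cst|exact: measurable_id].
Qed.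

Lemma ae_L2_ins (U : 'rV[R]_n.+1 -> R) : L2 lebS U ->
  {ae leb, forall y, L2 lambda (fun r => U (ins_row j r y))}.
Proof.
move=> LU; have mU := LU.1; have [_ i1] := (L2_ins_row mU).1 LU.
by apply: filterS (ae_intg2 i1) => y i2; split => //; exact: measurable_ins_at.
Qed.

Lemma intg_ins_sq (U : 'rV[R]_n.+1 -> R) : L2 lebS U ->
  intg leb (fun y => \int[lambda]_r (U (ins_row j r y) ^+ 2)) /\
  \int[leb]_y \int[lambda]_r (U (ins_row j r y) ^+ 2) = \int[lebS]_x (U x ^+ 2).
Proof.
move=> LU; have mU := LU.1; have [_ i1] := (L2_ins_row mU).1 LU.
rewrite (Rint_ins_row j); last exact: measurable_funX.
exact: (intg_fubini2 i1).
Qed.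

End slices.

Section segments.
Variable R : realType.
Notation lambda := (@lebesgue_measure R).
Notation RR := (measurableTypeR R).

Lemma belowB (s t : R) : s <= t ->
  (fun r => below r t - below r s) = \1_(`[s, t[%classic) :> (R -> R).
Proof.
move=> st; apply/funext => r; rewrite indicE mem_setE in_itv /= /below.
have [h|h] := ltP r s; first by rewrite (lt_le_trans h st) subrr.
by rewrite subr0; case: (r < t).
Qed.

Lemma L2_belowB (s t : R) : s <= t -> L2 lambda (fun r => below r t - below r s).
Proof.
move=> st; rewrite belowB//; split; first exact: measurable_indic.
have : intg lambda (\1_(`[s, t[%classic) : R -> R).
  by apply: intg_indic => //=; rewrite lebesgue_measure_itv/=; case: ifP; rewrite -?EFinB ltry.
congr intg; apply/funext => x; rewrite indicE.
by case: (_ \in _); rewrite ?expr1n ?expr0n.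
Qed.

Lemma Rint_belowB (s t : R) : s <= t ->
  \int[lambda]_r ((below r t - below r s) ^+ 2) = t - s.
Proof.
move=> st; transitivity (\int[lambda]_r (\1_(`[s, t[%classic) r : R)).
  apply: eq_Rintegral => r _; have := congr1 (@^~ r) (belowB st) => /= ->.
  by rewrite indicE; case: (_ \in _); rewrite ?expr1n ?expr0n.
rewrite /Rintegral integral_indic// setIT /=.
rewrite lebesgue_measure_itv/= lte_fin.
by move: st; rewrite le_eqVlt => /predU1P[->|->//]; rewrite ltxx subrr.
Qed.

Definition win (T r : R) : R := if 0 < r < T then 1 else 0.

Lemma winE (T r : R) : win T r = \1_(`]0, T[%classic) r.
Proof. by rewrite indicE mem_setE in_itv /= /win; case: ifP. Qed.

Lemma L2_win (T : R) : L2 lambda (win T).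
Proof.
rewrite (_ : win T = \1_(`]0, T[%classic)); last by apply/funext => r; exact: winE.
split; first exact: measurable_indic.
have : intg lambda (\1_(`]0, T[%classic) : R -> R).
  by apply: intg_indic => //=; rewrite lebesgue_measure_itv/=; case: ifP; rewrite -?EFinB ltry.
congr intg; apply/funext => x; rewrite indicE.
by case: (_ \in _); rewrite ?expr1n ?expr0n.
Qed.

Lemma measurable_win (T : R) : measurable_fun setT (win T : RR -> R).
Proof. by have [] := L2_win T. Qed.

Lemma win_ge0 (T r : R) : 0 <= win T r. Proof. by rewrite /win; case: ifP. Qed.

Lemma win_bound (T r : R) : `|win T r| <= 1.
Proof. by rewrite /win; case: ifP; rewrite ?normr1 ?normr0. Qed.

Lemma intg_win (T : R) : intg lambda (win T).
Proof.
have [_] := L2_win T; congr intg; apply/funext => r; rewrite /win.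
by case: ifP; rewrite ?expr1n ?expr0n.
Qed.

End segments.

Section time_integral.
Variables (R : realType) (n : nat) (T : R) (D : set 'rV[R]_n).
Hypothesis T0 : 0 < T.
Notation lambda := (@lebesgue_measure R).
Notation RR := (measurableTypeR R).
Notation leb := (lebesgue_rV R n).
Notation lebS := (lebesgue_rV R n.+1).
Implicit Types U W : 'rV[R]_n.+1 -> R.

(** Functions on the cylinder are represented by their extension by zero, so that integrals run over
    the whole space and Fubini's theorem needs no domain. *)
Definition cyl U := L2 lebS U /\ forall x, ~ cylinder T D x -> U x = 0.

Lemma cylinder_ins t y : cylinder T D (ins_row ord0 t y) <-> (0 < t < T) /\ D y.
Proof. by rewrite /cylinder /= ins_row_at tail_rowE del_ins_row. Qed.

Lemma cyl_win U t y : cyl U -> U (ins_row ord0 t y) = win T t * U (ins_row ord0 t y).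
Proof.
move=> [_ H]; rewrite /win; case: ifPn => [_|h]; first by rewrite mul1r.
by rewrite mul0r H// => /cylinder_ins[h' _]; rewrite h' in h.
Qed.

Lemma ae_intg_cyl U : cyl U -> {ae leb, forall y, intg lambda (fun r => U (ins_row ord0 r y))}.
Proof.
move=> cU; apply: filterS (ae_L2_ins ord0 cU.1) => y LU.
have := L2M (L2_win T) LU; congr intg; apply/funext => r.
by rewrite -cyl_win.
Qed.

Definition tint W (t : R) (y : 'rV[R]_n) : R :=
  \int[lambda]_r (below r t * W (ins_row ord0 r y)).

Lemma measurable_tint W : measurable_fun setT W ->
  measurable_fun setT (fun p : RR * 'rV[R]_n => tint W p.1 p.2).
Proof.
move=> mW; apply: (@measurable_Rint _ _ (RR * 'rV[R]_n)%type RR R lambda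
  (fun q => below q.2 q.1.1 * W (ins_row ord0 q.2 q.1.2))).
have m1 : measurable_fun setT (fun q : (RR * 'rV[R]_n) * RR => q.1.1).
  exact: (measurableT_comp measurable_fst measurable_fst).
have m2 : measurable_fun setT (fun q : (RR * 'rV[R]_n) * RR => q.1.2).
  exact: (measurableT_comp measurable_snd measurable_fst).
have m3 : measurable_fun setT (fun q : (RR * 'rV[R]_n) * RR => q.2).
  exact: measurable_snd.
apply: measurable_funM; first exact: measurable_below.
have mi : measurable_fun setT (fun q : (RR * 'rV[R]_n) * RR => ins_row ord0 q.2 q.1.2).
  exact: measurable_ins_row_comp.
exact: (measurableT_comp mW mi).
Qed.

Lemma measurable_tint_slice W t : measurable_fun setT W ->
  measurable_fun setT (tint W t).
Proof.
move=> mW; have mp : measurable_fun setT (fun y : 'rV[R]_n => (t : RR, y)).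
  by apply/measurable_fun_pairP; split; [exact: measurable_cst|exact: measurable_id].
exact: (measurableT_comp (measurable_tint mW) mp).
Qed.

Lemma tint_le0 W t y : cyl W -> t <= 0 -> tint W t y = 0.
Proof.
move=> cW t0; rewrite /tint -[RHS](@Rint0 _ _ R lambda); apply: eq_Rintegral => r _.
rewrite (cyl_win r y cW) /below /win; case: ifP => [rt|]; last by rewrite mul0r.
by rewrite (le_gtF (ltW (lt_le_trans rt t0))) /= mul0r mulr0.
Qed.

Lemma tint_out W t y : cyl W -> ~ D y -> tint W t y = 0.
Proof.
move=> cW nD; rewrite /tint -[RHS](@Rint0 _ _ R lambda); apply: eq_Rintegral => r _.
by rewrite cW.2 ?mulr0// => /cylinder_ins[].
Qed.

Lemma tintB_le W s t y : L2 lambda (fun r => W (ins_row ord0 r y)) ->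
  intg lambda (fun r => W (ins_row ord0 r y)) -> s <= t ->
  (tint W t y - tint W s y) ^+ 2 <= (t - s) * \int[lambda]_r (W (ins_row ord0 r y) ^+ 2).
Proof.
move=> LW iW st; have Lb := L2_belowB st.
rewrite /tint -RintB; try exact: intg_below_l.
rewrite -(Rint_belowB st); apply: le_trans (cauchy_schwarz Lb LW).
by under eq_Rintegral do rewrite -mulrBl.
Qed.

(** Cauchy-Schwarz on each time line, integrated over the lines: the primitive is Hölder continuous
    of exponent 1/2 in time with values in the square-integrable functions. *)
Lemma tintB_L2 W s t : cyl W -> s <= t ->
  L2 leb (fun y => tint W t y - tint W s y) /\
  \int[leb]_y ((tint W t y - tint W s y) ^+ 2) <= (t - s) * \int[lebS]_x (W x ^+ 2).
Proof.
move=> cW st; have [i1 e1] := intg_ins_sq ord0 cW.1.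
have mt r := measurable_tint_slice r cW.1.1.
have md : measurable_fun setT (fun y => tint W t y - tint W s y) by exact: measurable_funB.
have H : {ae leb, forall y, (tint W t y - tint W s y) ^+ 2 <=
    (t - s) * \int[lambda]_r (W (ins_row ord0 r y) ^+ 2)}.
  apply: filterS (filterI (ae_L2_ins ord0 cW.1) (ae_intg_cyl cW)) => y [LW iW].
  exact: tintB_le.
have i2 : intg leb (fun y => (tint W t y - tint W s y) ^+ 2).
  apply: (intg_le_ae _ (intgZ (t - s) i1)); first exact: measurable_funX.
  by apply: filterS H => y h; rewrite ger0_norm// sqr_ge0.
split => //; rewrite -e1 -RintZ//.
(* [Rint_le] asks for an inequality at every point, while [H] holds almost everywhere; taking the
   minimum alters the left side on a null set only. *)
pose h y := Num.min ((tint W t y - tint W s y) ^+ 2)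
  ((t - s) * \int[lambda]_r (W (ins_row ord0 r y) ^+ 2)).
have mh : measurable_fun setT h.
  apply: measurable_minr; first exact: intg_measurable i2.
  exact: intg_measurable (intgZ _ i1).
have E : {ae leb, forall y, (tint W t y - tint W s y) ^+ 2 = h y}.
  by apply: filterS H => y hy; rewrite /h min_l.
rewrite (ae_Rint E)//; last exact: intg_measurable i2.
apply: Rint_le; [exact: ae_intg E mh i2|exact: intgZ|].
by move=> y; rewrite /h ge_min lexx orbT.
Qed.

Lemma tint_L2 W t : cyl W -> L2 leb (tint W t).
Proof.
move=> cW; have [t0|t0] := leP t 0.
  rewrite (_ : tint W t = fun=> 0); first exact: L20.
  by apply/funext => y; exact: tint_le0.
have [L _] := tintB_L2 cW (ltW t0).
by move: L; congr L2; apply/funext => y; rewrite (tint_le0 y cW (lexx 0)) subr0.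
Qed.

Lemma tint_win_L2 W : cyl W ->
  L2 (lambda \x leb)%E (fun p => win T p.1 * tint W p.1 p.2).
Proof.
move=> cW; have [i1 _] := intg_ins_sq ord0 cW.1.
have mw : measurable_fun setT (fun p : RR * 'rV[R]_n => win T p.1).
  exact: (measurableT_comp (measurable_win T) measurable_fst).
have mt : measurable_fun setT (fun p : RR * 'rV[R]_n => win T p.1 * tint W p.1 p.2).
  by apply: measurable_funM => //; exact: measurable_tint cW.1.1.
suff H' : {ae (lambda \x leb)%E, forall p, `|(win T p.1 * tint W p.1 p.2) ^+ 2| <=
    T * (win T p.1 * \int[lambda]_r W (ins_row ord0 r p.2) ^+ 2)}.
  split => //; apply: (intg_le_ae _ (intgZ T (intg_prod (intg_win T) i1)) H').
  exact: measurable_funX.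
have H1 := @ae_snd _ _ RR _ R lambda leb _ (ae_L2_ins ord0 cW.1).
have H2 := @ae_snd _ _ RR _ R lambda leb _ (ae_intg_cyl cW).
apply: filterS2 H1 H2 => p LW iW; rewrite ger0_norm ?sqr_ge0// /win.
case: ifP => [/andP[p0 pT]|_]; last by rewrite !mul0r mulr0 expr0n.
rewrite !mul1r; have := tintB_le LW iW (ltW p0).
rewrite (tint_le0 _ cW (lexx 0)) !subr0 => /le_trans; apply.
apply: ler_wpM2r; last exact: ltW.
by apply: Rint_ge0 => r; exact: sqr_ge0.
Qed.

End time_integral.

(** * Continuous representatives in time *)

Lemma third_lt (R : realFieldType) (T : R) : 0 < T -> T / 3 < 2 * T / 3.
Proof. by move=> T0; lra. Qed.

Lemma third_in (R : realFieldType) (T t : R) : 0 < T ->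
  T / 3 < t < 2 * T / 3 -> 0 < t < T.
Proof. by move=> T0 /andP[h1 h2]; apply/andP; split; lra. Qed.

Section primitive_range.
Variables (R : realType) (a b : R) (m : nat).
Notation lambda := (@lebesgue_measure R).

Lemma lprim_le t : t <= a -> lprim a b m t = 0.
Proof.
move=> ta; rewrite /lprim -[RHS](@Rint0 _ _ R lambda); apply: eq_Rintegral => r _.
rewrite /below; case: ifPn => [rt|]; last by rewrite mul0r.
by rewrite bump1_out ?mulr0// negb_and -leNgt (le_trans (ltW rt) ta).
Qed.

Lemma rprim_ge t : b <= t -> rprim a b m t = 0.
Proof.
move=> bt; rewrite /rprim -[RHS]oppr0 -[in RHS](@Rint0 _ _ R lambda); congr (- _).
apply: eq_Rintegral => r _.
rewrite /below; case: ifPn => [rt|]; last by rewrite mul0r.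
by rewrite bump1_out ?mulr0// negb_and orbC -leNgt (le_trans bt (ltW rt)).
Qed.

Lemma Rint_bump1_gt0 : a < b -> exists m, 0 < \int[lambda]_r bump1 a b m r.
Proof.
move=> ab; pose s := a + (b - a) / 4; pose t := a + (b - a) * 3 / 4.
have st : s < t by rewrite /s /t; lra.
have s1 : 1 <= (4 / (b - a)) * (s - a).
  rewrite (_ : _ * _ = 1)//; rewrite /s; field; lra.
(* The layers of the bump then have width at most [(b - a) / 4], so it equals 1 on [[s, t[]. *)
pose k := (Num.truncn (4 / (b - a))).+1.
have k1 : 4 / (b - a) <= k%:R.
  by apply: ltW; apply: truncnS_gt.
exists k; have i1 := intg_bump1 a b k.
have := @Rint_le _ _ _ lambda _ _ (L2_belowB (ltW st)).2 i1.
rewrite Rint_belowB ?(ltW st)// => H.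
apply: lt_le_trans (H _); first by rewrite subr_gt0.
move=> r; have := congr1 (@^~ r) (belowB (ltW st)) => /= ->.
rewrite indicE mem_setE in_itv /=.
case/boolP: (s <= r < t) => [/andP[sr rt]|_]; last by rewrite expr0n bump1_ge0.
rewrite expr1n /bump1 !step_ge1 ?mulr1//.
- apply: (@le_trans _ _ (4 / (b - a) * (b - r))).
    have e1 : 4 / (b - a) * (b - t) = 1 by rewrite /t; field; lra.
    rewrite -[X in X <= _]e1; apply: ler_wpM2l; last by lra.
    by rewrite divr_ge0//; lra.
  by rewrite ler_wpM2r//; move: rt; rewrite /t; lra.
- apply: le_trans s1 _; apply: (@le_trans _ _ (4 / (b - a) * (r - a))).
    by apply: ler_wpM2l; [rewrite divr_ge0//; lra|lra].
  by rewrite ler_wpM2r//; move: sr; rewrite /s; lra.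
Qed.

End primitive_range.

Section representation.
Variables (R : realType) (n : nat) (T : R) (D : set 'rV[R]_n).
Hypotheses (T0 : 0 < T) (oD : open D).
Notation lambda := (@lebesgue_measure R).
Notation RR := (measurableTypeR R).
Notation leb := (lebesgue_rV R n).
Notation lebS := (lebesgue_rV R n.+1).
Notation Q := (cylinder T D).

Lemma open_cylinder : open Q.
Proof.
rewrite openE => x [/andP[x0 xT] Dx].
have [e e0 He] := nbhs_cbox oD Dx.
pose d := Num.min e (Num.min (x ord0 ord0) (T - x ord0 ord0)).
have d0 : 0 < d by rewrite !lt_min e0 x0 subr_gt0.
suff : \forall y \near (x : 'rV[R]_n.+1), Q y by [].
apply/nbhs_normP; exists d => //= y; rewrite /ball_ /= => yx.
have H i : `|y ord0 i - x ord0 i| < d.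
  apply: le_lt_trans yx; rewrite distrC [leRHS]/Num.norm /= mx_normrE.
  by apply/bigmax_geP; right => /=; exists (ord0, i) => //=; rewrite !mxE.
split.
  have := H ord0; rewrite ltr_norml /d !lt_min => /andP[].
  rewrite ltrNl !lt_min => /and3P[_ h1 _] /and3P[_ _ h2].
  by apply/andP; split; lra.
by apply: He => i; rewrite !mxE (lt_le_trans (H _))// /d ge_min lexx.
Qed.

Variables U W : 'rV[R]_n.+1 -> R.
Hypotheses (cU : cyl T D U) (cW : cyl T D W).
Hypothesis UW : forall phi, test_function Q phi ->
  \int[lebS]_x (U x * partial phi ord0 x) = - \int[lebS]_x (W x * phi x).

Let mU : measurable_fun setT U := cU.1.1.
Let mW : measurable_fun setT W := cW.1.1.

(** This provides a fixed bump [k] in the middle third of []0, T[], with positive mass [I0], used to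
    remove the mean in time of a test function. *)
Let kap : exists m, 0 < \int[lambda]_r bump1 (T / 3) (2 * T / 3) m r.
Proof. exact: Rint_bump1_gt0 (third_lt T0). Qed.

Let m0 := projT1 (cid kap).
Let k r := bump1 (T / 3) (2 * T / 3) m0 r.
Let I0 := \int[lambda]_r k r.
Let I0_gt0 : 0 < I0. Proof. exact: projT2 (cid kap). Qed.

(** Its weak time derivative in the cylinder is zero, so it has to be a function of [y] alone
    there. *)
Let hfun (p : RR * 'rV[R]_n) := U (ins_row ord0 p.1 p.2) - win T p.1 * tint W p.1 p.2.

Let Lh : L2 (lambda \x leb)%E hfun.
Proof.
have L1 := (L2_ins_row ord0 mU).1 cU.1; have L3 := L2Z (-1) (tint_win_L2 cW).
by have := L2D L1 L3; congr L2; apply/funext => p; rewrite mulN1r.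
Qed.

Let L2_prod_test (b : R -> R) (psi : 'rV[R]_n -> R) : L2 lambda b -> L2 leb psi ->
  L2 (lambda \x leb)%E (fun p => b p.1 * psi p.2).
Proof.
move=> [mb ib] [mp ip]; split.
  apply: measurable_funM; first exact: (measurableT_comp mb measurable_fst).
  exact: (measurableT_comp mp measurable_snd).
by have := intg_prod ib ip; congr intg; apply/funext => p; rewrite exprMn.
Qed.

Let L2_bump1 a b m : L2 lambda (bump1 a b m : R -> R).
Proof.
have ib := intg_bump1 a b m; have mb := intg_measurable ib; split => //.
apply: (intg_le _ ib); first exact: measurable_funX.
move=> r; rewrite ger0_norm ?sqr_ge0// expr2 ler_piMr ?bump1_ge0 ?bump1_le1//.
Qed.

(* A test function with zero mean in time has a primitive with compact support. *)
Let zero_mean (a b : 'rV[R]_n.+1) m : cbox a b `<=` Q -> cbox a b !=set0 ->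
  let c := \int[lambda]_r bump1 (a ord0 ord0) (b ord0 ord0) m r / I0 in
  \int[(lambda \x leb)%E]_p (hfun p *
    ((bump1 (a ord0 ord0) (b ord0 ord0) m p.1 - c * k p.1) *
      bump (del_row ord0 a) (del_row ord0 b) m p.2)) = 0.
Proof.
move=> abQ [x0 abx] c; set b1 := bump1 _ _ m; set psi := bump _ _ m.
have sub y (t : R) : a ord0 ord0 <= t <= b ord0 ord0 ->
    cbox (del_row ord0 a) (del_row ord0 b) y -> cbox a b (ins_row ord0 t y).
  move=> ht hy i; case: (unliftP ord0 i) => [i' ->|->]; last by rewrite ins_row_at.
  by rewrite ins_row_lift; have := hy i'; rewrite !mxE.
have x00 := abx ord0; have dx : cbox (del_row ord0 a) (del_row ord0 b) (del_row ord0 x0).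
  by move=> i; rewrite !mxE; exact: abx.
have subD : cbox (del_row ord0 a) (del_row ord0 b) `<=` D.
  by move=> y hy; have [] := (cylinder_ins T D _ _).1 (abQ _ (sub _ _ x00 hy)).
have ab0 : a ord0 ord0 <= b ord0 ord0 by case/andP: x00 => /le_trans; apply.
have a0 : 0 < a ord0 ord0.
  have h : a ord0 ord0 <= a ord0 ord0 <= b ord0 ord0 by rewrite lexx.
  by have [/andP[]] := (cylinder_ins T D _ _).1 (abQ _ (sub _ _ h dx)).
have bT : b ord0 ord0 < T.
  have h : a ord0 ord0 <= b ord0 ord0 <= b ord0 ord0 by rewrite lexx andbT.
  by have [/andP[]] := (cylinder_ins T D _ _).1 (abQ _ (sub _ _ h dx)).
pose b0 (t : R) := b1 t - c * k t.
pose B0 (t : R) := lprim (a ord0 ord0) (b ord0 ord0) m t - c * lprim (T / 3) (2 * T / 3) m0 t.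
have cI : c * I0 = \int[lambda]_r b1 r.
  by apply: divfK; rewrite gt_eqF.
(* The constant [c] balances the two masses, so [B0] is also a combination of the primitives that
   vanish on the right. It is therefore zero on both sides, and [phi] has compact support. *)
have B0E t : B0 t = rprim (a ord0 ord0) (b ord0 ord0) m t - c * rprim (T / 3) (2 * T / 3) m0 t.
  rewrite /B0 (rprimE (a ord0 ord0)) (rprimE (T / 3)) mulrBr.
  have -> : c * \int[lambda]_r bump1 (T / 3) (2 * T / 3) m0 r = \int[lambda]_r b1 r.
    exact: cI.
  by rewrite opprB addrA subrK.
have dB (t : R) : is_derive t 1 B0 (b0 t).
  apply: is_deriveB; first exact: is_derive_lprim.
  have := is_deriveM (is_derive_cst c t 1) (is_derive_lprim (T / 3) (2 * T / 3) m0 t).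
  by move=> H; apply: is_derive_eq H _; rewrite scaler0 addr0.
have sb (f : 'rV[R]_n.+1 -> R) : Cinf f -> Cinf (fun x => b0 (f x)).
  move=> sf; apply: smoothB; first exact: smooth_bump1.
  by apply: smoothZ; exact: smooth_bump1.
pose phi (x : 'rV[R]_n.+1) := B0 (x ord0 ord0) * psi (del_row ord0 x).
pose lo := Num.min (a ord0 ord0) (T / 3); pose hi := Num.max (b ord0 ord0) (2 * T / 3).
have tphi : test_function Q phi.
  split; first by apply/CinfP; exact: smooth_tensor.
  exists (cbox (ins_row ord0 lo (del_row ord0 a)) (ins_row ord0 hi (del_row ord0 b))); split.
  - exact: compact_cbox.
  - move=> x hx; rewrite -(ins_del_row ord0 x); apply/cylinder_ins; split.
      have := hx ord0; rewrite !ins_row_at => /andP[h1 h2].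
      rewrite (lt_le_trans _ h1) ?(le_lt_trans h2)// /lo /hi ?gt_max ?lt_min ?a0 ?bT /=; lra.
    by apply: subD => i; have := hx (lift ord0 i); rewrite !ins_row_lift !mxE.
  - move=> x nx; rewrite /phi.
    have [hd|hd] := pselect (cbox (del_row ord0 a) (del_row ord0 b) (del_row ord0 x)); last first.
      by rewrite /psi bump_out ?mulr0// => /obox_sub_cbox.
    have [h1|h1] := leP (x ord0 ord0) lo.
      rewrite /B0 !lprim_le ?mulr0 ?subr0 ?mul0r//; move: h1; rewrite /lo le_min => /andP[]//.
    have [h2|h2] := leP hi (x ord0 ord0).
      rewrite B0E !rprim_ge ?mulr0 ?subr0 ?mul0r//; move: h2; rewrite /hi ge_max => /andP[]//.
    exfalso; apply: nx => i; case: (unliftP ord0 i) => [i' ->|->].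
      by rewrite !ins_row_lift; have := hd i'; rewrite !mxE.
    by rewrite !ins_row_at !ltW.
have tpsi : test_function D psi by exact: test_bump.
have Lpsi := L2_test tpsi; have mpsi := measurable_test tpsi.
have Lb0 : L2 lambda b0.
  have := L2D (L2_bump1 (a ord0 ord0) (b ord0 ord0) m) (L2Z (- c) (L2_bump1 (T / 3) (2 * T / 3) m0)).
  by congr L2; apply/funext => t; rewrite mulNr.
have LB : L2 lebS phi by exact: L2_test tphi.
have Lbp := L2_prod_test Lb0 Lpsi.
have Lt := tint_win_L2 cW; have LUi := (L2_ins_row ord0 mU).1 cU.1.
rewrite -/psi -/b1.
transitivity (\int[(lambda \x leb)%E]_p (U (ins_row ord0 p.1 p.2) * (b0 p.1 * psi p.2) -
    win T p.1 * tint W p.1 p.2 * (b0 p.1 * psi p.2))).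
  by apply: eq_Rintegral => p _; rewrite mulrBl.
rewrite (RintB (L2M LUi Lbp) (L2M Lt Lbp)).
have -> : \int[(lambda \x leb)%E]_p (U (ins_row ord0 p.1 p.2) * (b0 p.1 * psi p.2)) =
    - \int[lebS]_x (W x * phi x).
  rewrite -(UW tphi) (Rint_ins_row ord0); last first.
    by apply: measurable_funM => //; exact: measurable_test (test_partial _ tphi).
  apply: eq_Rintegral => p _; rewrite /phi (partial_tensor ord0 dB sb).
  by rewrite ins_row_at del_ins_row.
apply/eqP; rewrite subr_eq0 eq_sym; apply/eqP.
rewrite -RintN; last exact: L2M cW.1 LB.
rewrite (Rint_ins_row ord0); last first.
  by apply: measurable_funN; apply: measurable_funM => //; exact: measurable_test tphi.
have j1 := L2M Lt Lbp.
have j2 : intg (lambda \x leb)%E (fun p => - (W (ins_row ord0 p.1 p.2) * phi (ins_row ord0 p.1 p.2))).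
  have iN := intgN (L2M cW.1 LB).
  exact: (intg_ins_row ord0 (intg_measurable iN)).1 iN.
have [k1 e1] := intg_fubini2 j1; have [k2 e2] := intg_fubini2 j2.
rewrite -e1 -e2; apply: ae_Rint; [|exact: intg_measurable k1|exact: intg_measurable k2].
apply: filterS (ae_intg_cyl cW) => y iW.
have ib0 : intg lambda b0.
  have := intgD (intg_bump1 (a ord0 ord0) (b ord0 ord0) m) (intgZ (- c) (intg_bump1 (T / 3) (2 * T / 3) m0)).
  by congr intg; apply/funext => t; rewrite mulNr.
have mB : measurable_fun setT (fun p : RR * RR => below p.1 p.2).
  by apply: measurable_below; [exact: measurable_fst|exact: measurable_snd].
have := kernel_swap mB (@below_bound R) iW ib0 => E.
have b0win t : win T t * b0 t = b0 t.
  rewrite /win; case: ifPn => [_|h]; first by rewrite mul1r.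
  rewrite mul0r /b0 /b1 /k !bump1_out ?mulr0 ?subr0//.
  - by apply: contra h; exact: third_in.
  - apply: contra h => /andP[h1 h2]; apply/andP; split.
      exact: lt_trans a0 h1.
    exact: lt_trans h2 bT.
have ib : intg lambda (fun t => b0 t * tint W t y).
  have mti : measurable_fun setT (fun t : RR => tint W t y).
    have mp : measurable_fun setT (fun t : RR => (t, y)).
      by apply/measurable_fun_pairP; split; [exact: measurable_id|exact: measurable_cst].
    exact: (measurableT_comp (measurable_tint mW) mp).
  apply: (intg_le _ (intgZ (\int[lambda]_r `|W (ins_row ord0 r y)|) (intg_abs ib0))).
    by apply: measurable_funM => //; exact: intg_measurable ib0.
  move=> t; rewrite normrM mulrC ler_wpM2r// /tint.
  rewrite (le_trans (Rint_norm (intg_below_l t iW)))//.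
  apply: Rint_le; [exact/intg_abs/intg_below_l|exact: intg_abs|].
  by move=> r; rewrite normrM ler_piMl// below_bound.
transitivity (psi y * \int[lambda]_t (b0 t * tint W t y)).
  rewrite -RintZ//; apply: eq_Rintegral => t _ /=.
  by rewrite -[in RHS]b0win; ring.
rewrite [X in _ * X]E.
have ibB : intg lambda (fun r => W (ins_row ord0 r y) * \int[lambda]_t (below r t * b0 t)).
  have mti : measurable_fun setT (fun r : RR => \int[lambda]_t (below r t * b0 t)).
    apply: (@measurable_Rint _ _ RR RR R lambda (fun q => below q.1 q.2 * b0 q.2)).
    apply: measurable_funM => //.
    exact: (measurableT_comp (intg_measurable ib0) measurable_snd).
  apply: (intg_le _ (intgZ (\int[lambda]_r `|b0 r|) (intg_abs iW))).
    by apply: measurable_funM => //; exact: intg_measurable iW.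
  move=> r; rewrite normrM mulrC ler_wpM2r//.
  rewrite (le_trans (Rint_norm (intg_below_r r ib0)))//.
  apply: Rint_le; [exact/intg_abs/intg_below_r|exact: intg_abs|].
  by move=> t; rewrite normrM ler_piMl// below_bound.
rewrite -RintZ//; apply: eq_Rintegral => r _ /=.
rewrite /phi ins_row_at del_ins_row.
have -> : \int[lambda]_t (below r t * b0 t) = - B0 r.
  rewrite B0E /rprim.
  transitivity (\int[lambda]_t (below r t * b1 t - c * (below r t * k t))).
    by apply: eq_Rintegral => t _; rewrite /b0; ring.
  rewrite RintB; last 2 first.
  - exact: intg_below_r (intg_bump1 _ _ _).
  - by apply: intgZ; exact: intg_below_r (intg_bump1 _ _ _).
  rewrite RintZ; last exact: intg_below_r (intg_bump1 _ _ _).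
  by rewrite mulrN opprB opprK addrC.
by ring.
Qed.

(** A function constant in time is its own mean against the weight [k / I0]. Defining the constant
    as this mean gives measurability and, by Cauchy-Schwarz, square-integrability. *)
Let c0 (y : 'rV[R]_n) := \int[lambda]_t (k t * hfun (t, y)) / I0.

Let Lk : L2 lambda k. Proof. exact: L2_bump1. Qed.

Let Lc0 : L2 leb c0.
Proof.
have [mh ih] := Lh.
have mkh : measurable_fun setT (fun p : RR * 'rV[R]_n => k p.1 * hfun p).
  by apply: measurable_funM => //; exact: (measurableT_comp Lk.1 measurable_fst).
have mc : measurable_fun setT c0.
  apply: measurable_funM => //.
  have ms : measurable_fun setT (fun q : 'rV[R]_n * RR => (q.2, q.1)).
    by apply/measurable_fun_pairP; split; [exact: measurable_snd|exact: measurable_fst].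
  exact: (@measurable_Rint _ _ _ RR R lambda (fun q => k q.2 * hfun (q.2, q.1))
    (measurableT_comp mkh ms)).
have [i1 _] := intg_fubini2 ih.
split => //; apply: (intg_le_ae _ (intgZ ((\int[lambda]_t (k t ^+ 2)) / I0 ^+ 2) i1)).
  exact: measurable_funX.
apply: filterS (ae_intg2 ih) => y iy; rewrite ger0_norm ?sqr_ge0//.
rewrite /c0 exprMn exprVn [leRHS]mulrAC.
apply: ler_wpM2r; first by rewrite invr_ge0 sqr_ge0.
apply: cauchy_schwarz => //; split => //.
have mp : measurable_fun setT (fun t : RR => (t, y)).
  by apply/measurable_fun_pairP; split; [exact: measurable_id|exact: measurable_cst].
exact: (measurableT_comp mh mp).
Qed.

Let c0_out y : ~ D y -> c0 y = 0.
Proof.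
move=> nD; rewrite /c0 (_ : \int[lambda]_t _ = 0) ?mul0r//.
rewrite -[RHS](@Rint0 _ _ R lambda); apply: eq_Rintegral => t _.
rewrite /hfun /= (tint_out t cW nD) cU.2 ?mulr0 ?subr0 ?mulr0// => /cylinder_ins[]//.
Qed.

(** By du Bois-Reymond it suffices to test [hfun - c0] against tensor bumps. The time factor is
    split as [(b1 - c * k) + c * k]: the first part has mean zero and is handled by [zero_mean], the
    second by the definition of [c0]. *)
Theorem time_representation : exists c, [/\ L2 leb c, forall y, ~ D y -> c y = 0 &
  {ae (lambda \x leb)%E, forall p : RR * 'rV[R]_n, 0 < p.1 < T ->
    U (ins_row ord0 p.1 p.2) = c p.2 + tint W p.1 p.2}].
Proof.
exists c0; split; [exact: Lc0|exact: c0_out|].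
pose Hp (p : RR * 'rV[R]_n) := hfun p - win T p.1 * c0 p.2.
pose H (x : 'rV[R]_n.+1) := Hp (x ord0 ord0, del_row ord0 x).
have LHp : L2 (lambda \x leb)%E Hp.
  have := L2D Lh (L2Z (-1) (L2_prod_test (L2_win T) Lc0)); congr L2.
  by apply/funext => p; rewrite mulN1r.
have mH : measurable_fun setT H.
  apply: (measurableT_comp LHp.1); apply/measurable_fun_pairP; split.
    exact: measurable_rV_coord.
  exact: measurable_del_row.
have HE p : H (ins_row ord0 p.1 p.2) = Hp p.
  by case: p => t y; rewrite /H ins_row_at del_ins_row.
have LH : L2 lebS H.
  by apply/(L2_ins_row ord0 mH); under eq_fun do rewrite HE.
have Hout x : ~ Q x -> H x = 0.
  move=> nQ; rewrite /H /Hp /hfun /= ins_del_row cU.2//.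
  have [Dx|Dx] := pselect (D (del_row ord0 x)); last first.
    by rewrite (tint_out _ cW Dx) c0_out// !mulr0 !subr0.
  rewrite /win; case: ifPn => [h|]; last by rewrite !mul0r !subr0.
  by exfalso; apply: nQ; split => //; rewrite tail_rowE.
have oQ := open_cylinder; have mQ := open_measurable_rV oQ.
have HQ : H \_ Q = H.
  apply/funext => x; rewrite patchE; have [xQ|xQ] := pselect (Q x).
    by rewrite mem_set.
  by rewrite memNset// Hout.
have lH : locally_integrable_on Q H by apply: li_patch => //; rewrite HQ.
have H0 : {ae lebS, forall x, Q x -> H x = 0}.
  apply: (dBR oQ); [exact: lH.1|exact: lH.2|move=> a b m abQ].
  rewrite (Rint_test _ (test_bump m abQ)).
  have [abx|abx] := pselect (cbox a b !=set0); last first.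
    rewrite -[RHS](@Rint0 _ _ R lebS); apply: eq_Rintegral => x _.
    by rewrite bump_out ?mulr0// => /obox_sub_cbox xab; apply: abx; exists x.
  have := zero_mean m abQ abx => /=.
  set c := _ / I0; set b1 := bump1 _ _ m; set psi := bump (del_row _ _) _ m => E.
  have tb := test_bump m abQ.
  have Lpsi : L2 leb psi.
    by apply: (@L2_test _ _ setT); exact: test_bump.
  have Lb1 : L2 lambda b1 by exact: L2_bump1.
  rewrite (Rint_ins_row ord0); last by apply: measurable_funM => //; exact: measurable_test tb.
  have L1 := L2_prod_test Lb1 Lpsi; have L3 := L2_prod_test Lk Lpsi.
  have L4 := L2_prod_test (L2_win T) Lc0.
  transitivity (\int[(lambda \x leb)%E]_p (hfun p * (b1 p.1 * psi p.2) -
      win T p.1 * c0 p.2 * (b1 p.1 * psi p.2))).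
    by apply: eq_Rintegral => p _; rewrite HE bump_ins_row /Hp mulrBl.
  have j1 := L2M Lh L1; have j2 := L2M L4 L1; have j3 := L2M Lh L3.
  rewrite (RintB j1 j2).
  have -> : \int[(lambda \x leb)%E]_p (hfun p * (b1 p.1 * psi p.2)) =
      c * \int[(lambda \x leb)%E]_p (hfun p * (k p.1 * psi p.2)).
    apply/eqP; rewrite -subr_eq0 -(RintZ c j3) -(RintB j1 (intgZ c j3)).
    apply/eqP; rewrite -[RHS]E; apply: eq_Rintegral => p _.
    by rewrite -/b1 -/psi; ring.
  have b1win t : win T t * b1 t = b1 t.
    rewrite /win; case: ifPn => [_|h]; first by rewrite mul1r.
    rewrite mul0r /b1 bump1_out//; apply: contra h => /andP[h1 h2].
    have [x abx'] := abx.
    have cb s : a ord0 ord0 <= s <= b ord0 ord0 -> Q (ins_row ord0 s (del_row ord0 x)).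
      move=> hs; apply: abQ => i; case: (unliftP ord0 i) => [i' ->|->].
        by rewrite ins_row_lift mxE; exact: abx'.
      by rewrite ins_row_at.
    have hs : a ord0 ord0 <= t <= b ord0 ord0 by rewrite !ltW.
    by have [] := (cylinder_ins T D _ _).1 (cb _ hs).
  apply/eqP; rewrite subr_eq0; apply/eqP.
  have [_ e1] := intg_fubini2 (L2M Lh L3); have [_ e2] := intg_fubini2 (L2M L4 L1).
  have [i3 _] := intg_fubini2 (L2M Lh L3).
  rewrite -e1 -e2 -(RintZ c i3); apply: ae_Rint.
  - apply: filterS (ae_intg2 (L2M Lh L3)) => y iy.
    have ib1 : intg lambda b1 by exact: intg_bump1.
    transitivity (c0 y * psi y * \int[lambda]_t b1 t); last first.
      rewrite -RintZ//; apply: eq_Rintegral => t _ /=.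
      by rewrite -[in LHS]b1win; ring.
    rewrite /c -/b1 /c0.
    have -> : \int[lambda]_x (hfun (x, y) * (k x * psi y)) =
        psi y * \int[lambda]_t (k t * hfun (t, y)).
      (* Integrability is known only for the product with [psi y], and division by [psi y] requires
         it to be nonzero; where it is zero both sides vanish. *)
      have [p0|p0] := eqVneq (psi y) 0.
        rewrite p0 mul0r -[RHS](@Rint0 _ _ R lambda); apply: eq_Rintegral => t _.
        by rewrite !mulr0.
      rewrite -RintZ; first by apply: eq_Rintegral => t _ /=; ring.
      have := intgZ (psi y)^-1 iy; congr intg; apply/funext => t /=.
      by field.
    by field; rewrite gt_eqF.
  - exact: intg_measurable (intgZ c i3).
  - exact: intg_measurable (intg_fubini2 (L2M L4 L1)).1.
have H1 := (ae_ins_row ord0 (fun x => Q x -> H x = 0)).1 H0.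
apply: ae_impl H1 => p + p0T.
rewrite HE /Hp /hfun /win p0T !mul1r => Hp0.
have [Dp|Dp] := pselect (D p.2); last first.
  by rewrite cU.2 ?(tint_out _ cW Dp) ?c0_out ?addr0// => /cylinder_ins[].
have := Hp0 ((cylinder_ins _ _ _ _).2 (conj p0T Dp)).
by move=> /eqP; rewrite subr_eq0 subr_eq => /eqP.
Qed.

End representation.

(** * Products of slices *)

Section one_dimensional_product.
Variable R : realType.
Notation lambda := (@lebesgue_measure R).
Notation RR := (measurableTypeR R).

Lemma Rint_below_split (f : R -> R) (t : R) : intg lambda f ->
  \int[lambda]_r f r =
  \int[lambda]_r (below r t * f r) + \int[lambda]_r (below t r * f r).
Proof.
move=> iF; have i1 := intg_below_l t iF; have i2 := intg_below_r t iF.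
rewrite -RintD//; apply: ae_Rint.
- exists [set t]; split; [exact: measurable_set1|exact: lebesgue_measure_set1|].
  move=> r /= H; apply: contrapT => rt; apply: H; rewrite /below.
  by have [h|h|h] := ltgtP r t; rewrite ?mul1r ?mul0r ?add0r ?addr0.
- exact: intg_measurable iF.
- exact: intg_measurable (intgD i1 i2).
Qed.

Lemma measurable_below_Rint (f : R -> R) : intg lambda f ->
  measurable_fun setT (fun t : RR => \int[lambda]_r (below r t * f r)).
Proof.
move=> iF; apply: (@measurable_Rint _ _ RR RR R lambda (fun q => below q.2 q.1 * f q.2)).
apply: measurable_funM.
  by apply: measurable_below; [exact: measurable_snd|exact: measurable_fst].
exact: (measurableT_comp (intg_measurable iF) measurable_snd).
Qed.

Lemma below_Rint_bound (f : R -> R) t : intg lambda f ->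
  `|\int[lambda]_r (below r t * f r)| <= \int[lambda]_r `|f r|.
Proof.
move=> iF; rewrite (le_trans (Rint_norm (intg_below_l t iF)))//.
apply: Rint_le; [exact/intg_abs/intg_below_l|exact: intg_abs|].
by move=> r; rewrite normrM ler_piMl// below_bound.
Qed.

Lemma intg_below_prod (f g : R -> R) : intg lambda f -> intg lambda g ->
  intg lambda (fun r => g r * \int[lambda]_q (below q r * f q)).
Proof.
move=> iF iG; apply: (intg_le _ (intgZ (\int[lambda]_r `|f r|) (intg_abs iG))).
  by apply: measurable_funM; [exact: intg_measurable iG|exact: measurable_below_Rint].
by move=> r; rewrite normrM mulrC ler_wpM2r// below_Rint_bound.
Qed.

(** The product of the two integrals is an integral over a square. Splitting it along the diagonal
    gives the two terms in which one factor is a primitive of the other's variable, and the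
    constants give the linear terms. *)
Lemma product_below (c d : R) (f g : R -> R) (t : R) :
  intg lambda f -> intg lambda g ->
  let F r := c + \int[lambda]_q (below q r * f q) in
  let G r := d + \int[lambda]_q (below q r * g q) in
  F t * G t - c * d = \int[lambda]_r (below r t * (f r * G r + F r * g r)).
Proof.
move=> iF iG F G.
pose ft r := below r t * f r; pose gt r := below r t * g r.
have ift : intg lambda ft by exact: intg_below_l.
have igt : intg lambda gt by exact: intg_below_l.
have mB : measurable_fun setT (fun p : RR * RR => below p.1 p.2).
  by apply: measurable_below; [exact: measurable_fst|exact: measurable_snd].
(* Under the weight [below r t], truncating the inner integrand at [t] changes nothing, because
   [q < r < t]. *)
have tr h r : below r t * \int[lambda]_q (below q r * h q) =
    below r t * \int[lambda]_q (below q r * (below q t * h q)).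
  rewrite /below; case: ifP => rt; last by rewrite !mul0r.
  congr (_ * _); apply: eq_Rintegral => q _.
  by case: ifP => qr; rewrite ?mul0r// (lt_trans qr rt) !mul1r.
have i1 : intg lambda (fun r => gt r * \int[lambda]_q (below q r * ft q)).
  exact: intg_below_prod.
have i2 : intg lambda (fun r => ft r * \int[lambda]_q (below q r * gt q)).
  exact: intg_below_prod.
transitivity (c * \int[lambda]_r gt r + d * \int[lambda]_r ft r +
   (\int[lambda]_r (gt r * \int[lambda]_q (below q r * ft q)) +
    \int[lambda]_r (ft r * \int[lambda]_q (below q r * gt q)))); last first.
  have j1 := intgZ c igt; have j2 := intgZ d ift.
  rewrite -(RintZ c igt) -(RintZ d ift) -(RintD j1 j2) -(RintD i1 i2).
  rewrite -(RintD (intgD j1 j2) (intgD i1 i2)).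
  apply: eq_Rintegral => r _; rewrite /F /G /ft /gt.
  have Ef := tr f r; have Eg := tr g r; rewrite -/below in Ef Eg.
  transitivity (c * (below r t * g r) + d * (below r t * f r) +
    (g r * (below r t * \int[lambda]_q (below q r * (below q t * f q))) +
     f r * (below r t * \int[lambda]_q (below q r * (below q t * g q))))).
    by ring.
  by rewrite -Ef -Eg; ring.
rewrite [X in _ + (X + _)](kernel_swap mB (@below_bound R) ift igt) -RintD//; last first.
  apply: (intg_le _ (intgZ (\int[lambda]_r `|gt r|) (intg_abs ift))).
    apply: measurable_funM; first exact: intg_measurable ift.
    apply: (@measurable_Rint _ _ RR RR R lambda (fun q => below q.1 q.2 * gt q.2)).
    apply: measurable_funM => //.
    exact: (measurableT_comp (intg_measurable igt) measurable_snd).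
  move=> r; rewrite normrM mulrC ler_wpM2r//.
  rewrite (le_trans (Rint_norm (intg_below_r r igt)))//.
  apply: Rint_le; [exact/intg_abs/intg_below_r|exact: intg_abs|].
  by move=> q; rewrite normrM ler_piMl// below_bound.
have -> : \int[lambda]_r (ft r * \int[lambda]_q (below r q * gt q) +
     ft r * \int[lambda]_q (below q r * gt q)) =
   \int[lambda]_r gt r * \int[lambda]_r ft r.
  rewrite -RintZ//; apply: eq_Rintegral => r _.
  by rewrite -mulrDr addrC -Rint_below_split// mulrC.
rewrite /F /G -/ft -/gt; ring.
Qed.

End one_dimensional_product.

Section product_in_time.
Variables (R : realType) (n : nat) (T : R) (D : set 'rV[R]_n).
Notation lambda := (@lebesgue_measure R).
Notation RR := (measurableTypeR R).
Notation leb := (lebesgue_rV R n).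
Notation lebS := (lebesgue_rV R n.+1).

Definition tslice (c : 'rV[R]_n -> R) (W : 'rV[R]_n.+1 -> R) (t : R) (y : 'rV[R]_n) : R :=
  c y + tint W t y.

(* [c] and [W] describe the continuous-in-time representative of [U]. *)
Definition trep (U W : 'rV[R]_n.+1 -> R) (c : 'rV[R]_n -> R) : Prop :=
  [/\ cyl T D U, cyl T D W, L2 leb c, forall y, ~ D y -> c y = 0 &
  {ae (lambda \x leb)%E, forall p : RR * 'rV[R]_n, 0 < p.1 < T ->
    U (ins_row ord0 p.1 p.2) = tslice c W p.1 p.2}].

Lemma tslice_L2 U W c t : trep U W c -> L2 leb (tslice c W t).
Proof. by move=> [_ cW Lc _ _]; apply: L2D => //; exact: tint_L2 cW. Qed.

Lemma tslice_out U W c t y : trep U W c -> ~ D y -> tslice c W t y = 0.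
Proof. by move=> [_ cW _ c0 _] nD; rewrite /tslice c0// (tint_out t cW nD) addr0. Qed.

Lemma tslice_le0 U W c t y : trep U W c -> t <= 0 -> tslice c W t y = c y.
Proof. by move=> [_ cW _ _ _] t0; rewrite /tslice (tint_le0 y cW t0) addr0. Qed.

(** For almost every [y] the product rule [product_below] holds on the time line through [y]; the
    weight [g] is independent of time and is carried along when integrating in [y]. *)
Lemma product_time U W c U' W' c' (g : 'rV[R]_n -> R) (M t : R) :
  trep U W c -> trep U' W' c' -> measurable_fun setT g -> (forall y, `|g y| <= M) ->
  \int[leb]_y (g y * (tslice c W t y * tslice c' W' t y)) -
    \int[leb]_y (g y * (c y * c' y)) =
  \int[lebS]_x (below (x ord0 ord0) t *
     (g (del_row ord0 x) * (W x * U' x + U x * W' x))).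
Proof.
move=> r1 r2 mg gM; have [cU cW Lc _ UE] := r1; have [cU' cW' Lc' _ UE'] := r2.
have L1 := tslice_L2 t r1; have L1' := tslice_L2 t r2.
have gL h : L2 leb h -> L2 leb (fun y => g y * h y) by exact: L2_bounded mg gM.
have i1 : intg leb (fun y => g y * (tslice c W t y * tslice c' W' t y)).
  by have := L2M (gL _ L1) L1'; congr intg; apply/funext => y; rewrite mulrA.
have i2 : intg leb (fun y => g y * (c y * c' y)).
  by have := L2M (gL _ Lc) Lc'; congr intg; apply/funext => y; rewrite mulrA.
have mx0 : measurable_fun setT (fun x : 'rV[R]_n.+1 => below (x ord0 ord0) t).
  by apply: measurable_below; [exact: measurable_rV_coord|exact: measurable_cst].
have mgd : measurable_fun setT (fun x : 'rV[R]_n.+1 => g (del_row ord0 x)).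
  by apply: (measurableT_comp mg); exact: measurable_del_row.
have i3 : intg lebS (fun x => below (x ord0 ord0) t *
     (g (del_row ord0 x) * (W x * U' x + U x * W' x))).
  have i := intgD (L2M cW.1 cU'.1) (L2M cU.1 cW'.1).
  apply: (intg_le _ (intgZ M (intg_abs i))).
    by do 2!apply: measurable_funM => //; exact: intg_measurable i.
  move=> x; rewrite !normrM; apply: (@le_trans _ _ (1 * (M * `|W x * U' x + U x * W' x|))).
    by apply: ler_pM => //; [exact: below_bound|rewrite ler_wpM2r].
  by rewrite mul1r.
rewrite -RintB// (Rint_ins_row ord0); last exact: intg_measurable i3.
have ip := (intg_ins_row ord0 (intg_measurable i3)).1 i3.
have [k3 <-] := intg_fubini2 ip.
apply: ae_Rint; [|exact: intg_measurable (intgB i1 i2)|exact: intg_measurable k3].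
have H1 := ae_prod2 UE; have H2 := ae_prod2 UE'.
have H3 := ae_intg_cyl cW; have H4 := ae_intg_cyl cW'; have H5 := ae_intg2 ip.
apply: filterS (filterI H1 (filterI H2 (filterI H3 (filterI H4 H5)))) => y [h1 [h2 [h3 [h4 h5]]]].
rewrite -mulrBr [X in g y * X](product_below (c y) (c' y) t h3 h4).
pose F (r : R) := c y + \int[lambda]_q (below q r * W (ins_row ord0 q y)).
pose G (r : R) := c' y + \int[lambda]_q (below q r * W' (ins_row ord0 q y)).
rewrite -/(F _) -/(G _).
have i : intg lambda (fun r => below r t * (W (ins_row ord0 r y) * G r + F r * W' (ins_row ord0 r y))).
  apply: intg_below_l; apply: intgD.
    have := intgD (intgZ (c' y) h3) (intg_below_prod h4 h3); congr intg.
    by apply/funext => r; rewrite /G; ring.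
  have := intgD (intgZ (c y) h4) (intg_below_prod h3 h4); congr intg.
  by apply/funext => r; rewrite /F; ring.
rewrite -RintZ//; apply: ae_Rint; [|exact: intg_measurable (intgZ _ i)|exact: intg_measurable h5].
apply: filterS (filterI h1 h2) => r [/= e1 e2]; rewrite ins_row_at del_ins_row mulrCA.
congr (_ * (_ * _)).
have [rT|rT] := boolP (0 < r < T); first by rewrite e1// e2.
have out V : cyl T D V -> V (ins_row ord0 r y) = 0.
  by move=> [_ ->]// /cylinder_ins[h _]; rewrite h in rT.
by rewrite !out// !(mul0r,mulr0).
Qed.

End product_in_time.

Section cutoff_in_time.
Variables (R : realType) (t : R).
Hypothesis t0 : 0 < t.

Let zeta (m : nat) (r : R) : R := bump1 (t / m.+3%:R) (t - t / m.+3%:R) m r.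

Let zeta_cvg r : (zeta ^~ r) @ \oo --> win t r.
Proof.
rewrite /win; case: ifPn => [/andP[r0 rt]|nr]; last first.
  rewrite (_ : zeta^~ r = fun=> 0); first exact: cvg_cst.
  apply/funext => m; rewrite /zeta bump1_out//; apply: contra nr => /andP[h1 h2].
  have h : 0 < t / m.+3%:R by rewrite divr_gt0.
  by rewrite (lt_trans h h1) (lt_trans h2)// gtrBl.
pose d := Num.min r (t - r).
have d0 : 0 < d by rewrite lt_min r0 subr_gt0.
(* Since [m * (t / m.+3) <= t], the bound [2 + 2 * t <= m * d] leaves more than 1 once the margin is
   subtracted, so both steps have reached 1. *)
pose N := (Num.truncn ((2 + 2 * t) / d)).+1.
have N1 : (2 + 2 * t) / d <= N%:R by apply: ltW; apply: truncnS_gt.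
apply: cvg_near_cst; exists N => // m /= Nm.
have m1 : 2 + 2 * t <= m%:R * d.
  by rewrite -ler_pdivrMr// (le_trans N1)// ler_nat.
have mp : 0 < m%:R :> R.
  by rewrite -(pmulr_lgt0 _ d0) (lt_le_trans _ m1)// addr_gt0// mulr_gt0.
have a1 : m%:R * (t / m.+3%:R) <= t.
  rewrite mulrCA -[leRHS]mulr1 ler_wpM2l ?(ltW t0)// ler_pdivrMr// mul1r ler_nat.
  by rewrite -addn3 leq_addr.
have h e : d <= e -> 1 <= m%:R * (e - t / m.+3%:R).
  move=> de; have : m%:R * d <= m%:R * e by rewrite ler_wpM2l.
  move=> h3; rewrite mulrBr; move: m1 a1 h3 t0; clear.
  move: (m%:R * d) (m%:R * e) (m%:R * (t / m.+3%:R)) => u v w h1 h2 h3 h4; lra.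
rewrite /zeta /bump1 !step_ge1 ?mulr1//.
  by rewrite -addrAC; apply: h; rewrite /d ge_min lexx orbT.
by apply: h; rewrite /d ge_min lexx.
Qed.

(** Weak derivatives on the open cylinder are tested with compact supports only, so the window in
    time is approximated by smooth functions supported strictly inside []0, T[]. *)
Lemma win_approx (T : R) : t <= T -> exists z : nat -> R -> R,
  [/\ forall m r, 0 <= z m r <= 1, forall r, z ^~ r @ \oo --> win t r,
      forall m n (f : 'rV[R]_n -> R), Cinf f -> Cinf (fun x => z m (f x)) &
      forall m, exists a b, [/\ 0 < a, b < T & forall r, ~~ (a < r < b) -> z m r = 0]].
Proof.
move=> tT; exists zeta; split.
- by move=> m r; rewrite bump1_ge0 bump1_le1.
- exact: zeta_cvg.
- by move=> m n f; exact: smooth_bump1.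
- move=> m; exists (t / m.+3%:R), (t - t / m.+3%:R); split.
  + by rewrite divr_gt0.
  + by rewrite (lt_le_trans _ tT)// gtrBl divr_gt0.
  + by move=> r; exact: bump1_out.
Qed.

End cutoff_in_time.

Section cylinder_tests.
Variables (R : realType) (n : nat) (T : R) (D : set 'rV[R]_n.+1).

Lemma test_cyl (z : R -> R) (chi : 'rV[R]_n.+1 -> R) (a b : R) :
  0 < a -> b < T -> (forall r, ~~ (a < r < b) -> z r = 0) ->
  (forall f : 'rV[R]_n.+2 -> R, Cinf f -> Cinf (fun x => z (f x))) ->
  test_function D chi ->
  test_function (cylinder T D) (fun x => z (x ord0 ord0) * chi (del_row ord0 x)).
Proof.
move=> a0 bT zab sz tchi; have schi := test_Cinf tchi; have [_ [K [cK KD H]]] := tchi.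
have [al [be Kbox]] := compact_sub_cbox cK.
split.
  apply/CinfP; apply: smoothM; last exact: smooth_del.
  by apply: sz; exact: smooth_coord.
exists (cbox (ins_row ord0 a al) (ins_row ord0 b be) `&` (del_row ord0 @^-1` K)); split.
- apply: compact_closedI; first exact: compact_cbox.
  apply: (@closed_comp _ _ (del_row ord0 : 'rV[R]_n.+2 -> 'rV[R]_n.+1)).
    move=> x _; suff : forall e : R, 0 < e -> \forall y \near x, `|del_row ord0 x - del_row ord0 y| < e.
      by move=> H'; apply/(@cvgrPdist_lt _ _ _ (nbhs x)).
    move=> e e0.
    apply/nbhs_normP; exists e => //= y; rewrite /ball_ /= => xy.
    rewrite (_ : _ - _ = del_row ord0 (x - y)).
      exact: le_lt_trans (norm_del_row _ _) xy.
    by apply/rowP => i; rewrite !mxE.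
  by apply: compact_closed.
- move=> x [bx /= /KD Dx]; split; last by rewrite tail_rowE.
  have := bx ord0; rewrite !ins_row_at => /andP[h1 h2].
  by rewrite (lt_le_trans a0 h1) (le_lt_trans h2 bT).
- move=> x nx; have [Kx|/H ->] := pselect (K (del_row ord0 x)); last by rewrite mulr0.
  rewrite zab ?mul0r//; apply/negP => /andP[h1 h2]; apply: nx; split => // i.
  case: (unliftP ord0 i) => [i' ->|->]; last by rewrite !ins_row_at !ltW.
  by rewrite !ins_row_lift; have := Kbox _ Kx i'; rewrite mxE.
Qed.

Lemma partial_cyl (z : R -> R) (psi : 'rV[R]_n.+1 -> R) (j : 'I_n.+1) (x : 'rV[R]_n.+2) :
  (forall f : 'rV[R]_n.+2 -> R, Cinf f -> Cinf (fun x => z (f x))) -> Cinf psi ->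
  partial (fun x => z (x ord0 ord0) * psi (del_row ord0 x)) (lift ord0 j) x =
  z (x ord0 ord0) * partial psi j (del_row ord0 x).
Proof.
move=> sz spsi; rewrite partialM; last exact: smooth_del; last first.
  by apply: sz; exact: smooth_coord.
rewrite partial_del_lift//.
rewrite (_ : partial _ (lift ord0 j) x = 0) ?mul0r ?add0r//; apply: partial_val.
apply: is_derive_of_line; rewrite (_ : (fun t => _) = cst (z (x ord0 ord0))).
  exact: is_derive_cst.
apply/funext => s; congr (z _); rewrite !mxE.
by rewrite (_ : (ord0 == lift ord0 j) = false) ?andbF ?mulr0 ?addr0.
Qed.

End cylinder_tests.

Section parts_in_space.
Variables (R : realType) (n : nat) (T : R) (D : set 'rV[R]_n.+1).
Notation leb := (lebesgue_rV R n.+1).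
Notation lebS := (lebesgue_rV R n.+2).
Notation Q := (cylinder T D).

Variables (j : 'I_n.+1) (U W U' W' : 'rV[R]_n.+2 -> R).
Notation jS := (lift ord0 j).
Hypotheses (LU : L2 lebS U) (LW : L2 lebS W) (LU' : L2 lebS U') (LW' : L2 lebS W').
Hypothesis UW : forall phi, test_function Q phi ->
  \int[lebS]_x (U x * partial phi jS x) = - \int[lebS]_x (W x * phi x).
Hypothesis UW' : forall phi, test_function Q phi ->
  \int[lebS]_x (U' x * partial phi jS x) = - \int[lebS]_x (W' x * phi x).

(** [line_deriv_parts] is applied to [U] and [g * U'], each multiplied by [z m * chi]. As [z m]
    depends on time alone, the identity carries the factor [z m ^+ 2], which tends to [win t];
    dominated convergence removes it. *)
Lemma space_parts (g chi : 'rV[R]_n.+1 -> R) (t : R) : Cinf g ->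
  test_function D chi -> 0 < t <= T ->
  intg lebS (fun x => chi (del_row ord0 x) ^+ 2 * g (del_row ord0 x) *
       (W x * U' x + U x * W' x)) /\
  intg lebS (fun x => (2 * chi (del_row ord0 x) * partial chi j (del_row ord0 x) * g (del_row ord0 x) +
        chi (del_row ord0 x) ^+ 2 * partial g j (del_row ord0 x)) * (U x * U' x)) /\
  \int[lebS]_x (win t (x ord0 ord0) *
    (chi (del_row ord0 x) ^+ 2 * g (del_row ord0 x) * (W x * U' x + U x * W' x) +
     (2 * chi (del_row ord0 x) * partial chi j (del_row ord0 x) * g (del_row ord0 x) +
        chi (del_row ord0 x) ^+ 2 * partial g j (del_row ord0 x)) * (U x * U' x))) = 0.
Proof.
move=> sg tchi /andP[t0 tT]; have schi := test_Cinf tchi.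
have tchig : test_function D (fun y => chi y * g y) by exact: testM.
have bdd psi : test_function D psi -> forall h, intg lebS h ->
    intg lebS (fun x => psi (del_row ord0 x) * h x).
  move=> tpsi h ih; have [M HM] := test_bounded tpsi.
  apply: (intg_le _ (intgZ M (intg_abs ih))).
    apply: measurable_funM; last exact: intg_measurable ih.
    by apply: (measurableT_comp (measurable_test tpsi)); exact: measurable_del_row.
  by move=> x; rewrite normrM ler_wpM2r.
have k1 := L2M LW LU'; have k2 := L2M LU LW'; have k3 := L2M LU LU'.
have t2 : test_function D (fun y => chi y * (chi y * g y)).
  by apply: (testM tchi); exact: smoothM.
have t3 : test_function D (fun y => chi y * (2 * partial chi j y * g y + chi y * partial g j y)).
  apply: (testM tchi); apply: smoothD; apply: smoothM => //; try exact: smooth_partial.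
  by apply: smoothZ; exact: smooth_partial.
have i1 : intg lebS (fun x => chi (del_row ord0 x) ^+ 2 * g (del_row ord0 x) *
       (W x * U' x + U x * W' x)).
  have := bdd _ t2 _ (intgD k1 k2); congr intg; apply/funext => x.
  by rewrite mulrA -expr2.
have i2 : intg lebS (fun x => (2 * chi (del_row ord0 x) * partial chi j (del_row ord0 x) * g (del_row ord0 x) +
        chi (del_row ord0 x) ^+ 2 * partial g j (del_row ord0 x)) * (U x * U' x)).
  have := bdd _ t3 _ k3; congr intg; apply/funext => x; congr (_ * _).
  by move: (chi _) (partial chi _ _) (g _) (partial g _ _) => a b c d; ring.
split => //; split => //.
have [z [z01 zcvg sz zab]] := win_approx t0 tT.
set h := (X in \int[_]_x (_ * X x) = _).
have ih : intg lebS h by exact: intgD.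
have mz m : measurable_fun setT (fun x : 'rV[R]_n.+2 => z m (x ord0 ord0)).
  by apply: continuous_measurable_rV; apply: smooth_continuous; apply: sz; exact: smooth_coord.
have cz (x : 'rV[R]_n.+2) : (fun m => z m (x ord0 ord0) ^+ 2 * h x) @ \oo --> win t (x ord0 ord0) * h x.
  apply: cvgMl; have := cvgM (zcvg (x ord0 ord0)) (zcvg (x ord0 ord0)).
  have -> : win t (x ord0 ord0) * win t (x ord0 ord0) = win t (x ord0 ord0).
    by rewrite /win; case: ifP => _; rewrite ?mulr1 ?mulr0.
  by apply.
have bz (m : nat) (x : 'rV[R]_n.+2) : `|z m (x ord0 ord0) ^+ 2 * h x| <= `|h x|.
  rewrite normrM ler_piMl// ger0_norm ?sqr_ge0//.
  by have /andP[z0 z1] := z01 m (x ord0 ord0); rewrite expr_le1.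
have [_ cv] := Rint_dct (fun m => measurable_funM (measurable_funX 2 (mz m)) (intg_measurable ih))
  cz (intg_abs ih) bz.
have Z m : \int[lebS]_x (z m (x ord0 ord0) ^+ 2 * h x) = 0.
  have [a [b [a0 bT zout]]] := zab m.
  have T1 := test_cyl a0 bT zout (sz m _) tchi.
  have T2 := test_cyl a0 bT zout (sz m _) tchig.
  have D1 := loc_line_deriv LU LW UW T1; have D2 := loc_line_deriv LU' LW' UW' T2.
  have bddS psi : test_function Q psi -> forall h, intg lebS h ->
      intg lebS (fun x => psi x * h x).
    move=> tpsi k ik; have [M HM] := test_bounded tpsi.
    apply: (intg_le _ (intgZ M (intg_abs ik))).
      by apply: measurable_funM; [exact: measurable_test tpsi|exact: intg_measurable ik].
    by move=> x; rewrite normrM ler_wpM2r.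
  have := line_deriv_parts D1 D2.
  set X1 := fun x : 'rV[R]_n.+2 => z m (x ord0 ord0) * chi (del_row ord0 x).
  set X2 := fun x : 'rV[R]_n.+2 => z m (x ord0 ord0) * (chi (del_row ord0 x) * g (del_row ord0 x)).
  have S1 := test_Cinf T1; have S2 := test_Cinf T2.
  have q12 := testM T1 S2; have qd1 := testM (test_partial jS T1) S2.
  have q1d := testM T1 (smooth_partial jS S2).
  have j1 : intg lebS (fun x => (W x * X1 x + U x * partial X1 jS x) * (U' x * X2 x)).
    have := intgD (bddS _ q12 _ k1) (bddS _ qd1 _ k3); congr intg; apply/funext => x.
    rewrite /X1 /X2 /=; move: (z m _) (chi _) (g _) (partial _ _ _) => a' b' c' d'; ring.
  have j2 : intg lebS (fun x => U x * X1 x * (W' x * X2 x + U' x * partial X2 jS x)).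
    have := intgD (bddS _ q12 _ k2) (bddS _ q1d _ k3); congr intg; apply/funext => x.
    rewrite /X1 /X2 /=; move: (z m _) (chi _) (g _) (partial _ _ _) => a' b' c' d'; ring.
  move=> /(_ j1 j2) <-; rewrite -(RintD j1 j2); apply: eq_Rintegral => x _.
  rewrite /X1 /X2 (partial_cyl _ _ (sz m _) schi) (partial_cyl _ _ (sz m _) (smoothM schi sg)) (partialM _ _ schi sg) /h.
  move: (z m _) (chi _) (g _) (partial chi _ _) (partial g _ _) (W x) (U x) (W' x) (U' x).
  by move=> a1 a2 a3 a4 a5 a6 a7 a8 a9; ring.
by move: cv; under eq_fun do rewrite Z; move=> /cvg_lim <-//; rewrite lim_cst.
Qed.

End parts_in_space.

(** * Sobolev norms *)

Section multi_indices.
Variables (n m : nat).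

Lemma count_multi_index (a : {ffun 'I_n -> 'I_m.+1}) i :
  count_mem i (multi_index a) = a i.
Proof.
rewrite /multi_index count_flatten -map_comp sumnE big_map big_enum /=.
rewrite (bigD1 i)//= count_nseq /= eqxx mul1n big1 ?addn0// => k ki.
by rewrite count_nseq /= (negbTE ki) mul0n.
Qed.

Lemma sum_count_mem (s : seq 'I_n) : (\sum_i count_mem i s)%N = size s.
Proof.
elim: s => [|k s IH]; first by rewrite big1.
rewrite /= -IH -add1n -(_ : \sum_i (k == i) = 1)%N; last first.
  by rewrite (bigD1 k)//= eqxx big1 ?addn0// => i ik; rewrite eq_sym (negbTE ik).
by rewrite -big_split.
Qed.

Definition index_of (s : seq 'I_n) : {ffun 'I_n -> 'I_m.+1} :=
  [ffun i => inord (count_mem i s)].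

Lemma index_ofE s i : (size s <= m)%N -> index_of s i = count_mem i s :> nat.
Proof.
move=> sm; rewrite ffunE inordK// ltnS (leq_trans _ sm)//; exact: count_size.
Qed.

Lemma index_of_sum s : (size s <= m)%N -> (\sum_i index_of s i = size s)%N.
Proof.
by move=> sm; rewrite -sum_count_mem; apply: eq_bigr => i _; exact: index_ofE.
Qed.

Lemma index_of_perm s : (size s <= m)%N -> perm_eq (multi_index (index_of s)) s.
Proof.
move=> sm; apply/allP => i _ /=.
by rewrite count_multi_index index_ofE.
Qed.

Lemma index_of_sym s s' : perm_eq s s' -> index_of s = index_of s'.
Proof. by move=> /seq.permP H; apply/ffunP => i; rewrite !ffunE H. Qed.

End multi_indices.

Section iterated_partials.
Variables (R : realType) (n : nat).
Implicit Type f : 'rV[R]_n -> R.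

Lemma partials_partial f j s : Cinf f ->
  partials (partial f j) s = partial (partials f s) j.
Proof.
elim: s f => [//|i s IH] f sf /=.
rewrite -/(partials (partial (partial f j) i) s) -/(partials (partial f i) s).
rewrite -IH; last exact: smooth_partial.
suff -> : partial (partial f j) i = partial (partial f i) j by [].
by apply/funext => x; apply: partial_sym; exact: sf.
Qed.

Lemma partialsC f s1 s2 : Cinf f ->
  partials (partials f s1) s2 = partials (partials f s2) s1.
Proof.
elim: s1 f => [//|j s1 IH] f sf /=.
rewrite -/(partials (partial f j) s1) IH; last exact: smooth_partial.
by rewrite partials_partial.
Qed.

Lemma partials_perm f s s' : Cinf f -> perm_eq s s' -> partials f s = partials f s'.
Proof.
move=> sf ss'; pose P r := partials f s = partials f r.
suff : P s' by [].
apply: (catCA_perm_ind (P := P) _ ss') => // s1 s2 s3; rewrite /P => ->.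
rewrite /partials !foldl_cat; congr foldl; exact: partialsC.
Qed.

End iterated_partials.

Section sobolev_spaces.
Variables (R : realType) (n : nat) (Q : set 'rV[R]_n).
Hypothesis oQ : open Q.
Notation leb := (lebesgue_rV R n).

Lemma wd_perm u w s s' : perm_eq s s' -> weak_derivative Q s u w -> weak_derivative Q s' u w.
Proof.
move=> ss' W; have [lu lw _] := W; apply: wdI => // phi tphi.
by rewrite -(partials_perm (test_Cinf tphi) ss') (wdE W tphi) (perm_size ss').
Qed.

Lemma L2norm2_ge0 (u : 'rV[R]_n -> R) : (0 <= L2norm2 Q u)%E.
Proof. by apply: integral_ge0 => x _; rewrite lee_fin sqr_ge0. Qed.

Lemma patch_id (u : 'rV[R]_n -> R) : (forall x, ~ Q x -> u x = 0) -> u \_ Q = u.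
Proof.
move=> u0; apply/funext => x; rewrite patchE; have [xQ|xQ] := pselect (Q x).
  by rewrite mem_set.
by rewrite memNset// u0.
Qed.

Lemma patch_out (u : 'rV[R]_n -> R) x : ~ Q x -> (u \_ Q) x = 0.
Proof. by move=> nQ; rewrite patchE memNset. Qed.

Lemma patch_in (u : 'rV[R]_n -> R) x : Q x -> (u \_ Q) x = u x.
Proof. by move=> xQ; rewrite patchE mem_set. Qed.

Lemma Rint_patch_test (u phi : 'rV[R]_n -> R) : test_function Q phi ->
  \int[leb]_x ((u \_ Q) x * phi x) = \int[leb]_x (u x * phi x).
Proof.
move=> tphi; apply: eq_Rintegral => x _; have [xQ|xQ] := pselect (Q x).
  by rewrite patch_in.
by rewrite (test_out tphi)// !mulr0.
Qed.

Lemma sobolev_weak m u : in_sobolev m Q u -> exists w : seq 'I_n -> 'rV[R]_n -> R,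
  [/\ forall s, (size s <= m)%N -> L2 leb (w s) /\ weak_derivative Q s u (w s),
      forall s x, ~ Q x -> w s x = 0 & forall s s', perm_eq s s' -> w s = w s'].
Proof.
move=> /ereal_inf_lt[_ [w wP <-] woo].
exists (fun s => w (index_of m s) \_ Q); split; last 2 first.
- by move=> s x; exact: patch_out.
- by move=> s s' ss'; rewrite (index_of_sym _ ss').
move=> s sm.
have am : (\sum_i index_of m s i <= m)%N by rewrite index_of_sum.
have W := wP _ am; have [lu lw _] := W.
have L : L2 leb (w (index_of m s) \_ Q).
  apply: L2_patch; [exact: open_measurable_rV|exact: lw.1|].
  apply: le_lt_trans woo; rewrite (bigD1 (index_of m s))//= leeDl//.
  by apply: sume_ge0 => a _; exact: L2norm2_ge0.
split => //; have W' := wd_perm (index_of_perm sm) W.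
have lw' : locally_integrable_on Q (w (index_of m s) \_ Q).
  by apply: li_patch => //; rewrite patch_id// => x; exact: patch_out.
apply: wdI => // phi tphi.
by rewrite (wdE W' tphi) Rint_patch_test.
Qed.

(* [V], [A k] and [B j k] are [v] and its weak derivatives, extended by zero. *)
Lemma sobolev2_data (v : 'rV[R]_n -> R) : in_sobolev 2 Q v -> exists V A B,
  [/\ [/\ L2 leb V, forall x, ~ Q x -> V x = 0 & forall x, Q x -> V x = v x],
      forall k : 'I_n, [/\ L2 leb (A k), forall x, ~ Q x -> A k x = 0,
        weak_derivative Q [:: k] v (A k) & forall phi, test_function Q phi ->
        \int[leb]_x (V x * partial phi k x) = - \int[leb]_x (A k x * phi x)],
      forall j k : 'I_n, [/\ L2 leb (B j k), forall x, ~ Q x -> B j k x = 0 &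
        forall phi, test_function Q phi ->
        \int[leb]_x (A k x * partial phi j x) = - \int[leb]_x (B j k x * phi x)] &
      forall j k, B j k = B k j].
Proof.
move=> sv; have [w [wP w0 wS]] := sobolev_weak sv.
have [L0 W0] := wP [::] isT.
have V0 phi : test_function Q phi -> forall s,
    \int[leb]_x ((v \_ Q) x * partials phi s x) = \int[leb]_x (v x * partials phi s x).
  by move=> tphi s; apply: Rint_patch_test; exact: test_partials.
(* The entry for the empty list is just a weak derivative of order 0, so it equals [v] almost
   everywhere on [Q]; through it [v] extended by zero is square-integrable. *)
have vw : {ae leb, forall x, w [::] x = (v \_ Q) x}.
  have [lv lw0 _] := W0.
  have H : {ae leb, forall x, Q x -> v x - w [::] x = 0}.
    apply: (dBR oQ).
    - by apply: measurable_funB; [exact: lv.1|exact: lw0.1].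
    - move=> K cK KD; have mK : measurable K.
        by apply: closed_measurable_rV; exact: compact_closed.
      have := integrableB mK (lv.2 K cK KD) (lw0.2 K cK KD).
      by apply: eq_integrable.
    - move=> a b m abQ; have tb := test_bump m abQ.
      rewrite (Rint_test _ tb).
      transitivity (\int[leb]_x (v x * bump a b m x - w [::] x * bump a b m x)).
        by apply: eq_Rintegral => x _; rewrite mulrBl.
      rewrite (RintB (intg_test lv tb) (intg_test lw0 tb)).
      by have := wdE W0 tb; rewrite /= expr0 mul1r => ->; rewrite subrr.
  apply: filterS H => x H; have [xQ|xQ] := pselect (Q x).
    by rewrite patch_in//; have /eqP := H xQ; rewrite subr_eq0 => /eqP.
  by rewrite patch_out// w0.
have mv : measurable_fun setT (v \_ Q).
  have mQ := open_measurable_rV oQ.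
  apply/(measurable_restrict _ mQ measurableT); rewrite setTI.
  by have [[]] := W0.
exists (v \_ Q), (fun k => w [:: k]), (fun j k => w [:: j; k]); split.
- split; [exact: ae_L2 vw mv L0|by move=> x; exact: patch_out|by move=> x; exact: patch_in].
- move=> k; have [Lk Wk] := wP [:: k] isT; split => //; first exact: w0.
  move=> phi tphi; have := V0 phi tphi [:: k]; rewrite /= => ->.
  by have := wdE Wk tphi; rewrite /= expr1 mulN1r => ->.
- move=> j k; have [Lk Wk] := wP [:: j; k] isT; split => //; first exact: w0.
  move=> phi tphi; have [_ W1] := wP [:: k] isT.
  have := wdE W1 (test_partial j tphi); rewrite /= expr1 mulN1r => H.
  have := wdE Wk tphi; rewrite /= expr2 mulN1r opprK mul1r => <-.
  by rewrite H opprK.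
- by move=> j k; apply: wS; rewrite (perm_catC [:: j] [:: k]).
Qed.

Lemma wd_L2norm2 s u u' w w' : weak_derivative Q s u w -> weak_derivative Q s u' w' ->
  {ae leb, forall x, Q x -> u x = u' x} -> L2norm2 Q w = L2norm2 Q w'.
Proof.
move=> W W' uu'; have ww := wd_unique oQ W W' uu'.
have [_ [mw _] _] := W; have [_ [mw' _] _] := W'.
apply: ae_eq_integral => //.
- exact: open_measurable_rV.
- by apply/measurable_EFinP; exact: measurable_funX.
- by apply/measurable_EFinP; exact: measurable_funX.
- by apply: filterS ww => x H xQ; rewrite H.
Qed.

(** A multi-index of order at most 1 is zero or a unit vector; [option 'I_n] enumerates them, with
    [None] for zero. *)
Lemma big_index1 (F : {ffun 'I_n -> 'I_2} -> \bar R) :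
  (\sum_(a : {ffun 'I_n -> 'I_2} | (\sum_i a i <= 1)%N) F a =
   F (index_of 1 [::]) + \sum_i F (index_of 1 [:: i]))%E.
Proof.
pose h (o : option 'I_n) := index_of 1 (if o is Some i then [:: i] else [::]).
pose h' (a : {ffun 'I_n -> 'I_2}) := [pick i | a i != 0%N :> nat].
have hE o i : h o i = (if o is Some k then (k == i : nat) else 0)%N :> nat.
  by rewrite /h index_ofE; case: o => //= k; rewrite addn0.
rewrite (reindex_onto h h') /=; last first.
  move=> a a1; apply/ffunP => i; apply: val_inj; rewrite /= hE /h'.
  case: pickP => [k ak|a0]; last by have /negbFE/eqP := a0 i.
  move: a1; rewrite (bigD1 k)//=; have [<- a1|ki] := eqVneq k i.
    have : (a k <= 1)%N by rewrite -ltnS ltn_ord.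
    by move: ak; case: (nat_of_ord (a k)) => [|[]].
  rewrite (bigD1 i) /=; last by rewrite eq_sym.
  move: ak; move: (\sum_(i0 < n | _) _)%N (nat_of_ord (a k)) (nat_of_ord (a i)) => x y z.
  lia.
rewrite (bigD1 None) /=; last first.
  rewrite index_of_sum//= /h'; case: pickP => // i.
  by rewrite (hE None).
congr (_ + _)%E; rewrite (reindex_omap Some id) /=; last by case=> [//|]; rewrite andbF.
apply: eq_bigl => i; rewrite index_of_sum//= eqxx !andbT.
rewrite /h'; case: pickP => [k|/(_ i)]; last by rewrite (hE (Some i)) eqxx.
by rewrite (hE (Some i)); have [->|] := eqVneq i k => // _; rewrite eqxx.
Qed.

(** The given derivatives show that the set under the infimum is nonempty, and uniqueness almost
    everywhere makes it a singleton. *)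
Lemma sobolev1E u (w : 'I_n -> 'rV[R]_n -> R) : L2 leb (u \_ Q) ->
  (forall i, weak_derivative Q [:: i] u (w i)) ->
  sobolev_norm2 1 Q u = (L2norm2 Q u + \sum_i L2norm2 Q (w i))%E.
Proof.
move=> Lu W; have lu : locally_integrable_on Q u by exact: li_patch.
have W0 : weak_derivative Q [::] u u by apply: wdI => // phi _; rewrite expr0 mul1r.
set v := (X in _ = X).
have val (w' : {ffun 'I_n -> 'I_2} -> 'rV[R]_n -> R) :
    (forall a : {ffun 'I_n -> 'I_2}, (\sum_i a i <= 1)%N ->
      weak_derivative Q (multi_index a) u (w' a)) ->
    (\sum_(a : {ffun 'I_n -> 'I_2} | (\sum_i a i <= 1)%N) L2norm2 Q (w' a))%E = v.
  move=> W'; rewrite (big_index1 (fun a => L2norm2 Q (w' a))); congr (_ + _)%E.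
    have i0 := @index_of_sum n 1 [::] isT.
    have a1 : (\sum_(i < n) index_of 1 [::] i <= 1)%N by rewrite i0.
    apply: (wd_L2norm2 (wd_perm (@index_of_perm n 1 [::] isT) (W' _ a1)) W0).
    exact: aeW.
  apply: eq_bigr => i _; have i1 := @index_of_sum n 1 [:: i] isT.
  have a1 : (\sum_(k < n) index_of 1 [:: i] k <= 1)%N by rewrite i1.
  apply: (wd_L2norm2 (wd_perm (@index_of_perm n 1 [:: i] isT) (W' _ a1)) (W i)).
  exact: aeW.
pose w0 (a : {ffun 'I_n -> 'I_2}) := if [pick i | a i != 0%N :> nat] is Some i then w i else u.
have w0P (a : {ffun 'I_n -> 'I_2}) : (\sum_i a i <= 1)%N ->
    weak_derivative Q (multi_index a) u (w0 a).
  move=> a1; rewrite /w0; case: pickP => [k ak|a0].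
    apply: (wd_perm _ (W k)); apply/allP => i _ /=; rewrite count_multi_index addn0.
    move: a1; rewrite (bigD1 k)//=; have [<- a1|ki] := eqVneq k i.
      have : (a k <= 1)%N by rewrite -ltnS ltn_ord.
      by move: ak; case: (nat_of_ord (a k)) => [|[]].
    rewrite (bigD1 i) /=; last by rewrite eq_sym.
    move: ak; move: (\sum_(i0 < n | _) _)%N (nat_of_ord (a k)) (nat_of_ord (a i)) => x y z.
    lia.
  apply: (wd_perm _ W0); apply/allP => i _ /=; rewrite count_multi_index.
  by have /negbFE/eqP -> := a0 i.
rewrite /sobolev_norm2 (_ : [set _ | _ in _] = [set v]) ?ereal_inf1//.
apply/seteqP; split => x /=.
  by move=> [w' W' <-]; rewrite val.
by move=> ->; exists w0 => //; exact: val.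
Qed.

End sobolev_spaces.

(** * Time traces *)

Lemma sqrD_le (R : realFieldType) (p q a b : R) : p ^+ 2 <= a -> q ^+ 2 <= b ->
  (p + q) ^+ 2 <= 2 * a + 2 * b.
Proof. by move=> pa qb; have := sqr_ge0 (p - q); lra. Qed.

Lemma ae_and d (T : measurableType d) (R : realType)
    (mu : {measure set T -> \bar R}) (P Q : T -> Prop) : {ae mu, forall x, P x} ->
  {ae mu, forall x, Q x} -> {ae mu, forall x, P x /\ Q x}.
Proof. by move=> H1 H2; apply: filterS2 H1 H2 => x. Qed.

Lemma ae_exists_itv (R : realType) (P : R -> Prop) (a b : R) : a < b ->
  {ae @lebesgue_measure R, forall s, P s} -> exists2 s, a < s < b & P s.
Proof.
move=> ab [N [mN N0 NP]]; apply: contrapT => H.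
have : (@lebesgue_measure R `]a, b[%classic <= @lebesgue_measure R N)%E.
  apply: (@le_measure _ _ _ (@lebesgue_measure R)); rewrite ?inE//.
  move=> s /=; rewrite in_itv /= => sab; apply: NP => /= Ps.
  by apply: H; exists s.
rewrite N0 lebesgue_measure_itv /= lte_fin ab -EFinB lee_fin.
by rewrite leNgt subr_gt0 ab.
Qed.

Section traces.
Variables (R : realType) (n : nat) (T : R) (D : set 'rV[R]_n).
Hypotheses (T0 : 0 < T) (oD : open D).
Notation lambda := (@lebesgue_measure R).
Notation RR := (measurableTypeR R).
Notation leb := (lebesgue_rV R n).
Notation lebS := (lebesgue_rV R n.+1).
Notation Q := (cylinder T D).
Implicit Types (U W : 'rV[R]_n.+1 -> R) (c w : 'rV[R]_n -> R).

Lemma tsliceB_le U W c s t : trep T D U W c ->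
  L2 leb (fun y => tslice c W t y - tslice c W s y) /\
  \int[leb]_y ((tslice c W t y - tslice c W s y) ^+ 2) <= `|t - s| * \int[lebS]_x (W x ^+ 2).
Proof.
move=> [_ cW _ _ _]; wlog st : s t / s <= t.
  move=> H; have [|/ltW] := leP s t; first exact: H.
  move=> /H[L E]; rewrite distrC; split.
    by have := L2Z (-1) L; congr L2; apply/funext => y; rewrite mulN1r opprB.
  apply: le_trans E; rewrite le_eqVlt; apply/orP; left; apply/eqP.
  by apply: eq_Rintegral => y _; rewrite -sqrrN opprB.
have [L E] := tintB_L2 cW st; rewrite ger0_norm ?subr_ge0//.
have eqf : (fun y => tslice c W t y - tslice c W s y) = (fun y => tint W t y - tint W s y).
  by apply/funext => y; rewrite /tslice opprD addrACA subrr add0r.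
rewrite eqf; split => //; apply: le_trans E.
rewrite le_eqVlt; apply/orP; left; apply/eqP.
by apply: eq_Rintegral => y _; rewrite /tslice opprD addrACA subrr add0r.
Qed.

Lemma trep_ae U U' W c : trep T D U W c -> measurable_fun setT U' ->
  (forall x, ~ Q x -> U' x = 0) -> {ae lebS, forall x, U x = U' x} -> trep T D U' W c.
Proof.
move=> [cU cW Lc c0 UE] mU' U'0 UU'; split => //.
  by split => //; exact: ae_L2 UU' mU' cU.1.
have H := (ae_ins_row ord0 (fun x => U x = U' x)).1 UU'.
by apply: filterS2 UE H => p h1 h2 p0; rewrite -h2 h1.
Qed.

Lemma trep_slices U W c : trep T D U W c -> {ae lambda, forall s, 0 < s < T ->
  {ae leb, forall y, U (ins_row ord0 s y) = tslice c W s y}}.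
Proof.
move=> [_ _ _ _ UE]; apply: filterS (ae_prod1 UE) => s Hs s0.
by apply: filterS Hs => y /(_ s0).
Qed.

Variables (U W : 'rV[R]_n.+1 -> R) (c : 'rV[R]_n -> R) (v : 'rV[R]_n.+1 -> R).
Hypotheses (rU : trep T D U W c) (vU : forall x, Q x -> v x = U x).

Let mU : measurable_fun setT U. Proof. by have [[[]]] := rU. Qed.

Let slice_distE s w : 0 < s < T -> measurable_fun D w ->
  {ae leb, forall y, U (ins_row ord0 s y) = tslice c W s y} ->
  (L2norm2 D (fun y => (v (cons_row s y) - w y)%R) =
   L2norm2 D (fun y => (tslice c W s y - w y)%R)).
Proof.
move=> s0 mw Us; have mD := open_measurable_rV oD.
rewrite (_ : L2norm2 D _ = L2norm2 D (fun y => (U (ins_row ord0 s y) - w y)%R)); last first.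
  apply: eq_integral => y /set_mem yD; rewrite cons_rowE vU//.
  exact/cylinder_ins.
apply: ae_eq_integral => //.
- apply/measurable_EFinP; apply: measurable_funX; apply: measurable_funB => //.
  by apply: measurable_funTS; exact: measurable_ins_slice.
- apply/measurable_EFinP; apply: measurable_funX; apply: measurable_funB => //.
  by apply: measurable_funTS; have [] := tslice_L2 s rU.
- by apply: filterS Us => y -> _.
Qed.

Let patch_tslice t : tslice c W t \_ D = tslice c W t.
Proof. by apply: patch_id => y nD; apply: tslice_out rU nD. Qed.

Lemma trep_trace t : 0 <= t <= T -> time_trace T D v t (tslice c W t).
Proof.
move=> _; have mD := open_measurable_rV oD; have Lt := tslice_L2 t rU.
have mt : measurable_fun D (tslice c W t) by apply: measurable_funTS; exact: Lt.1.
split => //.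
  by rewrite L2norm2E// ?patch_tslice ?ltry.
move=> e e0; pose N := \int[lebS]_x (W x ^+ 2).
have N0 : 0 <= N by apply: Rint_ge0 => x; exact: sqr_ge0.
have N1 : 0 < N + 1 by rewrite ltr_wpDl.
exists (e / (N + 1)); first by rewrite divr_gt0.
apply: ae_impl (trep_slices rU) => s Us s0 st.
rewrite (slice_distE s0 mt (Us s0)).
have [L E] := tsliceB_le t s rU.
have pE : (fun y => tslice c W s y - tslice c W t y) \_ D = (fun y => tslice c W s y - tslice c W t y).
  by apply: patch_id => y nD; rewrite !(tslice_out _ rU nD) subrr.
rewrite L2norm2E// ?pE// lee_fin (le_trans E)// -/N.
apply: (@le_trans _ _ (e / (N + 1) * N)); first by rewrite ler_wpM2r// ltW.
by rewrite -mulrA ler_piMr ?(ltW e0)// mulrC ler_pdivrMr// mul1r lerDl.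
Qed.

(** At almost every time [s] near [t] the slice of [v] is close to both [w] and the continuous
    representative at [t]. With squared distances at most [e / 4], the inequality
    [(p + q)^2 <= 2 p^2 + 2 q^2] bounds their squared distance by [e]. *)
Lemma trace_unique t w : 0 <= t <= T -> time_trace T D v t w ->
  {ae leb, forall y, (w \_ D) y = tslice c W t y}.
Proof.
move=> t0T [mw w2 wt]; have mD := open_measurable_rV oD.
have Lw := L2_patch mD mw w2.
have Lt := tslice_L2 t rU.
have [_ _ tt] := trep_trace t0T.
have Ld : L2 leb (fun y => (w \_ D) y - tslice c W t y).
  by have := L2D Lw (L2Z (-1) Lt); congr L2; apply/funext => y; rewrite mulN1r.
suff H : \int[leb]_y (((w \_ D) y - tslice c W t y) ^+ 2) = 0.
  have := Rint_eq0 Ld.2 (fun y => sqr_ge0 _) H.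
  by apply: filterS => y /eqP; rewrite sqrf_eq0 subr_eq0 => /eqP.
apply/eqP; rewrite eq_le Rint_ge0 ?andbT => [|y]; last exact: sqr_ge0.
apply/ler_addgt0Pl => e e0; rewrite addr0.
have e4 : 0 < e / 4 by rewrite divr_gt0.
have [d1 d10 H1] := wt _ e4; have [d2 d20 H2] := tt _ e4.
(* A common good time must exist in []0, T[], also when [t] is an endpoint, so the interval lies on
   the side of [t] with more room: right if [t <= T / 2], left otherwise. *)
have [a [b [ab Hab]]] : exists a b : R, a < b /\
    forall s, a < s < b -> [/\ 0 < s < T, `|s - t| < d1 & `|s - t| < d2].
  pose d := Num.min (Num.min d1 d2) T.
  have d0 : 0 < d by rewrite !lt_min d10 d20.
  have dd1 : d <= d1 by rewrite /d !ge_min lexx.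
  have dd2 : d <= d2 by rewrite /d !ge_min lexx orbT.
  have dT : d <= T by rewrite /d ge_min lexx orbT.
  have T0' := T0; move/andP: t0T => [t0 tT].
  have [h|h] := leP t (T / 2).
    exists t, (t + d / 2); split; first by lra.
    move=> s /andP[s1 s2]; rewrite ger0_norm; last by lra.
    by split; [apply/andP; split|..]; lra.
  exists (t - d / 2), t; split; first by lra.
  move=> s /andP[s1 s2]; rewrite ltr0_norm; last by lra.
  by split; [apply/andP; split|..]; lra.
have [s sab [Us [h1 h2]]] := ae_exists_itv ab (ae_and (trep_slices rU) (ae_and H1 H2)).
have [s0 sd1 sd2] := Hab _ sab.
have {}h1 := h1 s0 sd1; have {}h2 := h2 s0 sd2; have {}Us := Us s0.
have Ls := tslice_L2 s rU.
have mt : measurable_fun D (tslice c W t) by apply: measurable_funTS; exact: Lt.1.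
move: h1 h2; rewrite (slice_distE s0 mw Us) (slice_distE s0 mt Us).
have Lsw : L2 leb (fun y => tslice c W s y - (w \_ D) y).
  by have := L2D Ls (L2Z (-1) Lw); congr L2; apply/funext => y; rewrite mulN1r.
have Lst : L2 leb (fun y => tslice c W s y - tslice c W t y).
  by have := L2D Ls (L2Z (-1) Lt); congr L2; apply/funext => y; rewrite mulN1r.
have E1 : (fun y => tslice c W s y - w y) \_ D = (fun y => tslice c W s y - (w \_ D) y).
  apply/funext => y; have [yD|yD] := pselect (D y); first by rewrite !patch_in.
  by rewrite !patch_out// (tslice_out _ rU yD) subrr.
have E2 : (fun y => tslice c W s y - tslice c W t y) \_ D = (fun y => tslice c W s y - tslice c W t y).
  by apply: patch_id => y nD; rewrite !(tslice_out _ rU nD) subrr.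
rewrite (L2norm2E mD) ?E1// (L2norm2E mD) ?E2// !lee_fin => h1 h2.
apply: (@le_trans _ _ (\int[leb]_y (2 * (tslice c W s y - (w \_ D) y) ^+ 2 +
    2 * (tslice c W s y - tslice c W t y) ^+ 2))).
  apply: Rint_le; [exact: Ld.2|by apply: intgD; apply: intgZ; [exact: Lsw.2|exact: Lst.2]|].
  move=> y; move: (tslice c W s y) ((w \_ D) y) (tslice c W t y) => p q r.
  by have := sqr_ge0 (p - q + (p - r)); lra.
rewrite RintD; [|exact: intgZ Lsw.2|exact: intgZ Lst.2].
rewrite (RintZ _ Lsw.2) (RintZ _ Lst.2); move: h1 h2.
move: (\int[leb]_y _) (\int[leb]_y _) => p q h1 h2; lra.
Qed.

Lemma trace_L2norm2 t w : 0 <= t <= T -> time_trace T D v t w ->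
  L2norm2 D w = (\int[leb]_y (tslice c W t y ^+ 2))%:E.
Proof.
move=> t0 tw; have H := trace_unique t0 tw; have [mw w2 _] := tw.
have mD := open_measurable_rV oD; have Lw := L2_patch mD mw w2.
rewrite L2norm2E//; congr (_%:E); apply: ae_Rint.
- by apply: filterS H => y ->.
- exact: measurable_funX Lw.1.
- exact: measurable_funX (tslice_L2 t rU).1.
Qed.

Lemma slice_norm2E (N : ('rV[R]_n -> R) -> \bar R) (a : \bar R) t : 0 <= t <= T ->
  (forall w, time_trace T D v t w -> N w = a) -> slice_norm2 T D N v t = a.
Proof.
move=> t0 H; rewrite /slice_norm2 (_ : [set _ | _ in _] = [set a]) ?ereal_inf1//.
apply/seteqP; split => x /=.
  by move=> [w tw <-]; exact: H.
by move=> ->; exists (tslice c W t); [exact: trep_trace|apply: H; exact: trep_trace].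
Qed.

End traces.

Section slice_derivatives.
Variables (R : realType) (n : nat) (T : R) (D : set 'rV[R]_n.+1).
Hypotheses (T0 : 0 < T) (oD : open D).
Notation lambda := (@lebesgue_measure R).
Notation RR := (measurableTypeR R).
Notation leb := (lebesgue_rV R n.+1).
Notation lebS := (lebesgue_rV R n.+2).
Notation Q := (cylinder T D).
Variables (j : 'I_n.+1) (U W A B : 'rV[R]_n.+2 -> R) (c a : 'rV[R]_n.+1 -> R).
Hypotheses (rU : trep T D U W c) (rA : trep T D A B a).
Hypothesis UA : forall phi, test_function Q phi ->
  \int[lebS]_x (U x * partial phi (lift ord0 j) x) = - \int[lebS]_x (A x * phi x).

(** For a fixed test function in space, the defect [h] of the defining identity is Hölder continuous
    in time. The weak derivative in space-time, tested with products, shows that [h] is orthogonal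
    to bumps in time; hence it vanishes at every [t], endpoints included. *)
Lemma slice_weak_derivative t : 0 <= t <= T ->
  weak_derivative D [:: j] (tslice c W t) (tslice a B t).
Proof.
move=> t0T;
have LU s := tslice_L2 s rU; have LA s := tslice_L2 s rA.
have li X Y e s : trep T D X Y e -> locally_integrable_on D (tslice e Y s).
  move=> rX; apply: li_patch => //; rewrite patch_id; first exact: tslice_L2 rX.
  by move=> y nD; apply: tslice_out rX nD.
apply: wdI; [exact: li rU|exact: li rA|move=> psi tpsi].
rewrite /= expr1 mulN1r.
have tdpsi := test_partial j tpsi.
have Lp := L2_test tpsi; have Ld := L2_test tdpsi.
pose h s := \int[leb]_y (tslice c W s y * partial psi j y) + \int[leb]_y (tslice a B s y * psi y).
suff : h t = 0 by rewrite /h => /eqP; rewrite addr_eq0 => /eqP.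
have [K K0 HK] : exists2 K, 0 <= K & forall s, (h t - h s) ^+ 2 <= `|t - s| * K.
  pose K1 := \int[lebS]_x (W x ^+ 2) * \int[leb]_y (partial psi j y ^+ 2).
  pose K2 := \int[lebS]_x (B x ^+ 2) * \int[leb]_y (psi y ^+ 2).
  exists (2 * K1 + 2 * K2).
    by rewrite addr_ge0// mulr_ge0// mulr_ge0//; apply: Rint_ge0 => x; exact: sqr_ge0.
  move=> s; have [L1 E1] := tsliceB_le s t rU; have [L2 E2] := tsliceB_le s t rA.
  have -> : h t - h s = \int[leb]_y ((tslice c W t y - tslice c W s y) * partial psi j y) +
      \int[leb]_y ((tslice a B t y - tslice a B s y) * psi y).
    rewrite /h opprD addrACA -(RintB (L2M (LU t) Ld) (L2M (LU s) Ld)).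
    rewrite -(RintB (L2M (LA t) Lp) (L2M (LA s) Lp)).
    by congr (_ + _); apply: eq_Rintegral => y _; rewrite mulrBl.
  have C1 := cauchy_schwarz L1 Ld; have C2 := cauchy_schwarz L2 Lp.
  have F1 : (\int[leb]_y ((tslice c W t y - tslice c W s y) * partial psi j y)) ^+ 2 <= `|t - s| * K1.
    apply: (le_trans C1); rewrite mulrA; apply: ler_wpM2r => //.
    by apply: Rint_ge0 => x; exact: sqr_ge0.
  have F2 : (\int[leb]_y ((tslice a B t y - tslice a B s y) * psi y)) ^+ 2 <= `|t - s| * K2.
    apply: (le_trans C2); rewrite mulrA; apply: ler_wpM2r => //.
    by apply: Rint_ge0 => x; exact: sqr_ge0.
  rewrite mulrDr !(mulrCA _ 2); exact: sqrD_le F1 F2.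
have zero (p q : R) m : 0 < p -> q < T -> \int[lambda]_s (bump1 p q m s * h s) = 0 /\
    intg lambda (fun s => bump1 p q m s * h s).
  move=> p0 qT; pose b := bump1 p q m.
  have sb (f : 'rV[R]_n.+2 -> R) : Cinf f -> Cinf (fun x => b (f x)) by exact: smooth_bump1.
  have tphi : test_function Q (fun x => b (x ord0 ord0) * psi (del_row ord0 x)).
    apply: (test_cyl p0 qT _ sb tpsi) => s; exact: bump1_out.
  have Lphi := L2_test tphi; have Ldphi := L2_test (test_partial (lift ord0 j) tphi).
  (* A space-time pairing with a product test function is rewritten as a time integral of pairings
     of slices of the continuous representative. *)
  have half X Y e k : trep T D X Y e -> L2 leb k ->
      intg lebS (fun x => X x * (b (x ord0 ord0) * k (del_row ord0 x))) ->
      intg lambda (fun s => b s * \int[leb]_y (tslice e Y s y * k y)) /\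
      \int[lebS]_x (X x * (b (x ord0 ord0) * k (del_row ord0 x))) =
      \int[lambda]_s (b s * \int[leb]_y (tslice e Y s y * k y)).
    move=> rX Lk ix; have mx := intg_measurable ix.
    have ip := (intg_ins_row ord0 mx).1 ix; have [i1 e1] := intg_fubini1 ip.
    have mb : measurable_fun setT (b : RR -> R) by exact: intg_measurable (intg_bump1 p q m).
    have [[[mX _] _] [[mY _] _] [me _] _ _] := rX; have [mk _] := Lk.
    have mi : measurable_fun setT (fun s : RR => b s * \int[leb]_y (tslice e Y s y * k y)).
      apply: measurable_funM => //.
      apply: (@measurable_Rint _ _ RR _ R leb (fun z => tslice e Y z.1 z.2 * k z.2)).
      apply: measurable_funM; last exact: (measurableT_comp mk measurable_snd).
      apply: measurable_funD; last exact: measurable_tint.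
      exact: (measurableT_comp me measurable_snd).
    have E : {ae lambda, forall s : RR, \int[leb]_y
        (X (ins_row ord0 s y) * (b (ins_row ord0 s y ord0 ord0) * k (del_row ord0 (ins_row ord0 s y)))) =
        b s * \int[leb]_y (tslice e Y s y * k y)}.
      apply: ae_impl (trep_slices rX) => s Xs; have iM := L2M (tslice_L2 s rX) Lk.
      have [s0|s0] := boolP (0 < s < T); last first.
        have b0 : b s = 0.
          apply: bump1_out; apply: contra s0 => /andP[h1 h2].
          by rewrite (lt_trans p0 h1) (lt_trans h2 qT).
        rewrite b0 mul0r -[RHS](@Rint0 _ _ R leb); apply: eq_Rintegral => y _.
        by rewrite ins_row_at b0 mul0r mulr0.
      rewrite -RintZ//; apply: ae_Rint.
      - apply: filterS (Xs s0) => y ->; rewrite ins_row_at del_ins_row.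
        by rewrite mulrCA.
      - apply: measurable_funM; first exact: measurable_ins_slice.
        under eq_fun do rewrite ins_row_at del_ins_row.
        by apply: measurable_funM.
      - exact: intg_measurable (intgZ _ iM).
    split; first exact: ae_intg E mi i1.
    rewrite (Rint_ins_row ord0)// -e1; apply: ae_Rint => //; exact: intg_measurable i1.
  have pE x : partial (fun x => b (x ord0 ord0) * psi (del_row ord0 x)) (lift ord0 j) x =
      b (x ord0 ord0) * partial psi j (del_row ord0 x).
    by apply: partial_cyl => //; exact: test_Cinf tpsi.
  have [[LUU _] _ _ _ _] := rU; have [[LAA _] _ _ _ _] := rA.
  have ix1 : intg lebS (fun x => U x * (b (x ord0 ord0) * partial psi j (del_row ord0 x))).
    have := L2M LUU Ldphi; congr intg; apply/funext => x; by rewrite pE.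
  have [j1 e1] := half _ _ _ _ rU Ld ix1.
  have [j2 e2] := half _ _ _ _ rA Lp (L2M LAA Lphi).
  have H : (fun s => b s * h s) = (fun s => b s * \int[leb]_y (tslice c W s y * partial psi j y) +
      b s * \int[leb]_y (tslice a B s y * psi y)).
    by apply/funext => s; rewrite /h mulrDr.
  rewrite -/b H; split; last exact: intgD.
  rewrite RintD// -e1 -e2; have := UA tphi.
  under eq_Rintegral do rewrite pE.
  by move=> ->; rewrite addNr.
(* Against a bump supported within distance [d] of [t], [h] has zero mean, so [h t] is the mean of
   [h t - h s], of size at most the square root of [d * K]. *)
have small (d : R) : 0 < d -> d <= T / 2 -> h t ^+ 2 <= d * K.
  move=> d0 dT; have T0' := T0; have /andP[t0 tT] := t0T.
  have [p [q [p0 qT pq Hpq]]] : exists p q : R, [/\ 0 < p, q < T, p < q &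
      forall s, p < s < q -> `|t - s| <= d].
    have [ht|ht] := leP t (T / 2).
      exists (t + d / 3), (t + d / 2); split; [by lra|by lra|by lra|].
      by move=> s /andP[s1 s2]; rewrite ler_norml; apply/andP; split; lra.
    exists (t - d / 2), (t - d / 3); split; [by lra|by lra|by lra|].
    by move=> s /andP[s1 s2]; rewrite ler_norml; apply/andP; split; lra.
  have [m bm] := Rint_bump1_gt0 pq; have [z0 iz] := zero p q m p0 qT.
  have ib := intg_bump1 p q m.
  have E : h t * \int[lambda]_s bump1 p q m s = \int[lambda]_s (bump1 p q m s * (h t - h s)).
    transitivity (\int[lambda]_s (h t * bump1 p q m s - bump1 p q m s * h s)).
      by rewrite (RintB (intgZ _ ib) iz) z0 subr0 RintZ.
    by apply: eq_Rintegral => s _; rewrite mulrBr [h t * _]mulrC.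
  have id : intg lambda (fun s => bump1 p q m s * (h t - h s)).
    have := intgB (intgZ (h t) ib) iz; congr intg; apply/funext => s.
    by rewrite mulrBr [h t * _]mulrC.
  have B1 : `|h t| * \int[lambda]_s bump1 p q m s <= Num.sqrt (d * K) * \int[lambda]_s bump1 p q m s.
    rewrite -[X in _ * X <= _](gtr0_norm bm) -normrM E (le_trans (Rint_norm id))// -RintZ//.
    apply: Rint_le; [exact: intg_abs|exact: intgZ|move=> s].
    rewrite normrM (ger0_norm (bump1_ge0 _ _ _ _)).
    have [hs|hs] := boolP (p < s < q); last by rewrite bump1_out// mul0r mulr0.
    rewrite mulrC; apply: ler_wpM2r; first exact: bump1_ge0.
    rewrite -sqrtr_sqr ler_wsqrtr// (le_trans (HK s))// ler_wpM2r//.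
    exact: Hpq.
  move: B1; rewrite ler_pM2r// => B1.
  have dK : 0 <= d * K by rewrite mulr_ge0// ltW.
  by rewrite -real_normK ?num_real// -[d * K]sqr_sqrtr// ler_sqr ?nnegrE ?sqrtr_ge0.
apply/eqP; rewrite -sqrf_eq0 eq_le sqr_ge0 andbT.
apply/ler_addgt0Pl => e e0; rewrite addr0.
have K1 : 0 < K + 1 by rewrite ltr_wpDl.
pose d := Num.min (T / 2) (e / (K + 1)).
have d0 : 0 < d by rewrite lt_min !divr_gt0.
have := small d d0; rewrite ge_min lexx => /(_ isT) /le_trans; apply.
apply: (@le_trans _ _ (e / (K + 1) * K)); first by rewrite ler_wpM2r// ge_min lexx orbT.
by rewrite -mulrA ler_piMr ?(ltW e0)// mulrC ler_pdivrMr// mul1r lerDl.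
Qed.

End slice_derivatives.

(** * Lorentzian quadratic forms *)

Section lorentz_algebra.
Variables (R : realType) (n : nat).
Implicit Types (M : 'M[R]_n.+1) (x y z : 'rV[R]_n.+1).

Definition mform M x y : R := \sum_j \sum_k M j k * x ord0 j * y ord0 k.

Lemma mformE M x y : mform M x y = (x *m M *m y^T) ord0 ord0.
Proof.
rewrite mxE /mform exchange_big /=; apply: eq_bigr => k _.
rewrite !mxE big_distrl /=; apply: eq_bigr => j _.
by rewrite [x ord0 j * _]mulrC.
Qed.

Lemma mformDl M x y z : mform M (x + y) z = mform M x z + mform M y z.
Proof. by rewrite !mformE mulmxDl mulmxDl mxE. Qed.

Lemma mformDr M x y z : mform M x (y + z) = mform M x y + mform M x z.
Proof. by rewrite !mformE linearD /= mulmxDr mxE. Qed.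

Lemma mformZl M (c : R) x y : mform M (c *: x) y = c * mform M x y.
Proof. by rewrite !mformE -!scalemxAl mxE. Qed.

Lemma mformZr M (c : R) x y : mform M x (c *: y) = c * mform M x y.
Proof. by rewrite !mformE linearZ /= -scalemxAr mxE. Qed.

Lemma mform_sym M x y : M^T = M -> mform M x y = mform M y x.
Proof.
move=> sM; rewrite /mform exchange_big /=; apply: eq_bigr => k _.
by apply: eq_bigr => j _; rewrite -{1}sM mxE mulrAC.
Qed.

Definition e0 : 'rV[R]_n.+1 := delta_mx ord0 ord0.

Lemma mform_e0l M y : mform M e0 y = \sum_k M ord0 k * y ord0 k.
Proof.
rewrite /mform (bigD1 ord0)//= [X in _ + X]big1 ?addr0.
  by apply: eq_bigr => k _; rewrite mxE eqxx mulr1.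
move=> j j0; rewrite big1// => k _.
by rewrite mxE eqxx /= (negbTE j0) mulr0 mul0r.
Qed.

Lemma mform_e0 M : mform M e0 e0 = M ord0 ord0.
Proof.
rewrite mform_e0l (bigD1 ord0)//= mxE !eqxx mulr1 big1 ?addr0// => k k0.
by rewrite mxE eqxx /= (negbTE k0) mulr0.
Qed.

(* Up to the factor [M 0 0], the form induced on the orthogonal of e0. *)
Definition hform M x y : R :=
  mform M e0 x * mform M e0 y - M ord0 ord0 * mform M x y.

Definition energy_form M x : R := mform M e0 x ^+ 2 + hform M x x.

Lemma mform_lorentz M P x y : P \in unitmx ->
  P *m M *m P^T = diag_mx (\row_j (if j == ord0 then 1 else -1)) ->
  mform M x y = (x *m invmx P) ord0 ord0 * (y *m invmx P) ord0 ord0 -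
   \sum_(i < n) (x *m invmx P) ord0 (lift ord0 i) * (y *m invmx P) ord0 (lift ord0 i).
Proof.
move=> uP E; set u := x *m invmx P; set v := y *m invmx P.
have Ex : x = u *m P by rewrite /u mulmxKV.
have Ey : y = v *m P by rewrite /v mulmxKV.
transitivity ((u *m (P *m M *m P^T) *m v^T) ord0 ord0).
  by rewrite mformE {1}Ex {1}Ey trmx_mul !mulmxA.
rewrite E mul_mx_diag mxE big_ord_recl /=.
rewrite !mxE /= mulr1; congr (_ + _); rewrite -sumrN; apply: eq_bigr => i _.
by rewrite !mxE /= mulrN1 mulNr.
Qed.

Section one_form.
Variables (M : 'M[R]_n.+1) (C0 : R).
Hypotheses (sM : M^T = M) (LM : lorentzian M) (C00 : 0 < C0) (MC : C0 <= M ord0 ord0).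

Let g0 : 0 < M ord0 ord0. Proof. exact: lt_le_trans MC. Qed.

(** [e0] lies in the kernel of [hform]: its two terms coincide when one argument is [e0]. *)
Lemma hform_shift x (c : R) : hform M (x + c *: e0) (x + c *: e0) = hform M x x.
Proof.
rewrite /hform !mformDl !mformDr !mformZl !mformZr !(mform_sym x e0 sM) mform_e0.
by ring.
Qed.

(* Shift [x] along e0 until its time component in Lorentz coordinates vanishes. *)
Lemma hform_shifted x : exists c : R, exists s t : R,
  [/\ hform M x x = s ^+ 2 + M ord0 ord0 * t, 0 <= t & t = 0 -> x = c *: e0].
Proof.
have [P uP E] := LM.
pose e := e0 *m invmx P; pose u := x *m invmx P.
have F y z := mform_lorentz y z uP E.
have g0E : M ord0 ord0 = e ord0 ord0 ^+ 2 -
    \sum_(i < n) e ord0 (lift ord0 i) * e ord0 (lift ord0 i).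
  by rewrite -mform_e0 F.
have ne0 : e ord0 ord0 != 0.
  apply: contraTneq g0 => e00; rewrite g0E e00 expr0n /= sub0r -leNgt oppr_le0.
  by apply: sumr_ge0 => i _; rewrite -expr2 sqr_ge0.
pose c := u ord0 ord0 / e ord0 ord0.
pose w := (x + (- c) *: e0) *m invmx P.
have w0 : w ord0 ord0 = 0.
  have -> : w = u - c *: e by rewrite /w mulmxDl -scalemxAl scaleNr.
  by rewrite [LHS]mxE [X in _ + X]mxE [X in _ - X]mxE /c divfK// subrr.
exists c, (\sum_(i < n) e ord0 (lift ord0 i) * w ord0 (lift ord0 i)),
  (\sum_(i < n) w ord0 (lift ord0 i) ^+ 2); split.
- rewrite -(hform_shift x (- c)) /hform !F -/w -/e w0 !mulr0 !sub0r mulrNN -expr2.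
  by rewrite mulrN opprK; congr (_ + _ * _); apply: eq_bigr => i _; rewrite expr2.
- by apply: sumr_ge0 => i _; exact: sqr_ge0.
- move=> /eqP; rewrite psumr_eq0 => [/allP H|i _]; last exact: sqr_ge0.
  have w00 : w = 0.
    apply/rowP => k; rewrite [RHS]mxE; case: (unliftP ord0 k) => [i ->|->//].
    by have := H i (mem_index_enum _); rewrite /= sqrf_eq0 => /eqP.
  have : (x + (- c) *: e0) = 0.
    by rewrite -[LHS](mulmxKV uP) -/w w00 mul0mx.
  by rewrite scaleNr => /eqP; rewrite subr_eq0 => /eqP.
Qed.

Lemma hform_ge0 x : 0 <= hform M x x.
Proof.
have [c [s [t [-> t0 _]]]] := hform_shifted x.
by rewrite addr_ge0 ?sqr_ge0// mulr_ge0// ltW.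
Qed.

Lemma energy_form_ge0 x : 0 <= energy_form M x.
Proof. by rewrite addr_ge0 ?sqr_ge0 ?hform_ge0. Qed.

(** If [hform] vanishes at [x] then [x] is a multiple of [e0] by [hform_shifted], and on such
    vectors the first square vanishes only at 0. *)
Lemma energy_form_gt0 x : x != 0 -> 0 < energy_form M x.
Proof.
move=> x0; rewrite lt_neqAle energy_form_ge0 andbT eq_sym; apply: contra x0.
rewrite /energy_form paddr_eq0 ?sqr_ge0 ?hform_ge0// sqrf_eq0 => /andP[/eqP a0 /eqP h0].
have [c [s [t [E t0 xE]]]] := hform_shifted x.
move: E; rewrite h0 => /esym/eqP; rewrite paddr_eq0 ?sqr_ge0//; last first.
  by rewrite mulr_ge0// ltW.
rewrite [M ord0 ord0 * t == 0]mulf_eq0 (gt_eqF g0) /= => /andP[_ /eqP /xE xc].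
move: a0; rewrite xc mformZr mform_e0 => /eqP; rewrite mulf_eq0.
by rewrite (gt_eqF g0) orbF => /eqP ->; rewrite scale0r.
Qed.

(* The flux through [w] of the energy-momentum form of [x] for the field M e0. *)
Definition flux_form w x : R :=
  2 * mform M w x * mform M e0 x - mform M e0 w * mform M x x.

(** The combination of [w] and [x] in [H] is orthogonal to [e0], hence the form is nonpositive on
    it; this is the completed square. Dividing by [M ord0 ord0 * s], which is negative, isolates the
    flux. *)
Lemma flux_form_le w x : mform M e0 w < 0 ->
  flux_form w x <= mform M w w / mform M e0 w * mform M e0 x ^+ 2.
Proof.
move=> s0; set s := mform M e0 w in s0 *.
have H := hform_ge0 (mform M e0 x *: w + (- s) *: x).
have E : hform M (mform M e0 x *: w + (- s) *: x) (mform M e0 x *: w + (- s) *: x) =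
    M ord0 ord0 * s * (flux_form w x) - M ord0 ord0 * mform M w w * mform M e0 x ^+ 2.
  rewrite /hform /flux_form !mformDl !mformDr !mformZl !mformZr (mform_sym x w sM) -/s.
  by ring.
rewrite E -!mulrA -mulrBr pmulr_rge0// subr_ge0 in H.
rewrite mulrAC ler_ndivlMr//.
by rewrite [leRHS]mulrC.
Qed.

End one_form.

End lorentz_algebra.

(** * Bounds on the operator *)

Section square_norm.
Variable R : realType.

Definition sq n (x : 'rV[R]_n) : R := \sum_j x ord0 j ^+ 2.

Lemma sq_ge0 n (x : 'rV[R]_n) : 0 <= sq x.
Proof. by apply: sumr_ge0 => i _; exact: sqr_ge0. Qed.

Lemma sqZ n (c : R) (x : 'rV[R]_n) : sq (c *: x) = c ^+ 2 * sq x.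
Proof. by rewrite /sq mulr_sumr; apply: eq_bigr => i _; rewrite mxE exprMn. Qed.

Lemma le_sq n (x : 'rV[R]_n) j : x ord0 j ^+ 2 <= sq x.
Proof. by rewrite /sq (bigD1 j)//= lerDl; apply: sumr_ge0 => i _; exact: sqr_ge0. Qed.

Lemma norm_le_sq n (x : 'rV[R]_n) j : `|x ord0 j| <= Num.sqrt (sq x).
Proof. by rewrite -sqrtr_sqr ler_wsqrtr// le_sq. Qed.

Lemma sum_sq_le n (c : 'I_n -> R) (B : R) (x : 'rV[R]_n) : (forall j, `|c j| <= B) ->
  `|\sum_j c j * x ord0 j| <= n%:R * B * Num.sqrt (sq x).
Proof.
move=> cB; rewrite (le_trans (ler_norm_sum _ _ _))//.
rewrite -mulrA -[n in n%:R](card_ord n) -sum1_card natr_sum mulr_suml.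
apply: ler_sum => j _; rewrite mul1r normrM; apply: ler_pM => //.
exact: norm_le_sq.
Qed.

End square_norm.

Lemma sum_continuous (R : realType) (T : topologicalType) (I : Type) (r : seq I)
    (F : I -> T -> R) : (forall i, continuous (F i)) ->
  continuous (fun x => \sum_(i <- r) F i x).
Proof.
move=> cF; elim: r => [|i r IH].
  by under eq_fun do rewrite big_nil; move=> x; exact: cvg_cst.
under eq_fun do rewrite big_cons.
by move=> x; apply: (@cvgD _ R^o); [exact: cF|exact: IH].
Qed.

Section bounded_c1.
Variables (R : realType) (n : nat).
Implicit Types f g : 'rV[R]_n -> R.

Definition bdd1 f := Cinf f /\ exists M : R,
  forall x, `|f x| <= M /\ forall j, `|partial f j x| <= M.

Lemma bdd1_cst (c : R) : bdd1 (fun=> c).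
Proof.
split; first exact: smooth_cst.
exists `|c| => x; split => // j.
have -> : partial (fun=> c) j x = 0 by exact: (congr1 (@^~ x) (partial_cst c j)).
by rewrite normr0.
Qed.

Lemma bdd1M f g : bdd1 f -> bdd1 g -> bdd1 (fun x => f x * g x).
Proof.
move=> [sf [M HM]] [sg [N HN]]; split; first exact: smoothM.
exists (M * N + M * N) => x; have [f1 f2] := HM x; have [g1 g2] := HN x.
have M0 : 0 <= M by exact: le_trans f1.
have N0 : 0 <= N by exact: le_trans g1.
split => [|j].
  by rewrite normrM (le_trans (ler_pM _ _ f1 g1))// lerDl mulr_ge0.
rewrite partialM// (le_trans (ler_normD _ _))// !normrM.
by apply: lerD; apply: ler_pM.
Qed.

Lemma bdd1D f g : bdd1 f -> bdd1 g -> bdd1 (fun x => f x + g x).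
Proof.
move=> [sf [M HM]] [sg [N HN]]; split; first exact: smoothD.
exists (M + N) => x; have [f1 f2] := HM x; have [g1 g2] := HN x.
split => [|j]; first by rewrite (le_trans (ler_normD _ _))// lerD.
by rewrite partialD// (le_trans (ler_normD _ _))// lerD.
Qed.

Lemma bdd1_sum (I : Type) (r : seq I) (F : I -> 'rV[R]_n -> R) :
  (forall i, bdd1 (F i)) -> bdd1 (fun x => \sum_(i <- r) F i x).
Proof.
move=> H; elim: r => [|i r IH].
  by under eq_fun do rewrite big_nil; exact: bdd1_cst.
by under eq_fun do rewrite big_cons; apply: bdd1D.
Qed.

Lemma bdd1_prod (I : Type) (r : seq I) (F : I -> 'rV[R]_n -> R) :
  (forall i, bdd1 (F i)) -> bdd1 (fun x => \prod_(i <- r) F i x).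
Proof.
move=> H; elim: r => [|i r IH].
  by under eq_fun do rewrite big_nil; exact: bdd1_cst.
by under eq_fun do rewrite big_cons; apply: bdd1M.
Qed.

End bounded_c1.

Lemma det_bounded (R : realType) n (B : R) : 0 <= B -> exists2 M : R, 0 < M &
  forall A : 'M[R]_n, (forall i j, `|A i j| <= B) -> `|\det A| <= M.
Proof.
move=> B0; exists (\sum_(s : {perm 'I_n}) B ^+ n + 1).
  by rewrite ltr_wpDl// sumr_ge0// => s _; rewrite exprn_ge0.
move=> A AB; rewrite /determinant (le_trans (ler_norm_sum _ _ _))//.
rewrite ler_wpDr//; apply: ler_sum => s _.
rewrite normrM normrX normrN1 expr1n mul1r normr_prod.
rewrite -[n in B ^+ n](card_ord n) -prodr_const; apply: ler_prod => i _.
by rewrite normr_ge0 AB.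
Qed.

Section wave_operator.
Variables (R : realType) (n : nat) (G : 'rV[R]_n -> 'M[R]_n.+1) (C0 : R).
Hypothesis hG : wave_coefficients G C0.

Lemma G_bdd1 j k : bdd1 (fun x => G x j k).
Proof.
split; first by apply/CinfP; exact: wave_smooth hG j k.
have [M0 H0] := wave_bounded hG j k [::].
have /choice[M1 H1] i := wave_bounded hG j k [:: i].
exists (`|M0| + \sum_i `|M1 i|) => x; split => [|i].
  by rewrite (le_trans (H0 x))// (le_trans (ler_norm _))// lerDl sumr_ge0.
rewrite (le_trans (H1 i x))// (le_trans (ler_norm _))//.
rewrite (bigD1 i)//= addrCA lerDl addr_ge0// sumr_ge0//.
Qed.

Lemma G_bound : exists2 B : R, 0 < B & forall x j k,
  `|G x j k| <= B /\ forall i, `|partial (fun y => G y j k) i x| <= B.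
Proof.
have H j k := (G_bdd1 j k).2.
have /choice[f Hf] jk : exists M : R, forall x, `|G x jk.1 jk.2| <= M /\
   forall i, `|partial (fun y => G y jk.1 jk.2) i x| <= M by exact: H.
exists (\sum_(jk : 'I_n.+1 * 'I_n.+1) `|f jk| + 1).
  by rewrite ltr_wpDl// sumr_ge0.
move=> x j k; have fB : f (j, k) <= \sum_(jk : 'I_n.+1 * 'I_n.+1) `|f jk| + 1.
  rewrite (le_trans (ler_norm _))// ler_wpDr// (bigD1 (j, k))//= lerDl sumr_ge0//.
have [h1 h2] := Hf (j, k) x.
by split => [|i]; [exact: le_trans h1 fB|exact: le_trans (h2 i) fB].
Qed.

Let sG x : (G x)^T = G x := wave_sym hG x.
Let LG x : lorentzian (G x) := wave_signature hG x.
Let C00 : 0 < C0 := wave_C0 hG.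
Let GC x : C0 <= G x ord0 ord0 := wave_time hG x.

(** Decompose [xi] into its time part and a spatial part [eta]. As [hform] ignores [e0], the
    assumption on the spatial form at infinity makes it at least [C0 ^+ 2 * sq xi']; this controls
    [eta], after which the first square of the energy form controls the time component. *)
Let coercive_far : exists r : R, exists2 c : R, 0 < c & forall x xi, r <= `|x| ->
  c * sq xi <= energy_form (G x) xi.
Proof.
have [r Hr] := wave_space hG; have [B B0 HB] := G_bound.
pose K := (n%:R * B) ^+ 2.
have K0 : 0 <= K by exact: sqr_ge0.
(* The last summand bounds [sq xi'] by the energy ([H2]), the first one the square of the time
   component ([H4]); [K] bounds the square of [be] relative to [sq xi']. *)
pose L := C0 ^- 2 * (2 + 2 * K * C0 ^- 2) + C0 ^- 2.
have L0 : 0 < L.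
  have c2 : 0 < C0 ^- 2 by rewrite invr_gt0 exprn_gt0.
  by rewrite /L addr_gt0// mulr_gt0// ltr_wpDr// !mulr_ge0// ltW.
exists r, L^-1; first by rewrite invr_gt0.
move=> x xi xr; rewrite ler_pdivrMl//.
pose eta := xi + (- xi ord0 ord0) *: e0 R n.
have eta0 : eta ord0 ord0 = 0 by rewrite !mxE !eqxx mulr1 subrr.
pose xi' : 'rV[R]_n := del_row ord0 xi.
have etaS k : eta ord0 (lift ord0 k) = xi' ord0 k.
  by rewrite !mxE /= mulr0 addr0.
have h1 : mform (G x) eta eta <= - C0 * sq xi'.
  apply: le_trans (Hr x xr xi'); rewrite /mform big_ord_recl.
  rewrite big1 ?add0r; last by move=> k _; rewrite eta0 mulr0 mul0r.
  apply: ler_sum => j _; rewrite big_ord_recl eta0 mulr0 add0r.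
  by apply: ler_sum => k _; rewrite !etaS [spatial_part _ _ _]mxE.
pose be := mform (G x) (e0 R n) eta.
have h2 : be ^+ 2 <= K * sq xi'.
  rewrite /be mform_e0l big_ord_recl eta0 mulr0 add0r.
  under eq_bigr do rewrite etaS.
  have := @sum_sq_le _ _ (fun k => G x ord0 (lift ord0 k)) B xi'
    (fun k => (HB x _ _).1).
  rewrite -ler_sqr ?nnegrE// ?mulr_ge0 ?sqrtr_ge0// ?(ltW B0)//.
  by rewrite real_normK ?num_real// exprMn sqr_sqrtr ?sq_ge0.
have hE : hform (G x) xi xi = be ^+ 2 - G x ord0 ord0 * mform (G x) eta eta.
  by rewrite -(hform_shift (sG x) xi (- xi ord0 ord0)) /hform expr2.
have aE : mform (G x) (e0 R n) xi = G x ord0 ord0 * xi ord0 ord0 + be.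
  rewrite /be /eta mformDr mformZr mform_e0.
  by move: (mform _ _ _) (G x ord0 ord0) (xi ord0 ord0) => *; ring.
have sqE : sq xi = xi ord0 ord0 ^+ 2 + sq xi'.
  by rewrite /sq big_ord_recl; congr (_ + _); apply: eq_bigr => k _; rewrite mxE.
rewrite sqE /energy_form hE aE; clear hE aE sqE etaS eta0.
have := GC x; have := sq_ge0 xi'; move: h1 h2; rewrite /L.
rewrite -/be; move: be (mform (G x) eta eta) (sq xi') (G x ord0 ord0) (xi ord0 ord0) => b m s g z.
move=> h1 h2 s0 gC.
set E := _ + (_ - _).
have g0 : 0 < g by exact: lt_le_trans gC.
have H1 : C0 ^+ 2 * s <= - (g * m).
  rewrite -mulrN; apply: (@le_trans _ _ (C0 * (C0 * s))); first by rewrite mulrA.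
  by apply: ler_pM => //; [exact: ltW|rewrite mulr_ge0// ltW|lra].
have E0 : C0 ^+ 2 * s <= E by rewrite /E; have := sqr_ge0 (g * z + b); have := sqr_ge0 b; lra.
have c2 : 0 < C0 ^+ 2 by rewrite exprn_gt0.
have H2 : s <= C0 ^- 2 * E by rewrite ler_pdivlMl.
have H3 : C0 ^+ 2 * z ^+ 2 <= 2 * (g * z + b) ^+ 2 + 2 * b ^+ 2.
  apply: (@le_trans _ _ ((g * z) ^+ 2)).
    rewrite exprMn; apply: ler_wpM2r; first exact: sqr_ge0.
    by rewrite ler_sqr// nnegrE ltW.
  by have := sqr_ge0 (g * z + 2 * b); lra.
have H4 : C0 ^+ 2 * z ^+ 2 <= (2 + 2 * K * C0 ^- 2) * E.
  have : (g * z + b) ^+ 2 <= E.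
    have s1 : 0 <= C0 ^+ 2 * s by apply: mulr_ge0 => //; exact: ltW.
    by rewrite /E lerDl; apply: addr_ge0; [exact: sqr_ge0|exact: le_trans s1 H1].
  have : K * s <= K * (C0 ^- 2 * E) by rewrite ler_wpM2l.
  by move: h2 H3; rewrite -/K; lra.
rewrite mulrDl; apply: lerD => //.
by rewrite -[X in _ <= X]mulrA ler_pdivlMl.
Qed.

(** The energy form is quadratic in [xi], so its minimum over the compact product of the ball and
    the Euclidean unit sphere, where it is positive and continuous, serves as the constant. *)
Let coercive_near (r : R) : exists2 c : R, 0 < c & forall x xi, `|x| <= r ->
  c * sq xi <= energy_form (G x) xi.
Proof.
pose A := [set x : 'rV[R]_n | `|x| <= r].
pose S := [set xi : 'rV[R]_n.+1 | sq xi = 1].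
have cA : compact A.
  apply: bounded_closed_compact.
    by exists r; split; [exact: num_real|move=> x rx y /= yr; exact: le_trans yr (ltW rx)].
  apply: (@closed_comp _ _ (fun x : 'rV[R]_n => `|x|) [set t | t <= r]); last exact: closed_le.
  by move=> x _; exact: norm_continuous.
have csq : continuous (@sq R n.+1).
  apply: sum_continuous => i x.
  have cc : (fun y : 'rV[R]_n.+1 => y ord0 i) @ nbhs x --> x ord0 i.
    exact: coord_continuous.
  exact: (cvgM cc cc).
have cS : compact S.
  apply: bounded_closed_compact.
    exists 1; split; [exact: num_real|move=> x rx y /= y1].
    rewrite [leLHS]/Num.norm /= mx_normrE; apply/bigmax_leP; split.
      exact: le_trans ler01 (ltW rx).
    move=> [i k] _ /=; rewrite (ord1 i) (le_trans (norm_le_sq _ _))// y1 sqrtr1.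
    exact: ltW.
  apply: (@closed_comp _ _ (@sq R n.+1) [set t | t = 1]); last exact: closed_eq.
  by move=> x _; exact: csq.
pose F (p : 'rV[R]_n * 'rV[R]_n.+1) := energy_form (G p.1) p.2.
have cG j k : continuous (fun p : 'rV[R]_n * 'rV[R]_n.+1 => G p.1 j k).
  move=> p; apply: (@cvg_comp _ _ _ fst (fun x => G x j k) _ (nbhs p.1)).
    exact: cvg_fst.
  by apply: smooth_continuous; exact: (G_bdd1 j k).1.
have cx j : continuous (fun p : 'rV[R]_n * 'rV[R]_n.+1 => p.2 ord0 j).
  move=> p; apply: (@cvg_comp _ _ _ snd (fun x : 'rV[R]_n.+1 => x ord0 j) _ (nbhs p.2)).
    exact: cvg_snd.
  exact: coord_continuous.
have cM1 : continuous (fun p : 'rV[R]_n * 'rV[R]_n.+1 => mform (G p.1) (e0 R n) p.2).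
  under eq_fun do rewrite mform_e0l.
  by apply: sum_continuous => k p; apply: cvgM; [exact: cG|exact: cx].
have cM2 : continuous (fun p : 'rV[R]_n * 'rV[R]_n.+1 => mform (G p.1) p.2 p.2).
  apply: sum_continuous => j; apply: sum_continuous => k p.
  by apply: cvgM; [apply: cvgM; [exact: cG|exact: cx]|exact: cx].
have cF : continuous F.
  move=> p; apply: (@cvgD _ R^o).
    by rewrite expr2; under eq_fun do rewrite expr2; apply: cvgM; exact: cM1.
  apply: (@cvgB _ R^o); apply: cvgM; try exact: cM1; [exact: cG|exact: cM2].
have cAS : compact (A `*` S) by exact: compact_setX.
have [[x0 Ax0]|A0] := pselect (A !=set0); last first.
  by exists 1 => // x xi xr; exfalso; apply: A0; exists x.
have S1 : S (e0 R n).
  rewrite /S /= /sq (bigD1 ord0)//= big1 ?addr0; first by rewrite mxE !eqxx expr1n.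
  by move=> i i0; rewrite mxE eqxx /= (negbTE i0) expr0n.
have cFs : {within A `*` S, continuous F} by exact: continuous_subspaceT.
have [p /set_mem [Ap Sp] Hp] := @compact_EVT_min _ R F (A `*` S)
  (ex_intro _ (x0, e0 R n) (conj Ax0 S1)) cAS cFs.
have Fp : 0 < F p.
  apply: (energy_form_gt0 (sG _) (LG _) C00 (GC _)).
  apply: contraPneq Sp => ->; rewrite /S /= /sq big1; first by move/esym/eqP; rewrite oner_eq0.
  by move=> i _; rewrite mxE expr0n.
exists (F p) => // x xi xr.
have [->|xi0] := eqVneq (sq xi) 0.
  by rewrite mulr0 (energy_form_ge0 (sG _) (LG _) C00 (GC _)).
have s0 : 0 < sq xi by rewrite lt_neqAle eq_sym xi0 sq_ge0.
pose c := (Num.sqrt (sq xi))^-1.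
have c2 : c ^+ 2 = (sq xi)^-1 by rewrite /c exprVn sqr_sqrtr// sq_ge0.
have : F p <= energy_form (G x) (c *: xi).
  apply: (Hp (x, c *: xi)); apply/mem_set; split => //=.
  by rewrite /S /= sqZ c2 mulVf.
have -> : energy_form (G x) (c *: xi) = c ^+ 2 * energy_form (G x) xi.
  by rewrite /energy_form /hform !mformZl !mformZr; ring.
by rewrite c2 mulrC ler_pdivlMr.
Qed.

Lemma coercive : exists2 c : R, 0 < c & forall x xi,
  c * sq xi <= energy_form (G x) xi.
Proof.
have [r [c1 c10 H1]] := coercive_far; have [c2 c20 H2] := coercive_near r.
exists (Num.min c1 c2) => [|x xi]; first by rewrite lt_min c10.
have m1 : Num.min c1 c2 * sq xi <= c1 * sq xi.
  by rewrite ler_wpM2r ?sq_ge0// ge_min lexx.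
have m2 : Num.min c1 c2 * sq xi <= c2 * sq xi.
  by rewrite ler_wpM2r ?sq_ge0// ge_min lexx orbT.
have [h|h] := leP r `|x|; first exact: le_trans m1 (H1 x xi h).
exact: le_trans m2 (H2 x xi (ltW h)).
Qed.

Definition ndet (x : 'rV[R]_n) : R := (-1) ^+ n * \det (G x).

Let ndet_gt0 x : 0 < ndet x.
Proof.
have [P uP E] := LG x.
have dP : \det P != 0 by move: uP; rewrite unitmxE unitfE.
have : \det P ^+ 2 * ndet x = 1.
  have := congr1 determinant E; rewrite !det_mulmx det_tr det_diag big_ord_recl !mxE /= mul1r.
  have -> : \prod_(i < n) (\row_j (if j == ord0 then 1 else -1)) ord0 (lift ord0 i) = (-1) ^+ n :> R.
    rewrite -[n in RHS](card_ord n) -prodr_const; apply: eq_bigr => i _.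
    by rewrite mxE.
  move=> E'; rewrite /ndet mulrCA -[RHS](sqrr_sign R n) expr2; congr (_ * _).
  by rewrite -E'; ring.
move=> H; rewrite -(pmulr_rgt0 _ (_ : 0 < \det P ^+ 2)) ?H//.
by rewrite exprn_even_gt0.
Qed.

Let unitG x : G x \in unitmx.
Proof.
rewrite unitmxE unitfE; have := ndet_gt0 x.
by apply: contraTneq => d0; rewrite /ndet d0 mulr0 ltxx.
Qed.

(** Coercivity makes [G x] invertible uniformly in [x]. The energy form is at most twice
    [sq (xi *m G x)] plus a bounded multiple of the pairing of [xi] with [xi *m G x]; Young's
    inequality with weight [d = c / (2 * B)] absorbs the latter into half of [c * sq xi]. *)
Let sq_le_mul : exists2 K : R, 0 < K & forall x (xi : 'rV[R]_n.+1),
  sq xi <= K * sq (xi *m G x).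
Proof.
have [c c0 Hc] := coercive; have [B B0 HB] := G_bound.
pose d := c / (2 * B).
have d0 : 0 < d by rewrite divr_gt0// mulr_gt0.
exists (2 / c * (2 + B / d)).
  by rewrite mulr_gt0 ?divr_gt0// addr_gt0// divr_gt0.
move=> x xi; have := Hc x xi; rewrite /energy_form /hform -!expr2.
have a2 : mform (G x) (e0 R n) xi ^+ 2 <= sq (xi *m G x).
  rewrite (_ : mform _ _ _ = (xi *m G x) ord0 ord0); first exact: le_sq.
  rewrite mform_e0l mxE; apply: eq_bigr => k _.
  by rewrite -{1}(sG x) mxE mulrC.
have b2 : `|mform (G x) xi xi| <= d * sq xi + d^-1 * sq (xi *m G x).
  rewrite mformE; move: (xi *m G x) => v.
  rewrite mxE (le_trans (ler_norm_sum _ _ _))//.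
  rewrite /sq !mulr_sumr -big_split /=; apply: ler_sum => k _.
  rewrite [_^T k ord0]mxE normrM; move: (v ord0 k) (xi ord0 k) => a b.
  rewrite -[a ^+ 2]real_normK ?num_real// -[b ^+ 2]real_normK ?num_real//.
  have := normr_ge0 a; have := normr_ge0 b; move: `|a| `|b| => {}a {}b b0 a0.
  have H : 0 <= d^-1 * (d * b - a) ^+ 2 by rewrite mulr_ge0 ?sqr_ge0// invr_ge0 ltW.
  have E : d^-1 * (d * b - a) ^+ 2 = d * b ^+ 2 + d^-1 * a ^+ 2 - 2 * (a * b).
    by field; rewrite gt_eqF.
  have : 0 <= a * b by rewrite mulr_ge0.
  by rewrite E in H; clear E; lra.
have g1 : G x ord0 ord0 * - mform (G x) xi xi <= B * (d * sq xi + d^-1 * sq (xi *m G x)).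
  rewrite (le_trans (ler_norm _))// normrM normrN; apply: ler_pM => //.
  exact: (HB x _ _).1.
have Bd : B * (d * sq xi) = c / 2 * sq xi.
  by rewrite /d; field; rewrite gt_eqF.
move: a2 g1; rewrite mulrDr Bd mulrN; move: (mform _ _ _ ^+ 2) (_ * mform _ _ _) => a m.
have := sq_ge0 xi; have := sq_ge0 (xi *m G x); move: (sq xi) (sq (xi *m G x)) => s t.
move=> t0 s0 a2 g1 H.
have H1 : c / 2 * s <= (2 + B / d) * t by move: H a2 g1; lra.
have -> : s = 2 / c * (c / 2 * s) by field; rewrite gt_eqF.
by rewrite -[X in _ <= X]mulrA ler_wpM2l// divr_ge0// ltW.
Qed.

(** By [sq_le_mul] applied to its rows, the inverse of [G x] has entries bounded uniformly in [x],
    so its determinant is bounded. The logarithmic derivative of the density in [drift] is bounded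
    for this reason. *)
Lemma ndet_ge : exists2 d : R, 0 < d & forall x, d <= ndet x.
Proof.
have [K K0 HK] := sq_le_mul.
have [M M0 HM] := det_bounded n.+1 (sqrtr_ge0 K).
exists M^-1 => [|x]; first by rewrite invr_gt0.
have H : `|\det (invmx (G x))| <= M.
  apply: HM => i j; rewrite -sqrtr_sqr ler_wsqrtr//.
  have := HK x (row i (invmx (G x))).
  rewrite -row_mul mulVmx// [X in K * X](_ : _ = 1) ?mulr1.
    by apply: le_trans; have := le_sq (row i (invmx (G x))) j; rewrite mxE.
  rewrite /sq (bigD1 i)//= big1 ?addr0; first by rewrite !mxE eqxx expr1n.
  by move=> k ki; rewrite !mxE eq_sym (negbTE ki) expr0n.
have E : `|\det (invmx (G x))| = (ndet x)^-1.
  rewrite det_inv normrV; last by rewrite -unitmxE.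
  by rewrite -[ndet x]gtr0_norm// normrM normrX normrN1 expr1n mul1r.
by move: H; rewrite E -[M in _ <= M]invrK lef_pV2 ?posrE ?invr_gt0.
Qed.

Let ndet_bdd1 : bdd1 ndet.
Proof.
apply: bdd1M; first exact: bdd1_cst.
rewrite /determinant; apply: bdd1_sum => s; apply: bdd1M; first exact: bdd1_cst.
by apply: bdd1_prod => i; exact: G_bdd1.
Qed.

(** For [s > 0], the [k]-th derivative of [s^(-1/2)], in the form that [smooth_comp] expects; the
    density is [pw 0] of [ndet]. *)
Let pw (k : nat) (s : R) : R :=
  (\prod_(i < k) (- 2^-1 - i%:R)) * expR ((- 2^-1 - k%:R) * ln s).

Let densityE x : density G x = pw 0 (ndet x).
Proof.
rewrite /pw big_ord0 mul1r subr0 /density /metric_det.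
have -> : (-1) ^+ n * (\det (G x))^-1 = (ndet x)^-1.
  by rewrite /ndet invfM -exprVn invrN invr1.
have d0 := ndet_gt0 x.
rewrite -[X in Num.sqrt X^-1](lnK (_ : ndet x \is Num.pos)) ?posrE// -expRN.
rewrite (_ : - ln (ndet x) = - 2^-1 * ln (ndet x) *+ 2); last first.
  by rewrite -mulr_natr; field.
by rewrite mulr2n expRD -expr2 sqrtr_sqr ger0_norm ?expR_ge0.
Qed.

Let is_derive_pw k (s : R) : 0 < s -> is_derive s 1 (pw k) (pw k.+1 s).
Proof.
move=> s0; have dl : is_derive s 1 (fun t : R => (- 2^-1 - k%:R) * ln t)
    ((- 2^-1 - k%:R) * s^-1).
  apply: is_derive_eq (is_deriveM (is_derive_cst _ _ _) (is_derive1_ln s0)) _.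
  by rewrite scaler0 addr0.
have de := is_derive1_comp (g := fun t : R => (- 2^-1 - k%:R) * ln t)
  (is_derive_expR _) dl.
apply: is_derive_eq (is_deriveM (is_derive_cst _ _ _) de) _.
rewrite scaler0 addr0 /pw big_ord_recr /= /GRing.scale /= -!mulrA; congr (_ * _).
rewrite -{2}[s](lnK (_ : s \is Num.pos)) ?posrE// -expRN mulrCA -expRD; congr (_ * expR _).
by rewrite -natr1; ring.
Qed.

Lemma smooth_density : Cinf (density G).
Proof.
rewrite (_ : density G = fun x => pw 0 (ndet x)); last by apply/funext => x; rewrite densityE.
apply: smooth_comp; last exact: ndet_bdd1.1.
by move=> k x; exact: is_derive_pw.
Qed.

Lemma density_gt0 x : 0 < density G x.
Proof. by rewrite densityE /pw big_ord0 mul1r expR_gt0. Qed.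

Lemma partial_density i x :
  partial (density G) i x = density G x * (- 2^-1 * (ndet x)^-1 * partial ndet i x).
Proof.
have d0 := ndet_gt0 x.
rewrite (_ : density G = fun x => pw 0 (ndet x)); last by apply/funext => y; rewrite densityE.
transitivity (pw 1 (ndet x) * partial ndet i x).
  apply: partial_val; apply: (is_derive_comp1 (g := pw 0)); first by apply: smooth_derivable; exact: ndet_bdd1.1.
  exact: is_derive_pw.
rewrite mulrA; congr (_ * _); rewrite /pw big_ord0 big_ord_recl big_ord0 !mul1r mulr1 subr0.
rewrite [RHS]mulrCA; congr (_ * _).
rewrite -[X in _ = _ * X^-1](lnK (_ : ndet x \is Num.pos)) ?posrE// -expRN -expRD.
by congr expR; ring.
Qed.

(* The first-order coefficients rho^-1 sum_j d_j(rho G_jk) of the operator,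
   where rho = ndet^(-1/2); the term j = 0 vanishes. *)
Definition drift (k : 'I_n.+1) (x : 'rV[R]_n) : R :=
  \sum_(j < n) (partial (fun y => G y (lift ord0 j) k) j x +
     G x (lift ord0 j) k * (- 2^-1 * (ndet x)^-1 * partial ndet j x)).

Lemma drift_bounded : exists M : R, forall k x, `|drift k x| <= M.
Proof.
have [B B0 HB] := G_bound; have [d d0 Hd] := ndet_ge.
have [_ [N HN]] := ndet_bdd1.
exists (\sum_(j < n) (B + B * (2^-1 * d^-1 * N))) => k x.
rewrite (le_trans (ler_norm_sum _ _ _))//; apply: ler_sum => j _.
have [h1 h2] := HB x (lift ord0 j) k.
rewrite (le_trans (ler_normD _ _))//; apply: lerD; first exact: h2.
rewrite normrM; apply: ler_pM => //; rewrite !normrM; apply: ler_pM => //.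
- rewrite normrN (ger0_norm (_ : 0 <= 2^-1)) ?invr_ge0//; apply: ler_pM => //.
  rewrite gtr0_norm ?invr_gt0// lef_pV2 ?posrE//.
- by have [_] := HN x; exact.
Qed.

Lemma measurable_drift k : measurable_fun setT (drift k).
Proof.
apply: measurable_sum => j; apply: measurable_funD.
  apply: continuous_measurable_rV; apply: smooth_continuous; apply: smooth_partial.
  exact: (G_bdd1 _ _).1.
apply: measurable_funM.
  by apply: continuous_measurable_rV; apply: smooth_continuous; exact: (G_bdd1 _ _).1.
apply: measurable_funM.
  apply: measurable_funM => //.
  rewrite (_ : (fun x => _) = (fun x => (ndet x)^-1))//.
  apply: continuous_measurable_rV => x.
  have nz : ndet x != 0 by rewrite gt_eqF.
  have cd : ndet @ nbhs x --> ndet x by apply: smooth_continuous; exact: ndet_bdd1.1.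
  exact: (cvgV nz cd).
apply: continuous_measurable_rV; apply: smooth_continuous; apply: smooth_partial.
exact: ndet_bdd1.1.
Qed.

End wave_operator.

(** * Hypersurfaces *)

Section level_sets.
Variables (R : realType) (n : nat).
Implicit Types (f psi : 'rV[R]_n -> R) (x y z v : 'rV[R]_n).
Notation e k := (delta_mx ord0 k : 'rV[R]_n).

Lemma norm_e_le (s : R) k : `|s *: e k| <= `|s|.
Proof. by rewrite normrZ ler_piMr// norm_delta_mx. Qed.

Lemma small_deriv f x v (d eps : R) : is_derive x v f d -> 0 < eps ->
  exists2 del : R, 0 < del & forall t, `|t| < del -> `|f (x + t *: v) - f x - t * d| <= eps * `|t|.
Proof.
move=> [df <-] eps0.
have : (fun h : R => h^-1 *: ((f \o shift x) (h *: v) - f x)) @ 0^' --> 'D_v f x by exact: df.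
move=> /cvgrPdist_le/(_ _ eps0); rewrite near_withinE => /nbhs_normP[del /= del0 H].
exists del => // t tdel; have [->|t0] := eqVneq t 0.
  by rewrite scale0r addr0 subrr mul0r subrr !normr0 mulr0.
have := H t; rewrite /ball_ /= sub0r normrN => /(_ tdel t0).
rewrite -(ler_pM2r (_ : 0 < `|t|)) ?normr_gt0// -normrM; apply: le_trans.
rewrite distrC mulrBl [X in X - _]mulrC /GRing.scale /= mulrAC mulVf// mul1r.
by rewrite (addrC (scalemx t v) x).
Qed.

(** Connectedness of a segment: the function equal to 1 on [A] and to -1 off it would be continuous
    along the segment and would have to vanish somewhere. *)
Lemma segment_side (A B : set 'rV[R]_n) x y : open A -> open B -> A `&` B = set0 ->
  (forall s : R, 0 <= s <= 1 -> (A `|` B) (x + s *: (y - x))) -> A x -> A y.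
Proof.
move=> oA oB AB H Ax; apply: contrapT => nAy.
pose g (s : R) : R := if `[< A (x + s *: (y - x)) >] then 1 else -1.
have cl : continuous (fun s : R => x + s *: (y - x)).
  move=> s; apply: cvgD; first exact: cvg_cst.
  by apply: cvgZr_tmp; exact: cvg_id.
have cg : {within `[0, 1], continuous g}.
  apply: continuous_in_subspaceT => s /set_mem; rewrite /= in_itv /= => s01.
  have [As|Bs] := H s s01.
    have nA : \forall u \near s, A (x + u *: (y - x)).
      by apply: cl; exact: open_nbhs_nbhs.
    apply: (@cvg_trans _ (cst 1 @ nbhs s)).
      apply: near_eq_cvg; near=> u; rewrite /g asboolT//; near: u; exact: nA.
    by rewrite /g asboolT//; exact: cvg_cst.
  have nB : \forall u \near s, B (x + u *: (y - x)).
    by apply: cl; exact: open_nbhs_nbhs.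
  have disj u : B u -> ~ A u by move=> Bu Au; have : (A `&` B) u by []; rewrite AB.
  apply: (@cvg_trans _ (cst (-1) @ nbhs s)).
    apply: near_eq_cvg; near=> u; rewrite /g asboolF//; apply: disj; near: u; exact: nB.
  by rewrite /g asboolF; [exact: cvg_cst|exact: disj].
have g0 : g 0 = 1 by rewrite /g scale0r addr0 asboolT.
have g1 : g 1 = -1 by rewrite /g scale1r addrC subrK asboolF.
have [|s _] := IVT (v := 0) (@ler01 R) cg.
  by rewrite g0 g1 ge_min le_max ler01 lerN10 orbT.
by rewrite /g; case: asboolP => _ /eqP; rewrite ?oppr_eq0 oner_eq0.
Unshelve. all: by end_near.
Qed.

(** In direction [e k] the function varies monotonically at rate at least [d], with sign [sig];
    going [|psi x| / d] in both directions brackets 0. The last assumption on [x] keeps this segment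
    in the ball where the rate is known. *)
Lemma zero_along psi y k (d sig r : R) : Cinf psi -> 0 < d -> sig ^+ 2 = 1 ->
  (forall x, `|x - y| < r -> d <= sig * partial psi k x) ->
  forall x, `|x - y| + `|psi x| / d < r ->
  exists2 h : R, `|h| <= `|psi x| / d & psi (x + h *: e k) = 0.
Proof.
move=> spsi; move=> d0 s1 H x; set h0 := `|psi x| / d => xr.
have h00 : 0 <= h0 by rewrite divr_ge0// ltW.
have h0d : `|psi x| = h0 * d by rewrite divfK// gt_eqF.
clearbody h0.
have ns : `|sig| = 1 by apply/eqP; rewrite -(@eqrXn2 _ 2) ?normr_ge0// real_normK ?num_real// s1 expr1n.
have near_x (c : R) : `|c| <= h0 -> `|x + c *: e k - y| < r.
  move=> ch; rewrite addrAC (le_lt_trans (ler_normD _ _))//.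
  by rewrite (le_lt_trans _ xr)// lerD2l (le_trans (norm_e_le _ _)).
have key (u : R) : u ^+ 2 = 1 -> u * psi x + `|psi x| <= u * psi (x + (u * sig * h0) *: e k).
  move=> u1; have nu : `|u| = 1.
    by apply/eqP; rewrite -(@eqrXn2 _ 2) ?normr_ge0// real_normK ?num_real// u1 expr1n.
  have [c cb E] := mean_value_partial k x (u * sig * h0) spsi.
  have nh : `|u * sig * h0| = h0 by rewrite !normrM nu ns !mul1r ger0_norm.
  rewrite nh in cb; have := H _ (near_x _ cb); move: E.
  move: (psi (x + _)) (partial psi k _) => p q E dq.
  have -> : p = psi x + u * sig * h0 * q by rewrite -E addrC subrK.
  rewrite mulrDr lerD2l (_ : u * (u * sig * h0 * q) = u ^+ 2 * (h0 * (sig * q))); last by ring.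
  rewrite u1 mul1r h0d.
  by rewrite ler_wpM2l.
have cf : continuous (fun s : R => psi (x + s *: e k)).
  move=> s; apply: (@cvg_comp _ _ _ (fun s : R => x + s *: e k) psi _ (nbhs (x + s *: e k))).
    apply: cvgD; first exact: cvg_cst.
    by apply: cvgZr_tmp; exact: cvg_id.
  exact: smooth_continuous.
have k1 := key 1 (expr1n _ _).
have H1 : psi x + `|psi x| <= psi (x + (sig * h0) *: e k).
  by move: k1; rewrite !mul1r.
have H2 : psi (x + (- (sig * h0)) *: e k) <= psi x - `|psi x|.
  have : (-1 : R) ^+ 2 = 1 by rewrite sqrrN expr1n.
  move=> /key; rewrite !mulN1r mulNr.
  by move: (psi (x + _)) => q; rewrite -lerN2 opprD !opprK.
have A1 : 0 <= psi x + `|psi x|.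
  by rewrite addrC -lerBlDr sub0r; have := ler_norm (- psi x); rewrite normrN.
have A2 : psi x - `|psi x| <= 0 by rewrite subr_le0 ler_norm.
have [s /[!in_itv]/= sh sE] : exists2 s, s \in `[(- h0), h0] & psi (x + s *: e k) = 0.
  apply: IVT; [by rewrite ge0_cp|exact: continuous_subspaceT|].
  have [sg|sg] : sig = 1 \/ sig = -1.
    by have /eqP := s1; rewrite sqrf_eq1 => /orP[/eqP ->|/eqP ->]; [left|right].
    rewrite sg !mul1r in H1 H2; rewrite ge_min (le_trans H2 A2) /=.
    by rewrite le_max (le_trans A1 H1) orbT.
  rewrite sg !mulN1r opprK in H1 H2; rewrite ge_min (le_trans H2 A2) orbT /=.
  by rewrite le_max (le_trans A1 H1).
by exists s => //; rewrite ler_norml.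
Qed.

(* Two equations of the same hypersurface have parallel gradients: moving
   along a direction tangent to the first level set and correcting along e_k
   produces points where both functions vanish. *)
Lemma parallel_partials psi phi z k i : Cinf psi -> Cinf phi -> psi z = 0 ->
  partial psi k z != 0 -> (\forall y \near z, psi y = 0 -> phi y = 0) ->
  partial psi k z * partial phi i z = partial psi i z * partial phi k z.
Proof.
move=> spsi sphi psi0 pk H; have [r1 /= r10 Hr1] := (nbhs_normP _ _).1 H.
pose sig : R := Num.sg (partial psi k z).
have sig2 : sig ^+ 2 = 1 by rewrite sqr_sg pk.
pose d := `|partial psi k z| / 2.
have d0 : 0 < d by rewrite divr_gt0// normr_gt0.
have [r2 r20 Hr2] := continuous_dist z (smooth_continuous (smooth_partial k spsi)) d0.
have [r3 r30 Hr3] := continuous_dist z (smooth_continuous (smooth_partial k sphi)) (@ltr01 R).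
pose M := `|partial phi k z| + 1.
have M0 : 0 < M by rewrite ltr_wpDl.
pose r := Num.min r1 (Num.min r2 r3).
have r0 : 0 < r by rewrite !lt_min r10 r20.
have rr1 : r <= r1 by rewrite /r !ge_min lexx.
have rr2 : r <= r2 by rewrite /r !ge_min lexx orbT.
have rr3 : r <= r3 by rewrite /r !ge_min lexx !orbT.
have mono x : `|x - z| < r -> d <= sig * partial psi k x.
  move=> xr; have := Hr2 x (lt_le_trans xr rr2); rewrite -(mul1r (`|_|)).
  have ns : `|sig| = 1 by rewrite /sig normr_sg pk.
  rewrite -ns -normrM mulrBr (_ : sig * partial psi k z = 2 * d); last first.
    by rewrite /sig /d -normrEsg mulrC divfK.
  by rewrite ltr_norml => /andP[h _]; lra.
have Mb x : `|x - z| < r -> `|partial phi k x| <= M.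
  move=> xr; have := Hr3 x (lt_le_trans xr rr3); move: (partial phi k x) => q h.
  rewrite -[q](subrK (partial phi k z)) (le_trans (ler_normD _ _))// addrC lerD2l.
  exact: ltW.
set a := partial psi k z; set b := partial psi i z.
set a' := partial phi k z; set b' := partial phi i z.
apply/eqP; rewrite -subr_eq0; apply/negP => /negP be0.
set be := _ - _ in be0.
pose v : 'rV[R]_n := a *: e i + (- b) *: e k.
have dv f : Cinf f -> is_derive z v f (a * partial f i z - b * partial f k z).
  move=> sf; have dai : is_derive z (a *: e i) f (a * partial f i z).
    have := is_derive_addl a i sf (is_derive_grad z 0 sf).
    rewrite add0r big1 ?add0r// => l _; by rewrite mxE mul0r.
  by have := is_derive_addl (- b) k sf dai; rewrite mulNr.
(* Chosen so that [eps * (1 + M / d)] is half of [|be|]: the first-order error of [phi] and the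
   correction along [e k] then cannot add up to [t * |be|]. *)
pose eps := `|be| / (2 * (1 + M / d)).
have Md : 0 < 1 + M / d by rewrite addr_gt0// divr_gt0.
have eps0 : 0 < eps by rewrite divr_gt0 ?normr_gt0// mulr_gt0.
have [e1 e10 H1] := small_deriv (dv _ spsi) eps0.
have [e2 e20 H2] := small_deriv (dv _ sphi) eps0.
pose K := `|v| + eps / d + 1.
have K0 : 0 < K by rewrite ltr_wpDl// addr_ge0// divr_ge0 ?ltW.
pose t := Num.min (Num.min e1 e2) (r / K) / 2.
have t0 : 0 < t by rewrite divr_gt0// !lt_min e10 e20 divr_gt0.
have th (x : R) : Num.min (Num.min e1 e2) (r / K) <= x -> 0 < x -> t < x.
  by move=> mx x0; rewrite /t ltr_pdivrMr// mulr2n mulrDr mulr1; lra.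
have te1 : `|t| < e1 by rewrite gtr0_norm//; apply: th => //; rewrite !ge_min lexx.
have te2 : `|t| < e2 by rewrite gtr0_norm//; apply: th => //; rewrite !ge_min lexx orbT.
have tr : t < r / K by apply: th; [rewrite ge_min lexx orbT|rewrite divr_gt0].
have B1 := H1 t te1; have B2 := H2 t te2.
rewrite psi0 subr0 -/a -/b [b * a]mulrC subrr mulr0 subr0 (gtr0_norm t0) in B1.
rewrite (gtr0_norm t0) -/a' -/b' -/be in B2.
have tK : t * K < r by rewrite -ltr_pdivlMr.
have xr : `|z + t *: v - z| + `|psi (z + t *: v)| / d < r.
  rewrite addrAC subrr add0r normrZ (gtr0_norm t0) (le_lt_trans _ tK)//.
  rewrite /K !mulrDr mulr1 -addrA lerD2l; apply: (@le_trans _ _ (t * (eps / d))).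
    by rewrite mulrA ler_pM2r ?invr_gt0// mulrC.
  by rewrite lerDl ltW.
have [h hb hz] := zero_along spsi d0 sig2 mono xr.
have hx (c : R) : `|c| <= `|h| -> `|z + t *: v + c *: e k - z| < r.
  move=> ch; rewrite addrAC (le_lt_trans (ler_normD _ _))// (le_lt_trans _ xr)// lerD2l.
  by rewrite (le_trans (norm_e_le _ _))// (le_trans ch).
have phi0 : phi (z + t *: v + h *: e k) = 0.
  apply: Hr1 => //=; rewrite /ball_ /= distrC (lt_le_trans _ rr1)//; exact: hx.
have phiz : phi z = 0.
  by apply: Hr1 => //=; rewrite /ball_ /= subrr normr0.
have [c cb E] := mean_value_partial k (z + t *: v) h sphi.
rewrite phi0 sub0r in E; rewrite phiz subr0 in B2.
have hb2 : `|h| <= t * (eps / d).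
  by rewrite (le_trans hb)// mulrA ler_pM2r ?invr_gt0// mulrC.
have B3 : `|phi (z + t *: v)| <= t * (eps / d) * M.
  rewrite -normrN E normrM; apply: ler_pM => //; apply: Mb; exact: hx.
have : t * `|be| <= eps * t + t * (eps / d) * M.
  rewrite -[t in t * `|be|](gtr0_norm t0) -normrM.
  rewrite -[t * be](subrK (phi (z + t *: v))) (le_trans (ler_normD _ _))//.
  by rewrite lerD// distrC.
have -> : eps * t + t * (eps / d) * M = t * (`|be| / 2).
  transitivity (t * (eps * (1 + M / d))).
    rewrite [eps * (1 + _)]mulrDr mulr1 [RHS]mulrDr [t * eps]mulrC; congr (_ + _).
    by rewrite -!mulrA [d^-1 * M]mulrC.
  by congr (_ * _); rewrite /eps invfM mulrA divfK// gt_eqF.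
rewrite ler_pM2l//; have : 0 < `|be| by rewrite normr_gt0.
by move: (`|be|) => q; lra.
Qed.

End level_sets.

Section sides.
Variables (R : realType) (n : nat) (S0 Oint : set 'rV[R]_n).
Hypothesis hO : hypersurface_interior S0 Oint.
Notation D := (exterior Oint).
Notation e k := (delta_mx ord0 k : 'rV[R]_n).
Implicit Types x y : 'rV[R]_n.

Lemma open_inside : open Oint. Proof. by case: hO. Qed.

Lemma open_exterior : open D.
Proof. by apply: closed_openC; exact: closed_closure. Qed.

Lemma interior_or_exterior x : ~ S0 x -> (Oint `|` D) x.
Proof.
move=> nS; have [|nO] := pselect (Oint x); first by left.
right=> cO; apply: nS; case: hO => _ _ <- _; by split.
Qed.

Lemma exterior_not_S0 x : D x -> ~ S0 x.
Proof. by move=> Dx; case: hO => _ _ <- _ [cO _]. Qed.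

Lemma interior_exterior0 : Oint `&` D = set0.
Proof.
apply/seteqP; split => // x [Ox Dx]; apply: Dx; exact: subset_closure.
Qed.

Lemma interior_segment x y :
  (forall s : R, 0 <= s <= 1 -> ~ S0 (x + s *: (y - x))) -> Oint x -> Oint y.
Proof.
move=> H; apply: (segment_side open_inside open_exterior interior_exterior0).
by move=> s s01; apply: interior_or_exterior; exact: H.
Qed.

Lemma interior_segment_iff x y :
  (forall s : R, 0 <= s <= 1 -> ~ S0 (x + s *: (y - x))) -> Oint x <-> Oint y.
Proof.
move=> H; split; first exact: interior_segment.
apply: interior_segment => s /andP[s0 s1].
have -> : y + s *: (x - y) = x + (1 - s) *: (y - x).
  by rewrite -[x - y]opprB scalerN scalerBl scale1r addrA [x + _]addrC subrK.
by apply: H; rewrite subr_ge0 s1 gerBl.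
Qed.

Variables (y0 nu : 'rV[R]_n) (psi : 'rV[R]_n -> R) (c : R).
Hypotheses (spsi : Cinf psi) (psi0 : psi y0 = 0) (c0 : 0 < c).
Hypothesis gradE : forall j, partial psi j y0 = c * nu ord0 j.
Hypothesis nu1 : \sum_j nu ord0 j ^+ 2 = 1.
Hypothesis eqS : \forall x \near y0, S0 x <-> psi x = 0.
Hypothesis inside : \forall t \near (0 : R)^'+, Oint (y0 - t *: nu).

Lemma exists_monotone : exists k (sig d r : R), [/\ 0 < d, sig ^+ 2 = 1, 0 < r &
  forall x, `|x - y0| < r -> d <= sig * partial psi k x].
Proof.
have [k nk] : exists k, nu ord0 k != 0.
  apply/existsP; rewrite -negb_forall; apply/negP => /forallP H.
  move: nu1; rewrite big1 => [/esym/eqP|j _]; first by rewrite oner_eq0.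
  by rewrite (eqP (H j)) expr0n.
have pk : partial psi k y0 != 0 by rewrite gradE mulf_neq0// gt_eqF.
pose d := `|partial psi k y0| / 2.
have d0 : 0 < d by rewrite divr_gt0// normr_gt0.
have [r r0 Hr] := continuous_dist y0 (smooth_continuous (smooth_partial k spsi)) d0.
exists k, (Num.sg (partial psi k y0)), d, r; split => //; first by rewrite sqr_sg pk.
move=> x xr; have := Hr x xr; rewrite -(mul1r (`|_|)).
have ns : `|Num.sg (partial psi k y0)| = 1 by rewrite normr_sg pk.
rewrite -ns -normrM mulrBr (_ : Num.sg _ * partial psi k y0 = 2 * d); last first.
  by rewrite /d -normrEsg mulrC divfK.
by rewrite ltr_norml => /andP[h _]; lra.
Qed.

(** The normal ray gives interior points on which [psi] is negative, but only on that ray. Any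
    nearby point with [psi < 0] is joined to the common point [y1] by two segments on which [psi]
    stays negative, hence which avoid [S0]; so all these points lie on the same side, the interior
    one. Where [psi = 0] the point is on [S0]. *)
Lemma nonpos_not_exterior : exists2 r : R, 0 < r &
  forall x, `|x - y0| < r -> psi x <= 0 -> ~ D x.
Proof.
have [k [sig [d [r1 [d0 s1 r10 mono]]]]] := exists_monotone.
have [r2 /= r20 Hr2] := (nbhs_normP _ _).1 eqS.
pose r := Num.min r1 r2.
have r0 : 0 < r by rewrite lt_min r10.
have rr1 : r <= r1 by rewrite ge_min lexx.
have rr2 : r <= r2 by rewrite ge_min lexx orbT.
have ns : `|sig| = 1 by apply/eqP; rewrite -(@eqrXn2 _ 2) ?normr_ge0// real_normK ?num_real// s1 expr1n.
have Sneg x : `|x - y0| < r -> psi x < 0 -> ~ S0 x.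
  move=> xr px Sx; have /Hr2 : ball_ Num.norm y0 r2 x.
    by rewrite /ball_ /= distrC (lt_le_trans xr).
  by move=> [/(_ Sx) p0 _]; move: px; rewrite p0 ltxx.
have down x (s : R) : 0 <= s -> `|x - y0| + s < r -> psi (x - (sig * s) *: e k) <= psi x - s * d.
  move=> s0 xs; have [h hb E] := mean_value_partial k x (- (sig * s)) spsi.
  have nh : `|- (sig * s)| = s by rewrite normrN normrM ns mul1r ger0_norm.
  rewrite nh in hb; have := mono (x + h *: e k) _; rewrite scaleNr in E.
  have -> : `|x + h *: e k - y0| < r1.
    rewrite addrAC (le_lt_trans (ler_normD _ _))// (lt_le_trans _ rr1)//.
    by rewrite (le_lt_trans _ xs)// lerD2l (le_trans (norm_e_le _ _)).
  move=> /(_ isT); move: E; move: (psi _) (partial psi k _) => p q E dq.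
  have -> : p = psi x - s * (sig * q) by rewrite -[LHS](subrK (psi x)) E; ring.
  by rewrite lerD2l lerN2 ler_wpM2l.
pose y1 := y0 - (sig * (r / 2)) *: e k.
have r2' : 0 < r / 2 by rewrite divr_gt0.
have py1 : psi y1 < 0.
  apply: (@le_lt_trans _ _ (psi y0 - r / 2 * d)).
    apply: down; first exact: ltW.
    by rewrite subrr normr0 add0r; lra.
  by rewrite psi0 sub0r oppr_lt0 mulr_gt0.
have npy : 0 < - psi y1 by rewrite oppr_gt0.
have [rho1 rho10 Hrho1] := continuous_dist y1 (smooth_continuous spsi) npy.
have ball1 x : `|x - y1| < rho1 -> psi x < 0.
  by move=> /Hrho1; rewrite ltr_norml => /andP[_]; lra.
pose rho := Num.min rho1 (r / 2).
have rho0 : 0 < rho by rewrite lt_min rho10.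
have rho_1 : rho <= rho1 by rewrite ge_min lexx.
have rho_2 : rho <= r / 2 by rewrite ge_min lexx orbT.
(* First segment: from [x] in the direction of [e k] along which [psi] decreases, to [x1]. Second
   segment: from [x1] to [y1], inside a ball around [y1] on which [psi] is negative. *)
have side x : `|x - y0| < rho -> psi x < 0 -> Oint x <-> Oint y1.
  move=> xr px; pose x1 := x - (sig * (r / 2)) *: e k.
  apply: (@iff_trans _ (Oint x1)); apply: interior_segment_iff => s /andP[s0 s1'].
    have -> : x + s *: (x1 - x) = x - (sig * (s * (r / 2))) *: e k.
      rewrite /x1 addrAC subrr add0r scalerN scalerA; congr (_ - _ *: _); ring.
    have sr : s * (r / 2) <= r / 2 by rewrite ler_piMl// ltW.
    have sr0 : 0 <= s * (r / 2) by rewrite mulr_ge0// ltW.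
    have xs : `|x - y0| + s * (r / 2) < r by lra.
    apply: Sneg.
      rewrite addrAC (le_lt_trans (ler_normB _ _))// (le_lt_trans _ xs)// lerD2l.
      by rewrite (le_trans (norm_e_le _ _))// normrM ns mul1r ger0_norm.
    apply: (le_lt_trans (down x _ sr0 xs)).
    apply: (@le_lt_trans _ _ (psi x)) => //; rewrite lerBlDr lerDl.
    by rewrite mulr_ge0// ltW.
  have xy : x1 - y1 = x - y0 by rewrite /x1 /y1 opprB addrA subrK.
  have E : x1 + s *: (y1 - x1) - y1 = (1 - s) *: (x - y0).
    by rewrite -xy scalerBl scale1r -[y1 - x1]opprB scalerN addrAC.
  have nE : `|x1 + s *: (y1 - x1) - y1| < rho.
    rewrite E normrZ ger0_norm ?subr_ge0//; apply: le_lt_trans xr.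
    by rewrite ler_piMl// gerBl.
  apply: Sneg; last by apply: ball1; exact: lt_le_trans rho_1.
  rewrite -[X in `|X|](subrKA y1) (le_lt_trans (ler_normD _ _))//.
  have n1 : `|y1 - y0| <= r / 2.
    rewrite /y1 addrAC subrr add0r normrN (le_trans (norm_e_le _ _))//.
    by rewrite normrM ns mul1r gtr0_norm.
  by lra.
have [t [t0 tnu pt Ot]] : exists t : R, [/\ 0 < t, `|t *: nu| < rho,
    psi (y0 - t *: nu) < 0 & Oint (y0 - t *: nu)].
  have dpsi : is_derive y0 nu psi c.
    apply: is_derive_eq (is_derive_grad y0 nu spsi) _.
    rewrite -[RHS]mulr1 -nu1 mulr_sumr; apply: eq_bigr => j _.
    by rewrite gradE expr2; ring.
  have c2 : 0 < c / 2 by rewrite divr_gt0.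
  have [del del0 Hdel] := small_deriv dpsi c2.
  have nu0 : 0 < `|nu| + 1 by rewrite ltr_wpDl.
  pose b := Num.min del (rho / (`|nu| + 1)).
  have b0 : 0 < b by rewrite lt_min del0 divr_gt0.
  have H1 : \forall t \near (0 : R)^'+, t < b by apply: nbhs_right_lt.
  have H2 : \forall t \near (0 : R)^'+, 0 < t by apply: nbhs_right_gt.
  have [t [Ot [tb t0]]] := filter_ex (filterI inside (filterI H1 H2)).
  have t_del : t < del by apply: lt_le_trans tb _; rewrite ge_min lexx.
  have t_rho : t < rho / (`|nu| + 1) by apply: lt_le_trans tb _; rewrite ge_min lexx orbT.
  exists t; split => //.
    rewrite normrZ gtr0_norm//; move: t_rho; rewrite ltr_pdivlMr//; apply: le_lt_trans.
    by rewrite ler_pM2l// lerDl.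
  have := Hdel (- t); rewrite normrN gtr0_norm// => /(_ t_del).
  rewrite psi0 subr0 scaleNr mulNr opprK ler_norml => /andP[_].
  have : 0 < c * t by rewrite mulr_gt0.
  by move: (psi _) => p; lra.
have Oy1 : Oint y1.
  apply/(side _ _ pt).1 => //; rewrite addrAC subrr add0r normrN//.
exists rho => // x xr; rewrite le_eqVlt => /predU1P[px|px] Dx.
  apply: (exterior_not_S0 Dx).
  have /Hr2 [_] : ball_ Num.norm y0 r2 x; last exact.
  by rewrite /ball_ /= distrC; lra.
have Ox : Oint x by apply/(side _ xr px).
have : (Oint `&` D) x by [].
by rewrite interior_exterior0.
Qed.

End sides.

(** * Cutoffs at the characteristic hypersurface *)

Section flux_bounds.
Variables (R : realType) (n : nat).
Implicit Types (M : 'M[R]_n.+1) (u w a : 'rV[R]_n.+1) (v : 'rV[R]_n).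

Definition sp v : 'rV[R]_n.+1 := ins_row ord0 0 v.

Lemma sp0 v : sp v ord0 ord0 = 0. Proof. exact: ins_row_at. Qed.
Lemma spS v j : sp v ord0 (lift ord0 j) = v ord0 j. Proof. exact: ins_row_lift. Qed.

Lemma spL (c d : R) v v' : sp (c *: v + d *: v') = c *: sp v + d *: sp v'.
Proof.
apply/rowP => i; rewrite !mxE; case: (unlift ord0 i) => [i'|]; first by rewrite !mxE.
by rewrite !mulr0 addr0.
Qed.

Lemma mform_sp M v : mform M (sp v) (sp v) =
  \sum_j \sum_k M (lift ord0 j) (lift ord0 k) * v ord0 j * v ord0 k.
Proof.
rewrite /mform big_ord_recl big1 ?add0r => [|k _]; last by rewrite sp0 mulr0 mul0r.
apply: eq_bigr => j _; rewrite big_ord_recl sp0 mulr0 add0r.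
by apply: eq_bigr => k _; rewrite !spS.
Qed.

Lemma mform_e0_sp M v : mform M (e0 R n) (sp v) = \sum_k M ord0 (lift ord0 k) * v ord0 k.
Proof.
rewrite mform_e0l big_ord_recl sp0 mulr0 add0r.
by apply: eq_bigr => k _; rewrite spS.
Qed.

Lemma flux_formL M (c d : R) u w a :
  flux_form M (c *: u + d *: w) a = c * flux_form M u a + d * flux_form M w a.
Proof.
rewrite /flux_form mformDl !mformDr !mformZl !mformZr.
by move: (mform _ _ _) (mform _ _ _) (mform _ _ _) (mform _ _ _) (mform _ _ _) (mform _ _ _) => *; ring.
Qed.

Lemma mform_bound M u w (B N N' : R) : (forall j k, `|M j k| <= B) ->
  (forall j, `|u ord0 j| <= N) -> (forall j, `|w ord0 j| <= N') ->
  `|mform M u w| <= n.+1%:R ^+ 2 * (B * N * N').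
Proof.
move=> HB HN HN'.
have sumc (c : R) : \sum_(i < n.+1) c = n.+1%:R * c by rewrite sumr_const card_ord mulr_natl.
rewrite expr2 -mulrA -!sumc (le_trans (ler_norm_sum _ _ _))//.
apply: ler_sum => j _; rewrite (le_trans (ler_norm_sum _ _ _))//.
apply: ler_sum => k _; rewrite !normrM; apply: ler_pM => //.
by apply: ler_pM.
Qed.

Lemma flux_bound M v a (B N : R) : (forall j k, `|M j k| <= B) ->
  (forall j, `|v ord0 j| <= N) -> 0 <= N ->
  `|flux_form M (sp v) a| <= 3 * (n.+1%:R ^+ 2 * B) ^+ 2 * N * sq a.
Proof.
move=> HB HN N0.
have HNs j : `|sp v ord0 j| <= N.
  by case: (unliftP ord0 j) => [i ->|->]; rewrite ?spS// sp0 normr0.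
have He j : `|e0 R n ord0 j| <= 1.
  by rewrite mxE eqxx /=; case: (_ == _); rewrite ?normr1 ?normr0.
have Ha := norm_le_sq a.
have h1 := mform_bound HB HNs Ha; have h2 := mform_bound HB He Ha.
have h3 := mform_bound HB He HNs; have h4 := mform_bound HB Ha Ha.
have s0 := sqrtr_ge0 (sq a).
have sE : sq a = Num.sqrt (sq a) * Num.sqrt (sq a) by rewrite -expr2 sqr_sqrtr// sq_ge0.
rewrite sE /flux_form; move: h1 h2 h3 h4 s0.
move: (mform M _ _) (mform M _ _) (mform M _ _) (mform M _ _) (Num.sqrt (sq a)) (n.+1%:R ^+ 2 : R).
move=> p q r t s k h1 h2 h3 h4 s0.
rewrite (le_trans (ler_normB _ _))// !normrM (ger0_norm (_ : 0 <= 2))//.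
have k1 : 2 * `|t| * `|r| <= 2 * (k * (B * N * s)) * (k * (B * 1 * s)).
  by apply: ler_pM => //; exact: ler_wpM2l.
have k2 : `|q| * `|p| <= (k * (B * 1 * N)) * (k * (B * s * s)) by apply: ler_pM.
rewrite (le_trans (lerD k1 k2))// le_eqVlt; apply/orP; left; apply/eqP; ring.
Qed.

End flux_bounds.

Section cutoffs.
Variables (R : realType) (n : nat) (G : 'rV[R]_n -> 'M[R]_n.+1) (C0 : R).
Hypothesis hG : wave_coefficients G C0.
Variable D : set 'rV[R]_n.

(* [2 * f * grad f] is the gradient of [f ^+ 2]: what the cutoff feeds into the
   energy is bounded from above, however steep [f] is. *)
Definition cutoff (K : R) (f : 'rV[R]_n -> R) : Prop :=
  [/\ Cinf f, forall x, 0 <= f x <= 1 & forall x a, D x ->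
    2 * f x * flux_form (G x) (sp (grad f x)) a <= K * sq a].

(** In the Leibniz rule each flux term is multiplied by the square of the other factor, which lies
    in [[0, 1]]; an upper bound by a nonnegative quantity is preserved. *)
Lemma cutoffM K L f g : 0 <= K -> 0 <= L -> cutoff K f -> cutoff L g ->
  cutoff (K + L) (fun x => f x * g x).
Proof.
move=> K0 L0 [sf f01 hf] [sg g01 hg]; split; first exact: smoothM.
  move=> x; have /andP[f0 f1] := f01 x; have /andP[g0 g1] := g01 x.
  by rewrite mulr_ge0//= mulr_ile1.
move=> x a Dx; have /andP[f0 f1] := f01 x; have /andP[g0 g1] := g01 x.
have -> : grad (fun x => f x * g x) x = g x *: grad f x + f x *: grad g x.
  by apply/rowP => j; rewrite !mxE partialM// [_ * g x]mulrC.
rewrite spL flux_formL; have := hf x a Dx; have := hg x a Dx.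
have := sq_ge0 a.
move: (flux_form _ _ _) (flux_form _ _ _) (f x) (g x) (sq a) f0 f1 g0 g1.
move=> p q u w s u0 u1 w0 w1 s0 h1 h2.
have -> : 2 * (u * w) * (w * p + u * q) = w ^+ 2 * (2 * u * p) + u ^+ 2 * (2 * w * q) by ring.
have a1 : w ^+ 2 * (2 * u * p) <= K * s.
  apply: (@le_trans _ _ (w ^+ 2 * (K * s))); first by rewrite ler_wpM2l ?sqr_ge0.
  by rewrite ler_piMl ?mulr_ge0// expr_le1.
have a2 : u ^+ 2 * (2 * w * q) <= L * s.
  apply: (@le_trans _ _ (u ^+ 2 * (L * s))); first by rewrite ler_wpM2l ?sqr_ge0.
  by rewrite ler_piMl ?mulr_ge0// expr_le1.
by rewrite [leRHS]mulrDl; exact: lerD a1 a2.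
Qed.

Lemma cutoff1 : cutoff 0 (fun=> 1).
Proof.
split; first exact: smooth_cst.
  by move=> x; rewrite ler01 lexx.
move=> x a _; have -> : grad (fun=> 1 : R) x = 0 *: (0 : 'rV[R]_n) + 0 *: 0.
  rewrite !scale0r addr0; apply/rowP => j; rewrite !mxE.
  exact: (congr1 (@^~ x) (partial_cst (1 : R) j)).
by rewrite spL flux_formL !mul0r addr0 mulr0.
Qed.

Lemma cutoff_prod (I : Type) (r : seq I) (K : I -> R) (f : I -> 'rV[R]_n -> R) :
  (forall i, 0 <= K i) -> (forall i, cutoff (K i) (f i)) ->
  cutoff (\sum_(i <- r) K i) (fun x => \prod_(i <- r) f i x).
Proof.
move=> K0 H; elim: r => [|i r IH].
  by rewrite big_nil; under eq_fun do rewrite big_nil; exact: cutoff1.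
rewrite big_cons (_ : (fun x => _) = fun x => f i x * \prod_(j <- r) f j x).
  by apply: cutoffM => //; apply: sumr_ge0.
by apply/funext => x; rewrite big_cons.
Qed.

Lemma flux_G_bound : exists2 K : R, 0 < K & forall x (v : 'rV[R]_n) a (N : R),
  (forall j, `|v ord0 j| <= N) -> 0 <= N ->
  `|flux_form (G x) (sp v) a| <= K * N * sq a.
Proof.
have [B B0 HB] := G_bound hG.
exists (3 * (n.+1%:R ^+ 2 * B) ^+ 2).
  by rewrite mulr_gt0// exprn_gt0// mulr_gt0// exprn_gt0.
by move=> x v a N HN N0; apply: flux_bound => // j k; have [] := HB x j k.
Qed.

Lemma e0_bound : exists2 K : R, 0 < K & forall x a,
  mform (G x) (e0 R n) a ^+ 2 <= K * sq a.
Proof.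
have [B B0 HB] := G_bound hG.
exists ((n.+1%:R ^+ 2 * B) ^+ 2).
  by rewrite exprn_gt0// mulr_gt0// exprn_gt0.
move=> x a; have He j : `|e0 R n ord0 j| <= 1.
  by rewrite mxE eqxx /=; case: (_ == _); rewrite ?normr1 ?normr0.
have := mform_bound (fun j k => (HB x j k).1) He (norm_le_sq a).
rewrite -ler_sqr ?nnegrE//; last first.
  by rewrite mulr_ge0 ?sqr_ge0// !mulr_ge0 ?sqrtr_ge0// ltW.
rewrite real_normK ?num_real// mulr1 mulrA exprMn.
by rewrite sqr_sqrtr ?sq_ge0.
Qed.

End cutoffs.

(** Here [q] and [s] stand for the symbols [<w, w>] and [<dx_0, w>], [p] for the value of the
    defining function, [m] for the steepness and [F] for the flux. The characteristic condition
    enters as [|q| <= M * p], and in the layer [m * p <= 2]: the factor [p] compensates [m]. *)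
Lemma past_flux_le (R : realFieldType) (q s s0 M p m e E F : R) : 0 < s0 -> s <= - s0 ->
  `|q| <= M * p -> 0 <= M -> 0 < p -> 0 <= m -> m * p <= 2 -> 0 <= e -> e <= E ->
  F <= q / s * e -> m * F <= 2 * M / s0 * E.
Proof.
move=> s00 ss0 qM M0 p0 m0 mp e0 eE FE.
have s1 : 0 < - s by lra.
have qs : q / s <= M * p / s0.
  rewrite -[q / s]mulrNN -invrN; apply: (@le_trans _ _ (`|q| / (- s))).
    by rewrite ler_wpM2r ?invr_ge0 ?(ltW s1)// -normrN ler_norm.
  apply: ler_pM => //; first by rewrite invr_ge0 ltW.
  by rewrite lef_pV2 ?posrE//; lra.
apply: (@le_trans _ _ (m * (M * p / s0 * E))).
  apply: ler_wpM2l => //; apply: le_trans FE _.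
  apply: (@le_trans _ _ (M * p / s0 * e)); first exact: ler_wpM2r.
  by apply: ler_wpM2l => //; rewrite divr_ge0 ?mulr_ge0// ltW.
have -> : m * (M * p / s0 * E) = (m * p) * (M / s0 * E) by ring.
have -> : 2 * M / s0 * E = 2 * (M / s0 * E) by ring.
apply: ler_wpM2r => //; apply: mulr_ge0; last exact: le_trans eE.
by rewrite divr_ge0// ltW.
Qed.

Lemma weighted_flux_le (R : realFieldType) (f t d m F B X : R) : 0 <= f <= 1 ->
  0 <= t <= 1 -> 0 <= d -> d <= B -> m * F <= X -> 0 <= X ->
  2 * f * (t * d * m * F) <= 2 * B * X.
Proof.
move=> /andP[f0 f1] /andP[t0 t1] d0 dB mF X0.
have -> : 2 * f * (t * d * m * F) = 2 * (f * (t * (d * (m * F)))) by ring.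
rewrite -mulrA ler_wpM2l//.
have B0 : 0 <= B by exact: le_trans dB.
have BX : 0 <= B * X by exact: mulr_ge0.
have h1 : d * (m * F) <= B * X.
  by apply: (@le_trans _ _ (d * X)); [exact: ler_wpM2l|exact: ler_wpM2r].
have h2 : t * (d * (m * F)) <= B * X.
  by apply: (@le_trans _ _ (t * (B * X))); [exact: ler_wpM2l|rewrite ler_piMl].
by apply: (@le_trans _ _ (f * (B * X))); [exact: ler_wpM2l|rewrite ler_piMl].
Qed.

Lemma cutoff_flux_le (R : realFieldType) (f u P Q A A' : R) : 0 <= f <= 1 -> 0 <= u <= 1 ->
  `|P| <= A -> 2 * f * Q <= A' -> 2 * f * (- (1 - u) * P + Q) <= 2 * A + A'.
Proof.
move=> /andP[f0 f1] /andP[u0 u1] PA QA; rewrite mulrDr lerD//.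
rewrite -mulrA ler_wpM2l// (le_trans (ler_norm _))// !normrM normrN.
rewrite (ger0_norm f0) (ger0_norm (_ : 0 <= 1 - u)) ?subr_ge0//.
apply: (@le_trans _ _ (1 * (1 * A))); last by rewrite !mul1r.
apply: ler_pM => //; first by rewrite mulr_ge0 ?subr_ge0.
by apply: ler_pM => //; rewrite ?subr_ge0// gerBl.
Qed.

Section local_cutoff.
Variables (R : realType) (n : nat) (G : 'rV[R]_n -> 'M[R]_n.+1) (C0 : R).
Hypothesis hG : wave_coefficients G C0.
Variables (S0 Oint : set 'rV[R]_n) (nu : 'rV[R]_n -> 'rV[R]_n).
Hypothesis hO : hypersurface_interior S0 Oint.
Hypothesis hnu : forall x, S0 x -> outward_unit_normal S0 Oint x (nu x).
Hypothesis hchar : forall x, S0 x ->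
  \sum_(j < n) \sum_(k < n)
    G x (lift ord0 j) (lift ord0 k) * nu x ord0 j * nu x ord0 k = 0.
Hypothesis hneg : forall x, S0 x ->
  \sum_(j < n) G x (lift ord0 j) ord0 * nu x ord0 j < 0.
Notation D := (exterior Oint).
Implicit Types x y z : 'rV[R]_n.

(** The gradient is a nonzero multiple of the normal, and changing the sign of the equation makes
    the multiple positive, so that [psi] increases outwards. *)
Lemma oriented_equation y : S0 y -> exists psi (c : R), [/\ Cinf psi,
  \forall x \near y, S0 x <-> psi x = 0, 0 < c & forall j, partial psi j y = c * nu y ord0 j].
Proof.
move=> Sy; have [_ [psi [[spsi g0 H] [c gE]]] _] := hnu Sy.
have sp' : Cinf psi by apply/CinfP.
have pE j : partial psi j y = c * nu y ord0 j.
  by have /rowP/(_ j) := gE; rewrite !mxE.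
have [c0|c0|c0] := ltgtP c 0.
- exists (fun x => - psi x), (- c); split; [exact: smoothN| |by rewrite oppr_gt0|].
    apply: filterS H => x H; split => [/H ->|/eqP]; first by rewrite oppr0.
    by rewrite oppr_eq0 => /eqP /H.
  by move=> j; rewrite partialN// pE mulNr.
- by exists psi, c.
- by move: g0; rewrite gE c0 scale0r eqxx.
Qed.

Let quad psi x := mform (G x) (sp (grad psi x)) (sp (grad psi x)).

Let quadE psi x : quad psi x = \sum_j \sum_k
  G x (lift ord0 j) (lift ord0 k) * partial psi j x * partial psi k x.
Proof.
by rewrite /quad mform_sp; apply: eq_bigr => j _; apply: eq_bigr => k _; rewrite !mxE.
Qed.

Let smooth_quad psi : Cinf psi -> Cinf (quad psi).
Proof.
move=> spsi; rewrite (_ : quad psi = fun x => \sum_j \sum_k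
  G x (lift ord0 j) (lift ord0 k) * partial psi j x * partial psi k x); last first.
  by apply/funext => x; exact: quadE.
apply: smooth_sum => j _; apply: smooth_sum => k _; apply: smoothM.
  by apply: smoothM; [exact: (G_bdd1 hG _ _).1|exact: smooth_partial].
exact: smooth_partial.
Qed.

(* The gradient of any equation of S0 is parallel to the normal, so [hchar]
   applies to it. *)
Let quad_S0 psi z k : Cinf psi -> S0 z -> partial psi k z != 0 ->
  (\forall x \near z, S0 x <-> psi x = 0) -> quad psi z = 0.
Proof.
move=> spsi Sz pk H; have [phi [c [sphi Hphi c0 phiE]]] := oriented_equation Sz.
have psi0 : psi z = 0 by have [/(_ Sz)] := nbhs_singleton H.
have Z : \forall x \near z, psi x = 0 -> phi x = 0.
  by apply: filterS2 H Hphi => x h1 h2 /h1 /h2.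
have P i := parallel_partials i spsi sphi psi0 pk Z.
have pE i : partial psi k z * (c * nu z ord0 i) = partial psi i z * (c * nu z ord0 k).
  by rewrite -!phiE; exact: P.
have nk : nu z ord0 k != 0.
  apply: contraTneq (oner_neq0 R) => n0; rewrite negbK; have [<- _ _] := hnu Sz.
  apply/eqP; apply: big1 => i _; have := pE i; rewrite n0 !mulr0 => /eqP.
  by rewrite !mulf_eq0 (negbTE pk) (gt_eqF c0) /= => /eqP ->; rewrite expr0n.
have E i : partial psi i z = partial psi k z / nu z ord0 k * nu z ord0 i.
  have := pE i; rewrite mulrCA [RHS]mulrCA => /(mulfI (lt0r_neq0 c0)) e.
  by rewrite mulrAC e mulfK.
set l := partial psi k z / nu z ord0 k in E.
rewrite quadE; transitivity (l ^+ 2 * (\sum_(i < n) \sum_(j < n)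
    G z (lift ord0 i) (lift ord0 j) * nu z ord0 i * nu z ord0 j)); last by rewrite hchar// mulr0.
rewrite mulr_sumr; apply: eq_bigr => i _; rewrite mulr_sumr.
apply: eq_bigr => j _; rewrite (E i) (E j); clear -l.
by move: l (G _ _ _) (nu _ _ _) (nu _ _ _) => *; ring.
Qed.

(* The symbol of d psi vanishes where psi does, hence is O(psi). *)
Let local_bounds y : S0 y -> exists psi (s0 M r : R),
  [/\ Cinf psi /\ (\forall x \near y, S0 x -> psi x = 0), 0 < s0 /\ 0 <= M, 0 < r,
    forall x, `|x - y| < r -> psi x <= 0 -> ~ D x &
    forall x, `|x - y| < r -> mform (G x) (e0 R n) (sp (grad psi x)) <= - s0 /\
       `|quad psi x| <= M * `|psi x| ].
Proof.
move=> Sy; have [psi [c [spsi Hpsi c0 psiE]]] := oriented_equation Sy.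
have [nu1 _ side] := hnu Sy.
have psi0 : psi y = 0 by have [/(_ Sy)] := nbhs_singleton Hpsi.
have inside : \forall t \near (0 : R)^'+, Oint (y - t *: nu y) by apply: filterS side => t [].
have [r1 r10 H1] := nonpos_not_exterior hO spsi psi0 c0 psiE nu1 Hpsi inside.
have [k [sig [d [r2 [d0 sig2 r20 mono]]]]] := exists_monotone spsi c0 psiE nu1.
have [r3 /= r30 H3] := (nbhs_normP _ _).1 Hpsi.
pose s1 x := mform (G x) (e0 R n) (sp (grad psi x)).
have s1E x : s1 x = \sum_j G x ord0 (lift ord0 j) * partial psi j x.
  by rewrite /s1 mform_e0_sp; apply: eq_bigr => j _; rewrite mxE.
have ss1 : Cinf s1.
  rewrite (_ : s1 = fun x => \sum_j G x ord0 (lift ord0 j) * partial psi j x).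
    apply: smooth_sum => j _; apply: smoothM; first exact: (G_bdd1 hG _ _).1.
    exact: smooth_partial.
  by apply/funext => x; exact: s1E.
have s1y : s1 y < 0.
  have -> : s1 y = c * \sum_(j < n) G y (lift ord0 j) ord0 * nu y ord0 j.
    rewrite s1E mulr_sumr; apply: eq_bigr => j _; rewrite psiE mulrCA; congr (_ * (_ * _)).
    by rewrite -{1}(wave_sym hG y) mxE.
  by rewrite pmulr_rlt0// hneg.
(* Half of the strictly positive value at [y], leaving the other half to continuity nearby. *)
pose s0 := - s1 y / 2.
have s00 : 0 < s0 by rewrite divr_gt0// oppr_gt0.
have [r4 r40 H4] := continuous_dist y (smooth_continuous ss1) s00.
have sq' := smooth_partial k (smooth_quad spsi).
have [r5 r50 H5] := continuous_dist y (smooth_continuous sq') (@ltr01 R).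
pose N := `|partial (quad psi) k y| + 1.
have N0 : 0 < N by rewrite ltr_wpDl.
pose r := Num.min (Num.min r2 r3) r5.
have r0 : 0 < r by rewrite !lt_min r20 r30.
have rr2 : r <= r2 by rewrite /r !ge_min lexx.
have rr3 : r <= r3 by rewrite /r !ge_min lexx orbT.
have rr5 : r <= r5 by rewrite /r !ge_min lexx orbT.
have rd0 : 0 < r / 2 * d by rewrite mulr_gt0// divr_gt0.
have [r6 r60 H6] := continuous_dist y (smooth_continuous spsi) rd0.
pose rho := Num.min (Num.min r1 r4) (Num.min r6 (r / 2)).
have rho0 : 0 < rho by rewrite !lt_min r10 r40 r60 divr_gt0.
have p1 : rho <= r1 by rewrite /rho !ge_min lexx.
have p4 : rho <= r4 by rewrite /rho !ge_min lexx orbT.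
have p6 : rho <= r6 by rewrite /rho !ge_min lexx !orbT.
have pr : rho <= r / 2 by rewrite /rho !ge_min lexx !orbT.
exists psi, s0, (N / d), rho; split => //.
- by split => //; apply: filterS Hpsi => x [].
- by split => //; rewrite divr_ge0// ltW.
- by move=> x xr; apply: H1; exact: lt_le_trans xr p1.
move=> x xr; split.
  have := H4 x (lt_le_trans xr p4); rewrite -/(s1 x) /s0.
  by move: (s1 x) (s1 y) => u v; rewrite ltr_norml => /andP[_]; lra.
have px : `|psi x| / d < r / 2.
  by have := H6 x (lt_le_trans xr p6); rewrite psi0 subr0 ltr_pdivrMr.
have mono' z : `|z - y| < r -> d <= sig * partial psi k z.
  by move=> zr; apply: mono; exact: lt_le_trans zr rr2.
have xs : `|x - y| + `|psi x| / d < r by move: xr px pr; move: (`|x - y|) (`|psi x| / d) => u v; lra.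
(* A zero [z] of [psi] at distance at most [|psi x| / d] in direction [k]. It lies on [S0], where
   the symbol [quad psi] vanishes; the mean value theorem for the symbol between [x] and [z] gives
   the constant [N / d]. *)
have [h hb hz] := zero_along spsi d0 sig2 mono' xs.
have hx (c' : R) : `|c'| <= `|h| -> `|x + c' *: delta_mx ord0 k - y| < r.
  move=> ch; rewrite addrAC (le_lt_trans (ler_normD _ _))// (le_lt_trans _ xs)// lerD2l.
  by rewrite (le_trans (norm_e_le _ _))// (le_trans ch).
have zr := hx h (lexx _); set z := x + h *: _ in hz zr.
have near_z : \forall w \near z, S0 w <-> psi w = 0.
  apply/nbhs_normP; exists (r - `|z - y|) => /=; first by rewrite subr_gt0.
  move=> w; rewrite /ball_ /= => wz; apply: H3 => /=.
  rewrite /ball_ /= (lt_le_trans _ rr3)// distrC -[w - y](subrKA z).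
  by rewrite (le_lt_trans (ler_normD _ _))// distrC -ltrBrDr.
have Sz : S0 z by have [_] := nbhs_singleton near_z; exact.
have pk : partial psi k z != 0.
  by apply: contraTneq (mono' z zr) => ->; rewrite mulr0 -ltNge.
have qz := quad_S0 spsi Sz pk near_z.
have [c' cb E] := mean_value_partial k x h (smooth_quad spsi).
rewrite -/z qz sub0r in E.
rewrite -normrN E normrM mulrC mulrAC -mulrA; apply: ler_pM => //.
have := H5 (x + c' *: delta_mx ord0 k) (lt_le_trans (hx _ cb) rr5).
move: (partial (quad psi) k (x + _)) => q hq.
rewrite -[q](subrK (partial (quad psi) k y)) (le_trans (ler_normD _ _))// addrC lerD2l.
exact: ltW.
Qed.

Let theta y (r : R) : 0 < r -> exists th : 'rV[R]_n -> R, exists N : R,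
  [/\ Cinf th, forall x, 0 <= th x <= 1, forall x, ~ `|x - y| < r -> th x = 0,
     \forall x \near y, th x = 1 & 0 <= N /\ forall x j, `|partial th j x| <= N].
Proof.
move=> r0; pose a : 'rV[R]_n := \row_i (y ord0 i - r / 2).
pose b : 'rV[R]_n := \row_i (y ord0 i + r / 2).
(* Layers of width at most [r / 4] inside a box of half-width [r / 2] leave the value 1 within
   [r / 4] of [y]. *)
pose m := (Num.truncn (4 / r)).+1.
have m1 : 4 / r <= m%:R by apply: ltW; apply: truncnS_gt.
have tb : test_function setT (bump a b m) by exact: test_bump.
have bd j := test_bounded (test_partial j tb).
have [N HN] := choice bd.
exists (bump a b m), (\sum_j `|N j|); split.
- exact: smooth_bump.
- by move=> x; rewrite bump_ge0 bump_le1.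
- move=> x nx; apply: bump_out => ox; apply: nx.
  rewrite [ltLHS]/Num.norm /= mx_normrE; apply/bigmax_ltP; split => // -[i k] _ /=.
  rewrite (ord1 i) !mxE; have := ox k; rewrite !mxE => /andP[h1 h2].
  by rewrite ltr_norml; apply/andP; split; lra.
- have r4 : 0 < r / 4 by rewrite divr_gt0.
  apply/nbhs_normP; exists (r / 4) => //= x; rewrite /ball_ /= => xy.
  have H i : `|y ord0 i - x ord0 i| < r / 4.
    apply: le_lt_trans xy; rewrite [leRHS]/Num.norm /= mx_normrE.
    by apply/bigmax_geP; right => /=; exists (ord0, i) => //=; rewrite !mxE.
  rewrite /bump big1// => i _; rewrite !mxE /bump1.
  have k1 (u : R) : r / 4 <= u -> 1 <= m%:R * u.
    move=> ru; have : 4 / r * (r / 4) <= m%:R * u.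
      apply: ler_pM => //; [by rewrite divr_ge0// ltW|exact: ltW].
    by rewrite (_ : 4 / r * (r / 4) = 1)//; field; rewrite gt_eqF.
  have := H i; rewrite ltr_norml => /andP[h1 h2].
  rewrite !step_ge1 ?mulr1//; apply: k1; lra.
- split; first exact: sumr_ge0.
  move=> x j; rewrite (le_trans (HN j x))// (le_trans (ler_norm _))//.
  by rewrite (bigD1 j)//= lerDl sumr_ge0.
Qed.

(** Near [y] the cutoff is a step of [m * psi], and off the ball it is 1. The localisation by [th]
    costs a gradient independent of [m], while the steep part has a flux bounded from above by
    [past_flux_le]. *)
Lemma local_cutoff y : S0 y -> exists K (f : nat -> 'rV[R]_n -> R),
  [/\ 0 <= K, forall m, cutoff G D K (f m),
      forall x, D x -> exists m0, forall m, (m0 <= m)%N -> f m x = 1 &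
      \forall z \near y, S0 z -> forall m, \forall x \near z, f m x = 0].
Proof.
move=> Sy; have [psi [s0 [M [r [[spsi psi0] [s00 M0] r0 side Hb]]]]] := local_bounds Sy.
have [th [N [sth th01 thout th1 [N0 HN]]]] := theta y r0.
have [KF KF0 HF] := flux_G_bound hG.
have [KE KE0 HE] := e0_bound hG.
have [B B0 HB] := dstep_bounded R.
(* The shift by 1 makes the step vanish as long as [m * psi <= 1], hence on a neighbourhood of [S0];
   the gradient lives where [1 < m * psi < 2]. *)
pose st m x := step (m%:R * psi x - 1).
pose f m x := 1 - th x * (1 - st m x).
have sst m : Cinf (st m).
  apply: smooth_step; apply: smoothB; last exact: smooth_cst.
  exact: smoothZ.
have st01 m x : 0 <= st m x <= 1 by rewrite step_ge0 step_le1.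
(* The first term accounts for the gradient of [th], bounded by [N]; the second for the step, with
   [B] bounding [dstep] and the rest coming from [past_flux_le]. *)
pose K := 2 * (KF * N) + 2 * B * (2 * M / s0 * KE).
have KN : 0 <= KF * N by rewrite mulr_ge0// ltW.
have Ms : 0 <= 2 * M / s0 by rewrite divr_ge0 ?(ltW s00)// mulr_ge0.
have KM : 0 <= 2 * M / s0 * KE by rewrite mulr_ge0// ltW.
exists K, f; split.
- by apply: addr_ge0; apply: mulr_ge0 => //; exact: mulr_ge0.
- move=> m; split.
  + apply: smoothB; first exact: smooth_cst.
    by apply: smoothM => //; apply: smoothB => //; exact: smooth_cst.
  + move=> x; rewrite /f; have /andP[t0 t1] := th01 x; have /andP[u0 u1] := st01 m x.
    move: (th x) (st m x) t0 t1 u0 u1 => t u t0 t1 u0 u1.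
    have : 0 <= t * (1 - u) by rewrite mulr_ge0// subr_ge0.
    have : t * (1 - u) <= 1 by rewrite mulr_ile1// ?subr_ge0// gerBl.
    by move: (t * _) => q q1 q0; apply/andP; split; lra.
  move=> x a Dx; have /andP[t0 t1] := th01 x; have /andP[u0 u1] := st01 m x.
  have -> : grad (f m) x = (- (1 - st m x)) *: grad th x +
      (th x * dstep (m%:R * psi x - 1) * m%:R) *: grad psi x.
    apply/rowP => j; rewrite !mxE /f.
    have s1 : Cinf (fun x => 1 - st m x) by apply: smoothB => //; exact: smooth_cst.
    have s2 : Cinf (fun x => th x * (1 - st m x)) by exact: smoothM.
    have sc : Cinf (fun x => m%:R * psi x) by exact: smoothZ.
    have s1' : Cinf (fun _ : 'rV[R]_n => 1 : R) by exact: smooth_cst.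
    have pc z : partial (fun _ : 'rV[R]_n => 1 : R) j z = 0.
      exact: (congr1 (@^~ z) (partial_cst (1 : R) j)).
    rewrite [LHS](partialD _ _ s1' (smoothN s2)) pc add0r partialN// partialM//.
    rewrite (partialD _ _ s1' (smoothN (sst m))) pc add0r partialN//.
    rewrite [partial (st m) j x](partial_step _ _ (smoothB sc s1')).
    rewrite (partialD _ _ sc (smoothN s1')) (partialN _ _ s1') pc oppr0 addr0 partialZ//.
    by move: (partial _ _ _) (partial _ _ _) (th x) (st m x) (dstep _) => *; ring.
  rewrite spL flux_formL.
  have f01 : 0 <= f m x <= 1.
    rewrite /f; have : 0 <= th x * (1 - st m x) by rewrite mulr_ge0// subr_ge0.
    have : th x * (1 - st m x) <= 1 by rewrite mulr_ile1// ?subr_ge0// gerBl.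
    by move: (_ * _) => q q1 q0; apply/andP; split; lra.
  have := HF x (grad th x) a N; have -> : (forall j, `|grad th x ord0 j| <= N) = True.
    by apply/propext; split => // _ j; rewrite mxE.
  move=> /(_ I N0) F1.
  have s_ge := sq_ge0 a.
  have F2 : 2 * f m x * (th x * dstep (m%:R * psi x - 1) * m%:R *
      flux_form (G x) (sp (grad psi x)) a) <= 2 * B * (2 * M / s0 * KE) * sq a.
    have rhs0 : 0 <= 2 * B * (2 * M / s0 * KE) * sq a.
      by apply: mulr_ge0 => //; apply: mulr_ge0 => //; exact: mulr_ge0.
    have [xr|/thout ->] := pselect (`|x - y| < r); last by rewrite !mul0r mulr0.
    have [/dstep_eq0 ->|] := boolP ((m%:R * psi x - 1 <= 0) || (1 <= m%:R * psi x - 1)).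
      by rewrite mulr0 !mul0r mulr0.
    rewrite negb_or -!ltNge => /andP[mp1 mp2].
    have [sb qb] := Hb x xr.
    have sneg : mform (G x) (e0 R n) (sp (grad psi x)) < 0.
      by rewrite (le_lt_trans sb)// oppr_lt0.
    have px : 0 < psi x by rewrite ltNge; apply/negP => /(side x xr).
    have fl := flux_form_le (wave_sym hG x) (wave_signature hG x) (wave_C0 hG) (wave_time hG x) a sneg.
    have He := HE x a.
    have d0 := dstep_ge0 (m%:R * psi x - 1); have dB := HB (m%:R * psi x - 1).
    rewrite ger0_norm// in dB; rewrite (gtr0_norm px) in qb.
    have fl2 : m%:R * flux_form (G x) (sp (grad psi x)) a <= 2 * M / s0 * (KE * sq a).
      apply: (past_flux_le s00 sb qb M0 px _ _ (sqr_ge0 _) He fl) => //.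
      by move: mp2; move: (m%:R * psi x) => v; lra.
    rewrite -[X in _ <= X]mulrA -[_ / s0 * KE * _]mulrA.
    apply: (weighted_flux_le f01 (th01 x) d0 dB fl2).
    by apply: mulr_ge0 => //; apply: mulr_ge0 => //; exact: ltW.
  have -> : K * sq a = 2 * (KF * N * sq a) + 2 * B * (2 * M / s0 * KE) * sq a.
    by rewrite /K mulrDl -(mulrA 2 (KF * N)).
  exact: (cutoff_flux_le f01 (st01 m x) F1 F2).
- move=> x Dx; have [xr|/thout t0] := pselect (`|x - y| < r); last first.
    by exists 0%N => m _; rewrite /f t0 mul0r subr0.
  have px : 0 < psi x by rewrite ltNge; apply/negP => /(side x xr).
  exists (Num.truncn (2 / psi x)).+1 => m mM.
  have h : 2 <= m%:R * psi x.
    rewrite -ler_pdivrMr// ltW// (lt_le_trans (truncnS_gt _))// ler_nat.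
    exact: mM.
  rewrite /f /st step_ge1 ?subrr ?mulr0 ?subr0//.
  by move: (m%:R * psi x) h => v; lra.
- have H1 := nbhs_interior th1; apply: filterS2 psi0 H1 => z pz nz Sz m.
  have cm : continuous (fun x => m%:R * psi x).
    by apply: smooth_continuous; exact: smoothZ.
  have [d d0 Hd] := continuous_dist z cm (@ltr01 R).
  have nd : \forall x \near z, `|x - z| < d.
    by apply/nbhs_normP; exists d => //= x; rewrite /ball_ /= distrC.
  apply: filterS2 nz nd => x tx /Hd; rewrite (pz Sz) mulr0 subr0 => mx.
  rewrite /f tx mul1r /st step_le0 ?subr0 ?subrr//.
  by rewrite subr_le0 (le_trans (ler_norm _))// ltW.
Qed.

End local_cutoff.

Section global_cutoff.
Variables (R : realType) (n : nat) (G : 'rV[R]_n -> 'M[R]_n.+1) (C0 : R).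
Hypothesis hG : wave_coefficients G C0.
Variables (S0 Oint : set 'rV[R]_n) (nu : 'rV[R]_n -> 'rV[R]_n).
Hypothesis hO : hypersurface_interior S0 Oint.
Hypothesis cS0 : compact S0.
Hypothesis hnu : forall x, S0 x -> outward_unit_normal S0 Oint x (nu x).
Hypothesis hchar : forall x, S0 x ->
  \sum_(j < n) \sum_(k < n)
    G x (lift ord0 j) (lift ord0 k) * nu x ord0 j * nu x ord0 k = 0.
Hypothesis hneg : forall x, S0 x ->
  \sum_(j < n) G x (lift ord0 j) ord0 * nu x ord0 j < 0.
Notation D := (exterior Oint).
Implicit Types x y z : 'rV[R]_n.

(** Cutoff at infinity. The box grows with [m] but the layers keep width 1, so the gradient, and
    with it the flux, is bounded uniformly in [m]. *)
Let kappa (m : nat) x : R := \prod_i bump1 (- (m%:R + 2)) (m%:R + 2) 1 (x ord0 i).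

Let smooth_kappa1 m i : Cinf (fun x => bump1 (- (m%:R + 2)) (m%:R + 2) 1 (x ord0 i)).
Proof. exact/smooth_bump1/smooth_coord. Qed.

Let kappa1_cutoff : exists2 K : R, 0 <= K & forall m i,
  cutoff G D K (fun x => bump1 (- (m%:R + 2)) (m%:R + 2) 1 (x ord0 i)).
Proof.
have [KF KF0 HF] := flux_G_bound hG; have [B B0 HB] := dstep_bounded R.
exists (2 * (KF * (2 * B))); first by apply: mulr_ge0 => //; apply: mulr_ge0; [exact: ltW|exact: mulr_ge0].
move=> m i; split; first exact: smooth_kappa1.
  by move=> x; rewrite bump1_ge0 bump1_le1.
move=> x a _.
have gN j : `|grad (fun x => bump1 (- (m%:R + 2)) (m%:R + 2) 1 (x ord0 i)) x ord0 j| <= 2 * B.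
  rewrite mxE /bump1.
  have sc := @smooth_coord R n i.
  have s1 : Cinf (fun x => 1%:R * (x ord0 i - - (m%:R + 2))).
    by apply: smoothZ; apply: smoothB => //; exact: smooth_cst.
  have s2 : Cinf (fun x => 1%:R * ((m%:R + 2) - x ord0 i)).
    by apply: smoothZ; apply: smoothB => //; exact: smooth_cst.
  rewrite (partialM _ _ (smooth_step s1) (smooth_step s2)) (partial_step _ _ s1) (partial_step _ _ s2).
  have sk (c : R) : Cinf (fun _ : 'rV[R]_n => c) by exact: smooth_cst.
  have pc (c : R) z : partial (fun _ : 'rV[R]_n => c) j z = 0.
    exact: (congr1 (@^~ z) (partial_cst c j)).
  have pi z : `|partial (fun x => x ord0 i) j z| <= 1.
    by rewrite (partial_val (is_derive_coord i j z)); case: (i == j); rewrite ?normr1 ?normr0.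
  rewrite (partialZ _ _ _ (smoothB sc (sk _))) (partialZ _ _ _ (smoothB (sk _) sc)).
  rewrite (partialD _ _ sc (smoothN (sk _))) (partialD _ _ (sk _) (smoothN sc)).
  rewrite (partialN _ _ (sk _)) (partialN _ _ sc) !pc oppr0 addr0 add0r !mul1r.
  have h u := HB u; have := pi x.
  move: (partial _ j x) => p p1; rewrite (le_trans (ler_normD _ _))//.
  have st u : `|step u| <= 1 :> R by rewrite ger0_norm ?step_ge0 ?step_le1.
  have key (u w q : R) : `|q| <= 1 -> `|step w * (dstep u * q)| <= B.
    move=> q1; apply: (@le_trans _ _ (1 * (B * 1))); last by rewrite mulr1 mul1r.
    move: (step w) (st w) (dstep u) (h u) => S hS d hd.
    by rewrite !normrM; do 2!apply: ler_pM => //; rewrite mulr_ge0.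
  rewrite mulr2n mulrDl mul1r; apply: lerD; first by rewrite mulrC; exact: key.
  by apply: key; rewrite normrN.
have B2 : 0 <= 2 * B by exact: mulr_ge0.
have H := HF x _ a _ gN B2; move: H; set fl := flux_form _ _ _ => H.
have b0 := bump1_ge0 (- (m%:R + 2)) (m%:R + 2) 1 (x ord0 i).
have b1 := bump1_le1 (- (m%:R + 2)) (m%:R + 2) 1 (x ord0 i).
move: H b0 b1; move: fl (bump1 _ _ _ _) (KF * (2 * B)) (sq a) => F b k s H b0 b1.
rewrite -mulrA -[leRHS]mulrA; apply: ler_wpM2l => //.
rewrite (le_trans (ler_norm _))// normrM (ger0_norm b0).
by apply: (@le_trans _ _ (1 * (k * s))); [exact: ler_pM|rewrite mul1r].
Qed.

(** By compactness finitely many local cutoffs suffice: one vanishing factor makes the product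
    vanish near each point of [S0], and the constants add up by [cutoff_prod]. *)
Let finite_cutoffs : exists K (f : nat -> 'rV[R]_n -> R),
  [/\ 0 <= K, forall m, cutoff G D K (f m),
      forall x, D x -> exists m0, forall m, (m0 <= m)%N -> f m x = 1 &
      forall z, S0 z -> forall m, \forall x \near z, f m x = 0].
Proof.
have H y := pselect (S0 y).
have L y : exists K (f : nat -> 'rV[R]_n -> R),
    [/\ 0 <= K, forall m, cutoff G D K (f m),
      forall x, D x -> exists m0, forall m, (m0 <= m)%N -> f m x = 1 &
      S0 y -> \forall z \near y, S0 z -> forall m, \forall x \near z, f m x = 0].
  have [Sy|nS] := H y.
    have [K [f [K0 c1 c2 c3]]] := local_cutoff hG hO hnu hchar hneg Sy.
    by exists K, f; split.
  (* Points off [S0] receive the constant family, so that the choice below is a total function. *)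
  exists 0, (fun _ _ => 1); split => //; first by move=> m; exact: cutoff1.
  by move=> x _; exists 0%N.
have [K /choice[f Hf]] := choice L.
have := cS0; rewrite compact_cover => /(_ _ S0
  (fun y => [set z | S0 z -> forall m, \forall x \near z, f y m x = 0]°)).
case.
- by move=> y _; exact: open_interior.
- move=> y Sy; exists y => //; have [_ _ _ /(_ Sy)] := Hf y.
  by move=> h; exact: h.
move=> F FS cov.
exists (\sum_(y <- F) K y), (fun m x => \prod_(y <- F) f y m x); split.
- by apply: sumr_ge0 => y _; have [] := Hf y.
- move=> m; apply: (@cutoff_prod _ _ _ _ _ _ K (fun y => f y m)).
    by move=> y; have [] := Hf y.
  by move=> y; have [_ c _ _] := Hf y.
- move=> x Dx; have /choice[m0 Hm0] y : exists m0, forall m, (m0 <= m)%N -> f y m x = 1.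
    by have [_ _ h _] := Hf y; exact: h.
  exists (\max_(y <- F) m0 y)%N => m mM; apply: big1_seq => y /andP[_ yF].
  apply: Hm0; apply: leq_trans mM; exact: (@leq_bigmax_seq _ _ xpredT).
- move=> z Sz m; have [y yF /interior_subset /(_ Sz m)] := cov z Sz.
  apply: filterS => x fx; rewrite (bigD1_seq y) /= ?finmap.fset_uniq//.
  by rewrite fx mul0r.
Qed.

(** The product [Phi] vanishes near [S0], so replacing it by zero off the exterior keeps it smooth;
    [kappa] makes the support bounded. At points off the exterior the flux inequality holds since
    the left side is zero. *)
Lemma cutoffs : exists K (chi : nat -> 'rV[R]_n -> R), 0 <= K /\
  [/\ forall m, test_function D (chi m), forall m x, 0 <= chi m x <= 1,
      forall x, D x -> chi^~ x @ \oo --> (1 : R) &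
      forall m x a, 2 * chi m x * flux_form (G x) (sp (grad (chi m) x)) a <= K * sq a].
Proof.
have [K1 K10 H1] := kappa1_cutoff; have [K2 [f [K20 c2 f1 f0]]] := finite_cutoffs.
have ck m : cutoff G D (\sum_(i < n) K1) (kappa m).
  by apply: cutoff_prod => // i; exact: H1.
pose K := \sum_(i < n) K1 + K2.
have K0 : 0 <= K by rewrite addr_ge0// sumr_ge0.
pose Phi m x := kappa m x * f m x.
have cP m : cutoff G D K (Phi m) by apply: cutoffM => //; apply: sumr_ge0.
pose chi m x := if `[< D x >] then Phi m x else 0.
have oD : open D by exact: open_exterior.
have chiD m x : D x -> \forall y \near x, chi m y = Phi m y.
  move=> Dx; have := open_nbhs_nbhs (conj oD Dx); apply: filterS => y Dy.
  by rewrite /chi asboolT.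
have chiN m x : ~ D x -> \forall y \near x, chi m y = 0.
  move=> nD; have [Sx|nS] := pselect (S0 x).
    apply: filterS (f0 x Sx m) => y fy; rewrite /chi /Phi fy mulr0.
    by case: asboolP.
  have Ox : Oint x by have [|] := interior_or_exterior hO nS.
  have := open_nbhs_nbhs (conj (open_inside hO) Ox); apply: filterS => y Oy.
  rewrite /chi asboolF// => Dy.
  by have : (Oint `&` D) y by []; rewrite interior_exterior0.
have schi m : Cinf (chi m).
  apply: smooth_local => x; have [Dx|nD] := pselect (D x).
    exists (Phi m); first by have [] := cP m.
    by apply: filterS (chiD m x Dx) => y ->.
  by exists (fun=> 0); [exact: smooth_cst|apply: filterS (chiN m x nD) => y ->].
exists K, chi; split => //; split.
- move=> m; split; first exact/CinfP.
  (* The support is the part of [closure D] in a box where [chi m] is not locally zero. Off [D] it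
     is locally zero, so this compact set is contained in [D]. *)
  pose N := [set x | chi m x = 0]°.
  pose b : 'rV[R]_n := \row_i (m%:R + 2).
  exists ((cbox (- b) b `&` closure D) `&` ~` N); split.
  + apply: compact_closedI; last by apply: open_closedC; exact: open_interior.
    by apply: compact_closedI; [exact: compact_cbox|exact: closed_closure].
  + move=> x [[_ cD] nN]; apply: contrapT => nD; apply: nN; exact: chiN.
  + move=> x nx; have [|nD] := pselect (D x); last exact: (nbhs_singleton (chiN m x nD)).
    move=> Dx; have [xb|xb] := pselect (cbox (- b) b x); last first.
      rewrite /chi asboolT// /Phi.
      have [i Hi] : exists i, ~ (- b) ord0 i <= x ord0 i <= b ord0 i.
        by apply/not_existsP => Hx; apply: xb => i; apply: contrapT; exact: Hx.
      rewrite /kappa (bigD1 i)//= bump1_out ?mul0r//.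
      by apply/negP => /andP[h1 h2]; apply: Hi; rewrite !mxE !ltW.
    have Nx : N x by apply: contrapT => nN; apply: nx; split => //; split => //; exact: subset_closure.
    exact: (nbhs_singleton Nx).
- move=> m x; rewrite /chi; case: asboolP => _; last by rewrite lexx ler01.
  by have [_ h _] := cP m; exact: h.
- move=> x Dx; have [m1 Hm1] := f1 x Dx.
  have [m2 Hm2] : exists m2 : nat, forall m, (m2 <= m)%N -> kappa m x = 1.
    exists (Num.truncn `|x|).+1 => m mx; rewrite /kappa big1// => i _.
    have xi : `|x ord0 i| <= m%:R.
      apply: (@le_trans _ _ `|x|).
        rewrite [leRHS]/Num.norm /= mx_normrE.
        by apply/bigmax_geP; right => /=; exists (ord0, i).
      by rewrite ltW// (lt_le_trans (truncnS_gt _))// ler_nat.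
    move: xi; rewrite ler_norml => /andP[h1 h2].
    by rewrite /bump1 !step_ge1 ?mulr1// mul1r; lra.
  apply: cvg_near_cst; exists (maxn m1 m2) => // m /=; rewrite geq_max => /andP[g1 g2].
  by rewrite /chi asboolT// /Phi Hm1// Hm2// mulr1.
- move=> m x a; have [Dx|nD] := pselect (D x); last first.
    rewrite (nbhs_singleton (chiN m x nD)) mulr0 mul0r mulr_ge0// sq_ge0.
    by [].
  have [_ _ h] := cP m; have := h x a Dx.
  rewrite (nbhs_singleton (chiD m x Dx)).
  suff -> : grad (chi m) x = grad (Phi m) x by [].
  apply/rowP => j; rewrite !mxE.
  exact: (nbhs_singleton (partials_near [:: j] (chiD m x Dx))).
Qed.

End global_cutoff.

(** * The energy current *)

Section current_algebra.
Variables (R : realType) (n : nat) (M : 'M[R]_n.+1).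
Hypothesis sM : M^T = M.
Implicit Types (w a : 'rV[R]_n.+1).

(* Coefficients of the energy current: the flux through [w] is
   sum_j w_j sum_{k,l} c_jkl a_k a_l. *)
Definition current (j k l : 'I_n.+1) : R :=
  2 * M j k * M ord0 l - M j ord0 * M k l.

Let sME j k : M j k = M k j. Proof. by rewrite -{1}sM mxE. Qed.

Lemma flux_formE w a : flux_form M w a =
  \sum_j w ord0 j * \sum_k \sum_l current j k l * (a ord0 k * a ord0 l).
Proof.
have E j : \sum_k \sum_l current j k l * (a ord0 k * a ord0 l) =
    2 * (\sum_k M j k * a ord0 k) * mform M (e0 R n) a - M ord0 j * mform M a a.
  rewrite mform_e0l -mulrA big_distrlr /= mulr_sumr /mform mulr_sumr -sumrB.
  apply: eq_bigr => k _; rewrite [2 * _]mulr_sumr [X in _ - X]mulr_sumr -sumrB.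
  apply: eq_bigr => l _; rewrite /current (sME j ord0).
  by move: (M _ _) (M _ _) (M _ _) (M _ _) (a _ _) (a _ _) => *; ring.
under eq_bigr do rewrite E mulrBr.
rewrite sumrB /flux_form; congr (_ - _).
  transitivity (2 * (\sum_j w ord0 j * \sum_k M j k * a ord0 k) * mform M (e0 R n) a).
    congr (2 * _ * _); apply: eq_bigr => j _; rewrite mulr_sumr; apply: eq_bigr => k _.
    by rewrite mulrCA mulrA.
  rewrite mulr_sumr mulr_suml; apply: eq_bigr => j _.
  by move: (\sum_k _) (mform _ _ _) => *; ring.
rewrite mform_e0l mulr_suml; apply: eq_bigr => j _.
by move: (mform _ _ _) => *; ring.
Qed.

Lemma energy_formE a : energy_form M a =
  \sum_k \sum_l current ord0 k l * (a ord0 k * a ord0 l).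
Proof.
have -> : energy_form M a = flux_form M (e0 R n) a.
  rewrite /energy_form /hform /flux_form mform_e0.
  by move: (mform _ _ _) (mform _ _ _) => *; ring.
rewrite flux_formE big_ord_recl [X in _ + X]big1 ?addr0; last first.
  by move=> i _; rewrite mxE eqxx /= mul0r.
by rewrite mxE !eqxx mul1r.
Qed.

(** Besides the right side, the contraction leaves two sums that cancel because [M] and [b] are
    symmetric. With [b] the second derivatives, the result is the principal part of the operator
    times the multiplier. *)
Lemma current_divergence (b : 'I_n.+1 -> 'I_n.+1 -> R) a : (forall j k, b j k = b k j) ->
  \sum_j \sum_k \sum_l current j k l * (b j k * a ord0 l + a ord0 k * b j l) =
  2 * (\sum_j \sum_k M j k * b j k) * mform M (e0 R n) a.
Proof.
move=> sb; rewrite mform_e0l.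
pose P (k : 'I_n.+1) := \sum_l M k l * a ord0 l.
pose q (j : 'I_n.+1) := \sum_l M ord0 l * b j l.
have E j : \sum_k \sum_l current j k l * (b j k * a ord0 l + a ord0 k * b j l) =
    2 * (\sum_k M j k * b j k) * P ord0 + 2 * P j * q j - 2 * (M j ord0 * \sum_k b j k * P k).
  have E1 : \sum_k \sum_l current j k l * (b j k * a ord0 l) =
      2 * (\sum_k M j k * b j k) * P ord0 - M j ord0 * \sum_k b j k * P k.
    rewrite -[X in X - _]mulrA /P big_distrlr /= mulr_sumr [X in _ - X]mulr_sumr -sumrB.
    apply: eq_bigr => k _; rewrite [2 * _]mulr_sumr [b j k * _]mulr_sumr [X in _ - X]mulr_sumr -sumrB.
    apply: eq_bigr => l _; rewrite /current.
    by move: (M _ _) (M _ _) (M _ _) (M _ _) (b _ _) (a _ _) => *; ring.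
  have E2 : \sum_k \sum_l current j k l * (a ord0 k * b j l) =
      2 * P j * q j - M j ord0 * \sum_k b j k * P k.
    have -> : \sum_k b j k * P k = \sum_k \sum_l M k l * (a ord0 k * b j l).
      rewrite /P exchange_big /=.
      under eq_bigr do rewrite mulr_sumr.
      apply: eq_bigr => k _; apply: eq_bigr => l _.
      by rewrite (sME l k); move: (M _ _) (b _ _) (a _ _) => *; ring.
    rewrite -[X in X - _]mulrA /P /q big_distrlr /= mulr_sumr [X in _ - X]mulr_sumr -sumrB.
    apply: eq_bigr => k _; rewrite [2 * _]mulr_sumr [X in _ - X]mulr_sumr -sumrB.
    apply: eq_bigr => l _; rewrite /current.
    by move: (M _ _) (M _ _) (M _ _) (M _ _) (b _ _) (a _ _) => *; ring.
  transitivity (\sum_k \sum_l current j k l * (b j k * a ord0 l) +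
      \sum_k \sum_l current j k l * (a ord0 k * b j l)).
    rewrite -big_split; apply: eq_bigr => k _; rewrite -big_split; apply: eq_bigr => l _.
    by rewrite mulrDr.
  by rewrite E1 E2; move: (\sum_k _) (\sum_k _) (P ord0) (P j) (q j) (M j ord0) => *; ring.
under eq_bigr do rewrite E.
rewrite sumrB big_split /=.
have -> : \sum_i 2 * P i * q i = \sum_i 2 * (M i ord0 * \sum_k b i k * P k).
  transitivity (2 * \sum_i P i * q i).
    by rewrite mulr_sumr; apply: eq_bigr => i _; rewrite mulrA.
  rewrite -mulr_sumr; congr (2 * _).
  under [RHS]eq_bigr do rewrite mulr_sumr.
  rewrite exchange_big /=; apply: eq_bigr => k _.
  rewrite /q mulr_sumr; apply: eq_bigr => i _.
  by rewrite (sME i ord0) (sb i k); move: (M _ _) (b _ _) (P k) => *; ring.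
rewrite addrK -/(P ord0) -mulrA mulr_suml [RHS]mulr_sumr.
by apply: eq_bigr => i _; rewrite mulrA.
Qed.

End current_algebra.

(** * Gronwall's inequality in integral form *)

Section gronwall.
Variable R : realType.
Notation lambda := (@lebesgue_measure R).
Notation RR := (measurableTypeR R).

Lemma Rint_win_expR (L t : R) : 0 < L -> 0 < t ->
  intg lambda (fun r => win t r * expR (L * r)) /\
  \int[lambda]_r (win t r * expR (L * r)) <= expR (L * t) / L.
Proof.
move=> L0 t0.
have cE : continuous (fun r : R => expR (L * r)).
  move=> r; apply: (@cvg_comp _ _ _ (fun r => L * r) (@expR R) _ (nbhs (L * r))).
    by apply: cvgMr; exact: cvg_id.
  exact: continuous_expR.
have mE : measurable_fun setT (fun r : RR => expR (L * r)).
  exact: (continuous_measurable_fun cE).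
have i1 : intg lambda (fun r => win t r * expR (L * r)).
  apply: (intg_le _ (intgZ (expR (L * t)) (intg_win t))).
    by apply: measurable_funM => //; exact: measurable_win.
  move=> r; rewrite /win; case: ifPn => [/andP[r0 rt]|_]; last by rewrite mul0r normr0 mulr0.
  by rewrite mul1r mulr1 ger0_norm ?expR_ge0// ler_expR ler_pM2l// ltW.
split => //.
pose F (r : R) := expR (L * r) / L.
have dF (r : R) : is_derive r 1 F (expR (L * r)).
  have dl : is_derive r 1 (fun r : R => L * r) L.
    have := is_deriveM (is_derive_cst L r 1) (is_derive_id r 1).
    by move=> H; apply: is_derive_eq H _; rewrite scaler0 addr0 /GRing.scale /= mulr1.
  have de := is_derive1_comp (is_derive_expR (L * r)) dl.
  have := is_deriveM de (is_derive_cst L^-1 r 1).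
  move=> H; apply: is_derive_eq H _; rewrite scaler0 add0r /GRing.scale /=.
  by rewrite mulrCA mulVf ?mulr1// gt_eqF.
have cF : continuous F.
  by move=> r; apply: differentiable_continuous; apply/derivable1_diffP; have [] := dF r.
have dLR : derivable_oo_LRcontinuous F 0 t.
  split; first by move=> x _; have [] := dF x.
    exact: cvg_at_right_filter (cF 0).
  exact: cvg_at_left_filter (cF t).
have dE : {in `]0, t[, (F^`())%classic =1 (fun r => expR (L * r))}.
  by move=> x _; rewrite derive1E; have [_ ->] := dF x.
have E := continuous_FTC2 t0 (continuous_subspaceT cE) dLR dE.
have -> : \int[lambda]_r (win t r * expR (L * r)) <= expR (L * t) / L =
    (\int[lambda]_r (win t r * expR (L * r)) <= F t) by [].
apply: (@le_trans _ _ (F t - F 0)); last first.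
  by rewrite gerBl /F divr_ge0 ?expR_ge0// ltW.
rewrite -lee_fin EFinB -E -RintE//.
rewrite [leRHS]integral_mkcond; apply: ge0_le_integral => //.
- by move=> r _; rewrite lee_fin mulr_ge0 ?win_ge0 ?expR_ge0.
- exact/measurable_EFinP/intg_measurable/i1.
- have mI : measurable (`[0, t]%classic : set RR) by exact: measurable_itv.
  by apply/(measurable_restrict _ mI measurableT); rewrite setTI; exact/measurable_EFinP/measurable_funTS.
move=> r _; rewrite patchE mem_setE in_itv /= /win; case: ifPn => [/andP[r0 rt]|_].
  by rewrite (ltW r0) (ltW rt) mul1r.
by rewrite mul0r; case: ifP => _; [rewrite lee_fin expR_ge0|exact: lexx].
Qed.

(** With the weight [expR (- (2 * L * t))] the integral term contributes at most half of the
    weighted supremum [S], so [S <= a + S / 2], which gives [S <= 2 * a]. The bound [S0] serves to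
    make this supremum finite. *)
Lemma gronwall (N : R -> R) (T a L S0 : R) : 0 < T -> 0 < L -> 0 <= a ->
  (forall t, 0 <= N t) -> (forall t, 0 <= t <= T -> N t <= S0) ->
  intg lambda (fun r => win T r * N r) ->
  (forall t, 0 <= t <= T -> N t <= a + L * \int[lambda]_r (win t r * N r)) ->
  forall t, 0 <= t <= T -> N t <= 2 * expR (2 * L * T) * a.
Proof.
move=> T0 L0 a0 N0 NS iN H.
pose lam := 2 * L; have lam0 : 0 < lam by rewrite mulr_gt0.
pose A := [set N t * expR (- (lam * t)) | t in [set t | 0 <= t <= T]].
have A0 : A !=set0 by exists (N 0 * expR (- (lam * 0))), 0 => //=; rewrite lexx ltW.
have Aub : has_ubound A.
  exists S0 => _ [t /= t0T <-]; have /andP[t0 _] := t0T.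
  apply: le_trans (NS t t0T); rewrite ler_piMr// -expR0 ler_expR oppr_le0.
  by rewrite mulr_ge0// ltW.
have hA : has_sup A by split.
set S := sup A.
have SN t : 0 <= t <= T -> N t <= S * expR (lam * t).
  move=> t0T; have : N t * expR (- (lam * t)) <= S by apply: ub_le_sup => //; exists t.
  by rewrite expRN ler_pdivrMr// expR_gt0.
have S0' : 0 <= S.
  have := SN 0; rewrite lexx (ltW T0) mulr0 expR0 mulr1 => /(_ isT); exact: le_trans.
have key t : 0 <= t <= T -> N t * expR (- (lam * t)) <= a + S / 2.
  move=> t0T; have /andP[t0 tT] := t0T.
  rewrite expRN ler_pdivrMr ?expR_gt0//.
  have e1 : 1 <= expR (lam * t) by rewrite -expR0 ler_expR mulr_ge0// ltW.
  have ae : a <= a * expR (lam * t) by rewrite ler_peMr.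
  apply: (le_trans (H t t0T)); rewrite mulrDl; apply: lerD => //.
  move: t0; rewrite le_eqVlt => /predU1P[<-|t0].
    rewrite (_ : \int[lambda]_r _ = 0) ?mulr0; last first.
      rewrite -[RHS](@Rint0 _ _ R lambda); apply: eq_Rintegral => r _.
      by rewrite /win; case: ifPn => [/andP[r0 /(lt_trans r0)]|]; rewrite ?ltxx// mul0r.
    by rewrite mulr_ge0 ?expR_ge0// divr_ge0.
  have [i1 b1] := Rint_win_expR lam0 t0.
  have i2 : intg lambda (fun r => win t r * N r).
    have mt : measurable_fun setT (fun r : RR => win t r * (win T r * N r)).
      by apply: measurable_funM; [exact: measurable_win|exact: intg_measurable iN].
    have := intg_le mt (intg_abs iN); have -> : (fun r => win t r * (win T r * N r)) = (fun r => win t r * N r).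
      apply/funext => r; rewrite /win; case: ifPn => [/andP[r0 rt]|]; last by rewrite !mul0r.
      by rewrite r0 (lt_le_trans rt tT) /= !mul1r.
    apply => r; rewrite /win; case: ifPn => [/andP[r0 rt]|]; last by rewrite mul0r normr0.
    by rewrite r0 (lt_le_trans rt tT) mul1r.
  have : \int[lambda]_r (win t r * N r) <= S * (expR (lam * t) / lam).
    apply: (@le_trans _ _ (\int[lambda]_r (S * (win t r * expR (lam * r))))).
      apply: Rint_le => //; first exact: intgZ.
      move=> r; rewrite /win; case: ifPn => [/andP[r0 rt]|]; last by rewrite !mul0r mulr0.
      by rewrite !mul1r; apply: SN; rewrite (ltW r0) (le_trans (ltW rt)).
    by rewrite RintZ// ler_wpM2l.
  move=> h; apply: (le_trans (ler_wpM2l (ltW L0) h)).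
  rewrite le_eqVlt; apply/orP; left; apply/eqP; rewrite /lam.
  by move: (expR _) => E; field; rewrite gt_eqF.
have SS : S <= a + S / 2 by apply: ge_sup => // _ [t t0T <-]; exact: key.
have S2 : S <= 2 * a by lra.
move=> t t0T; have /andP[t0 tT] := t0T; apply: (le_trans (SN t t0T)).
by rewrite [leRHS]mulrAC; apply: ler_pM => //; rewrite ler_expR ler_pM2l.
Qed.

End gronwall.

(** * Slice norms *)

Lemma slice_scalar_le (R : realFieldType) (p q u w : R) :
  p <= 2 * q + 2 * u -> u <= w -> 2 * p + 2 * q <= 6 * q + 4 * w.
Proof. by lra. Qed.

Section slice_norms.
Variables (R : realType) (n : nat) (T : R) (D : set 'rV[R]_n).
Notation lambda := (@lebesgue_measure R).
Notation RR := (measurableTypeR R).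
Notation leb := (lebesgue_rV R n).
Notation lebS := (lebesgue_rV R n.+1).
Variables (U W : 'rV[R]_n.+1 -> R) (c : 'rV[R]_n -> R).
Hypothesis rU : trep T D U W c.

Definition slice_sq (c : 'rV[R]_n -> R) (W : 'rV[R]_n.+1 -> R) (t : R) : R :=
  \int[leb]_y (tslice c W t y ^+ 2).

Let N := \int[lebS]_x (W x ^+ 2).
Let N0 : 0 <= N. Proof. by apply: Rint_ge0 => x; exact: sqr_ge0. Qed.

Lemma slice_sq_ge0 t : 0 <= slice_sq c W t.
Proof. by apply: Rint_ge0 => y; exact: sqr_ge0. Qed.

Lemma slice_sq_le s t : slice_sq c W t <= 2 * slice_sq c W s + 2 * (`|t - s| * N).
Proof.
have [L E] := tsliceB_le s t rU; have [_ Ls] := tslice_L2 s rU; have [_ Lt] := tslice_L2 t rU.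
have [_ Ld] := L.
apply: (@le_trans _ _ (\int[leb]_y (2 * tslice c W s y ^+ 2 +
    2 * (tslice c W t y - tslice c W s y) ^+ 2))).
  apply: Rint_le => //; first by apply: intgD; exact: intgZ.
  move=> y; move: (tslice _ _ s y) (tslice _ _ t y) => p q.
  by have := sqrD_le (lexx (p ^+ 2)) (lexx ((q - p) ^+ 2)); rewrite addrC subrK.
rewrite (RintD (intgZ _ Ls) (intgZ _ Ld)) (RintZ _ Ls) (RintZ _ Ld).
by rewrite /slice_sq lerD2l ler_wpM2l.
Qed.

(** A difference of squares is a product, to which Cauchy-Schwarz and the Hölder bound for the
    slices apply. The maximum of the energy is attained thanks to this continuity. *)
Lemma continuous_slice_sq : continuous (slice_sq c W).
Proof.
move=> s.
pose K := N * (6 * slice_sq c W s + 4 * N) + 1.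
have K0 : 0 < K.
  by rewrite ltr_wpDl// mulr_ge0// addr_ge0// mulr_ge0// slice_sq_ge0.
have H t : `|t - s| <= 1 -> (slice_sq c W t - slice_sq c W s) ^+ 2 <= `|t - s| * K.
  move=> ts; have [L E] := tsliceB_le s t rU.
  have Ls := tslice_L2 s rU; have Lt := tslice_L2 t rU.
  have La : L2 leb (fun y => tslice c W t y + tslice c W s y) by exact: L2D.
  have -> : slice_sq c W t - slice_sq c W s =
      \int[leb]_y ((tslice c W t y - tslice c W s y) * (tslice c W t y + tslice c W s y)).
    rewrite /slice_sq -(RintB Lt.2 Ls.2); apply: eq_Rintegral => y _.
    by rewrite subr_sqr.
  apply: (le_trans (cauchy_schwarz L La)).
  have E2 : \int[leb]_y ((tslice c W t y + tslice c W s y) ^+ 2) <=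
      2 * slice_sq c W t + 2 * slice_sq c W s.
    rewrite -(RintZ _ Lt.2) -(RintZ _ Ls.2) -(RintD (intgZ _ Lt.2) (intgZ _ Ls.2)).
    apply: Rint_le; [exact: La.2|by apply: intgD; apply: intgZ; [exact: Lt.2|exact: Ls.2]|].
    by move=> y; exact: sqrD_le.
  have E3 := slice_sq_le s t.
  apply: (@le_trans _ _ ((`|t - s| * N) * (6 * slice_sq c W s + 4 * N))); last first.
    by rewrite -mulrA ler_wpM2l// lerDl.
  apply: ler_pM => //; [by apply: Rint_ge0 => y; exact: sqr_ge0..|].
  apply: (le_trans E2); have : `|t - s| * N <= N by rewrite ler_piMl.
  exact: slice_scalar_le E3.
apply/(@cvgrPdist_lt _ _ _ (nbhs s)) => e e0.
apply/nbhs_normP; pose d := Num.min 1 (e ^+ 2 / K).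
have d0 : 0 < d by rewrite lt_min ltr01 divr_gt0// exprn_gt0.
exists d => //= t; rewrite /ball_ /= => st; have ts : `|t - s| < d by rewrite distrC.
have t1 : `|t - s| <= 1 by rewrite ltW// (lt_le_trans ts)// ge_min lexx.
have t2 : `|t - s| * K < e ^+ 2.
  by rewrite -ltr_pdivlMr// (lt_le_trans ts)// ge_min lexx orbT.
have := le_lt_trans (H t t1) t2; rewrite distrC -real_normK ?num_real//.
by rewrite ltr_sqr// nnegrE ltW.
Qed.

Lemma slice_sq_fubini t : t <= T ->
  intg lambda (fun r => win t r * slice_sq c W r) /\
  \int[lebS]_x (win t (x ord0 ord0) * U x ^+ 2) = \int[lambda]_r (win t r * slice_sq c W r).
Proof.
move=> tT; have [[[mU iU] _] [[mW _] _] [mc _] _ _] := rU.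
have mw : measurable_fun setT (fun x : 'rV[R]_n.+1 => win t (x ord0 ord0)).
  by apply: (measurableT_comp (measurable_win t)); exact: measurable_rV_coord.
have ix : intg lebS (fun x => win t (x ord0 ord0) * U x ^+ 2).
  apply: (intg_le _ iU); first by apply: measurable_funM => //; exact: measurable_funX.
  by move=> x; rewrite normrM (ger0_norm (sqr_ge0 _)) ler_piMl ?sqr_ge0// win_bound.
have ip := (intg_ins_row ord0 (intg_measurable ix)).1 ix.
have [i1 e1] := intg_fubini1 ip.
have mt : measurable_fun setT (fun z : RR * 'rV[R]_n => tslice c W z.1 z.2).
  apply: measurable_funD; last exact: measurable_tint.
  exact: (measurableT_comp mc measurable_snd).
have mi : measurable_fun setT (fun r : RR => win t r * slice_sq c W r).
  apply: measurable_funM; first exact: measurable_win.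
  apply: (@measurable_Rint _ _ RR _ R leb (fun z => tslice c W z.1 z.2 ^+ 2)).
  exact: measurable_funX.
have E : {ae lambda, forall r : RR, \int[leb]_y
    (win t (ins_row ord0 r y ord0 ord0) * U (ins_row ord0 r y) ^+ 2) =
    win t r * slice_sq c W r}.
  apply: ae_impl (trep_slices rU) => r Ur.
  have [r0|r0] := boolP (0 < r < t); last first.
    rewrite /win (negbTE r0) mul0r -[RHS](@Rint0 _ _ R leb); apply: eq_Rintegral => y _.
    by rewrite ins_row_at (negbTE r0) mul0r.
  have r0T : 0 < r < T by case/andP: r0 => -> /= /lt_le_trans; apply.
  rewrite /slice_sq -(RintZ _ (tslice_L2 r rU).2); apply: ae_Rint.
  - by apply: filterS (Ur r0T) => y ->; rewrite ins_row_at.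
  - apply: measurable_funM; last by apply: measurable_funX; exact: measurable_ins_slice.
    by under eq_fun do rewrite ins_row_at; exact: measurable_cst.
  - exact: intg_measurable (intgZ _ (tslice_L2 r rU).2).
split; first exact: ae_intg E mi i1.
rewrite (Rint_ins_row ord0 (intg_measurable ix)) -e1.
by apply: ae_Rint => //; exact: intg_measurable i1.
Qed.

End slice_norms.

(** * Growth of the energy *)

Lemma sq_mul_le (R : realType) n (a : 'rV[R]_n) k l : `|a ord0 k * a ord0 l| <= sq a.
Proof.
rewrite normrM -[leRHS]sqr_sqrtr ?sq_ge0// expr2; apply: ler_pM => //; exact: norm_le_sq.
Qed.

Section bounded_current.
Variables (R : realType) (n : nat) (G : 'rV[R]_n -> 'M[R]_n.+1) (C0 : R).
Hypothesis hG : wave_coefficients G C0.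

Lemma current_bdd1 j k l : bdd1 (fun x => current (G x) j k l).
Proof.
rewrite (_ : (fun x => _) = fun x => 2 * (G x j k * G x ord0 l) + (-1) * (G x j ord0 * G x k l)).
  by apply: bdd1D; (apply: bdd1M; [exact: bdd1_cst|apply: bdd1M; exact: G_bdd1 hG _ _]).
by apply/funext => x; rewrite /current; ring.
Qed.

Lemma current_bound : exists2 M : R, 0 <= M & forall x j k l,
  `|current (G x) j k l| <= M /\ forall i, `|partial (fun y => current (G y) j k l) i x| <= M.
Proof.
have /choice[f Hf] (jkl : 'I_n.+1 * ('I_n.+1 * 'I_n.+1)) : exists M : R, forall x,
    `|current (G x) jkl.1 jkl.2.1 jkl.2.2| <= M /\
    forall i, `|partial (fun y => current (G y) jkl.1 jkl.2.1 jkl.2.2) i x| <= M.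
  by have [_] := current_bdd1 jkl.1 jkl.2.1 jkl.2.2.
exists (\sum_jkl `|f jkl|); first exact: sumr_ge0.
move=> x j k l; have fB : f (j, (k, l)) <= \sum_jkl `|f jkl|.
  by rewrite (le_trans (ler_norm _))// (bigD1 (j, (k, l)))//= lerDl sumr_ge0.
have [h1 h2] := Hf (j, (k, l)) x.
by split => [|i]; [exact: le_trans h1 fB|exact: le_trans (h2 i) fB].
Qed.

End bounded_current.

Section energy_growth.
Variables (R : realType) (n : nat) (G : 'rV[R]_n.+1 -> 'M[R]_n.+2) (C0 : R).
Hypothesis hG : wave_coefficients G C0.
Variables (T : R) (D : set 'rV[R]_n.+1).
Hypotheses (T0 : 0 < T) (oD : open D).
Notation lambda := (@lebesgue_measure R).
Notation RR := (measurableTypeR R).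
Notation leb := (lebesgue_rV R n.+1).
Notation lebS := (lebesgue_rV R n.+2).
Notation Q := (cylinder T D).
Variables (A : 'I_n.+2 -> 'rV[R]_n.+2 -> R) (B : 'I_n.+2 -> 'I_n.+2 -> 'rV[R]_n.+2 -> R).
Variables (cA : 'I_n.+2 -> 'rV[R]_n.+1 -> R) (F : 'rV[R]_n.+2 -> R).
Hypothesis rA : forall k, trep T D (A k) (B ord0 k) (cA k).
Hypothesis cB : forall j k, cyl T D (B j k).
Hypothesis sB : forall j k, B j k = B k j.
Hypothesis dA : forall j k phi, test_function Q phi ->
  \int[lebS]_x (A k x * partial phi j x) = - \int[lebS]_x (B j k x * phi x).
Hypothesis cF : cyl T D F.
Hypothesis eqF : {ae lebS, forall x, \sum_j \sum_k G (del_row ord0 x) j k * B j k x =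
  F x - \sum_k drift G k (del_row ord0 x) * A k x}.

Let avec (x : 'rV[R]_n.+2) : 'rV[R]_n.+2 := \row_k A k x.
Let tvec (t : R) (y : 'rV[R]_n.+1) : 'rV[R]_n.+2 := \row_k tslice (cA k) (B ord0 k) t y.

Let cyA k : cyl T D (A k). Proof. by have [] := rA k. Qed.
Let LA k : L2 lebS (A k). Proof. by have [] := cyA k. Qed.
Let LB j k : L2 lebS (B j k). Proof. by have [] := cB j k. Qed.

Let ipair k l : intg lebS (fun x => A k x * A l x). Proof. exact: L2M. Qed.

Let isq : intg lebS (fun x => sq (avec x)).
Proof.
rewrite /sq; apply: intg_sum => k; have [_] := LA k; congr intg; apply/funext => x.
by rewrite mxE.
Qed.

Let mdel (g : 'rV[R]_n.+1 -> R) : measurable_fun setT g ->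
  measurable_fun setT (fun x : 'rV[R]_n.+2 => g (del_row ord0 x)).
Proof. by move=> mg; apply: (measurableT_comp mg); exact: measurable_del_row. Qed.

Let mwin (t : R) : measurable_fun setT (fun x : 'rV[R]_n.+2 => win t (x ord0 ord0)).
Proof. by apply: (measurableT_comp (measurable_win t)); exact: measurable_rV_coord. Qed.

Let iwin t h : intg lebS h -> intg lebS (fun x => win t (x ord0 ord0) * h x).
Proof.
move=> ih; apply: (intg_le _ (intg_abs ih)).
  by apply: measurable_funM => //; exact: intg_measurable ih.
by move=> x; rewrite normrM ler_piMl// win_bound.
Qed.

Section with_cutoff.
Variables (chi : 'rV[R]_n.+1 -> R) (K : R).
Hypotheses (tchi : test_function D chi) (chi01 : forall y, 0 <= chi y <= 1).
Hypothesis chiK : forall x a,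
  2 * chi x * flux_form (G x) (sp (grad chi x)) a <= K * sq a.

Let chi_energy t := \int[leb]_y (chi y ^+ 2 * energy_form (G y) (tvec t y)).

Let mcur j k l : measurable_fun setT (fun y => current (G y) j k l).
Proof.
by apply: continuous_measurable_rV; apply: smooth_continuous; have [] := current_bdd1 hG j k l.
Qed.

Let mchi : measurable_fun setT chi. Proof. exact: measurable_test tchi. Qed.

Let g0 k l y := chi y ^+ 2 * current (G y) ord0 k l.

Let mg0 k l : measurable_fun setT (g0 k l).
Proof. by apply: measurable_funM => //; exact: measurable_funX. Qed.

Let chi2_le1 y : `|chi y ^+ 2| <= 1.
Proof.
by have /andP[c0 c1] := chi01 y; rewrite ger0_norm ?sqr_ge0// expr_le1.
Qed.

Let g0_bound : exists M, forall k l y, `|g0 k l y| <= M.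
Proof.
have [M M0 HM] := current_bound hG; exists M => k l y; rewrite normrM -[leRHS]mul1r.
by apply: ler_pM => //; have [] := HM y ord0 k l.
Qed.

Let i_energy t k l : intg leb (fun y => g0 k l y *
  (tslice (cA k) (B ord0 k) t y * tslice (cA l) (B ord0 l) t y)).
Proof.
have [M HM] := g0_bound.
have := L2M (L2_bounded (mg0 k l) (HM k l) (tslice_L2 t (rA k))) (tslice_L2 t (rA l)).
by congr intg; apply/funext => y; rewrite mulrA.
Qed.

Let chi_energyE t : chi_energy t = \sum_k \sum_l \int[leb]_y (g0 k l y *
  (tslice (cA k) (B ord0 k) t y * tslice (cA l) (B ord0 l) t y)).
Proof.
transitivity (\int[leb]_y \sum_k \sum_l (g0 k l y *
  (tslice (cA k) (B ord0 k) t y * tslice (cA l) (B ord0 l) t y))).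
  apply: eq_Rintegral => y _; rewrite (energy_formE (wave_sym hG y)) mulr_sumr.
  apply: eq_bigr => k _; rewrite mulr_sumr; apply: eq_bigr => l _.
  by rewrite !mxE mulrA.
rewrite Rint_sum => [|k]; last by apply: intg_sum => l; exact: i_energy.
by apply: eq_bigr => k _; rewrite Rint_sum// => l; exact: i_energy.
Qed.

Let H0 k l x := chi (del_row ord0 x) ^+ 2 * current (G (del_row ord0 x)) ord0 k l *
  (B ord0 k x * A l x + A k x * B ord0 l x).

(** The [j]-th spatial derivative of [chi^2] times the current coefficient times [A k * A l],
    written out. Its integral over the time window is zero by [space_parts]; adding these terms to
    [H0] completes the divergence of the current. *)
Let Hj (j : 'I_n.+1) k l x :=
  chi (del_row ord0 x) ^+ 2 * current (G (del_row ord0 x)) (lift ord0 j) k l *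
    (B (lift ord0 j) k x * A l x + A k x * B (lift ord0 j) l x) +
  (2 * chi (del_row ord0 x) * partial chi j (del_row ord0 x) *
     current (G (del_row ord0 x)) (lift ord0 j) k l +
   chi (del_row ord0 x) ^+ 2 *
     partial (fun y => current (G y) (lift ord0 j) k l) j (del_row ord0 x)) *
  (A k x * A l x).

Let iH0 k l : intg lebS (H0 k l).
Proof.
have [M HM] := g0_bound; have i := intgD (L2M (LB ord0 k) (LA l)) (L2M (LA k) (LB ord0 l)).
apply: (intg_le _ (intgZ M (intg_abs i))).
  by apply: measurable_funM; [exact: (mdel (mg0 k l))|exact: intg_measurable i].
by move=> x; rewrite normrM ler_wpM2r//; exact: HM.
Qed.

Let space t j k l : 0 < t <= T -> intg lebS (Hj j k l) /\
  \int[lebS]_x (win t (x ord0 ord0) * Hj j k l x) = 0.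
Proof.
move=> t0T; have sc : Cinf (fun y => current (G y) (lift ord0 j) k l).
  by have [] := current_bdd1 hG (lift ord0 j) k l.
have [i1 [i2 E]] := space_parts (LA k) (LB (lift ord0 j) k) (LA l) (LB (lift ord0 j) l)
  (fun phi => @dA (lift ord0 j) k phi) (fun phi => @dA (lift ord0 j) l phi) sc tchi t0T.
by split; [exact: intgD i1 i2|exact: E].
Qed.

Let below_win (t : R) k l (x : 'rV[R]_n.+2) : below (x ord0 ord0) t * H0 k l x = win t (x ord0 ord0) * H0 k l x.
Proof.
have [Qx|nQ] := pselect (Q x); last first.
  by rewrite /H0 !(cB _ _).2// !(cyA _).2// !(mul0r,mulr0,addr0).
have [/andP[x0 _] _] := Qx; rewrite /below /win x0 /=.
by case: (x ord0 ord0 < t).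
Qed.

Let Htot x := \sum_k \sum_l H0 k l x + \sum_j \sum_k \sum_l Hj j k l x.

Let iHtot t : 0 < t <= T -> intg lebS Htot.
Proof.
move=> t0T; apply: intgD; first by apply: intg_sum => k; apply: intg_sum.
by apply: intg_sum => j; apply: intg_sum => k; apply: intg_sum => l; have [] := space j k l t0T.
Qed.

Let growthE t : 0 < t <= T ->
  chi_energy t - chi_energy 0 = \int[lebS]_x (win t (x ord0 ord0) * Htot x).
Proof.
move=> t0T; have [M HM] := g0_bound.
have -> : chi_energy t - chi_energy 0 =
    \sum_k \sum_l \int[lebS]_x (win t (x ord0 ord0) * H0 k l x).
  rewrite !chi_energyE -sumrB; apply: eq_bigr => k _; rewrite -sumrB; apply: eq_bigr => l _.
  have E0 : \int[leb]_y (g0 k l y *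
      (tslice (cA k) (B ord0 k) 0 y * tslice (cA l) (B ord0 l) 0 y)) =
      \int[leb]_y (g0 k l y * (cA k y * cA l y)).
    by apply: eq_Rintegral => y _; rewrite (tslice_le0 y (rA k) (lexx 0)) (tslice_le0 y (rA l) (lexx 0)).
  rewrite E0 (product_time t (rA k) (rA l) (mg0 k l) (HM k l)).
  by apply: eq_Rintegral => x _; exact: below_win.
have iS : intg lebS (fun x => \sum_k \sum_l win t (x ord0 ord0) * H0 k l x).
  by apply: intg_sum => k; apply: intg_sum => l; exact: iwin.
have iR : intg lebS (fun x => \sum_j \sum_k \sum_l win t (x ord0 ord0) * Hj j k l x).
  apply: intg_sum => j; apply: intg_sum => k; apply: intg_sum => l; apply: iwin.
  by have [] := space j k l t0T.
have E2 : \int[lebS]_x (\sum_j \sum_k \sum_l win t (x ord0 ord0) * Hj j k l x) = 0.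
  rewrite Rint_sum; last first.
    move=> j; apply: intg_sum => k; apply: intg_sum => l; apply: iwin.
    by have [] := space j k l t0T.
  apply: big1 => j _; rewrite Rint_sum; last first.
    by move=> k; apply: intg_sum => l; apply: iwin; have [] := space j k l t0T.
  apply: big1 => k _; rewrite Rint_sum; last first.
    by move=> l; apply: iwin; have [] := space j k l t0T.
  by apply: big1 => l _; have [] := space j k l t0T.
transitivity (\int[lebS]_x (\sum_k \sum_l win t (x ord0 ord0) * H0 k l x) +
  \int[lebS]_x (\sum_j \sum_k \sum_l win t (x ord0 ord0) * Hj j k l x)).
  rewrite E2 addr0 Rint_sum => [|k]; last by apply: intg_sum => l; exact: iwin.
  by apply: eq_bigr => k _; rewrite Rint_sum// => l; exact: iwin.
rewrite -(RintD iS iR); apply: eq_Rintegral => x _; rewrite /Htot mulrDr; congr (_ + _).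
  by rewrite mulr_sumr; apply: eq_bigr => k _; rewrite mulr_sumr.
rewrite mulr_sumr; apply: eq_bigr => j _; rewrite mulr_sumr; apply: eq_bigr => k _.
by rewrite mulr_sumr.
Qed.

(** The second derivatives are contracted by [current_divergence], and the derivatives of [chi]
    assemble into the flux through its gradient. The coefficients are independent of time, so only
    their spatial derivatives remain. *)
Let HtotE x (y := del_row ord0 x) : Htot x =
  chi y ^+ 2 * (2 * (\sum_j \sum_k G y j k * B j k x) * mform (G y) (e0 R n.+1) (avec x)) +
  2 * chi y * flux_form (G y) (sp (grad chi y)) (avec x) +
  chi y ^+ 2 * \sum_j \sum_k \sum_l
    partial (fun y => current (G y) (lift ord0 j) k l) j y * (A k x * A l x).
Proof.
have sbx j k : B j k x = B k j x by rewrite sB.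
have Ef : flux_form (G y) (sp (grad chi y)) (avec x) = \sum_(j < n.+1) grad chi y ord0 j *
    \sum_k \sum_l current (G y) (lift ord0 j) k l * (avec x ord0 k * avec x ord0 l).
  rewrite (flux_formE (wave_sym hG y)) [LHS]big_ord_recl sp0 mul0r add0r.
  by apply: eq_bigr => j _; rewrite spS.
rewrite -(current_divergence (wave_sym hG y) (avec x) sbx) [X in chi y ^+ 2 * X]big_ord_recl mulrDr Ef.
rewrite /Htot -!addrA; congr (_ + _).
  rewrite mulr_sumr; apply: eq_bigr => k _; rewrite mulr_sumr; apply: eq_bigr => l _.
  by rewrite /H0 !mxE mulrA.
rewrite !mulr_sumr -!big_split /=; apply: eq_bigr => j _.
rewrite mulrA !mulr_sumr -!big_split /=; apply: eq_bigr => k _.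
rewrite !mulr_sumr -!big_split /=; apply: eq_bigr => l _.
rewrite /Hj !mxE -/y.
move: (chi y) (partial chi j y) (current _ _ _ _) (partial _ j y) (A k x) (A l x).
by move: (B _ k x) (B _ l x) => b1 b2 c1 c2 c3 c4 a1 a2; ring.
Qed.

Variables (KE Dr Mc : R).
Hypotheses (KE0 : 0 <= KE) (Dr0 : 0 <= Dr) (Mc0 : 0 <= Mc) (K0 : 0 <= K).
Hypothesis HKE : forall x a, mform (G x) (e0 R n.+1) a ^+ 2 <= KE * sq a.
Hypothesis HDr : forall k x, `|drift G k x| <= Dr.
Hypothesis HMc : forall x j k l i, `|partial (fun y => current (G y) j k l) i x| <= Mc.

(* The terms account for the source and the drift, the flux through the cutoff,
   and the derivatives of the coefficients of the current. *)
Definition growth_constant : R :=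
  2 * KE + (n.+2%:R * Dr) ^+ 2 + K + n.+1%:R * (n.+2%:R * (n.+2%:R * Mc)).

Let Htot_le : {ae lebS, forall x, Htot x <= F x ^+ 2 + growth_constant * sq (avec x)}.
Proof.
apply: filterS eqF => x Ex; rewrite HtotE; set y := del_row ord0 x in Ex *.
have s0 := sq_ge0 (avec x).
have hm := HKE y (avec x); have hf := chiK y (avec x).
have hd : `|\sum_k drift G k y * A k x| <= n.+2%:R * Dr * Num.sqrt (sq (avec x)).
  have := @sum_sq_le _ _ (fun k => drift G k y) Dr (avec x) (fun k => HDr k y).
  by under eq_bigr do rewrite mxE.
have hd2 : (\sum_k drift G k y * A k x) ^+ 2 <= (n.+2%:R * Dr) ^+ 2 * sq (avec x).
  rewrite -[sq (avec x)]sqr_sqrtr// -exprMn -real_normK ?num_real// ler_sqr ?nnegrE//.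
  by rewrite mulr_ge0 ?sqrtr_ge0// mulr_ge0.
have sumc m (u : R) : \sum_(i < m) u = m%:R * u by rewrite sumr_const card_ord mulr_natl.
have h3 : `|\sum_j \sum_k \sum_l partial (fun y => current (G y) (lift ord0 j) k l) j y *
    (A k x * A l x)| <= n.+1%:R * (n.+2%:R * (n.+2%:R * Mc)) * sq (avec x).
  rewrite -!mulrA -!sumc (le_trans (ler_norm_sum _ _ _))//; apply: ler_sum => j _.
  rewrite (le_trans (ler_norm_sum _ _ _))//; apply: ler_sum => k _.
  rewrite (le_trans (ler_norm_sum _ _ _))//; apply: ler_sum => l _.
  rewrite normrM; apply: ler_pM => //.
  by have := sq_mul_le (avec x) k l; rewrite !mxE.
rewrite Ex; have c2 := chi2_le1 y; rewrite ger0_norm ?sqr_ge0// in c2.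
have c20 := sqr_ge0 (chi y).
move: (chi y ^+ 2) (F x) (mform _ _ _) (\sum_k _) (\sum_j _) (2 * chi y * _) c20 c2 hm hf hd2 h3.
move=> c f m d S fl c20 c2 hm hf hd2 h3.
(* The squares of [f - m] and [d + m] give [2 (f - d) m <= f^2 + d^2 + 2 m^2]; then [hm] bounds
   [m^2] and [hd2] bounds [d^2]. *)
have e1 : 2 * (f - d) * m <= f ^+ 2 + (2 * KE + (n.+2%:R * Dr) ^+ 2) * sq (avec x).
  have := sqr_ge0 (f - m); have := sqr_ge0 (d + m); move: hm hd2.
  move: (sq (avec x)) ((n.+2%:R * Dr) ^+ 2) (KE) => s q ke h1 h2 h4 h5.
  have k1 : (d + m) ^+ 2 = d ^+ 2 + 2 * (d * m) + m ^+ 2 by ring.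
  have k2 : (f - m) ^+ 2 = f ^+ 2 - 2 * (f * m) + m ^+ 2 by ring.
  have k3 : 2 * (f - d) * m = 2 * (f * m) - 2 * (d * m) by ring.
  have k4 : (2 * ke + q) * s = 2 * (ke * s) + q * s by ring.
  by rewrite k3 k4; rewrite k1 in h4; rewrite k2 in h5; clear k1 k2 k3 k4; lra.
have r1 : 0 <= f ^+ 2 + (2 * KE + (n.+2%:R * Dr) ^+ 2) * sq (avec x).
  by rewrite addr_ge0 ?sqr_ge0// mulr_ge0// addr_ge0 ?sqr_ge0// mulr_ge0.
have e2 : c * (2 * (f - d) * m) <= f ^+ 2 + (2 * KE + (n.+2%:R * Dr) ^+ 2) * sq (avec x).
  apply: (@le_trans _ _ (c * (f ^+ 2 + (2 * KE + (n.+2%:R * Dr) ^+ 2) * sq (avec x)))).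
    exact: ler_wpM2l.
  by rewrite ler_piMl.
have e3 : c * S <= n.+1%:R * (n.+2%:R * (n.+2%:R * Mc)) * sq (avec x).
  apply: (le_trans _ h3); rewrite (le_trans (ler_norm _))// normrM ger0_norm//.
  by rewrite ler_piMl.
have -> : growth_constant * sq (avec x) = (2 * KE + (n.+2%:R * Dr) ^+ 2) * sq (avec x) +
    K * sq (avec x) + n.+1%:R * (n.+2%:R * (n.+2%:R * Mc)) * sq (avec x).
  by rewrite /growth_constant (mulrDl _ _ (sq _)) (mulrDl _ K (sq _)).
by rewrite !addrA; apply: lerD => //; apply: lerD.
Qed.

Lemma cutoff_growth t : 0 < t <= T ->
  \int[leb]_y (chi y ^+ 2 * energy_form (G y) (tvec t y)) <=
  \int[leb]_y (chi y ^+ 2 * energy_form (G y) (tvec 0 y)) +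
  \int[lebS]_x (win t (x ord0 ord0) * (F x ^+ 2 + growth_constant * sq (avec x))).
Proof.
move=> t0T; rewrite -lerBlDl -/(chi_energy t) -/(chi_energy 0) growthE//.
have iR : intg lebS (fun x => F x ^+ 2 + growth_constant * sq (avec x)).
  by apply: intgD; [exact: cF.1.2|exact: intgZ].
have iH := iHtot t0T.
(* The minimum changes [Htot] on a null set only and makes the almost sure bound valid
   everywhere. *)
pose h x := Num.min (Htot x) (F x ^+ 2 + growth_constant * sq (avec x)).
have mh : measurable_fun setT h.
  by apply: measurable_minr; [exact: intg_measurable iH|exact: intg_measurable iR].
have E : {ae lebS, forall x : 'rV[R]_n.+2, win t (x ord0 ord0) * Htot x = win t (x ord0 ord0) * h x}.
  by apply: filterS Htot_le => x hx; rewrite /h min_l.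
have mwh : measurable_fun setT (fun x : 'rV[R]_n.+2 => win t (x ord0 ord0) * h x).
  exact: measurable_funM.
rewrite (ae_Rint E (intg_measurable (iwin t iH)) mwh).
apply: Rint_le; [exact: ae_intg E mwh (iwin t iH)|exact: iwin|].
by move=> x; rewrite ler_wpM2l ?win_ge0// /h ge_min lexx orbT.
Qed.

End with_cutoff.

End energy_growth.

Lemma energy_scalar_le (R : realFieldType) (c CE K1 sv sv0 sa sa0 f iv ia : R) :
  0 < c -> 0 <= CE -> 0 <= sv0 -> 0 <= sa0 -> 0 <= f -> 0 <= K1 -> 0 <= iv ->
  c * sa <= CE * sa0 + f + K1 * ia -> sv <= sv0 + (ia + iv) ->
  sv + sa <= (1 + CE / c + c^-1) * (sv0 + sa0 + f) + (1 + K1 / c) * (iv + ia).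
Proof.
move=> c0 CE0 v0 a0 f0 K10 iv0 h1 h2.
have : sa <= CE / c * sa0 + c^-1 * f + K1 / c * ia.
  have -> : CE / c * sa0 + c^-1 * f + K1 / c * ia = c^-1 * (CE * sa0 + f + K1 * ia) by ring.
  by rewrite ler_pdivlMl.
have c0' : 0 <= c^-1 by rewrite invr_ge0 ltW.
have : 0 <= CE / c by rewrite divr_ge0// ltW.
have : 0 <= K1 / c by rewrite divr_ge0// ltW.
move: (CE / c) => p; move: (K1 / c) => r; move: (c^-1) c0' => q q0 r0 p0 h3.
have := mulr_ge0 p0 v0; have := mulr_ge0 p0 f0; have := mulr_ge0 q0 v0.
have := mulr_ge0 q0 a0; have := mulr_ge0 r0 iv0.
have -> : (1 + p + q) * (sv0 + sa0 + f) = sv0 + sa0 + f + p * sv0 + p * sa0 + p * f +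
  q * sv0 + q * sa0 + q * f by ring.
have -> : (1 + r) * (iv + ia) = iv + ia + r * iv + r * ia by ring.
by lra.
Qed.

(* [A k] and [B j k] are the first and second derivatives of [V]; [cV] and
   [cA k] are the initial values of [V] and [A k]. *)
Record wave_data (R : realType) (n : nat) (G : 'rV[R]_n.+1 -> 'M[R]_n.+2) (T : R)
    (D : set 'rV[R]_n.+1) (V F : 'rV[R]_n.+2 -> R) (A : 'I_n.+2 -> 'rV[R]_n.+2 -> R)
    (B : 'I_n.+2 -> 'I_n.+2 -> 'rV[R]_n.+2 -> R)
    (cV : 'rV[R]_n.+1 -> R) (cA : 'I_n.+2 -> 'rV[R]_n.+1 -> R) : Prop := WaveData {
  wave_rV : trep T D V (A ord0) cV;
  wave_rA : forall k, trep T D (A k) (B ord0 k) (cA k);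
  wave_cB : forall j k, cyl T D (B j k);
  wave_sB : forall j k, B j k = B k j;
  wave_dA : forall j k phi, test_function (cylinder T D) phi ->
    \int[lebesgue_rV R n.+2]_x (A k x * partial phi j x) =
    - \int[lebesgue_rV R n.+2]_x (B j k x * phi x);
  wave_cF : cyl T D F;
  wave_eqF : {ae lebesgue_rV R n.+2, forall x,
    \sum_j \sum_k G (del_row ord0 x) j k * B j k x =
    F x - \sum_k drift G k (del_row ord0 x) * A k x} }.

Definition total_energy (R : realType) (n : nat) (A : 'I_n.+2 -> 'rV[R]_n.+2 -> R)
    (B : 'I_n.+2 -> 'I_n.+2 -> 'rV[R]_n.+2 -> R)
    (cV : 'rV[R]_n.+1 -> R) (cA : 'I_n.+2 -> 'rV[R]_n.+1 -> R) (t : R) : R :=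
  slice_sq cV (A ord0) t + \sum_k slice_sq (cA k) (B ord0 k) t.

Section total_energy_bound.
Variables (R : realType) (n : nat) (G : 'rV[R]_n.+1 -> 'M[R]_n.+2) (C0 : R).
Hypothesis hG : wave_coefficients G C0.
Variables (T : R) (D : set 'rV[R]_n.+1).
Hypotheses (T0 : 0 < T) (oD : open D).
Notation lambda := (@lebesgue_measure R).
Notation RR := (measurableTypeR R).
Notation leb := (lebesgue_rV R n.+1).
Notation lebS := (lebesgue_rV R n.+2).
Notation Q := (cylinder T D).

Lemma energy_form_le (M : R) (x : 'rV[R]_n.+1) (a : 'rV[R]_n.+2) : 0 <= M ->
  (forall k l, `|current (G x) ord0 k l| <= M) ->
  energy_form (G x) a <= n.+2%:R * (n.+2%:R * M) * sq a.
Proof.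
move=> M0 HM; rewrite (energy_formE (wave_sym hG x)) -!mulrA.
have sumc m (u : R) : \sum_(i < m) u = m%:R * u by rewrite sumr_const card_ord mulr_natl.
rewrite -!sumc; apply: ler_sum => k _; apply: ler_sum => l _.
apply: (le_trans (ler_norm _)); rewrite normrM; apply: ler_pM => //.
exact: sq_mul_le.
Qed.

Section with_data.
Variables (V F : 'rV[R]_n.+2 -> R) (A : 'I_n.+2 -> 'rV[R]_n.+2 -> R).
Variables (B : 'I_n.+2 -> 'I_n.+2 -> 'rV[R]_n.+2 -> R).
Variables (cV : 'rV[R]_n.+1 -> R) (cA : 'I_n.+2 -> 'rV[R]_n.+1 -> R).
Hypothesis W : wave_data G T D V F A B cV cA.

Let avec (x : 'rV[R]_n.+2) : 'rV[R]_n.+2 := \row_k A k x.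
Let tvec (t : R) (y : 'rV[R]_n.+1) : 'rV[R]_n.+2 := \row_k tslice (cA k) (B ord0 k) t y.
Let Sa t := \sum_k slice_sq (cA k) (B ord0 k) t.

Lemma total_energy_ge0 t : 0 <= total_energy A B cV cA t.
Proof. by rewrite addr_ge0 ?slice_sq_ge0// sumr_ge0// => k _; exact: slice_sq_ge0. Qed.

Let isqt t : intg leb (fun y => sq (tvec t y)) /\ \int[leb]_y sq (tvec t y) = Sa t.
Proof.
have E : (fun y => sq (tvec t y)) = (fun y => \sum_k tslice (cA k) (B ord0 k) t y ^+ 2).
  by apply/funext => y; apply: eq_bigr => k _; rewrite mxE.
have i k : intg leb (fun y => tslice (cA k) (B ord0 k) t y ^+ 2).
  exact: (tslice_L2 t (wave_rA W k)).2.
by rewrite E; split; [exact: intg_sum|rewrite Rint_sum].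
Qed.

Let iA t : t <= T -> intg lambda (fun r : RR => win t r * Sa r) /\
  intg lebS (fun x => win t (x ord0 ord0) * sq (avec x)) /\
  \int[lebS]_x (win t (x ord0 ord0) * sq (avec x)) = \int[lambda]_r (win t r * Sa r).
Proof.
move=> tT.
have E1 : (fun r : RR => win t r * Sa r) =
    (fun r => \sum_k win t r * slice_sq (cA k) (B ord0 k) r).
  by apply/funext => r; rewrite mulr_sumr.
have E2 : (fun x : 'rV[R]_n.+2 => win t (x ord0 ord0) * sq (avec x)) =
    (fun x => \sum_k win t (x ord0 ord0) * A k x ^+ 2).
  by apply/funext => x; rewrite mulr_sumr; apply: eq_bigr => k _; rewrite mxE.
have i1 k := (slice_sq_fubini (wave_rA W k) tT).1.
have i2 k : intg lebS (fun x => win t (x ord0 ord0) * A k x ^+ 2).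
  have [[[mA iA] _] _ _ _ _] := wave_rA W k.
  apply: (intg_le _ iA).
    apply: measurable_funM; last exact: measurable_funX.
    by apply: (measurableT_comp (measurable_win t)); exact: measurable_rV_coord.
  by move=> x; rewrite normrM (ger0_norm (sqr_ge0 _)) ler_piMl ?sqr_ge0// win_bound.
rewrite E1 E2; split; first exact: intg_sum.
split; first exact: intg_sum.
rewrite (Rint_sum _ i2) (Rint_sum _ i1); apply: eq_bigr => k _.
exact: (slice_sq_fubini (wave_rA W k) tT).2.
Qed.

(** The current says nothing about [V] itself, but the time derivative of [V^2] is [2 V V_t], at
    most [V^2] plus the square norm of the gradient. *)
Let V_growth t : 0 <= t <= T -> slice_sq cV (A ord0) t <= slice_sq cV (A ord0) 0 +
  (\int[lambda]_r (win t r * Sa r) + \int[lambda]_r (win t r * slice_sq cV (A ord0) r)).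
Proof.
move=> /andP[t0 tT]; have rV := wave_rV W; have rA := wave_rA W ord0.
have [iS [isa E]] := iA tT; have [iv Ev] := slice_sq_fubini rV tT.
have [cyV cyA _ _ _] := rV.
have := product_time t rV rV (measurable_cst (1 : R)) (fun y => lexx (`|1|)).
under eq_Rintegral do rewrite mul1r -expr2.
have -> : \int[leb]_y (1 * (cV y * cV y)) = slice_sq cV (A ord0) 0.
  by apply: eq_Rintegral => y _; rewrite (tslice_le0 y rV (lexx 0)) mul1r expr2.
rewrite -/(slice_sq cV (A ord0) t) => /eqP; rewrite subr_eq addrC => /eqP ->.
rewrite lerD2l -E -Ev.
have iV : intg lebS (fun x => win t (x ord0 ord0) * V x ^+ 2).
  apply: (intg_le _ cyV.1.2).
    apply: measurable_funM; last by apply: measurable_funX; exact: cyV.1.1.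
    by apply: (measurableT_comp (measurable_win t)); exact: measurable_rV_coord.
  by move=> x; rewrite normrM (ger0_norm (sqr_ge0 _)) ler_piMl ?sqr_ge0// win_bound.
rewrite -(RintD isa iV).
have Eb (x : 'rV[R]_n.+2) : below (x ord0 ord0) t * (1 * (A ord0 x * V x + V x * A ord0 x)) =
    win t (x ord0 ord0) * (2 * (A ord0 x * V x)).
  have [[/andP[x0 _] _]|nQ] := pselect (Q x); last by rewrite cyV.2// !(mulr0, mul0r, addr0).
  rewrite /below /win x0 /=; congr (_ * _).
  by rewrite mul1r (mulrC (V x)) -mulr2n mulr_natl.
under eq_Rintegral do rewrite Eb.
apply: Rint_le.
- apply: (intg_le _ (intg_abs (intgZ 2 (L2M cyA.1 cyV.1)))).
    apply: measurable_funM; last exact: intg_measurable (intgZ 2 (L2M cyA.1 cyV.1)).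
    by apply: (measurableT_comp (measurable_win t)); exact: measurable_rV_coord.
  by move=> x; rewrite normrM ler_piMl// win_bound.
- exact: intgD.
move=> x; rewrite -mulrDr ler_wpM2l ?win_ge0//.
have : A ord0 x ^+ 2 <= sq (avec x).
  by rewrite /sq (bigD1 ord0)//= mxE lerDl sumr_ge0// => k _; exact: sqr_ge0.
move: (A ord0 x) (V x) (sq _) => p q s h.
have := sqr_ge0 (p - q); have -> : (p - q) ^+ 2 = p ^+ 2 - 2 * (p * q) + q ^+ 2 by ring.
by move=> h2; lra.
Qed.

Variables (K : R) (chi : nat -> 'rV[R]_n.+1 -> R).
Hypotheses (K0 : 0 <= K) (tchi : forall m, test_function D (chi m)).
Hypotheses (chi01 : forall m y, 0 <= chi m y <= 1).
Hypotheses (chi1 : forall y, D y -> chi m y @[m --> \oo] --> (1 : R)).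
Hypothesis chiK : forall m x a,
  2 * chi m x * flux_form (G x) (sp (grad (chi m) x)) a <= K * sq a.
Variables (c KE Dr Mc : R).
Hypotheses (c0 : 0 < c) (KE0 : 0 <= KE) (Dr0 : 0 <= Dr) (Mc0 : 0 <= Mc).
Hypothesis Hc : forall x a, c * sq a <= energy_form (G x) a.
Hypothesis HKE : forall x a, mform (G x) (e0 R n.+1) a ^+ 2 <= KE * sq a.
Hypothesis HDr : forall k x, `|drift G k x| <= Dr.
Hypothesis HMc : forall x j k l, `|current (G x) j k l| <= Mc.
Hypothesis HMc' : forall x j k l i, `|partial (fun y => current (G y) j k l) i x| <= Mc.

Let CE := n.+2%:R * (n.+2%:R * Mc).
Let K1 := growth_constant n K KE Dr Mc.

Let CE0 : 0 <= CE. Proof. by rewrite !mulr_ge0. Qed.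

Let K10 : 0 <= K1.
Proof. by rewrite /K1 /growth_constant !addr_ge0 ?mulr_ge0 ?sqr_ge0// mulr_ge0. Qed.

Let ief t : intg leb (fun y => energy_form (G y) (tvec t y)) /\
  (forall m, measurable_fun setT (fun y => chi m y ^+ 2 * energy_form (G y) (tvec t y))).
Proof.
have mE : measurable_fun setT (fun y => energy_form (G y) (tvec t y)).
  rewrite (_ : (fun y => _) = fun y => \sum_k \sum_l current (G y) ord0 k l *
      (tslice (cA k) (B ord0 k) t y * tslice (cA l) (B ord0 l) t y)); last first.
    apply/funext => y; rewrite (energy_formE (wave_sym hG y)); apply: eq_bigr => k _.
    by apply: eq_bigr => l _; rewrite !mxE.
  apply: measurable_sum => k; apply: measurable_sum => l; apply: measurable_funM.
    by apply: continuous_measurable_rV; apply: smooth_continuous; have [] := current_bdd1 hG ord0 k l.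
  by apply: measurable_funM; [have [] := tslice_L2 t (wave_rA W k)|have [] := tslice_L2 t (wave_rA W l)].
split; last by move=> m; apply: measurable_funM => //; apply: measurable_funX; exact: measurable_test (tchi m).
apply: (intg_le mE (intgZ CE (isqt t).1)) => y.
rewrite ger0_norm; first exact: energy_form_le.
by apply: (le_trans _ (Hc y _)); rewrite mulr_ge0 ?sq_ge0// ltW.
Qed.

(** The cutoffs are removed at a fixed time by dominated convergence, the energy density itself
    dominating. The slices vanish off [D], so convergence of the cutoffs is only needed on [D]. *)
Let limit t : \int[leb]_y (chi m y ^+ 2 * energy_form (G y) (tvec t y)) @[m --> \oo] -->
  \int[leb]_y energy_form (G y) (tvec t y).
Proof.
have [i mE] := ief t; apply: (Rint_dct mE _ i _).2 => [y|m y].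
  have [Dy|nD] := pselect (D y); last first.
    have -> : tvec t y = 0 by apply/rowP => k; rewrite !mxE (tslice_out t (wave_rA W k) nD).
    have -> : energy_form (G y) 0 = 0.
      rewrite (energy_formE (wave_sym hG y)) big1// => k _; rewrite big1// => l _.
      by rewrite !mxE !mulr0.
    by under eq_fun do rewrite mulr0; exact: cvg_cst.
  rewrite -[X in _ --> X]mul1r -[X in X * _](expr1n _ 2); apply: cvgM; last exact: cvg_cst.
  by rewrite expr2; under eq_fun do rewrite expr2; apply: cvgM; exact: chi1.
have e0 : 0 <= energy_form (G y) (tvec t y).
  by apply: (le_trans _ (Hc y _)); rewrite mulr_ge0 ?sq_ge0// ltW.
have /andP[x0 x1] := chi01 m y.
by rewrite normrM ger0_norm ?sqr_ge0// ger0_norm// ler_piMl// expr_le1.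
Qed.

Let A_growth t : 0 < t <= T -> c * Sa t <=
  CE * Sa 0 + \int[lebS]_x (F x ^+ 2) + K1 * \int[lambda]_r (win t r * Sa r).
Proof.
move=> t0T; have /andP[t0 tT] := t0T.
have [i0 E0] := isqt 0; have [it Et] := isqt t; have [_ [isa Ea]] := iA tT.
have L1 := @limit t; have L2' := @limit 0.
pose I := \int[lebS]_x (win t (x ord0 ord0) * (F x ^+ 2 + K1 * sq (avec x))).
have H : \int[leb]_y energy_form (G y) (tvec t y) <=
    \int[leb]_y energy_form (G y) (tvec 0 y) + I.
  apply: (ler_cvg_to L1 (cvgD L2' (cvg_cst I))); near=> m.
  exact: (cutoff_growth hG (wave_rA W) (wave_cB W) (wave_sB W) (wave_dA W)
    (wave_cF W) (wave_eqF W) (tchi m) (chi01 m) (chiK m) KE0 Dr0 HKE HDr HMc' t0T).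
have iF : intg lebS (fun x => F x ^+ 2) by exact: (wave_cF W).1.2.
have iwF : intg lebS (fun x => win t (x ord0 ord0) * F x ^+ 2).
  apply: (intg_le _ iF).
    apply: measurable_funM; last exact: intg_measurable iF.
    by apply: (measurableT_comp (measurable_win t)); exact: measurable_rV_coord.
  by move=> x; rewrite normrM (ger0_norm (sqr_ge0 _)) ler_piMl ?sqr_ge0// win_bound.
have EI : I <= \int[lebS]_x (F x ^+ 2) + K1 * \int[lambda]_r (win t r * Sa r).
  have -> : I = \int[lebS]_x (win t (x ord0 ord0) * F x ^+ 2) +
      K1 * \int[lebS]_x (win t (x ord0 ord0) * sq (avec x)).
    rewrite -(RintZ K1 isa) -(RintD iwF (intgZ K1 isa)); apply: eq_Rintegral => x _.
    by rewrite mulrDr; congr (_ + _); rewrite mulrCA.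
  rewrite Ea lerD2r; apply: Rint_le => // x; rewrite ler_piMl ?sqr_ge0//.
  by rewrite (le_trans (ler_norm _))// win_bound.
have h1 : c * Sa t <= \int[leb]_y energy_form (G y) (tvec t y).
  by rewrite -Et -(RintZ c it); apply: Rint_le; [exact: intgZ|exact: (ief t).1|].
have h2 : \int[leb]_y energy_form (G y) (tvec 0 y) <= CE * Sa 0.
  rewrite -E0 -(RintZ CE i0); apply: Rint_le; [exact: (ief 0).1|exact: intgZ|].
  by move=> y; exact: energy_form_le.
by rewrite -addrA (le_trans h1)// (le_trans H)// lerD.
Unshelve. all: by end_near. Qed.

Lemma total_energy_le_data t : 0 <= t <= T -> total_energy A B cV cA t <=
  2 * expR (2 * (1 + K1 / c) * T) *
  ((1 + CE / c + c^-1) * (total_energy A B cV cA 0 + \int[lebS]_x (F x ^+ 2))).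
Proof.
pose S t := total_energy A B cV cA t.
pose a := (1 + CE / c + c^-1) * (S 0 + \int[lebS]_x (F x ^+ 2)).
have F0 : 0 <= \int[lebS]_x (F x ^+ 2) by apply: Rint_ge0 => x; exact: sqr_ge0.
have C10 : 1 <= 1 + CE / c + c^-1.
  by rewrite -addrA lerDl addr_ge0 ?divr_ge0 ?invr_ge0// ltW.
have a0 : 0 <= a.
  by rewrite mulr_ge0//; [exact: le_trans C10|rewrite addr_ge0// total_energy_ge0].
have L0 : 0 < 1 + K1 / c by rewrite ltr_wpDr// divr_ge0// ltW.
have TT : T <= T by [].
have [iSa _] := iA TT; have [iSv _] := slice_sq_fubini (wave_rV W) TT.
have iS (t' : R) : t' <= T -> intg lambda (fun r : RR => win t' r * S r) /\
    \int[lambda]_r (win t' r * S r) = \int[lambda]_r (win t' r * slice_sq cV (A ord0) r) +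
      \int[lambda]_r (win t' r * Sa r).
  move=> t'T; have [i1 _] := iA t'T; have [i2 _] := slice_sq_fubini (wave_rV W) t'T.
  have E : (fun r : RR => win t' r * S r) = fun r => win t' r * slice_sq cV (A ord0) r + win t' r * Sa r.
    by apply/funext => r; rewrite -mulrDr.
  by rewrite E; split; [exact: intgD|rewrite (RintD i2 i1)].
pose NV := \int[lebS]_x (A ord0 x ^+ 2).
pose NA k := \int[lebS]_x (B ord0 k x ^+ 2).
have NV0 : 0 <= NV by apply: Rint_ge0 => x; exact: sqr_ge0.
have NA0 k : 0 <= NA k by apply: Rint_ge0 => x; exact: sqr_ge0.
(* A crude bound from the Hölder estimate between times 0 and [t]. It depends on second derivatives,
   but it only ensures that the supremum in [gronwall] is finite and does not enter the final
   constant. *)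
pose bound := 2 * slice_sq cV (A ord0) 0 + 2 * (T * NV) +
  \sum_k (2 * slice_sq (cA k) (B ord0 k) 0 + 2 * (T * NA k)).
apply: (gronwall T0 L0 a0 (fun t => total_energy_ge0 t) (S0 := bound)).
- move=> s /andP[s0 sT]; apply: lerD.
    apply: (le_trans (slice_sq_le (wave_rV W) 0 s)); rewrite lerD2l ler_wpM2l// ler_wpM2r//.
    by rewrite subr0 ger0_norm.
  apply: ler_sum => k _.
  apply: (le_trans (slice_sq_le (wave_rA W k) 0 s)); rewrite lerD2l ler_wpM2l// ler_wpM2r//.
    exact: NA0.
  by rewrite subr0 ger0_norm.
- exact: (iS T TT).1.
move=> s /andP[s0 sT]; have [_ ES] := iS s sT.
have ge0 (h : RR -> R) : (forall r, 0 <= h r) -> 0 <= \int[lambda]_r (win s r * h r).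
  by move=> h0; apply: Rint_ge0 => r; rewrite mulr_ge0// win_ge0.
have Sa_ge0 r : 0 <= Sa r by rewrite sumr_ge0// => k _; exact: slice_sq_ge0.
(* The growth estimate [A_growth] is for positive times; at time 0 the bound follows from
   [1 <= 1 + CE / c + c^-1]. *)
move: s0; rewrite le_eqVlt => /predU1P[<-|s0].
  apply: (@le_trans _ _ a); last first.
    rewrite lerDl mulr_ge0 ?(ltW L0)//; apply: Rint_ge0 => r.
    by rewrite mulr_ge0 ?win_ge0// total_energy_ge0.
  rewrite -[leLHS]mul1r; apply: ler_pM => //; first exact: total_energy_ge0.
  by rewrite lerDl.
have s0T : 0 < s <= T by rewrite s0.
have s0T' : 0 <= s <= T by rewrite ltW.
rewrite -/(S _) ES; apply: energy_scalar_le (A_growth s0T) (V_growth s0T') => //.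
- exact: slice_sq_ge0.
- by apply: ge0 => r; exact: slice_sq_ge0.
Qed.

End with_data.

Lemma total_energy_bound (K : R) (chi : nat -> 'rV[R]_n.+1 -> R) : 0 <= K ->
  (forall m, test_function D (chi m)) -> (forall m y, 0 <= chi m y <= 1) ->
  (forall y, D y -> chi m y @[m --> \oo] --> (1 : R)) ->
  (forall m x a, 2 * chi m x * flux_form (G x) (sp (grad (chi m) x)) a <= K * sq a) ->
  exists2 C : R, 0 < C & forall V F A B cV cA, wave_data G T D V F A B cV cA ->
    forall t, 0 <= t <= T -> total_energy A B cV cA t <=
      C * (total_energy A B cV cA 0 + \int[lebS]_x (F x ^+ 2)).
Proof.
move=> K0 tchi chi01 chi1 chiK.
have [c c0 Hc] := coercive hG; have [KE KE0 HKE] := e0_bound hG.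
have [Dr HDr] := drift_bounded hG; have [Mc Mc0 HMc] := current_bound hG.
have Dr0 : 0 <= Dr by apply: le_trans (HDr ord0 0).
pose K1 := growth_constant n K KE Dr Mc.
pose CE := n.+2%:R * (n.+2%:R * Mc).
exists (2 * expR (2 * (1 + K1 / c) * T) * (1 + CE / c + c^-1)).
  rewrite mulr_gt0 ?mulr_gt0 ?expR_gt0// ltr_pwDr ?invr_gt0// addr_ge0// divr_ge0 ?(ltW c0)//.
  by rewrite !mulr_ge0.
move=> V F A B cV cA W t t0T; rewrite -mulrA.
exact: (total_energy_le_data W K0 tchi chi01 chi1 chiK c0 (ltW KE0) Dr0 Mc0 Hc HKE HDr
  (fun x j k l => (HMc x j k l).1) (fun x j k l i => (HMc x j k l).2 i) t0T).
Qed.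

End total_energy_bound.

(** * The expanded equation *)

Section weak_product.
Variables (R : realType) (n : nat) (Q : set 'rV[R]_n).
Notation leb := (lebesgue_rV R n).

Lemma li_continuousM (h u : 'rV[R]_n -> R) : open Q -> continuous h ->
  locally_integrable_on Q u -> locally_integrable_on Q (fun x => h x * u x).
Proof.
move=> oQ ch [mu iu].
have mh (A : set 'rV[R]_n) : measurable_fun A h.
  by apply: measurable_funTS; exact: continuous_measurable_rV.
split=> [|K cK KQ]; first exact: measurable_funM.
have mK : measurable K by apply: closed_measurable_rV; exact: compact_closed.
have /compact_bounded[M [_ HM]] := continuous_compact
  (continuous_subspaceT ch : {within K, continuous h}) cK.
apply: (@le_integrable _ _ _ leb K mK _ (fun x => ((`|M| + 1) * u x)%:E)).
- apply/measurable_EFinP; apply: measurable_funM => //.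
  by apply: measurable_funS mu => //; exact: open_measurable_rV.
- move=> x Kx; rewrite /= lee_fin !normrM; apply: ler_wpM2r => //.
  rewrite [leRHS]ger0_norm ?addr_ge0//; apply: HM; last by exists x.
  by rewrite (le_lt_trans (ler_norm _))// ltrDl.
- rewrite (_ : (fun x => _) = (fun x => (`|M| + 1)%:E * (EFin \o u) x)%E); last first.
    by apply/funext => x; rewrite /= EFinM.
  exact: integrableZl (iu K cK KQ).
Qed.

(** The factor [h] is moved onto the test function: [phi * h] is again a test function, and the
    Leibniz rule for it gives the extra term. *)
Lemma weak_derivativeM (h u w : 'rV[R]_n -> R) (j : 'I_n) : open Q -> Cinf h ->
  weak_derivative Q [:: j] u w ->
  weak_derivative Q [:: j] (fun x => h x * u x) (fun x => partial h j x * u x + h x * w x).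
Proof.
move=> oQ sh W; have [lu lw _] := W.
have ch := smooth_continuous sh; have cdh := smooth_continuous (smooth_partial j sh).
have l1 := li_continuousM oQ cdh lu; have l2 := li_continuousM oQ ch lw.
have l3 : locally_integrable_on Q (fun x => partial h j x * u x + h x * w x).
  split=> [|K cK KQ]; first by apply: measurable_funD; [exact: l1.1|exact: l2.1].
  have mK : measurable K by apply: closed_measurable_rV; exact: compact_closed.
  have := integrableD mK (l1.2 K cK KQ) (l2.2 K cK KQ).
  by apply: eq_integrable.
apply: wdI => //; first exact: li_continuousM.
move=> phi tphi; have th := testM tphi sh.
have := wdE W th; rewrite /= expr1 !mulN1r => E.
have i1 := intg_test lu (test_partial j th).
have i2 := intg_test l1 tphi; have i3 := intg_test l2 tphi.
transitivity (\int[leb]_x (u x * partial (fun x => phi x * h x) j x) -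
    \int[leb]_x (partial h j x * u x * phi x)).
  rewrite -(RintB i1 i2); apply: eq_Rintegral => x _.
  rewrite (partialM j x (test_Cinf tphi) sh).
  by move: (partial _ _ _) (partial _ _ _) => *; ring.
rewrite E -opprD; congr (- _).
have i4 := intg_test lw th.
rewrite addrC -(RintD i2 i4); apply: eq_Rintegral => x _.
by move: (partial _ _ _) => *; ring.
Qed.

End weak_product.

Section expanded_equation.
Variables (R : realType) (n : nat) (G : 'rV[R]_n -> 'M[R]_n.+1) (C0 : R).
Hypothesis hG : wave_coefficients G C0.
Notation lebS := (lebesgue_rV R n.+1).

Let rhoG j k (y : 'rV[R]_n) := density G y * G y j k.

Let s_rhoG j k : Cinf (rhoG j k).
Proof. by apply: smoothM; [exact: smooth_density hG|have [] := G_bdd1 hG j k]. Qed.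

Lemma density_drift k (x : 'rV[R]_n.+1) : \sum_j (density G (del_row ord0 x))^-1 *
  partial (fun x => density G (del_row ord0 x) * G (del_row ord0 x) j k) j x =
  drift G k (del_row ord0 x).
Proof.
rewrite big_ord_recl (partial_del_at ord0 (rhoG ord0 k)) mulr0 add0r.
apply: eq_bigr => j _; rewrite (partial_del_lift ord0 j x (s_rhoG (lift ord0 j) k)).
set y := del_row ord0 x.
have -> : partial (rhoG (lift ord0 j) k) j y =
    density G y * partial (fun y => G y (lift ord0 j) k) j y +
    partial (density G) j y * G y (lift ord0 j) k.
  rewrite /rhoG (partialM j y (smooth_density hG)); last by have [] := G_bdd1 hG (lift ord0 j) k.
  by move: (partial _ _ _) (partial _ _ _) => *; ring.
rewrite (partial_density hG) mulrDr mulKf ?gt_eqF ?(density_gt0 hG)//; congr (_ + _).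
by rewrite -mulrA mulKf ?gt_eqF ?(density_gt0 hG)// mulrC.
Qed.

(** By uniqueness of weak derivatives the functions [dv] and [p] of the divergence form are
    identified with [A] and with the Leibniz expansion of the products; dividing by the density
    collects the first-order terms in [drift]. *)
Lemma wave_equation_expanded (Q : set 'rV[R]_n.+1) v f A B : open Q ->
  (forall k, weak_derivative Q [:: k] v (A k)) ->
  (forall j k, weak_derivative Q [:: j] (A k) (B j k)) ->
  wave_equation G Q v f ->
  {ae lebS, forall x, Q x -> \sum_j \sum_k G (del_row ord0 x) j k * B j k x =
    f x - \sum_k drift G k (del_row ord0 x) * A k x}.
Proof.
move=> oQ WA WB [dv [p [Wdv Wp Ef]]].
pose h j k (x : 'rV[R]_n.+1) := density G (del_row ord0 x) * G (del_row ord0 x) j k.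
have sh j k : Cinf (h j k) by exact: (smooth_del ord0 (s_rhoG j k)).
have dvA k : {ae lebS, forall x, Q x -> dv k x = A k x}.
  by apply: (wd_unique oQ (Wdv k) (WA k)); exact: aeW.
have pE j k : {ae lebS, forall x, Q x -> p j k x = partial (h j k) j x * A k x + h j k x * B j k x}.
  apply: (wd_unique oQ (Wp j k) (weak_derivativeM oQ (sh j k) (WB j k))).
  by apply: filterS (dvA k) => x H Qx; rewrite !tail_rowE H.
have allp : {ae lebS, forall x, forall jk : 'I_n.+1 * 'I_n.+1, Q x ->
    p jk.1 jk.2 x = partial (h jk.1 jk.2) jk.1 x * A jk.2 x + h jk.1 jk.2 x * B jk.1 jk.2 x}.
  by apply: filter_forall => -[j k]; exact: pE.
apply: filterS2 Ef allp => x Ex px Qx; rewrite -(Ex Qx).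
have d0 : density G (del_row ord0 x) != 0 by rewrite gt_eqF// (density_gt0 hG).
under [X in _ - X]eq_bigr do rewrite -density_drift mulr_suml.
rewrite [X in _ - X]exchange_big -sumrB; apply: eq_bigr => j _; rewrite -sumrB; apply: eq_bigr => k _.
rewrite tail_rowE (px (j, k) Qx) /= /h mulrDr -!mulrA mulKf//.
by rewrite addrAC subrr add0r.
Qed.

End expanded_equation.

(** * The estimate *)

Section solution.
Variables (R : realType) (n : nat) (G : 'rV[R]_n.+1 -> 'M[R]_n.+2) (C0 : R).
Hypothesis hG : wave_coefficients G C0.
Variables (T : R) (D : set 'rV[R]_n.+1).
Hypotheses (T0 : 0 < T) (oD : open D).
Notation lambda := (@lebesgue_measure R).
Notation RR := (measurableTypeR R).
Notation leb := (lebesgue_rV R n.+1).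
Notation lebS := (lebesgue_rV R n.+2).
Notation Q := (cylinder T D).

Let oQ : open Q. Proof. exact: open_cylinder. Qed.
Let mQ : measurable Q. Proof. exact: open_measurable_rV. Qed.
Let mD : measurable D. Proof. exact: open_measurable_rV. Qed.

Let trep_ex U W : cyl T D U -> cyl T D W ->
  (forall phi, test_function Q phi ->
     \int[lebS]_x (U x * partial phi ord0 x) = - \int[lebS]_x (W x * phi x)) ->
  exists c, trep T D U W c.
Proof.
move=> cU cW H; have [c [Lc c0 E]] := time_representation T0 oD cU cW H.
by exists c.
Qed.

Lemma measurable_patch (u : 'rV[R]_n.+2 -> R) : measurable_fun Q u ->
  measurable_fun setT (u \_ Q).
Proof. by move=> mu; apply/(measurable_restrict _ mQ measurableT); rewrite setTI. Qed.

Lemma solution_data (v f : 'rV[R]_n.+2 -> R) : in_sobolev 2 Q v ->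
  measurable_fun Q f -> wave_equation G Q v f ->
  exists V A B cV cA, [/\ wave_data G T D V (f \_ Q) A B cV cA,
    forall x, Q x -> V x = v x,
    forall k, weak_derivative Q [:: k] v (A k) &
    forall k phi, test_function Q phi ->
      \int[lebS]_x (V x * partial phi k x) = - \int[lebS]_x (A k x * phi x)].
Proof.
move=> sv mf we; have [V [A [B [[LV V0 Vv] PA PB sB]]]] := sobolev2_data oQ sv.
have cyV : cyl T D V by [].
have cyA k : cyl T D (A k) by have [] := PA k.
have cyB j k : cyl T D (B j k) by have [] := PB j k.
have dV k phi : test_function Q phi ->
    \int[lebS]_x (V x * partial phi k x) = - \int[lebS]_x (A k x * phi x).
  by have [_ _ _] := PA k; exact.
have dA j k phi : test_function Q phi ->
    \int[lebS]_x (A k x * partial phi j x) = - \int[lebS]_x (B j k x * phi x).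
  by have [_ _] := PB j k; exact.
have wA k : weak_derivative Q [:: k] v (A k) by have [] := PA k.
have li U : cyl T D U -> locally_integrable_on Q U.
  by move=> [LU U0]; apply: li_patch => //; rewrite patch_id.
have wB j k : weak_derivative Q [:: j] (A k) (B j k).
  apply: wdI; [exact: li|exact: li|move=> phi tphi].
  by rewrite /= expr1 mulN1r; exact: dA.
have [cV rV] := trep_ex cyV (cyA ord0) (dV ord0).
have /choice[cA rA] k : exists c, trep T D (A k) (B ord0 k) c.
  by apply: trep_ex => //; exact: dA.
have E := wave_equation_expanded hG oQ wA wB we.
(* Square-integrability of the source is deduced from the equation: on the cylinder [f] equals
   [S + P] almost everywhere, a sum of bounded coefficients times square-integrable derivatives. *)
pose S (x : 'rV[R]_n.+2) := \sum_j \sum_k G (del_row ord0 x) j k * B j k x.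
pose P (x : 'rV[R]_n.+2) := \sum_k drift G k (del_row ord0 x) * A k x.
have SP x : ~ Q x -> S x + P x = 0.
  move=> nQ; rewrite /S /P big1 ?add0r ?big1// => j _.
    by rewrite (cyA j).2// mulr0.
  by rewrite big1// => k _; rewrite (cyB j k).2// mulr0.
have mdel (g : 'rV[R]_n.+1 -> R) : measurable_fun setT g ->
    measurable_fun setT (fun x : 'rV[R]_n.+2 => g (del_row ord0 x)).
  by move=> mg; apply: (measurableT_comp mg); exact: measurable_del_row.
have LSP : L2 lebS (fun x => S x + P x).
  apply: L2D.
    have [K _ HK] := G_bound hG.
    apply: L2_sum => j; apply: L2_sum => k.
    apply: (L2_bounded (M := K)); [|by move=> x; have [] := HK (del_row ord0 x) j k|by have [] := cyB j k].
    apply: (mdel (fun y => G y j k)); apply: continuous_measurable_rV; apply: smooth_continuous.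
    by have [] := G_bdd1 hG j k.
  have [K HK] := drift_bounded hG; apply: L2_sum => k.
  apply: (L2_bounded (M := K)); [|by move=> x; exact: HK|by have [] := cyA k].
  by apply: mdel; exact: measurable_drift hG k.
have SPF : {ae lebS, forall x, S x + P x = (f \_ Q) x}.
  apply: filterS E => x Ex; have [Qx|nQ] := pselect (Q x).
    by rewrite patch_in// /S (Ex Qx) subrK.
  by rewrite patch_out// SP.
exists V, A, B, cV, cA; split => //; split => //.
  split; last by move=> x; exact: patch_out.
  exact: ae_L2 SPF (measurable_patch mf) LSP.
by apply: filterS SPF => x <-; rewrite -/(S x) -/(P x) addrK.
Qed.

Lemma source_norm (f : 'rV[R]_n.+2 -> R) : measurable_fun Q f ->
  L2 lebS (f \_ Q) ->
  (\int[lambda]_(t in `]0%R, T[) L2norm2 D (fun x => f (cons_row t x)))%E =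
  (\int[lebS]_x ((f \_ Q) x ^+ 2))%:E.
Proof.
move=> mf LF; pose F2 (x : 'rV[R]_n.+2) : \bar R := ((f \_ Q) x ^+ 2)%:E.
have mF2 : measurable_fun setT F2.
  by apply/measurable_EFinP; apply: measurable_funX; exact: measurable_patch.
have F20 x : (0 <= F2 x)%E by rewrite lee_fin sqr_ge0.
rewrite -(RintE LF.2) [RHS](integral_ins_row ord0 mF2 F20).
have mp : measurable_fun setT (fun p : RR * 'rV[R]_n.+1 => F2 (ins_row ord0 p.1 p.2)).
  by apply: (measurableT_comp mF2); exact: measurable_ins_row.
rewrite [RHS](fubini_tonelli1 _ mp (fun p => F20 _)) [LHS]integral_mkcond.
apply: eq_integral => t _; rewrite /fubini_F patchE mem_setE in_itv /=.
case: ifPn => [t0T|nt].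
  rewrite /L2norm2 [LHS]integral_mkcond; apply: eq_integral => y _.
  rewrite /F2 patchE cons_rowE; have [Dy|nD] := pselect (D y).
    by rewrite mem_set// patch_in//; apply/cylinder_ins.
  by rewrite memNset// patch_out ?expr0n// => /cylinder_ins[].
rewrite -[LHS](integral0 leb setT); apply: eq_integral => y _.
rewrite /F2 patch_out ?expr0n// => /cylinder_ins[t0T _].
by rewrite t0T in nt.
Qed.

Section with_solution.
Variables (v v0 F V : 'rV[R]_n.+2 -> R) (A : 'I_n.+2 -> 'rV[R]_n.+2 -> R).
Variables (B : 'I_n.+2 -> 'I_n.+2 -> 'rV[R]_n.+2 -> R).
Variables (cV : 'rV[R]_n.+1 -> R) (cA : 'I_n.+2 -> 'rV[R]_n.+1 -> R).
Hypothesis W : wave_data G T D V F A B cV cA.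
Hypothesis Vv : forall x, Q x -> V x = v x.
Hypothesis wA : forall k, weak_derivative Q [:: k] v (A k).
Hypothesis dV : forall k phi, test_function Q phi ->
  \int[lebS]_x (V x * partial phi k x) = - \int[lebS]_x (A k x * phi x).
Hypothesis wv0 : weak_derivative Q [:: ord0] v v0.

Let vV x : Q x -> v x = V x. Proof. by move/Vv. Qed.
Let rV : trep T D V (A ord0) cV. Proof. exact: wave_rV W. Qed.
Let rA k : trep T D (A k) (B ord0 k) (cA k). Proof. exact: wave_rA W k. Qed.

(** [v0] is an arbitrary weak time derivative of [v]; by uniqueness it agrees almost everywhere with
    [A ord0], so it has the same continuous representative. *)
Let rv0 : trep T D (v0 \_ Q) (B ord0 ord0) (cA ord0).
Proof.
have [_ [mv0 _] _] := wv0.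
apply: (trep_ae (rA ord0)); [exact: measurable_patch|by move=> x; exact: patch_out|].
have := wd_unique oQ (wA ord0) wv0 (aeW _ (fun x _ => erefl)).
apply: filterS => x H; have [Qx|nQ] := pselect (Q x); first by rewrite patch_in// H.
by rewrite patch_out//; have [[_ ->]] := rA ord0.
Qed.

Let v0E x : Q x -> v0 x = (v0 \_ Q) x. Proof. by move=> Qx; rewrite patch_in. Qed.

(** A trace equals the slice almost everywhere by [trace_unique], and the identity defining weak
    derivatives does not see null sets. *)
Let trace_derivative t w j : 0 <= t <= T -> time_trace T D v t w ->
  weak_derivative D [:: j] w (tslice (cA (lift ord0 j)) (B ord0 (lift ord0 j)) t).
Proof.
move=> t0T tw; have wt := trace_unique T0 oD rV vV t0T tw.
have [mw w2 _] := tw; have Lw := L2_patch mD mw w2.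
have S := slice_weak_derivative T0 oD rV (rA (lift ord0 j)) (dV (lift ord0 j)) t0T.
have [_ la _] := S; apply: wdI => //; first exact: li_patch.
move=> phi tphi; rewrite -(wdE S tphi).
have tp := test_partials [:: j] tphi.
rewrite -(Rint_patch_test _ tp); apply: ae_Rint.
- by apply: filterS wt => y ->.
- by apply: measurable_funM; [exact: Lw.1|exact: measurable_test tp].
- by apply: measurable_funM; [exact: (tslice_L2 t rV).1|exact: measurable_test tp].
Qed.

Lemma trace_sobolev_norm t w : 0 <= t <= T -> time_trace T D v t w ->
  sobolev_norm2 1 D w = (slice_sq cV (A ord0) t +
    \sum_j slice_sq (cA (lift ord0 j)) (B ord0 (lift ord0 j)) t)%:E.
Proof.
move=> t0T tw; have [mw w2 _] := tw; have Lw := L2_patch mD mw w2.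
rewrite (sobolev1E oD Lw (fun j => trace_derivative j t0T tw)).
rewrite (trace_L2norm2 T0 oD rV vV t0T tw) EFinD -sumEFin; congr (_ + _)%E.
apply: eq_bigr => j _.
have E : tslice (cA (lift ord0 j)) (B ord0 (lift ord0 j)) t \_ D =
    tslice (cA (lift ord0 j)) (B ord0 (lift ord0 j)) t.
  by apply: patch_id => y; exact: tslice_out (rA _).
by rewrite L2norm2E ?E//; exact: tslice_L2 (rA _).
Qed.

Lemma trace_velocity_norm t w : 0 <= t <= T -> time_trace T D v0 t w ->
  L2norm2 D w = (slice_sq (cA ord0) (B ord0 ord0) t)%:E.
Proof. by move=> t0T tw; exact: (trace_L2norm2 T0 oD rv0 v0E t0T tw). Qed.

Lemma total_energyE t : ((slice_sq cV (A ord0) t +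
    (\sum_j slice_sq (cA (lift ord0 j)) (B ord0 (lift ord0 j)) t)%R)%R%:E +
  (slice_sq (cA ord0) (B ord0 ord0) t)%:E = (total_energy A B cV cA t)%:E)%E.
Proof. rewrite -EFinD; congr EFin; rewrite /total_energy [in RHS]big_ord_recl -addrA.
by congr (_ + _); exact: addrC. Qed.

Lemma slice_energyE t : 0 <= t <= T ->
  (slice_norm2 T D (sobolev_norm2 1 D) v t + slice_norm2 T D (L2norm2 D) v0 t)%E =
  (total_energy A B cV cA t)%:E.
Proof.
move=> t0T; rewrite -total_energyE; congr (_ + _)%E.
  apply: (slice_norm2E oD rV vV t0T) => w; exact: trace_sobolev_norm.
apply: (slice_norm2E oD rv0 v0E t0T) => w; exact: trace_velocity_norm.
Qed.

Lemma continuous_total_energy : continuous (total_energy A B cV cA).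
Proof.
move=> t; apply: cvgD; first exact: (continuous_slice_sq rV).
by apply: sum_continuous => k; exact: (continuous_slice_sq (rA k)).
Qed.

End with_solution.

End solution.

Theorem theorem9p1 (R : realType) (n : nat) (hn : (2 <= n)%N)
  (G : 'rV[R]_n -> 'M[R]_n.+1) (C0 : R) (hG : wave_coefficients G C0)
  (E : set 'rV[R]_n) (hE : ergosphere_interior G E)
  (S0 Oint : set 'rV[R]_n)
  (hS0 : closed_hypersurface S0)
  (hOint : hypersurface_interior S0 Oint)
  (hinside : S0 `<=` E)
  (nu : 'rV[R]_n -> 'rV[R]_n)
  (hnu : forall x, S0 x -> outward_unit_normal S0 Oint x (nu x))
  (hchar : forall x, S0 x ->
     \sum_(j < n) \sum_(k < n)
       G x (lift ord0 j) (lift ord0 k) * nu x ord0 j * nu x ord0 k = 0)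
  (hneg : forall x, S0 x ->
     \sum_(j < n) G x (lift ord0 j) ord0 * nu x ord0 j < 0)
  (T : R) (hT : 0 < T) :
  let Oext := exterior Oint in
  exists2 C : R, 0 < C &
    forall (v v0 f : 'rV[R]_n.+1 -> R) (phi0 phi1 : 'rV[R]_n -> R),
      in_sobolev 2 (cylinder T Oext) v ->
      weak_derivative (cylinder T Oext) [:: ord0] v v0 ->
      measurable_fun (cylinder T Oext) f ->
      wave_equation G (cylinder T Oext) v f ->
      time_trace T Oext v 0 phi0 ->
      time_trace T Oext v0 0 phi1 ->
      let energy (t : R) : \bar R :=
        (slice_norm2 T Oext (sobolev_norm2 1 Oext) v t +
         slice_norm2 T Oext (L2norm2 Oext) v0 t)%E in
      exists2 tmax : R, 0 <= tmax <= T &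
        (forall t : R, 0 <= t <= T -> (energy t <= energy tmax)%E) /\
        (energy tmax <=
           C%:E * (sobolev_norm2 1 Oext phi0 + L2norm2 Oext phi1 +
                   \int[@lebesgue_measure R]_(t in `]0%R, T[)
                     L2norm2 Oext (fun x => f (cons_row t x))))%E.
Proof.
(* Writing the dimension as a successor provides the spatial coordinates along which integration by
   parts is done. *)
case: n hn G hG E hE S0 Oint hS0 hOint hinside nu hnu hchar hneg => [//|n] _.
move=> G hG _ _ S0 Oint [_ cS0 _] hOint _ nu hnu hchar hneg D.
have oD : open D by exact: open_exterior.
have [K [chi [K0 [tchi chi01 chi1 chiK]]]] := cutoffs hG hOint cS0 hnu hchar hneg.
have [C Cgt0 HC] := total_energy_bound hG hT K0 tchi chi01 chi1 chiK.
exists C => // v v0 f phi0 phi1 sv wv0 mf we tr0 tr1 energy.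
have [V [A [B [cV [cA [W Vv wA dV]]]]]] := solution_data hG hT oD sv mf we.
have energyE t : 0 <= t <= T -> energy t = (total_energy A B cV cA t)%:E.
  exact: (slice_energyE hT oD W Vv wA dV wv0).
(* The extended-real energy of the statement is the finite and continuous function [total_energy] on
   [[0, T]], so it attains a maximum; the uniform estimate is then read at this time. *)
have [tmax tmax_in Hmax] := EVT_max (ltW hT)
  (continuous_subspaceT (continuous_total_energy W)).
move: tmax_in; rewrite in_itv /= => tmax_in; exists tmax => //.
rewrite energyE//; split=> [t t0T|]; first by rewrite energyE// lee_fin Hmax// in_itv.
have T00 : 0 <= (0 : R) <= T by rewrite lexx ltW.
rewrite (trace_sobolev_norm hT oD W Vv dV T00 tr0).
rewrite (trace_velocity_norm hT oD W wA wv0 T00 tr1) total_energyE.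
rewrite (source_norm oD mf (wave_cF W).1) -EFinD -EFinM lee_fin.
exact: HC W tmax tmax_in.
Qed.
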